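(* Let $n=1$, $s=\frac12$, $N\ge2$, $\Lambda\ge1$, and let $a(x,y)=a(x-y)$ with $a$ measurable, $a(\xi)=a(-\xi)$ and $\Lambda^{-1}\le a\le\Lambda$. Let $\Omega\subset\mathbb{R}$ be open, $B_{2R}(x_0)\Subset\Omega$, and let $u$ be a weak solution of $\mathcal{L}_{1/2}u=|\mathbf{d}_{1/2,a}u|^2u+\mu$ in $\Omega$. If $\mu\in L^\gamma(B_{2R}(x_0);\mathbb{R}^N)$ with $\gamma\in(1,\infty)$, then $u\in C^{1-\frac1\gamma}(B_R(x_0);\mathbb{R}^N)$. If in addition $a\equiv1$ and $\mu\in L^2(B_{2R}(x_0);\mathbb{R}^N)$, then $u\in W^{1,2}(B_R(x_0);\mathbb{R}^N)$.
   Context: Notation with $p=2$: $d_su(x,y)=\frac{u(x)-u(y)}{|x-y|^s}$; $\mathcal{C}\Omega=(\mathbb{R}^n\times\mathbb{R}^n)\setminus(\Omega^c\times\Omega^c)$; $\widetilde{\mathcal{E}}(u;\Omega)=\iint_{\mathcal{C}\Omega}|d_su|^2\frac{dxdy}{|x-y|^n}$; $\widehat{H}^s(\Omega;\mathbb{R}^N)=\{u\in L^2(\Omega;\mathbb{R}^N):\widetilde{\mathcal{E}}(u;\Omega)<\infty\}$, $\widehat{H}^s_{00}(\Omega;\mathbb{R}^N)=\{u\in\widehat H^s(\mathbb{R}^n;\mathbb{R}^N):u\equiv0\text{ on }\mathbb{R}^n\setminus\Omega\}$; $|\mathbf{d}_{s,a}u|^2(x)=\int_{\mathbb{R}^n}\frac{|u(x)-u(y)|^2}{|x-y|^{2s}}\frac{a(x,y)}{|x-y|^n}dy$.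 A weak solution of $\mathcal{L}_su=|\mathbf{d}_{s,a}u|^2u+\mu$ in $\Omega$ (with $\mu\in L^{p_*}(\Omega;\mathbb{R}^N)$, $p_*=\max\{2n/(n+2s),1\}$) is $u\in\widehat{H}^s(\Omega;\mathbb{R}^N)$ with $|u|=1$ a.e. on $\mathbb{R}^n$ such that for all $\phi\in\widehat{H}^s_{00}(\Omega;\mathbb{R}^N)$: $\iint_{\mathcal{C}\Omega}d_su\cdot d_s\phi\frac{a(x,y)}{|x-y|^n}dxdy=\int_\Omega|\mathbf{d}_{s,a}u|^2u\cdot\phi\,dx+\int_\Omega\mu\cdot\phi\,dx$. *)

(* Defs.v *)
From HB Require Import structures.
From mathcomp Require Import all_boot all_order all_algebra.
From mathcomp Require Import all_classical all_reals all_analysis.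
Set Implicit Arguments. Unset Strict Implicit. Unset Printing Implicit Defensive.
Import Order.TTheory GRing.Theory Num.Theory.
Import numFieldNormedType.Exports.
Local Open Scope classical_set_scope.
Local Open Scope ring_scope.

Section Defs.
Variables (R : realType) (N : nat).

Definition leb := (@lebesgue_measure R).
Definition leb2 := (leb \x leb)%E.

(* R^N-valued functions are represented by their components u x i *)
Definition vdot (v w : 'I_N -> R) : R := \sum_(i < N) v i * w i.
Definition vnorm (v : 'I_N -> R) : R := Num.sqrt (vdot v v).

Definition COmega (Om : set R) : set (R * R) := ~` (~` Om `*` ~` Om).

(* |d_s u|^2 (x,y) |x-y|^{-n} with n = 1, s = 1/2 :
   |u(x)-u(y)|^2 / |x-y|^2 *)
Definition en_density (u : R -> 'I_N -> R) (z : R * R) : R :=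
  vdot (fun i => u z.1 i - u z.2 i) (fun i => u z.1 i - u z.2 i)
  / (z.1 - z.2) ^+ 2.

Definition energy (u : R -> 'I_N -> R) (Om : set R) : \bar R :=
  (\int[leb2]_(z in COmega Om) (en_density u z)%:E)%E.

Definition Lp_on (p : R) (D : set R) (f : R -> 'I_N -> R) : Prop :=
  forall i : 'I_N, measurable_fun D (fun x => f x i) /\
    (\int[leb]_(x in D) ((`|f x i| `^ p)%:E) < +oo)%E.

Definition Hhat (Om : set R) (u : R -> 'I_N -> R) : Prop :=
  (forall i : 'I_N, measurable_fun setT (fun x => u x i)) /\
  Lp_on 2 Om u /\ (energy u Om < +oo)%E.

Definition Hhat00 (Om : set R) (phi : R -> 'I_N -> R) : Prop :=
  Hhat setT phi /\ (forall x, ~ Om x -> forall i : 'I_N, phi x i = 0).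

Definition dsa2 (a : R -> R) (u : R -> 'I_N -> R) (x : R) : \bar R :=
  (\int[leb]_y ((vdot (fun i => u x i - u y i) (fun i => u x i - u y i)
                 / (x - y) ^+ 2 * a (x - y))%:E))%E.

Definition lhs_integrand a (u phi : R -> 'I_N -> R) (z : R * R) : R :=
  vdot (fun i => u z.1 i - u z.2 i) (fun i => phi z.1 i - phi z.2 i)
  * a (z.1 - z.2) / (z.1 - z.2) ^+ 2.

Definition weak_solution (a : R -> R) (Om : set R)
    (u mu : R -> 'I_N -> R) : Prop :=
  Hhat Om u /\
  {ae leb, forall x, vnorm (u x) = 1} /\
  (forall phi, Hhat00 Om phi ->
     leb2.-integrable (COmega Om) (fun z => (lhs_integrand a u phi z)%:E) ->
     leb.-integrable Om (fun x => (fine (dsa2 a u x) * vdot (u x) (phi x))%:E) ->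
     leb.-integrable Om (fun x => (vdot (mu x) (phi x))%:E) ->
     (\int[leb2]_(z in COmega Om) (lhs_integrand a u phi z)%:E =
      \int[leb]_(x in Om) (fine (dsa2 a u x) * vdot (u x) (phi x))%:E
      + \int[leb]_(x in Om) (vdot (mu x) (phi x))%:E)%E).

Definition holder_on (alpha : R) (D : set R) (u : R -> 'I_N -> R) : Prop :=
  exists v : R -> 'I_N -> R,
    {ae leb, forall x, D x -> forall i, v x i = u x i} /\
    exists C : R, forall x y, D x -> D y ->
      vnorm (fun i => v x i - v y i) <= C * (`|x - y| `^ alpha).

Definition test_fun (D : set R) (phi : R -> R) : Prop :=
  (forall (k : nat) (x : R), derivable (derive1n k phi) x 1) /\
  exists K : set R, compact K /\ K `<=` D /\ (forall x, ~ K x -> phi x = 0).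

Definition W12_on (D : set R) (u : R -> 'I_N -> R) : Prop :=
  Lp_on 2 D u /\
  exists g : R -> 'I_N -> R, Lp_on 2 D g /\
    forall (i : 'I_N) (phi : R -> R), test_fun D phi ->
      (\int[leb]_(x in D) (u x i * derive1 phi x)%:E
       = - \int[leb]_(x in D) (g x i * phi x)%:E)%E.

End Defs.

(* Main.v *)
(** Hoelder continuity. Write [du = u(x) - u(y)]. Testing the equation with [f u_j] and [f u_i] and
    using [|u| = 1] turns it into a conservation law for the antisymmetric quantities
    [u_i(x) u_j(y) - u_j(x) u_i(y)], so that the critical term [|du|^2 u] is a product of a divergence
    free quantity with [du]. For [phi], [g] of finite energy the function
    [f = sum_k (Phi_k - Phi_(k-1)) (g - G_k)], where [Phi_k], [G_k] are dyadic averages, has [df] equal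
    to [phi dg] up to an error quadratic in the energies: this paraproduct replaces the duality of the
    Hardy space and BMO. With hole filling the energy on balls decays like a power, and [u] has a
    Hoelder representative. A cut-off copy [W] of a component then solves a linear equation whose right
    hand side has a Morrey type decay; the increments [W(x + h) - W(x)] satisfy the same kind of
    equation, which gives the Hoelder exponent of the right hand side, and Caccioppoli's inequality
    doubles the decay exponent of the energy until [1 - 1/gam] is reached.

    Square integrable derivative. For [gam = 2] the same increments are shown to satisfy
    [|W(. + h) - W|_2^2 <= C h^(3/2)], so that the right hand side acts on [L^2]. Testing with
    [sum_(j < n) 2^j D_(-h_j) D_(h_j) W], [h_j = h_0 / 2^j], bounds [sum_j 4^j |D_(h_j) D_(h_j) W|_2^2],
    hence the norms of the dyadic difference quotients. A coarse quotient is an average of translates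
    of a finer one, and a variance identity bounds their distance by the difference of the squared
    norms; the quotients thus converge in [L^2], to the weak derivative. *)

Require Import Defs.
From HB Require Import structures.
From mathcomp Require Import all_boot all_order all_algebra.
From mathcomp Require Import all_classical all_reals all_analysis.
From mathcomp Require Import measurable_realfun.
From mathcomp Require Import ring lra.
Set Implicit Arguments. Unset Strict Implicit. Unset Printing Implicit Defensive.
Import Order.TTheory GRing.Theory Num.Theory.
Import numFieldNormedType.Exports.
Local Open Scope classical_set_scope.
Local Open Scope ring_scope.

(** The obstacle is criticality: the energy is scale invariant and [|du|^2 u] is merely integrable,
    so testing with a cut-off of [u - const] returns a multiple of the energy whose factor does not
    become small on small balls. After the conservation law is inserted, only integrals of
    [|du|^3 |dphi|] and of [|du|] against the paraproduct error remain. They are quadratic in the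
    energy [V] of a larger ball, up to a term [t V] with [t] at our disposal and a multiple of the
    energy of an annulus. Small energy and hole filling absorb them. Since [a] is only bounded and
    measurable, no symbol calculus is available: the harmonic analysis is done by hand on dyadic
    scales. Two devices recur. Mean values are replaced by the value at one point of an annulus
    through which the slice of the energy is at most average. Every estimate is a pointwise
    inequality that Tonelli turns into a bound with an explicit constant. *)

Definition ind {R : realType} (b : bool) : R := if b then 1 else 0.

(* [lra] parses all hypotheses, and section variables cannot be cleared: irrelevant ones become [tt]. *)
Ltac order_context := repeat match goal with x := _ |- _ => clearbody x end;
  repeat match goal with H : ?T |- _ => lazymatch T with
    | is_true (_ <= _) => fail | is_true (_ < _) => fail | is_true (_ && _) => fail
    | is_true (~~ _) => fail | is_true (_ == _) => fail
    | _ = _ => fail | _ /\ _ => fail | unit => fail | _ => clear H; assert (H := tt) end end.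
Ltac goal_context := lazymatch goal with |- ?G => repeat
  match goal with H : ?T |- _ =>
    lazymatch T with is_true _ => idtac | _ = _ => idtac end;
    match goal with v : _ |- _ =>
      lazymatch T with context [v] => lazymatch G with context [v] => fail | _ => clear H; assert (H := tt) end end
    end
  end end.
Ltac clra := first [order_context; first [goal_context; lra | lra] | lra].
Ltac cnra := first [order_context; first [goal_context; nra | nra] | nra].

(** * Integration with real bounds *)

Section L1bound.
Context d (T : measurableType d) (R : realType).
Variable m : {measure set T -> \bar R}.
Implicit Types (F G : T -> R) (c : R).

(** Measurability and a real bound in one predicate: integrals can be treated as real numbers, and
    the constants of the estimates are assembled by adding and scaling such bounds. *)
Definition L1b F c :=
  measurable_fun setT F /\ (\int[m]_x (`|F x|)%:E <= c%:E)%E.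

Lemma measurable_absE F : measurable_fun setT F ->
  measurable_fun setT (fun x : T => (`|F x|)%:E : \bar R).
Proof. by move=> mF; apply/measurable_EFinP; exact: measurableT_comp. Qed.

Lemma L1b_meas F c : L1b F c -> measurable_fun setT F.
Proof. by case. Qed.

Lemma L1b_int F c : L1b F c -> m.-integrable setT (EFin \o F).
Proof.
case=> mF Fc; apply/integrableP; split; first exact/measurable_EFinP.
by apply: le_lt_trans (ltry c); rewrite /=.
Qed.

Lemma L1b_ge0 F c : L1b F c -> 0 <= c.
Proof.
by case=> _ Fc; rewrite -lee_fin; apply: le_trans Fc; apply: integral_ge0.
Qed.

Lemma L1b_weak F c c' : c <= c' -> L1b F c -> L1b F c'.
Proof. by move=> cc' [mF Fc]; split => //; apply: le_trans Fc _; rewrite lee_fin. Qed.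

Lemma L1b_le F G c : measurable_fun setT F -> (forall x, `|F x| <= G x) ->
  L1b G c -> L1b F c.
Proof.
move=> mF FG [mG Gc]; split => //; apply: le_trans Gc.
apply: ge0_le_integral => //; [exact: measurable_absE|exact: measurable_absE|].
by move=> x _; rewrite lee_fin; apply: le_trans (FG x) _; exact: ler_norm.
Qed.

Lemma L1b_norm F c : L1b F c -> L1b (fun x => `|F x|) c.
Proof.
move=> [mF Fc]; split; first exact: measurableT_comp.
by under eq_integral do rewrite normr_id.
Qed.

Lemma L1b_eq F G c : F =1 G -> L1b F c -> L1b G c.
Proof. by move=> /funext ->. Qed.

Lemma L1bD F G c c' : L1b F c -> L1b G c' -> L1b (fun x => F x + G x) (c + c').
Proof.
move=> [mF Fc] [mG Gc]; split; first exact: measurable_funD.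
apply: (@le_trans _ _ (\int[m]_x ((`|F x|)%:E + (`|G x|)%:E))%E).
  apply: ge0_le_integral => //.
  - by apply: measurable_absE; exact: measurable_funD.
  - by apply: emeasurable_funD; exact: measurable_absE.
  - by move=> x _; rewrite -EFinD lee_fin ler_normD.
rewrite ge0_integralD//; [|exact: measurable_absE|exact: measurable_absE].
by rewrite EFinD leeD.
Qed.

Lemma L1bZ k F c : L1b F c -> L1b (fun x => k * F x) (`|k| * c).
Proof.
move=> [mF Fc]; split; first exact: measurable_funM.
under eq_integral do rewrite normrM EFinM.
rewrite ge0_integralZl//; [|exact: measurable_absE].
by rewrite EFinM lee_pmul// integral_ge0.
Qed.

Lemma L1bN F c : L1b F c -> L1b (fun x => - F x) c.
Proof.
by move=> h; apply: L1b_le (L1b_norm h) => [|x]; [exact: measurable_funN (L1b_meas h)|rewrite normrN].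
Qed.

Lemma L1bB F G c c' : L1b F c -> L1b G c' -> L1b (fun x => F x - G x) (c + c').
Proof. by move=> h1 /L1bN; exact: L1bD. Qed.

Lemma L1b0 : L1b (fun=> 0) 0.
Proof.
split; first exact: measurable_cst.
by under eq_integral do rewrite normr0; rewrite integral0.
Qed.

Lemma L1b_sum (I : Type) (s : seq I) (P : pred I) (F : I -> T -> R) (c : I -> R) :
  (forall i, P i -> L1b (F i) (c i)) ->
  L1b (fun x => \sum_(i <- s | P i) F i x) (\sum_(i <- s | P i) c i).
Proof.
move=> h; elim: s => [|i s ih].
  by rewrite big_nil; apply: L1b_eq L1b0 => x; rewrite big_nil.
rewrite big_cons; case: ifPn => Pi.
  by apply: L1b_eq (L1bD (h _ Pi) ih) => x; rewrite big_cons Pi.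
by apply: L1b_eq ih => x; rewrite big_cons (negbTE Pi).
Qed.

Lemma L1b_Rint F c : L1b F c -> `|\int[m]_x F x| <= c.
Proof.
move=> h; apply: le_trans (le_normr_Rintegral _ (L1b_int h)) _ => //.
case: (h) => mF Fc; rewrite /Rintegral -lee_fin fineK//.
rewrite ge0_fin_numE; last exact: integral_ge0.
exact: le_lt_trans (ltry c).
Qed.

Lemma L1b_self F c : L1b F c -> (forall x, 0 <= F x) -> L1b F (\int[m]_x F x).
Proof.
move=> h F0; case: (h) => mF Fc; split => //.
under eq_integral do rewrite ger0_norm//.
rewrite /Rintegral fineK//; exact: integrable_fin_num (L1b_int h).
Qed.

Lemma Rint_le F G c c' : L1b F c -> L1b G c' -> (forall x, F x <= G x) ->
  \int[m]_x F x <= \int[m]_x G x.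
Proof. by move=> /L1b_int h1 /L1b_int h2 h; exact: le_Rintegral. Qed.

Lemma RintD F G c c' : L1b F c -> L1b G c' ->
  \int[m]_x (F x + G x) = \int[m]_x F x + \int[m]_x G x.
Proof. by move=> /L1b_int h1 /L1b_int h2; exact: RintegralD. Qed.

Lemma RintB F G c c' : L1b F c -> L1b G c' ->
  \int[m]_x (F x - G x) = \int[m]_x F x - \int[m]_x G x.
Proof. by move=> /L1b_int h1 /L1b_int h2; exact: RintegralB. Qed.

Lemma RintZ k F c : L1b F c -> \int[m]_x (k * F x) = k * \int[m]_x F x.
Proof. by move=> /L1b_int h1; exact: RintegralZl. Qed.

Lemma Rint_ext F G : F =1 G -> \int[m]_x F x = \int[m]_x G x.
Proof. by move=> /funext ->. Qed.

Lemma Rint_sum (I : Type) (s : seq I) (F : I -> T -> R) (c : I -> R) :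
  (forall i, L1b (F i) (c i)) ->
  \int[m]_x (\sum_(i <- s) F i x) = \sum_(i <- s) \int[m]_x F i x.
Proof.
move=> h; elim: s => [|i s ih].
  rewrite big_nil (_ : (fun x => _) = (fun=> 0)).
    by rewrite /Rintegral integral0.
  by apply/funext => x; rewrite big_nil.
rewrite big_cons -ih -(RintD (h i) (L1b_sum s (P := xpredT) (fun i _ => h i))).
by apply: Rint_ext => x; rewrite big_cons.
Qed.

Lemma L1b_ex (F : T -> R) : measurable_fun setT F ->
  (\int[m]_x (`|F x|)%:E < +oo)%E -> exists c, L1b F c.
Proof.
move=> mF h; exists (fine (\int[m]_x (`|F x|)%:E)); split => //.
by rewrite fineK// ge0_fin_numE// integral_ge0.
Qed.

Lemma L1b_Rint_le F c : L1b F c -> \int[m]_x F x <= c.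
Proof. by move/L1b_Rint; apply: le_trans; exact: ler_norm. Qed.

End L1bound.

(** * Measurability by syntax *)

Section meas.
Context d (T : measurableType d) (R : realType).
Implicit Types (f g : T -> R).
Notation mf := (measurable_fun [set: T]).

Lemma mes_cst (c : R) : mf (fun=> c). Proof. exact: measurable_cst. Qed.
Lemma mes_D f g : mf f -> mf g -> mf (fun x => f x + g x).
Proof. exact: measurable_funD. Qed.
Lemma mes_B f g : mf f -> mf g -> mf (fun x => f x - g x).
Proof. exact: measurable_funB. Qed.
Lemma mes_N f : mf f -> mf (fun x => - f x).
Proof. exact: measurable_funN. Qed.
Lemma mes_M f g : mf f -> mf g -> mf (fun x => f x * g x).
Proof. exact: measurable_funM. Qed.
Lemma mes_X f n : mf f -> mf (fun x => f x ^+ n).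
Proof. exact: measurable_funX. Qed.
Lemma mes_norm f : mf f -> mf (fun x => `|f x|).
Proof. by move=> h; exact: measurableT_comp. Qed.
Lemma mes_powR f p : mf f -> mf (fun x => f x `^ p).
Proof. by move=> h; apply: (measurableT_comp (measurable_powR p)). Qed.
Lemma mes_V f : mf f -> mf (fun x => (f x)^-1).
Proof.
(* The square makes the base nonnegative, where [powR] with exponent -1 is the inverse; at a zero of
   [f] both sides vanish. *)
move=> h; rewrite (_ : (fun x => _) = (fun x => f x * (f x ^+ 2) `^ (-1))).
  by apply: mes_M => //; apply: mes_powR; exact: mes_X.
apply/funext => x; rewrite powR_inv1 ?sqr_ge0//.
have [->|f0] := eqVneq (f x) 0; first by rewrite invr0 mul0r.
by rewrite expr2 invfM mulrA mulfV// mul1r.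
Qed.
Lemma mes_div f g : mf f -> mf g -> mf (fun x => f x / g x).
Proof. by move=> h1 h2; apply: mes_M => //; exact: mes_V. Qed.
Lemma mes_if (b : T -> bool) f g : measurable_fun setT b -> mf f -> mf g ->
  mf (fun x => if b x then f x else g x).
Proof. by move=> *; exact: measurable_fun_ifT. Qed.
Lemma mes_ind (b : T -> bool) : measurable_fun setT b -> mf (fun x => ind (b x) : R).
Proof. by move=> h; apply: mes_if. Qed.
Lemma mes_le f g : mf f -> mf g -> measurable_fun setT (fun x => f x <= g x).
Proof. exact: measurable_fun_ler. Qed.
Lemma mes_lt f g : mf f -> mf g -> measurable_fun setT (fun x => f x < g x).
Proof. exact: measurable_fun_ltr. Qed.
Lemma mes_and (b c : T -> bool) : measurable_fun setT b -> measurable_fun setT c ->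
  measurable_fun setT (fun x => b x && c x).
Proof. by move=> *; exact: measurable_and. Qed.
Lemma mes_max f g : mf f -> mf g -> mf (fun x => Num.max (f x) (g x)).
Proof. exact: measurable_maxr. Qed.
Lemma mes_min f g : mf f -> mf g -> mf (fun x => Num.min (f x) (g x)).
Proof. exact: measurable_minr. Qed.
Lemma mes_sum (I : Type) (s : seq I) (F : I -> T -> R) :
  (forall i, mf (F i)) -> mf (fun x => \sum_(i <- s) F i x).
Proof. by move=> *; exact: measurable_sum. Qed.
End meas.

Lemma mes_1 (R : realType) (f : R -> R) : measurable_fun setT f ->
  measurable_fun setT (fun z : R * R => f z.1).
Proof. by move=> h; exact: (measurableT_comp h). Qed.
Lemma mes_2 (R : realType) (f : R -> R) : measurable_fun setT f ->
  measurable_fun setT (fun z : R * R => f z.2).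
Proof. by move=> h; exact: (measurableT_comp h). Qed.
Lemma mes_fst (R : realType) : measurable_fun setT (fun z : R * R => z.1).
Proof. exact: measurable_fst. Qed.
Lemma mes_snd (R : realType) : measurable_fun setT (fun z : R * R => z.2).
Proof. exact: measurable_snd. Qed.
Lemma mes_id (R : realType) : measurable_fun setT (fun x : R => x).
Proof. exact: measurable_id. Qed.
Lemma mes_comp d (T : measurableType d) (R : realType) (f : R -> R) (g : T -> R) :
  measurable_fun setT f -> measurable_fun setT g -> measurable_fun setT (fun x => f (g x)).
Proof. by move=> hf hg; exact: (measurableT_comp hf). Qed.

Ltac mes1 := first
  [ match goal with H : measurable_fun _ ?f |- measurable_fun _ ?f => exact H end
  | lazymatch goal with
    | |- measurable_fun _ (fun x => x) => exact: mes_id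
    | |- measurable_fun _ fst => exact: mes_fst
    | |- measurable_fun _ snd => exact: mes_snd
    | |- measurable_fun _ (fun z => z.1) => exact: mes_fst
    | |- measurable_fun _ (fun z => z.2) => exact: mes_snd
    | |- measurable_fun _ (fun=> ?c) => exact: mes_cst
    | |- measurable_fun _ (fun x => _ - _) => apply: mes_B
    | |- measurable_fun _ (fun x => _ + _) => apply: mes_D
    | |- measurable_fun _ (fun x => - _) => apply: mes_N
    | |- measurable_fun _ (fun x => _ / _) => apply: mes_div
    | |- measurable_fun _ (fun x => _ * _) => apply: mes_M
    | |- measurable_fun _ (fun x => _^-1) => apply: mes_V
    | |- measurable_fun _ (fun x => _ ^+ _) => apply: mes_X
    | |- measurable_fun _ (fun x => `|_|) => apply: mes_norm
    | |- measurable_fun _ (fun x => _ `^ _) => apply: mes_powR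
    | |- measurable_fun _ (fun x => ind _) => apply: mes_ind
    | |- measurable_fun _ (fun x => _ <= _) => apply: mes_le
    | |- measurable_fun _ (fun x => _ < _) => apply: mes_lt
    | |- measurable_fun _ (fun x => _ && _) => apply: mes_and
    | |- measurable_fun _ (fun x => Num.max _ _) => apply: mes_max
    | |- measurable_fun _ (fun x => Num.min _ _) => apply: mes_min
    | |- measurable_fun _ (fun x => \sum_(i <- _) _) => apply: mes_sum; intro
    end
  | assumption
  | match goal with H : measurable_fun _ ?f |- measurable_fun _ (fun x => ?f _) =>
      apply: (mes_comp H) end
  | apply: mes_div | apply: mes_V | apply: mes_B | apply: mes_D | apply: mes_M | apply: mes_ind
  | apply: mes_le | apply: mes_lt | apply: mes_and | apply: mes_norm | apply: mes_X | apply: mes_powR ].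
Ltac mes := repeat mes1.

(** * Invariance of Lebesgue integrals and Tonelli *)

Section Lebesgue.
Variable R : realType.
Local Notation mu := (@lebesgue_measure R).
Local Notation mu2 := (mu \x mu)%E.

Section inv.
Context d (T : measurableType d) (m : {measure set T -> \bar R}) (phi : T -> T).
Hypothesis mphi : measurable_fun setT phi.
Hypothesis inv : forall f : T -> \bar R, measurable_fun setT f -> (forall x, 0 <= f x)%E ->
  (\int[m]_x f (phi x) = \int[m]_x f x)%E.

Lemma L1b_inv F c : L1b m F c -> L1b m (fun x => F (phi x)) c.
Proof.
move=> [mF Fc]; split; first exact: (measurableT_comp mF).
by rewrite (inv (f := fun x => (`|F x|)%:E))//; exact: measurable_absE.
Qed.

(** Positive and negative parts are transferred separately, each by the invariance of nonnegative
    integrals. *)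
Lemma Rint_inv (F : T -> R) : measurable_fun setT F ->
  \int[m]_x F (phi x) = \int[m]_x F x.
Proof.
move=> mF; rewrite /Rintegral integralE [in RHS]integralE.
have mE : measurable_fun setT (EFin \o F) by exact/measurable_EFinP.
congr (fine (_ - _)%E).
  have := inv (measurable_funepos mE) (fun x => funepos_ge0 _ x).
  by move=> <-; apply: eq_integral => x _; rewrite !funeposE.
have := inv (measurable_funeneg mE) (fun x => funeneg_ge0 _ x).
by move=> <-; apply: eq_integral => x _; rewrite !funenegE.
Qed.
End inv.

Lemma lebesgue_shift (h : R) (A : set R) : measurable A ->
  pushforward mu ((fun x => x + h) : _ -> measurableTypeR R) A = mu A.
Proof.
move=> mA; apply/esym/lebesgue_measure_unique => //.
  exact: measurable_funD.
move=> m' _ [[a b]] _ <-.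
change (mu `]a, b] = mu ((fun x : R => x + h) @^-1` `]a, b])).
rewrite (_ : (fun x : R => x + h) @^-1` `]a, b] = `]a - h, b - h]%classic).
  rewrite !lebesgue_measure_itv/= !lte_fin ltrD2r.
  by case: ifP => // _; rewrite -!EFinB; congr EFin; ring.
by apply/seteqP; split => x /=; rewrite !in_itv/= ltrBlDr lerBrDr.
Qed.

Lemma integral_shift (h : R) (f : R -> \bar R) : measurable_fun setT f ->
  (forall x, 0 <= f x)%E -> (\int[mu]_x f (x + h)%R = \int[mu]_x f x)%E.
Proof.
move=> mf f0.
have mphi : measurable_fun setT ((fun x => x + h) : R -> measurableTypeR R) by mes.
have := @ge0_integral_pushforward _ _ (measurableTypeR R) (measurableTypeR R) R _ mphi mu setT f measurableT mf (fun y _ => f0 y).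
rewrite preimage_setT => <-.
by apply: eq_measure_integral => //= A mA _; exact: lebesgue_shift.
Qed.

Lemma integral_opp (f : R -> \bar R) : measurable_fun setT f ->
  (forall x, 0 <= f x)%E -> (\int[mu]_x f (- x)%R = \int[mu]_x f x)%E.
Proof.
move=> mf f0.
have mphi : measurable_fun setT (-%R : R -> measurableTypeR R) by apply: mes_N; mes.
have := @ge0_integral_pushforward _ _ (measurableTypeR R) (measurableTypeR R) R _ mphi mu setT f measurableT mf (fun y _ => f0 y).
rewrite preimage_setT => <-.
by apply: eq_measure_integral => //= A mA _; exact: lebesgue_measureN.
Qed.

Lemma L1b_shift h (F : R -> R) c : L1b mu F c -> L1b mu (fun x => F (x + h)) c.
Proof.
move=> H; have m1 : measurable_fun setT (fun x : R => x + h) by mes.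
exact: (@L1b_inv _ _ mu (fun x : measurableTypeR R => x + h) m1 (integral_shift h) F c H).
Qed.

Lemma Rint_shift h (F : R -> R) : measurable_fun setT F ->
  \int[mu]_x F (x + h) = \int[mu]_x F x.
Proof. exact: (@Rint_inv _ _ mu (fun x : measurableTypeR R => x + h) (integral_shift h)). Qed.

Lemma tonelli12 (f : R * R -> \bar R) : measurable_fun setT f -> (forall z, 0 <= f z)%E ->
  (\int[mu2]_z f z = \int[mu]_x \int[mu]_y f (x, y))%E.
Proof. by move=> mf f0; rewrite fubini_tonelli1. Qed.

Lemma tonelli21 (f : R * R -> \bar R) : measurable_fun setT f -> (forall z, 0 <= f z)%E ->
  (\int[mu2]_z f z = \int[mu]_y \int[mu]_x f (x, y))%E.
Proof. by move=> mf f0; rewrite fubini_tonelli2. Qed.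

Lemma mes_tonelli (f : R * R -> \bar R) : measurable_fun setT f -> (forall z, 0 <= f z)%E ->
  measurable_fun setT (fun x => \int[mu]_y f (x, y))%E.
Proof. by move=> mf f0; exact: measurable_fun_fubini_tonelli_F. Qed.

Lemma measurable_swap : measurable_fun setT (fun z : R * R => (z.2, z.1)).
Proof. exact: measurable_fun_pair. Qed.

Lemma integral_swap (f : R * R -> \bar R) : measurable_fun setT f ->
  (forall z, 0 <= f z)%E -> (\int[mu2]_z f (z.2, z.1) = \int[mu2]_z f z)%E.
Proof.
move=> mf f0; rewrite (tonelli12 (f := fun z => f (z.2, z.1)))//.
  by rewrite tonelli21.
exact: (measurableT_comp mf measurable_swap).
Qed.

Lemma L1b_swap (F : R * R -> R) c : L1b mu2 F c -> L1b mu2 (fun z => F (z.2, z.1)) c.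
Proof.
apply: (@L1b_inv _ _ _ (fun z => (z.2, z.1))); [exact: measurable_swap|exact: integral_swap].
Qed.

Lemma Rint_swap (F : R * R -> R) : measurable_fun setT F ->
  \int[mu2]_z F (z.2, z.1) = \int[mu2]_z F z.
Proof. exact: (@Rint_inv _ _ mu2 (fun z => (z.2, z.1)) integral_swap). Qed.

Lemma measurable_shift2 h : measurable_fun setT (fun z : R * R => (z.1 + h, z.2 + h)).
Proof. by apply: measurable_fun_pair; mes. Qed.

Lemma measurable_pair1 (f : R * R -> \bar R) x : measurable_fun setT f -> measurable_fun setT (fun y => f (x, y)).
Proof. by move=> h; apply: (measurableT_comp h); exact: measurable_fun_pair. Qed.

Lemma integral_shift2 h (f : R * R -> \bar R) : measurable_fun setT f ->
  (forall z, 0 <= f z)%E -> (\int[mu2]_z f ((z.1 + h)%R, (z.2 + h)%R) = \int[mu2]_z f z)%E.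
Proof.
move=> mf f0; rewrite (tonelli12 (f := fun z => f (z.1 + h, z.2 + h)%R))//; last first.
  exact: (measurableT_comp mf (measurable_shift2 h)).
rewrite [RHS](tonelli12 mf f0).
under eq_integral => x _.
  rewrite (@integral_shift h (fun y => f ((x + h)%R, y)))//; last exact: measurable_pair1.
  over.
rewrite (@integral_shift h (fun x => \int[mu]_y f (x, y))%E)//.
  exact: measurable_fun_fubini_tonelli_F.
by move=> x; exact: integral_ge0.
Qed.

Lemma L1b_shift2 h (F : R * R -> R) c : L1b mu2 F c -> L1b mu2 (fun z => F (z.1 + h, z.2 + h)) c.
Proof.
move=> H; exact: (@L1b_inv _ _ mu2 (fun z => (z.1 + h, z.2 + h)) (measurable_shift2 h) (integral_shift2 h) F c H).
Qed.

Lemma Rint_shift2 h (F : R * R -> R) : measurable_fun setT F ->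
  \int[mu2]_z F (z.1 + h, z.2 + h) = \int[mu2]_z F z.
Proof. exact: (@Rint_inv _ _ mu2 (fun z => (z.1 + h, z.2 + h)) (integral_shift2 h)). Qed.

Lemma L1b_tonelli (F : R * R -> R) (g : R -> R) (c : R) : measurable_fun setT F ->
  (forall x, \int[mu]_y (`|F (x, y)|)%:E <= (g x)%:E)%E ->
  L1b mu g c -> L1b mu2 F c.
Proof.
move=> mF Fg [mg gc]; split => //.
rewrite tonelli12//; last exact: measurable_absE.
apply: le_trans gc; apply: ge0_le_integral => //.
- by move=> x _; exact: integral_ge0.
- apply: (mes_tonelli (f := fun z : R * R => (`|F z|)%:E)) => //.
  exact: measurable_absE.
- exact: measurable_absE.
- by move=> x _; apply: le_trans (Fg x) _; rewrite lee_fin ler_norm.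
Qed.

Lemma L1b_tonelli' (F : R * R -> R) (g : R -> R) (c : R) : measurable_fun setT F ->
  (forall y, \int[mu]_x (`|F (x, y)|)%:E <= (g y)%:E)%E ->
  L1b mu g c -> L1b mu2 F c.
Proof.
move=> mF Fg gc.
have := @L1b_tonelli (fun z => F (z.2, z.1)) g c (measurableT_comp mF measurable_swap) Fg gc.
by move/L1b_swap; apply: L1b_eq => -[].
Qed.

End Lebesgue.

Section Lebesgue2.
Variable R : realType.
Local Notation mu := (@lebesgue_measure R).
Local Notation mu2 := (mu \x mu)%E.

Lemma L1b_itv (x d : R) : 0 <= d -> L1b mu (fun y => ind (`|x - y| <= d)) (2 * d).
Proof.
move=> d0; split; first by mes.
rewrite (_ : (fun y => _) = (fun y => (\1_(`[x - d, x + d]) y)%:E)).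
  rewrite integral_indic//.
  have h : (mu [set` `[x - d, x + d]%R] <= (2 * d)%:E)%E.
    rewrite lebesgue_measure_itv/= lte_fin.
    case: ifPn => _; last by rewrite lee_fin mulr_ge0.
    by rewrite -EFinB lee_fin; clra.
  by rewrite setIT.
apply/funext => y; rewrite indicE /ind; congr EFin.
have -> : (y \in `[x - d, x + d]%classic) = (`|x - y| <= d).
  by apply/idP/idP; rewrite inE/= in_itv/= ler_norml => h; apply/andP; split; move: h => /andP[]; clra.
by case: ifP; rewrite ?normr1 ?normr0.
Qed.

Lemma L1b_far0 (d : R) : 0 < d -> L1b mu (fun y => ind (d <= y) / y ^+ 2) (d^-1).
Proof.
move=> d0; split; first by mes.
have -> : (\int[mu]_x (`|ind (d <= x) / x ^+ 2|)%:E = \int[mu]_(x in `[d, +oo[) ((x ^+ 2)^-1)%:E)%E.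
  rewrite [RHS]integral_mkcond; apply: eq_integral => y _.
  rewrite /patch; have -> : (y \in `[d, +oo[%classic) = (d <= y).
    by apply/idP/idP; rewrite inE/= in_itv/= andbT.
  rewrite /ind; case: ifP => _; last by rewrite mul0r normr0.
  by rewrite mul1r ger0_norm// invr_ge0 sqr_ge0.
rewrite (@ge0_continuous_FTC2y _ _ (fun x => - x^-1) d 0).
- by rewrite sub0e -EFinN opprK.
- by move=> x _; rewrite invr_ge0 sqr_ge0.
- apply: continuous_in_subspaceT => x; rewrite inE/= in_itv/= andbT => dx.
  have x0 : x != 0 by clra.
  apply: cvgV; first by rewrite sqrf_eq0.
  exact: exprn_continuous.
- rewrite -[X in _ --> X]oppr0; apply: cvgN.
  have h : \forall x \near +oo, 0 < (x : R) by exact: nbhs_pinfty_gt.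
  exact: ((gtr0_cvgV0 h).2 cvg_id).
- by move=> x dx; apply: derivableN; apply: derivableV => //; clra.
- apply: cvgN; apply: cvgV; first by clra.
  exact: cvg_at_right_filter.
- move=> x; rewrite in_itv/= andbT => dx.
  have x0 : x != 0 by clra.
  rewrite derive1E deriveN; last by apply: derivableV.
  rewrite deriveV// derive_id scaleNr opprK /GRing.scale/= mulr1.
  by rewrite -exprVn exprVn.
Qed.

Lemma L1b_opp (F : R -> R) c : L1b mu F c -> L1b mu (fun x => F (- x)) c.
Proof.
move=> H; have m1 : measurable_fun setT (fun x : R => - x) by mes.
exact: (@L1b_inv R _ _ mu (fun x : measurableTypeR R => - x) m1 (@integral_opp R) F c H).
Qed.

Lemma L1b_far (x d : R) : 0 < d ->
  L1b mu (fun y => ind (d <= `|x - y|) / (x - y) ^+ 2) (2 / d).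
Proof.
move=> d0; have h1 := L1b_shift (- x) (L1b_far0 d0).
have h2 := L1b_shift (- x) (L1b_opp (L1b_far0 d0)).
have := L1bD h1 h2; rewrite (_ : d^-1 + d^-1 = 2 / d); last by clra.
apply: L1b_le; first by mes.
move=> y; rewrite ger0_norm; last first.
  by rewrite /ind; case: ifP => _; rewrite ?mul0r// mul1r invr_ge0 sqr_ge0.
rewrite -(sqrrN (x - y)) opprB.
rewrite (_ : (- (y - x)) ^+ 2 = (y - x) ^+ 2); last by rewrite sqrrN.
have : 0 <= ((y - x) ^+ 2)^-1 by rewrite invr_ge0 sqr_ge0.
rewrite /ind; case: (leP d `|x - y|) => h; case: (leP d (y - x)) => h';
  case: (leP d (- (y - x))) => h''; rewrite ?mul1r ?mul0r => p; try clra.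
by exfalso; move: h; case: (lerP x y) => ? ?; clra.
Qed.

(** Averaging: if every slice over the set [b], of measure at least [L], exceeded [c / L], the
    double integral would exceed [c]. The value of a function at such a point later replaces its
    mean value. *)
Lemma pick_section (b : R -> bool) (F : R * R -> R) (L c : R) :
  measurable_fun setT b -> measurable_fun setT F -> (forall z, 0 <= F z) -> 0 < L ->
  (L%:E <= mu [set x | b x])%E ->
  L1b mu2 (fun z => ind (b z.1) * F z) c ->
  exists y0, b y0 /\ L1b mu (fun x => F (y0, x)) (c / L).
Proof.
move=> mb mF F0 L0 Lb [mbF bFc]; apply: contrapT => /forallNP H.
have c0 : 0 <= c by rewrite -lee_fin; apply: le_trans bFc; exact: integral_ge0.
have mF1 x : measurable_fun setT (fun y => F (x, y)).
  by apply: (measurableT_comp mF); exact: measurable_fun_pair.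
pose G (x : R) := (\int[mu]_y (F (x, y))%:E)%E.
have mG : measurable_fun setT G.
  apply: (mes_tonelli (f := fun z : R * R => (F z)%:E)) => //.
  exact/measurable_EFinP.
pose A := [set x | b x].
have mA : measurable A.
  by rewrite -[A]setTI (_ : A = b @^-1` [set true])//; exact: mb.
have GA x : A x -> ((c / L)%:E < G x)%E.
  move=> Ax; rewrite ltNge; apply/negP => Gx; apply: (H x); split => //; split; first exact: mF1.
  by under eq_integral do rewrite ger0_norm//.
have IA : (\int[mu]_(x in A) G x <= c%:E)%E.
  apply: le_trans bFc; rewrite tonelli12//; last exact: measurable_absE.
  rewrite integral_mkcond; apply: ge0_le_integral => //.
  - by move=> x _; rewrite /patch; case: ifP => // _; apply: integral_ge0 => z _; rewrite lee_fin.
  - by apply/(measurable_restrictT G mA)/measurable_funTS.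
  - apply: (mes_tonelli (f := fun z : R * R => (`|ind (b z.1) * F z|)%:E)) => //.
    exact: measurable_absE.
  - move=> x _; rewrite /patch; case: ifPn => xA; last exact: integral_ge0.
    apply: ge0_le_integral => //.
    + by move=> y _; rewrite lee_fin.
    + by apply/measurable_EFinP; exact: mF1.
    + apply: (@measurable_absE _ _ _ (fun y => ind (b x) * F (x, y))).
      by apply: mes_M; [exact: mes_cst|exact: mF1].
    + by move=> y _; rewrite lee_fin /ind /= ifT ?mul1r ?ler_norm//; rewrite inE in xA.
have mGc : measurable_fun setT (fun x => G x - (c / L)%:E)%E by apply: emeasurable_funB.
(* The excess over [c / L] is positive on [A] and leaves no room in the integral; it vanishes almost
   everywhere on [A], which makes [A] a null set. *)
have : (\int[mu]_(x in A) `|(G x - (c / L)%:E)| = 0)%E.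
  have e1 : (\int[mu]_(x in A) `|(G x - (c / L)%:E)| + (c / L)%:E * mu A <= c%:E)%E.
    rewrite -integral_cst// -ge0_integralD//.
    + apply: le_trans IA; rewrite le_eqVlt; apply/orP; left; apply/eqP.
      apply: eq_integral => x; rewrite inE => /GA h.
      by rewrite gee0_abs ?subeK// sube_ge0// ltW.
    + by apply: measurable_funTS; apply: measurableT_comp.
    + by move=> x _ /=; rewrite lee_fin divr_ge0// ltW.
  apply/eqP; rewrite eq_le; apply/andP; split; last exact: integral_ge0.
  have e2 : (c%:E <= (c / L)%:E * mu A)%E.
    apply: (@le_trans _ _ ((c / L)%:E * L%:E)%E); last by apply: lee_wpmul2l => //; rewrite lee_fin divr_ge0// ltW.
    by rewrite -EFinM divfK// gt_eqF.
  have := le_trans (leeD2l (\int[mu]_(x in A) `|(G x - (c / L)%:E)|) e2) e1.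
  by rewrite -[leRHS]add0e leeD2rE.
move/(@ae_eq_integral_abs _ _ _ mu A mA _ (measurable_funTS mGc)) => [N [mN N0 AN]].
have : (mu A <= mu N)%E.
  apply: le_measure; rewrite ?inE//.
  move=> x Ax; apply: AN => /= /(_ Ax) h; have := GA x Ax.
  by rewrite -sube_gt0 h ltxx.
rewrite N0 => h; have := le_trans Lb h; rewrite lee_fin; clra.
Qed.

End Lebesgue2.

(** * Energy and hole filling *)

Section Positivity.
Variable R : realType.
Local Notation mu := (@lebesgue_measure R).
Local Notation mu2 := (mu \x mu)%E.
Implicit Types (w phi v f : R -> R) (x y c s : R).

Lemma L1b_le2 (F G : R * R -> R) c : measurable_fun setT F ->
  (forall x y, `|F (x, y)| <= G (x, y)) -> L1b mu2 G c -> L1b mu2 F c.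
Proof. by move=> mF h; apply: L1b_le => // -[x y]; exact: h. Qed.

Lemma L1b_le1 (F G : R -> R) c : measurable_fun setT F ->
  (forall x, `|F x| <= G x) -> L1b mu G c -> L1b mu F c.
Proof. by move=> mF h; apply: L1b_le. Qed.

(** Density of the Gagliardo energy of order one half on the line. On the diagonal its value is
    0. *)
Definition en w (z : R * R) : R := (w z.1 - w z.2) ^+ 2 / (z.1 - z.2) ^+ 2.

Lemma en_ge0 w z : 0 <= en w z.
Proof. by rewrite mulr_ge0 ?invr_ge0 ?sqr_ge0. Qed.

Lemma mes_en w : measurable_fun setT w -> measurable_fun setT (en w).
Proof. by move=> mw; rewrite /en; mes. Qed.

Lemma ind_ge0 (b : bool) : 0 <= ind b :> R. Proof. by case: b. Qed.
Lemma ind_le1 (b : bool) : ind b <= 1 :> R. Proof. by case: b => /=. Qed.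
Lemma indT (b : bool) : b -> ind b = 1 :> R. Proof. by case: b. Qed.
Lemma indF (b : bool) : ~~ b -> ind b = 0 :> R. Proof. by case: b. Qed.

Lemma isq_ge0 x : 0 <= (x ^+ 2)^-1. Proof. by rewrite invr_ge0 sqr_ge0. Qed.

(** Reduces a quadratic inequality to a [ring] identity once the completed square is named. *)
Lemma le_sub_sq (t x y : R) : y - x = t ^+ 2 -> x <= y.
Proof. by move=> h; rewrite -subr_ge0 h sqr_ge0. Qed.

Lemma eqle x y : x = y -> x <= y. Proof. by move->. Qed.

End Positivity.

Ltac nn1 := first
  [ lazymatch goal with
    | |- is_true (_ <= _ ^+ 2) => exact: sqr_ge0
    | |- is_true (_ <= (_ ^+ 2)^-1) => exact: isq_ge0
    | |- is_true (_ <= ind _) => exact: ind_ge0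
    | |- is_true (_ <= `|_|) => exact: normr_ge0
    | |- is_true (_ <= en _ _) => exact: en_ge0
    | |- is_true (_ <= _%:R) => exact: ler0n
    | |- is_true (_ <= 1) => exact: ler01
    | |- is_true (_ <= _ * _) =>
        first [ match goal with H : is_true ?P |- is_true ?P => exact H end | apply: mulr_ge0 ]
    | |- is_true (_ <= _ + _) =>
        first [ match goal with H : is_true ?P |- is_true ?P => exact H end | apply: addr_ge0 ]
    | |- is_true (_ <= _ ^+ _) =>
        first [ match goal with H : is_true ?P |- is_true ?P => exact H end | apply: exprn_ge0 ]
    end
  | assumption | (by apply: ltW)
  | exact: sqr_ge0 | exact: isq_ge0 | exact: ind_ge0 ].
Ltac nn := repeat nn1.

Section CutOffEnergy.
Variable R : realType.
Local Notation mu := (@lebesgue_measure R).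
Local Notation mu2 := (mu \x mu)%E.
Implicit Types (w phi v f : R -> R) (x y c s : R).

Lemma isq_le (K b c : R) : 0 < K -> b != 0 -> `|b| <= K * `|c| ->
  (c ^+ 2)^-1 <= K ^+ 2 * (b ^+ 2)^-1.
Proof.
move=> K0 b0 h.
have c0 : c != 0 by apply: contraNneq b0 => c0; move: h; rewrite c0 normr0 mulr0 normr_le0.
have c2 : 0 < c ^+ 2 by rewrite exprn_even_gt0.
have b2 : 0 < b ^+ 2 by rewrite exprn_even_gt0.
have e : b ^+ 2 <= K ^+ 2 * c ^+ 2.
  by rewrite -(real_normK (num_real b)) -(real_normK (num_real c)) -exprMn lerXn2r// nnegrE mulr_ge0// ltW.
rewrite -[leLHS](@mulVKf _ (K ^+ 2)); last by rewrite gt_eqF// exprn_gt0.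
apply: ler_wpM2l; first by rewrite exprn_ge0// ltW.
by rewrite -invfM lef_pV2 ?posrE// mulr_gt0// exprn_gt0.
Qed.

(** The Schur-type bound behind most double integrals below: they are dominated by a function of one
    variable times a kernel with bounded row integrals. *)
Lemma L1b_ker (J : R * R -> R) f c j : measurable_fun setT J ->
  (forall x, L1b mu (fun y => J (x, y)) j) -> L1b mu f c ->
  L1b mu2 (fun z => f z.1 * J z) (c * j).
Proof.
move=> mJ hJ hf; have mf := L1b_meas hf.
have j0 := L1b_ge0 (hJ 0).
apply: (@L1b_tonelli _ _ (fun x => `|f x| * j)); first by mes.
  move=> x /=; have /(_ (f x)) := L1bZ _ (hJ x).
  by case.
have := L1bZ j (L1b_norm hf); rewrite ger0_norm// mulrC; apply: L1b_eq => x.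
by rewrite mulrC.
Qed.

Lemma L1b_ker2 (J : R * R -> R) f c j : measurable_fun setT J ->
  (forall x y, J (x, y) = J (y, x)) ->
  (forall x, L1b mu (fun y => J (x, y)) j) -> L1b mu f c ->
  L1b mu2 (fun z => f z.2 * J z) (c * j).
Proof.
move=> mJ sJ hJ hf; have := L1b_swap (L1b_ker mJ hJ hf).
by apply: L1b_eq => -[x y] /=; rewrite sJ.
Qed.

Definition Jfar s (z : R * R) : R := ind (s <= `|z.1 - z.2|) / (z.1 - z.2) ^+ 2.
Definition Jnear s (z : R * R) : R := ind (`|z.1 - z.2| <= s).
(** Majorant for the energy density of a function with values in [0, 1] and Lipschitz constant
    [1 / s]; its row integrals are of order [1 / s]. *)
Definition Jmix s (z : R * R) : R := Jnear s z / s ^+ 2 + Jfar s z.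

Lemma mes_Jfar s : measurable_fun setT (Jfar s). Proof. by rewrite /Jfar; mes. Qed.
Lemma mes_Jnear s : measurable_fun setT (Jnear s). Proof. by rewrite /Jnear; mes. Qed.
Lemma mes_Jmix s : measurable_fun setT (Jmix s).
Proof. by rewrite /Jmix /Jfar /Jnear; mes. Qed.
Lemma Jfar_sym s x y : Jfar s (x, y) = Jfar s (y, x).
Proof. by rewrite /Jfar/= distrC -sqrrN opprB. Qed.
Lemma Jnear_sym s x y : Jnear s (x, y) = Jnear s (y, x).
Proof. by rewrite /Jnear/= distrC. Qed.
Lemma Jmix_sym s x y : Jmix s (x, y) = Jmix s (y, x).
Proof. by rewrite /Jmix Jfar_sym Jnear_sym. Qed.
Lemma Jfar_ge0 s z : 0 <= Jfar s z. Proof. by rewrite mulr_ge0 ?ind_ge0 ?isq_ge0. Qed.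
Lemma Jnear_ge0 s z : 0 <= Jnear s z. Proof. exact: ind_ge0. Qed.
Lemma Jmix_ge0 s z : 0 <= Jmix s z.
Proof. by rewrite addr_ge0 ?Jfar_ge0// mulr_ge0 ?Jnear_ge0 ?isq_ge0. Qed.
Lemma L1b_Jfar s x : 0 < s -> L1b mu (fun y => Jfar s (x, y)) (2 / s).
Proof. exact: L1b_far. Qed.
Lemma L1b_Jnear s x : 0 < s -> L1b mu (fun y => Jnear s (x, y)) (2 * s).
Proof. by move=> /ltW; exact: L1b_itv. Qed.
Lemma L1b_Jmix s x : 0 < s -> L1b mu (fun y => Jmix s (x, y)) (4 / s).
Proof.
move=> s0; have h1 := L1bZ (s ^+ 2)^-1 (L1b_Jnear x s0).
have := L1bD h1 (L1b_Jfar x s0).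
rewrite (_ : _ + _ = 4 / s).
  by apply: L1b_eq => y; rewrite /Jmix mulrC.
by rewrite ger0_norm ?isq_ge0//; field; rewrite gt_eqF.
Qed.

(** Trapezoid of slope [1 / s]: one on the ball of radius [s], zero outside the ball of radius
    [2 s]. It serves both as cut-off and as averaging kernel. *)
Definition eta (c s x : R) : R := Num.max 0 (Num.min 1 (2 - `|x - c| / s)).

Lemma mes_eta c s : measurable_fun setT (eta c s). Proof. by rewrite /eta; mes. Qed.

Lemma clamp_cases (t : R) : let m := Num.max 0 (Num.min 1 t) in
  [\/ t <= 0 /\ m = 0, 0 <= t <= 1 /\ m = t | 1 <= t /\ m = 1].
Proof.
rewrite /Order.max /Order.min; case: (ltP 1 t) => h1.
  by rewrite ltr01; constructor 3; rewrite ltW.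
by case: (ltP 0 t) => h2; [constructor 2; rewrite ltW|constructor 1].
Qed.

Lemma eta_01 c s x : 0 <= eta c s x <= 1.
Proof. by rewrite /eta; case: (clamp_cases (2 - `|x - c| / s)) => -[? ->]; clra. Qed.

Lemma eta1 c s x : 0 < s -> `|x - c| <= s -> eta c s x = 1.
Proof.
move=> s0 h; have : `|x - c| / s <= 1 by rewrite ler_pdivrMr// mul1r.
by rewrite /eta; case: (clamp_cases (2 - `|x - c| / s)) => -[? ->]; clra.
Qed.

Lemma eta0 c s x : 0 < s -> 2 * s <= `|x - c| -> eta c s x = 0.
Proof.
move=> s0 h; have : 2 <= `|x - c| / s by rewrite ler_pdivlMr.
by rewrite /eta; case: (clamp_cases (2 - `|x - c| / s)) => -[? ->]; clra.
Qed.

Lemma eta_lip c s x y : 0 < s -> `|eta c s x - eta c s y| <= `|x - y| / s.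
Proof.
move=> s0; have h : `| `|x - c| / s - `|y - c| / s| <= `|x - y| / s.
  rewrite -mulrBl normrM (gtr0_norm (_ : 0 < s^-1)) ?invr_gt0// ler_pM2r ?invr_gt0//.
  by apply: le_trans (ler_dist_dist _ _) _; rewrite opprB addrA subrK.
move: h; rewrite /eta; set p := `|x - c| / s; set q := `|y - c| / s; set D := _ / s.
rewrite !ler_norml => /andP[h1 h2].
by case: (clamp_cases (2 - p)) => -[? ->]; case: (clamp_cases (2 - q)) => -[? ->]; apply/andP; split; clra.
Qed.

Lemma deta_sq c s x y : 0 < s ->
  (eta c s x - eta c s y) ^+ 2 / (x - y) ^+ 2 <= Jmix s (x, y).
Proof.
move=> s0; have := eta_lip c x y s0; have := eta_01 c s x; have := eta_01 c s y.
set p := eta _ _ _; set q := eta _ _ _ => hp hq hl.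
have [xy|xy] := eqVneq x y.
  by rewrite xy subrr expr0n/= invr0 mulr0 Jmix_ge0.
have l2 : 0 < (x - y) ^+ 2 by rewrite exprn_even_gt0//= subr_eq0.
rewrite /Jmix /Jfar /Jnear/=.
have [h|h] := leP `|x - y| s.
  apply: (@le_trans _ _ ((s ^+ 2)^-1)); last first.
    by rewrite indT//= mul1r lerDl mulr_ge0 ?ind_ge0 ?isq_ge0.
  rewrite ler_pdivrMr// -(real_normK (num_real (q - p))).
  have : `|q - p| ^+ 2 <= (`|x - y| / s) ^+ 2 by rewrite lerXn2r// nnegrE divr_ge0// ltW.
  by rewrite exprMn exprVn (real_normK (num_real (x - y))) mulrC.
have i1 : ind (s <= `|x - y|) = 1 :> R by rewrite indT// ltW.
rewrite i1 /ind mul0r add0r ler_pM2r ?invr_gt0//.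
rewrite -(real_normK (num_real (q - p))) -[leRHS](expr1n _ 2) lerXn2r ?nnegrE//.
by rewrite ler_norml; clra.
Qed.

Section hole.
Variables (w : R -> R) (c s y0 eA : R).
Local Notation hyA := (L1b mu (fun x => (w x - w y0) ^+ 2 / (x - y0) ^+ 2) eA).
Local Notation v := (fun x => w x - w y0).

(** A Poincare inequality without means: on the slice through [y0] the weight [1 / (x - y0)^2] is at
    least [1 / K^2]. *)
Lemma v_local (b : R -> bool) (K : R) : measurable_fun setT w -> hyA -> measurable_fun setT b -> 0 < K ->
  (forall x, b x -> `|x - y0| <= K) ->
  L1b mu (fun x => ind (b x) * v x ^+ 2) (K ^+ 2 * eA).
Proof.
move=> mw hA mb K0 hb.
have := L1bZ (K ^+ 2) hA; rewrite ger0_norm ?sqr_ge0//; apply: L1b_le; first by mes.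
move=> x; rewrite ger0_norm; last by nn.
have [bx|bx] := boolP (b x); last first.
  by rewrite indF// mul0r; nn.
rewrite indT// mul1r; have [->|xy] := eqVneq x y0.
  by rewrite !subrr expr0n/= mul0r mulr0.
have l2 : 0 < (x - y0) ^+ 2 by rewrite exprn_even_gt0//= subr_eq0.
rewrite mulrCA ler_peMr ?sqr_ge0// ler_pdivlMr// mul1r.
by rewrite -(real_normK (num_real (x - y0))) lerXn2r ?nnegrE ?(ltW K0) ?hb.
Qed.

(** Far away the kernel at [x] is comparable with the kernel at [y0], so the slice through [y0] also
    controls the nonlocal tail of [v]. *)
Lemma far_ptwise (K : R) (x y : R) : 0 < K -> `|y - y0| <= K * `|x - y| -> y != y0 ->
  v y ^+ 2 / (x - y) ^+ 2 <= K ^+ 2 * (v y ^+ 2 / (y - y0) ^+ 2).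
Proof.
move=> K0 h yy; rewrite mulrCA ler_wpM2l ?sqr_ge0// isq_le// subr_eq0//.
Qed.

(** By the product rule the energy of [w] costs [2 * E2], the part of [v] within [4 s] times the
    energy of the cut-off costs [2 * 144 = 288], and the tail of [v] costs [18 * 4 = 72], both in
    units of [s * eA]. *)
Lemma cut_energy E2 : measurable_fun setT w -> 0 < s -> hyA -> `|y0 - c| <= 2 * s ->
  L1b mu2 (fun z => ind (`|z.1 - c| <= 2 * s) * en w z) E2 ->
  L1b mu2 (en (fun x => eta c s x * v x)) (2 * E2 + 360 * s * eA).
Proof.
move=> mw s0 hA hy0 h2.
have mb4 : measurable_fun setT (fun y : R => `|y - c| <= 4 * s) by mes.
have h1 := v_local mw hA mb4 (_ : 0 < 6 * s) _.
have {}h1 : L1b mu (fun y => ind (`|y - c| <= 4 * s) * v y ^+ 2) ((6 * s) ^+ 2 * eA).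
  apply: h1; first by rewrite mulr_gt0.
  move=> y hy; have := ler_normD (y - c) (c - y0).
  by rewrite addrA subrK (distrC c); clra.
have k1 := L1b_ker2 (mes_Jmix s) (Jmix_sym s) (fun x => L1b_Jmix x s0) h1.
have k2 : L1b mu2 (fun z => ind (`|z.1 - c| <= 2 * s) * (v z.2 ^+ 2 / (z.2 - y0) ^+ 2)) (eA * (4 * s)).
  have i1 : L1b mu (fun x => ind (`|c - x| <= 2 * s)) (2 * (2 * s)) by apply: L1b_itv; rewrite mulr_ge0// ltW.
  have := @L1b_ker (fun z => v z.2 ^+ 2 / (z.2 - y0) ^+ 2) _ _ eA _ (fun=> hA) i1.
  rewrite (_ : 2 * (2 * s) * eA = eA * (4 * s)); last by ring.
  move=> H; apply: (L1b_eq _ (H _)); last by mes.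
  by move=> z; rewrite distrC.
have := L1bD (L1bZ 2 h2) (L1bD (L1bZ 2 k1) (L1bZ 18 k2)).
rewrite !ger0_norm// => H.
apply: (@L1b_weak _ _ _ _ _ _ _ _ (L1b_le2 _ _ H)).
- rewrite le_eqVlt; apply/orP; left; apply/eqP; field; exact: lt0r_neq0.
- by apply: mes_en; have me := mes_eta c s; mes.
move=> x y /=; rewrite ger0_norm ?en_ge0// /en/=.
have := eta_01 c s x; have := eta_01 c s y; have := deta_sq c x y s0.
set p := eta c s x; set q := eta c s y => hd hq hp.
have kap := isq_ge0 (x - y); set k := ((x - y) ^+ 2)^-1 in hd kap *.
have e1 : (p * v x - q * v y) ^+ 2 * k <= 2 * (p ^+ 2 * (w x - w y) ^+ 2) * k + 2 * (v y ^+ 2) * ((p - q) ^+ 2 * k).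
  have key : (p * v x - q * v y) ^+ 2 <= 2 * (p ^+ 2 * (w x - w y) ^+ 2) + 2 * (v y ^+ 2) * (p - q) ^+ 2.
    by apply: (@le_sub_sq _ (p * (w x - w y) - v y * (p - q))); ring.
  by apply: le_trans (ler_wpM2r kap key) _; apply: eqle; ring.
apply: le_trans e1 _; apply: lerD.
  rewrite -mulrA ler_pM2l// mulrA -/k.
  apply: ler_wpM2r => //; apply: ler_wpM2r; first exact: sqr_ge0.
  have [h|h] := leP `|x - c| (2 * s).
    by rewrite indT//; cnra.
  by rewrite /p eta0 ?(ltW h)// expr0n/=.
(* Beyond [4 s] the cut-off vanishes at [y]; a pair that contributes has [x] within [2 s], hence
   [|y - y0| <= 3 |x - y|] and the tail bound applies. *)
have [h|h] := leP `|y - c| (4 * s).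
  rewrite [X in 2 * (X * _ * _)]/ind mul1r.
  apply: (@le_trans _ _ (2 * (v y ^+ 2 * Jmix s (x, y)))).
    by rewrite -mulrA ler_pM2l// ler_wpM2l ?sqr_ge0.
  by rewrite lerDl; nn.
rewrite [X in 2 * (X * _ * _)]/ind !mul0r mulr0 add0r.
have q0 : q = 0 by apply: eta0 => //; clra.
have [hx|hx] := leP `|x - c| (2 * s); last first.
  by rewrite q0 /p eta0 ?(ltW hx)// subrr expr0n/= mul0r mulr0; nn.
rewrite indT// mul1r q0 subr0.
have hl : `|y - y0| <= 3 * `|x - y|.
  have := ler_normD (y - c) (c - y0); rewrite addrA subrK (distrC c y0) => t1.
  have := ler_normD (y - x) (x - c); rewrite addrA subrK (distrC y x) => t2.
  by clra.
have yy : y != y0 by apply: contraTneq h => ->; rewrite -leNgt; clra.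
have hf : v y ^+ 2 * k <= 3 ^+ 2 * (v y ^+ 2 / (y - y0) ^+ 2) by exact: far_ptwise.
apply: (@le_trans _ _ (2 * (v y ^+ 2 * k))); last by move: hf; set A := (_ / _); clra.
rewrite -mulrA ler_pM2l// ler_wpM2l ?sqr_ge0//.
by rewrite ler_piMl//; cnra.
Qed.

Definition Aset x := (s < `|x - c|) && (`|x - c| <= 2 * s).

(** The product is a full square when both points lie in the inner ball. Negative contributions need
    a point of the annulus, where the cut-off varies, or a jump from the inner ball over the
    annulus; these are the subtracted terms. The proof goes through the zones of [x] and [y]. *)
Lemma hole_ptwise x y : 0 < s ->
  4^-1 * (ind (`|x - c| <= s) * (w x - w y) ^+ 2)
   - 2 * ((ind (Aset x) + ind (Aset y)) * (w x - w y) ^+ 2)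
   - (ind (Aset x) * v x ^+ 2 + ind (Aset y) * v y ^+ 2) * (eta c s x - eta c s y) ^+ 2
   - ind (`|x - c| <= s) * ind (2 * s < `|y - c|) * v y ^+ 2
   - ind (`|y - c| <= s) * ind (2 * s < `|x - c|) * v x ^+ 2
  <= (w x - w y) * (eta c s x * v x - eta c s y * v y).
Proof.
move=> s0; set d := w x - w y; set e := eta c s.
have hx : 0 <= e x <= 1 := eta_01 c s x.
have hy : 0 <= e y <= 1 := eta_01 c s y.
have dE : d = v x - v y by rewrite /d; ring.
rewrite dE; set X := v x; set Y := v y.
have X2 := sqr_ge0 X; have Y2 := sqr_ge0 Y; have XY := sqr_ge0 (X + Y); have XY' := sqr_ge0 (X - Y).
have t1 := sqr_ge0 (X * (e x - e y)); have t2 := sqr_ge0 (Y * (e x - e y)).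
have t3 := sqr_ge0 ((X - Y) + X * (e x - e y)); have t4 := sqr_ge0 ((X - Y) + Y * (e x - e y)).
have t5 : 0 <= e y * (X - Y) ^+ 2 by apply: mulr_ge0 => //; case/andP: hy.
have t6 : 0 <= e x * (X - Y) ^+ 2 by apply: mulr_ge0 => //; case/andP: hx.
rewrite /Aset.
case: (leP `|x - c| s) => hx1; case: (leP `|y - c| s) => hy1 /=.
- have -> : e x = 1 by exact: eta1.
  have -> : e y = 1 by exact: eta1.
  have -> : (2 * s < `|x - c|) = false by apply/negbTE; rewrite -leNgt; clra.
  have -> : (2 * s < `|y - c|) = false by apply/negbTE; rewrite -leNgt; clra.
  by rewrite /ind; clra.
- have ex : e x = 1 by exact: eta1.
  have -> : (2 * s < `|x - c|) = false by apply/negbTE; rewrite -leNgt; clra.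
  case: (leP `|y - c| (2 * s)) => hy2 /=.
    by move: t2 t4 t6; rewrite /ind ex; clra.
  have -> : e y = 0 by apply: eta0 => //; exact: ltW.
  by rewrite /ind ex; clra.
- have ey : e y = 1 by exact: eta1.
  have -> : (2 * s < `|y - c|) = false by apply/negbTE; rewrite -leNgt; clra.
  case: (leP `|x - c| (2 * s)) => hx2 /=.
    by move: t1 t3 t5; rewrite /ind ey; clra.
  have -> : e x = 0 by apply: eta0 => //; exact: ltW.
  by rewrite /ind ey; clra.
- case: (leP `|x - c| (2 * s)) => hx2 /=; case: (leP `|y - c| (2 * s)) => hy2 /=.
  + by move: t1 t3 t5 t2; rewrite /ind; clra.
  + by move: t1 t3 t5; rewrite /ind; clra.
  + by move: t2 t4 t6; rewrite /ind; clra.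
  + have -> : e x = 0 by apply: eta0 => //; exact: ltW.
    have -> : e y = 0 by apply: eta0 => //; exact: ltW.
    by rewrite /ind; clra.
Qed.

End hole.
End CutOffEnergy.

Section Form.
Variable R : realType.
Local Notation mu := (@lebesgue_measure R).
Local Notation mu2 := (mu \x mu)%E.
Implicit Types (a w phi v f : R -> R) (x y c s : R).

Lemma ind_mono (b1 b2 : bool) : (b1 -> b2) -> ind b1 <= ind b2 :> R.
Proof. by case: b1 => [/(_ isT) ->//|_]; exact: ind_ge0. Qed.

Definition ker_ok a (Lam : R) := [/\ measurable_fun setT a, 1 <= Lam,
  forall x, a x = a (- x) & forall x, Lam^-1 <= a x <= Lam].

Definition kk a (z : R * R) : R := a (z.1 - z.2) / (z.1 - z.2) ^+ 2.

(** The integral runs over the whole plane: for [phi] vanishing off an open set, pairs with both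
    points off that set contribute nothing. *)
Definition form a w phi : R :=
  \int[mu2]_z ((w z.1 - w z.2) * (phi z.1 - phi z.2) * kk a z).

(** Only the first point is localized. By symmetry the energy of all pairs meeting [b] is at most
    twice this number. *)
Definition nuS w (b : R -> bool) : R := \int[mu2]_z (ind (b z.1) * en w z).

Lemma mes_kk a Lam : ker_ok a Lam -> measurable_fun setT (kk a).
Proof. by case=> ma _ _ _; rewrite /kk; mes. Qed.

Lemma kk_bnd a Lam x y : ker_ok a Lam ->
  Lam^-1 / (x - y) ^+ 2 <= kk a (x, y) <= Lam / (x - y) ^+ 2.
Proof.
by case=> _ _ _ /(_ (x - y)) /andP[h1 h2]; rewrite /kk/=; apply/andP; split;
  apply: ler_wpM2r => //; exact: isq_ge0.
Qed.

Lemma kk_ge0 a Lam z : ker_ok a Lam -> 0 <= kk a z.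
Proof.
case: z => x y h; case: (h) => _ L1 _ _; have /andP[+ _] := kk_bnd x y h; apply: le_trans.
by apply: mulr_ge0; [rewrite invr_ge0; clra|exact: isq_ge0].
Qed.

Lemma kk_sym a Lam x y : ker_ok a Lam -> kk a (x, y) = kk a (y, x).
Proof. by case=> _ _ sa _; rewrite /kk/= sa opprB -sqrrN opprB. Qed.

(** A solution has finite energy only near the domain. Pairs missing [b] do not contribute, so the
    energy of [w] on pairs meeting [b] is enough. *)
Lemma form_L1b a Lam w phi (b : R -> bool) E P : ker_ok a Lam ->
  measurable_fun setT w -> measurable_fun setT phi -> measurable_fun setT b ->
  (forall x, ~~ b x -> phi x = 0) ->
  L1b mu2 (fun z => ind (b z.1) * en w z) E -> L1b mu2 (en phi) P ->
  L1b mu2 (fun z => (w z.1 - w z.2) * (phi z.1 - phi z.2) * kk a z) (Lam * (E + P / 2)).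
Proof.
move=> ok mw mp mb b0 hE hP; have [ma L1 sa ba] := ok; have mk := mes_kk ok.
have H := L1bZ Lam (L1bD (L1bZ 2^-1 (L1bD hE (L1b_swap hE))) (L1bZ 2^-1 hP)).
apply: (@L1b_weak _ _ _ _ _ _ _ _ (L1b_le2 _ _ H)).
- by rewrite !ger0_norm//; clra.
- by mes.
move=> x y /=; rewrite /en/= -(sqrrN (y - x)) opprB -(sqrrN (w y - w x)) opprB.
rewrite normrM [`|kk a _|]ger0_norm; last exact: kk_ge0 ok.
set d := w x - w y; set e := phi x - phi y; set k := ((x - y) ^+ 2)^-1.
have k0 : 0 <= k := isq_ge0 _.
have /andP[_ hk] := kk_bnd x y ok.
have e0 : ind (b x) + ind (b y) < 1 :> R -> e = 0.
  rewrite /e /ind; case: ifPn => bx; case: ifPn => bY; try clra.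
  by move=> _; rewrite !b0// subrr.
have key : `|d * e| <= 2^-1 * (ind (b x) * d ^+ 2 + ind (b y) * d ^+ 2) + 2^-1 * e ^+ 2.
  have [/e0 ->|h] := ltP (ind (b x) + ind (b y)) (1 : R).
    rewrite mulr0 normr0 expr0n/= mulr0 addr0; apply: mulr_ge0 => //.
    by apply: addr_ge0; nn.
  have d2 : d ^+ 2 <= ind (b x) * d ^+ 2 + ind (b y) * d ^+ 2.
    by rewrite -mulrDl ler_peMl ?sqr_ge0.
  rewrite normrM; have := sqr_ge0 (`|d| - `|e|); rewrite sqrrB !real_normK ?num_real//.
  by move: d2; clra.
apply: le_trans (ler_wpM2l (normr_ge0 _) hk) _.
have := ler_wpM2r (mulr_ge0 (le_trans ler01 L1) k0) key.
by rewrite -/k; clra.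
Qed.

(** Integrates [hole_ptwise] against the kernel. [E2] only provides integrability; what is lost on
    the left is the energy of the annulus and the slice [s * eA]. *)
Lemma hole_filling a Lam w c s y0 eA E2 : ker_ok a Lam ->
  measurable_fun setT w -> 0 < s -> Aset c s y0 ->
  L1b mu (fun x => (w x - w y0) ^+ 2 / (x - y0) ^+ 2) eA ->
  L1b mu2 (fun z => ind (`|z.1 - c| <= 2 * s) * en w z) E2 ->
  (4 * Lam)^-1 * nuS w (fun x => `|x - c| <= s)
    - Lam * (4 * nuS w (Aset c s) + 192 * (s * eA))
  <= form a w (fun x => eta c s x * (w x - w y0)).
Proof.
move=> ok mw s0 Ay hA h2; have [ma L1 sa ba] := ok; have mk := mes_kk ok.
have me := mes_eta c s.
have mA : measurable_fun setT (Aset c s) by rewrite /Aset; mes.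
have hy0 : `|y0 - c| <= 2 * s by case/andP: Ay.
have mv : measurable_fun setT (fun x => w x - w y0) by mes.
have T1 : L1b mu2 (fun z => ind (`|z.1 - c| <= s) * en w z) E2.
  apply: L1b_le2 h2; first by have := mes_en mw => ?; mes.
  move=> x y /=; rewrite ger0_norm; last by nn.
  apply: ler_wpM2r; first exact: en_ge0.
  by apply: ind_mono => h; clra.
have T2 : L1b mu2 (fun z => ind (Aset c s z.1) * en w z) E2.
  apply: L1b_le2 h2; first by have := mes_en mw => ?; mes.
  move=> x y /=; rewrite ger0_norm; last by nn.
  apply: ler_wpM2r; first exact: en_ge0.
  by apply: ind_mono => /andP[].
have T1' := L1b_self T1 (fun z => mulr_ge0 (ind_ge0 _ _) (en_ge0 _ _)).
have T2' := L1b_self T2 (fun z => mulr_ge0 (ind_ge0 _ _) (en_ge0 _ _)).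
have V : L1b mu (fun x => ind (Aset c s x) * (w x - w y0) ^+ 2) ((4 * s) ^+ 2 * eA).
  apply: v_local => //; first by clra.
  move=> x /andP[_ hx]; have := ler_normD (x - c) (c - y0).
  by rewrite addrA subrK (distrC c); clra.
have T3 := L1b_ker (mes_Jmix s) (fun x => L1b_Jmix x s0) V.
have T4 : L1b mu2 (fun z => ind (`|z.1 - c| <= s) * ((w z.2 - w y0) ^+ 2 / (z.2 - y0) ^+ 2)) (2 * s * eA).
  have i1 : L1b mu (fun x => ind (`|c - x| <= s)) (2 * s) by apply: L1b_itv; exact: ltW.
  have := @L1b_ker _ (fun z => (w z.2 - w y0) ^+ 2 / (z.2 - y0) ^+ 2) _ _ eA _ (fun=> hA) i1.
  move=> H; apply: (L1b_eq _ (H _)); last by mes.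
  by move=> z; rewrite distrC.
(* The three groups give [4] times the energy of the annulus, then [128 * (s * eA)] from the
   variation of the cut-off and [64 * (s * eA)] from the tails, whence 192. *)
have S := L1bD (L1bZ 2 (L1bD T2' (L1b_swap T2')))
  (L1bD (L1bD T3 (L1b_swap T3)) (L1bZ 16 (L1bD T4 (L1b_swap T4)))).
have TT := L1bB (L1bZ (4 * Lam)^-1 T1') (L1bZ Lam S).
have PhiE : L1b mu2 (en (fun x => eta c s x * (w x - w y0))) (2 * E2 + 360 * s * eA).
  exact: cut_energy.
have mphi : measurable_fun setT (fun x => eta c s x * (w x - w y0)) by mes.
have FL : L1b mu2 (fun z => (w z.1 - w z.2) * ((eta c s z.1 * (w z.1 - w y0)) - (eta c s z.2 * (w z.2 - w y0))) * kk a z)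
    (Lam * (E2 + (2 * E2 + 360 * s * eA) / 2)).
  apply: (@form_L1b a Lam w (fun x => eta c s x * (w x - w y0)) (fun x => `|x - c| <= 2 * s)) => //.
  - by mes.
  - by move=> x; rewrite -ltNge => h; rewrite eta0 ?mul0r// ltW.
apply: le_trans (Rint_le TT FL _) => //; last first.
  move=> [x y] /=; rewrite /en/= -(sqrrN (y - x)) opprB -(sqrrN (w y - w x)) opprB.
  rewrite (Jmix_sym _ y x).
  have key := hole_ptwise w c y0 x y s0; have hd := deta_sq c x y s0.
  have /andP[hk1 hk2] := kk_bnd x y ok; have k0 := kk_ge0 (x, y) ok.
  set k := ((x - y) ^+ 2)^-1 in hd hk1 hk2 *; set K := kk a (x, y) in hk1 hk2 k0 *.
  have kp : 0 <= k := isq_ge0 _.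
  set d2 := (w x - w y) ^+ 2 in key *.
  set vx := (w x - w y0) ^+ 2 in key *; set vy := (w y - w y0) ^+ 2 in key *.
  set ix := ind (`|x - c| <= s) in key *; set iy := ind (`|y - c| <= s) in key *.
  set ax := ind (Aset c s x) in key *; set ay := ind (Aset c s y) in key *.
  set J := Jmix s (x, y) in hd *; set de := (_ - _) ^+ 2 in hd key *.
  have d20 : 0 <= d2 := sqr_ge0 _. have de0 : 0 <= de := sqr_ge0 _.
  have vx0 : 0 <= vx := sqr_ge0 _. have vy0 : 0 <= vy := sqr_ge0 _.
  have ix0 : 0 <= ix := ind_ge0 _ _. have iy0 : 0 <= iy := ind_ge0 _ _.
  have ax0 : 0 <= ax := ind_ge0 _ _. have ay0 : 0 <= ay := ind_ge0 _ _.
  have far x' y' : let vy' := (w y' - w y0) ^+ 2 in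
      ind (`|x' - c| <= s) * ind (2 * s < `|y' - c|) * vy' * ((x' - y') ^+ 2)^-1 <=
      16 * (ind (`|x' - c| <= s) * (vy' / (y' - y0) ^+ 2)).
    move=> vy'; rewrite /ind; case: (leP `|x' - c| s) => h1; rewrite ?mul0r ?mulr0//.
    case: (ltP (2 * s) `|y' - c|) => h2'; rewrite ?mul1r ?mul0r ?mulr0//.
      have -> : 16 = 4 ^+ 2 :> R by ring.
      apply: far_ptwise => //; last by apply: contraTneq h2' => ->; rewrite -leNgt.
      have := ler_normD (y' - c) (c - y0); rewrite addrA subrK (distrC c y0) => t1.
      have := ler_normD (y' - x') (x' - c); rewrite addrA subrK (distrC y' x') => t2.
      by clra.
    by nn.
  have f1 := far x y; have f2 := far y x; rewrite /= -/ix -/iy -/vx -/vy in f1 f2.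
  rewrite -(sqrrN (y - x)) opprB -/k in f2.
  set g1 := ind (2 * s < `|y - c|) in key f1; set g2 := ind (2 * s < `|x - c|) in key f2.
  have g10 : 0 <= g1 := ind_ge0 _ _. have g20 : 0 <= g2 := ind_ge0 _ _.
  set F1 := (ix * (vy / _)) in f1 *; set F2 := (iy * (vx / _)) in f2 *.
  have Lp : 0 < Lam by clra.
  have m1 : ix * d2 * (Lam^-1 * k) <= ix * d2 * K by apply: ler_wpM2l => //; nn.
  have m2 : (ax + ay) * d2 * K <= (ax + ay) * d2 * (Lam * k) by apply: ler_wpM2l => //; nn.
  have m3 : (ax * vx + ay * vy) * de * K <= (ax * vx + ay * vy) * (Lam * J).
    apply: (@le_trans _ _ ((ax * vx + ay * vy) * de * (Lam * k))).
      by apply: ler_wpM2l => //; nn.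
    rewrite -mulrA; apply: ler_wpM2l; first by nn.
    by rewrite mulrCA; apply: ler_wpM2l => //; clra.
  have m4 : ix * g1 * vy * K <= Lam * (16 * F1).
    apply: (@le_trans _ _ (ix * g1 * vy * (Lam * k))); first by apply: ler_wpM2l => //; nn.
    by rewrite mulrCA; apply: ler_wpM2l => //; clra.
  have m5 : iy * g2 * vx * K <= Lam * (16 * F2).
    apply: (@le_trans _ _ (iy * g2 * vx * (Lam * k))); first by apply: ler_wpM2l => //; nn.
    by rewrite mulrCA; apply: ler_wpM2l => //; clra.
  have := ler_wpM2r k0 key.
  have -> : (4 * Lam)^-1 * (ix * (d2 * k)) = 4^-1 * (ix * d2 * (Lam^-1 * k)).
    by rewrite invfM; ring.
  move: m1 m2 m3 m4 m5; clear; move: (ix * d2 * (Lam^-1 * k)) => P1.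
  clra.
rewrite (RintB (L1bZ _ T1') (L1bZ _ S)) (RintZ _ T1') (RintZ _ S) -/(nuS w _).
apply: lerB => //; apply: ler_wpM2l; first by clra.
apply: le_trans (L1b_Rint_le S) _; rewrite !ger0_norm// -/(nuS w (Aset c s)).
by apply: eqle; field; exact: lt0r_neq0.
Qed.

(** The right half of the annulus already has length [s]. With this choice of [y0] the term [s * eA]
    in [hole_filling] is at most the energy of the annulus, so it can be filled in as well. *)
Lemma pick_A (F : R * R -> R) c s E : 0 < s -> measurable_fun setT F ->
  (forall z, 0 <= F z) -> L1b mu2 (fun z => ind (Aset c s z.1) * F z) E ->
  exists y0, Aset c s y0 /\ L1b mu (fun x => F (y0, x)) (E / s).
Proof.
move=> s0 mF F0 h; apply: (pick_section (b := Aset c s)) => //.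
  by rewrite /Aset; mes.
have e : mu [set` `]c + s, c + 2 * s]%R] = s%:E.
  by rewrite lebesgue_measure_itv/= lte_fin ifT ?ltrD2l -?EFinB; [congr EFin; ring|clra].
rewrite -e; apply: le_measure; rewrite ?inE//.
  have mA : measurable_fun setT (Aset c s) by rewrite /Aset; mes.
  by have := mA measurableT [set true] I; rewrite setTI.
move=> x /=; rewrite in_itv/= => /andP[h1 h2].
by rewrite /Aset ger0_norm; [apply/andP; split; clra|clra].
Qed.

End Form.

(** * Dyadic averages and compensated products *)

Section Avg.
Variable R : realType.
Local Notation mu := (@lebesgue_measure R).
Local Notation mu2 := (mu \x mu)%E.
Implicit Types (w phi v f : R -> R) (x y c s : R).

Lemma Rint_itv x d : 0 <= d -> \int[mu]_y ind (`|x - y| <= d) = 2 * d.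
Proof.
move=> d0; rewrite /Rintegral (_ : (fun y => _) = (fun y => (\1_(`[x - d, x + d]) y)%:E)).
  rewrite integral_indic//.
  have h : mu [set` `[x - d, x + d]%R] = (2 * d)%:E.
    rewrite lebesgue_measure_itv/= lte_fin; case: ifPn => h.
      by rewrite -EFinB; congr EFin; ring.
    by congr EFin; move: h; rewrite -leNgt; clra.
  by rewrite setIT; exact: (congr1 fine h).
apply/funext => y; rewrite indicE /ind; congr EFin.
have -> : (y \in `[x - d, x + d]%classic) = (`|x - y| <= d).
  by apply/idP/idP; rewrite inE/= in_itv/= ler_norml => h; apply/andP; split; move: h => /andP[]; clra.
by case: ifP.
Qed.

Lemma lip_mes (K : R) f : (forall x y, `|f x - f y| <= K * `|x - y|) -> measurable_fun setT f.
Proof.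
move=> h; apply: continuous_measurable_fun => x.
apply/cvgrPdist_le => e e0.
have [K0|K0] := leP K 0.
  near=> y; apply: le_trans (h x y) _.
  by apply: le_trans (ltW e0); apply: mulr_le0_ge0.
have e1 : 0 < K^-1 * e by rewrite mulr_gt0// invr_gt0.
apply/nbhs_ballP; exists (K^-1 * e); first exact: e1.
move=> y; rewrite /ball/= => /ltW hy; apply: le_trans (h x y) _.
by rewrite -ler_pdivlMl.
Unshelve. all: by end_near. Qed.

Lemma eta_sym x d y : eta x d y = eta y d x.
Proof. by rewrite /eta distrC. Qed.

Lemma eta_ind x d z : 0 < d -> eta x d z <= ind (`|x - z| <= 2 * d).
Proof.
move=> d0; have [h|h] := leP `|x - z| (2 * d).
  by rewrite indT//; case/andP: (eta_01 x d z).
by rewrite eta0// distrC ltW.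
Qed.

Definition mass (d : R) : R := \int[mu]_z eta 0 d z.
(** Averaging against a trapezoid rather than an indicator makes the averages Lipschitz at scale
    [d]. Of the normalization only [mass_ge] and [mass_shift] matter. *)
Definition avg (d : R) w x : R := (mass d)^-1 * \int[mu]_z (w z * eta x d z).

Lemma L1b_eta x d : 0 < d -> L1b mu (fun z => eta x d z) (4 * d).
Proof.
move=> d0; have h0 : 0 <= 2 * d by clra.
have := L1b_itv x h0; rewrite mulrA => h.
have -> : 4 * d = 2 * 2 * d by ring.
apply: L1b_le1 h; first exact: mes_eta.
by move=> z; rewrite ger0_norm ?eta_ind//; case/andP: (eta_01 x d z).
Qed.

Lemma mass_ge d : 0 < d -> 2 * d <= mass d.
Proof.
move=> d0; rewrite -(Rint_itv 0 (ltW d0)) /mass.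
apply: (Rint_le (L1b_itv 0 (ltW d0)) (L1b_eta 0 d0)) => z.
rewrite /ind; case: (leP `|0 - z| d) => h; last by case/andP: (eta_01 0 d z).
by rewrite eta1// distrC.
Qed.

Lemma mass_shift x d : \int[mu]_z eta x d z = mass d.
Proof.
rewrite /mass -(Rint_shift (- x) (mes_eta 0 d)); apply: Rint_ext => z.
by rewrite /eta subr0.
Qed.

Section bounded.
Variables (w : R -> R) (M d : R).
Hypotheses (mw : measurable_fun setT w) (wM : forall x, `|w x| <= M) (d0 : 0 < d).

Lemma L1b_weta x : L1b mu (fun z => w z * eta x d z) (M * (4 * d)).
Proof.
have M0 : 0 <= M := le_trans (normr_ge0 _) (wM 0).
have := L1bZ M (L1b_eta x d0); rewrite (ger0_norm M0); apply: L1b_le1.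
  by have me := mes_eta x d; have mw' := mw; mes.
move=> z; rewrite normrM [`|eta _ _ _|]ger0_norm; last by case/andP: (eta_01 x d z).
by apply: ler_wpM2r => //; case/andP: (eta_01 x d z).
Qed.

Lemma avg_subc x c : avg d w x - c = (mass d)^-1 * \int[mu]_z ((w z - c) * eta x d z).
Proof.
have m0 : 0 < mass d by have := mass_ge d0; have d0' := d0; clra.
have -> : \int[mu]_z ((w z - c) * eta x d z) =
   \int[mu]_z (w z * eta x d z) - c * mass d.
  rewrite -(mass_shift x) -(RintZ c (L1b_eta x d0)) -(RintB (L1b_weta x) (L1bZ c (L1b_eta x d0))).
  by apply: Rint_ext => z; ring.
by rewrite /avg; field; exact: lt0r_neq0.
Qed.

Lemma avg_near x c D : L1b mu (fun z => ind (`|z - x| <= 2 * d) * `|w z - c|) D ->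
  `|avg d w x - c| <= D / (2 * d).
Proof.
move=> hD; have d0' := d0; have mg := mass_ge d0.
have m0 : 0 < mass d by clra.
rewrite avg_subc normrM [`|(mass d)^-1|]gtr0_norm ?invr_gt0//.
have H : L1b mu (fun z => (w z - c) * eta x d z) D.
  apply: L1b_le1 hD; first by have me := mes_eta x d; have mw' := mw; mes.
  move=> z; rewrite normrM [`|eta _ _ _|]ger0_norm; last by case/andP: (eta_01 x d z).
  by rewrite mulrC; apply: ler_wpM2r => //; rewrite (distrC z); exact: eta_ind.
have D0 := L1b_ge0 hD.
apply: (@le_trans _ _ ((mass d)^-1 * D)).
  by apply: ler_wpM2l; [rewrite invr_ge0 ltW|exact: L1b_Rint H].
rewrite mulrC; apply: ler_wpM2l => //.
by rewrite lef_pV2// posrE; clra.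
Qed.

Lemma avg_diff x y c : avg d w x - avg d w y =
  (mass d)^-1 * \int[mu]_z ((w z - c) * (eta x d z - eta y d z)).
Proof.
have -> : avg d w x - avg d w y = (avg d w x - c) - (avg d w y - c) by ring.
rewrite !avg_subc -mulrBr; congr (_ * _).
have h u : L1b mu (fun z => (w z - c) * eta u d z) (M * (4 * d) + `|c| * (4 * d)).
  have := L1bB (L1b_weta u) (L1bZ c (L1b_eta u d0)).
  by apply: L1b_eq => z; ring.
rewrite -(RintB (h x) (h y)).
by apply: Rint_ext => z; ring.
Qed.

Lemma avg_lip x y c D : L1b mu (fun z => ind (`|z - x| <= 3 * d) * `|w z - c|) D ->
  `|x - y| <= d -> `|avg d w x - avg d w y| <= `|x - y| / d * (D / (2 * d)).
Proof.
move=> hD xy; have d0' := d0; have mg := mass_ge d0.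
have m0 : 0 < mass d by clra.
rewrite (avg_diff x y c) normrM [`|(mass d)^-1|]gtr0_norm ?invr_gt0//.
have l0 : 0 <= `|x - y| / d by rewrite divr_ge0// ltW.
have H : L1b mu (fun z => (w z - c) * (eta x d z - eta y d z)) (`|x - y| / d * D).
  have := L1bZ (`|x - y| / d) hD; rewrite (ger0_norm l0); apply: L1b_le1.
    by have me := mes_eta x d; have me' := mes_eta y d; have mw' := mw; mes.
  move=> z; rewrite normrM mulrC.
  have [hz|hz] := leP `|z - x| (3 * d).
    rewrite indT// mul1r; apply: ler_wpM2r => //.
    by rewrite (eta_sym x) (eta_sym y); exact: eta_lip.
  rewrite !eta0//; first by rewrite subrr normr0 mul0r mulr_ge0// indF// mul0r.
    have := ler_normD (z - y) (y - x); rewrite addrA subrK (distrC y x); clra.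
  by clra.
have D0 := L1b_ge0 hD.
apply: (@le_trans _ _ ((mass d)^-1 * (`|x - y| / d * D))).
  by apply: ler_wpM2l; [rewrite invr_ge0 ltW|exact: L1b_Rint H].
rewrite mulrCA; apply: ler_wpM2l => //; rewrite mulrC; apply: ler_wpM2l => //.
by rewrite lef_pV2// posrE; clra.
Qed.

Lemma avg_glip x y : `|avg d w x - avg d w y| <= 4 * M / d * `|x - y|.
Proof.
have d0' := d0; have mg := mass_ge d0.
have m0 : 0 < mass d by clra.
have M0 : 0 <= M := le_trans (normr_ge0 _) (wM 0).
rewrite (avg_diff x y 0) normrM [`|(mass d)^-1|]gtr0_norm ?invr_gt0//.
have l0 : 0 <= `|x - y| / d by rewrite divr_ge0// ltW.
have h20 : 0 <= 2 * d by clra.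
have H : L1b mu (fun z => (w z - 0) * (eta x d z - eta y d z)) (`|x - y| / d * M * (8 * d)).
  have := L1bZ (`|x - y| / d * M) (L1bD (L1b_itv x h20) (L1b_itv y h20)).
  rewrite (ger0_norm (mulr_ge0 l0 M0)) (_ : 2 * (2 * d) + 2 * (2 * d) = 8 * d); last by ring.
  apply: L1b_le1.
    by have me := mes_eta x d; have me' := mes_eta y d; have mw' := mw; mes.
  move=> z; rewrite normrM subr0.
  have e1 : `|eta x d z - eta y d z| <= `|x - y| / d * (ind (`|x - z| <= 2 * d) + ind (`|y - z| <= 2 * d)).
    have [hx|hx] := leP `|x - z| (2 * d).
      apply: (@le_trans _ _ (`|x - y| / d)); first by rewrite (eta_sym x) (eta_sym y); exact: eta_lip.
      by apply: ler_peMr => //; rewrite [ind true]/ind lerDl ind_ge0.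
    have [hy|hy] := leP `|y - z| (2 * d).
      apply: (@le_trans _ _ (`|x - y| / d)); first by rewrite (eta_sym x) (eta_sym y); exact: eta_lip.
      by apply: ler_peMr => //; rewrite [ind true]/ind lerDr ind_ge0.
    have ex : eta x d z = 0 by apply: eta0 => //; rewrite distrC ltW.
    have ey : eta y d z = 0 by apply: eta0 => //; rewrite distrC ltW.
    by rewrite ex ey subrr normr0 /ind addr0 mulr0.
  rewrite mulrAC [leRHS]mulrC; apply: ler_pM => //.
apply: (@le_trans _ _ ((mass d)^-1 * (`|x - y| / d * M * (8 * d)))).
  by apply: ler_wpM2l; [rewrite invr_ge0 ltW|exact: L1b_Rint H].
apply: (@le_trans _ _ ((2 * d)^-1 * (`|x - y| / d * M * (8 * d)))).
  apply: ler_wpM2r; first by nn.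
  by rewrite lef_pV2// posrE; clra.
by apply: eqle; field; exact: lt0r_neq0.
Qed.

Lemma mes_avg : measurable_fun setT (avg d w).
Proof. exact: lip_mes avg_glip. Qed.

Lemma avg_bnd x : `|avg d w x| <= 2 * M.
Proof.
have d0' := d0; have M0 : 0 <= M := le_trans (normr_ge0 _) (wM 0).
have h20 : 0 <= 2 * d by clra.
rewrite -[avg d w x]subr0; apply: (le_trans (@avg_near x 0 (M * (2 * (2 * d))) _)).
  have := L1bZ M (L1b_itv x h20); rewrite (ger0_norm M0); apply: L1b_le1.
    by have mw' := mw; mes.
  move=> z; rewrite subr0 normrM normr_id ger0_norm ?ind_ge0// (distrC z) mulrC.
  by apply: ler_wpM2r => //; exact: ind_ge0.
by apply: eqle; field; exact: lt0r_neq0.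
Qed.

Lemma avg_supp x c r : (forall z, r < `|z - c| -> w z = 0) -> r + 2 * d < `|x - c| -> avg d w x = 0.
Proof.
move=> h hx; have d0' := d0; rewrite /avg (_ : (fun z => _) = fun=> 0).
  by rewrite /Rintegral integral0 mulr0.
apply/funext => z; have [hz|hz] := leP `|z - x| (2 * d).
  rewrite h ?mul0r//; have := ler_normD (x - z) (z - c).
  by rewrite addrA subrK (distrC x z); clra.
by rewrite eta0 ?mulr0// ltW.
Qed.

End bounded.

(** The scale invariant embedding of the energy space into BMO: averages are compared with the value
    of [w] at a slice point of the annulus between [3/2 d] and [3 d]. The bounds do not involve
    [M]. *)
Lemma avg_osc w M d x sg : measurable_fun setT w -> (forall x, `|w x| <= M) -> 0 < d -> 0 < sg ->
  L1b mu2 (fun z => ind (`|z.1 - x| <= 3 * d) * en w z) (sg ^+ 2) ->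
  [/\ `|avg d w x - avg (d / 2) w x| <= 18 * sg &
     forall y, `|x - y| <= d -> `|avg d w x - avg d w y| <= 6 * sg * (`|x - y| / d)].
Proof.
move=> mw wM d0 s0 hE.
have hs : 0 < 3 / 2 * d by clra.
have hA : L1b mu2 (fun z => ind (Aset x (3 / 2 * d) z.1) * en w z) (sg ^+ 2).
  have mA : measurable_fun setT (Aset x (3 / 2 * d)) by rewrite /Aset; mes.
  have me := mes_en mw.
  apply: L1b_le2 hE; first by mes.
  move=> u v /=; rewrite ger0_norm; last by nn.
  apply: ler_wpM2r; first exact: en_ge0.
  by apply: ind_mono => /andP[_]; clra.
have [y0 [Ay0 hy0]] := pick_A hs (mes_en mw) (en_ge0 _) hA.
have hy : L1b mu (fun z => (w z - w y0) ^+ 2 / (z - y0) ^+ 2) (sg ^+ 2 / (3 / 2 * d)).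
  by apply: L1b_eq hy0 => z; rewrite /en/= -(sqrrN (w y0 - _)) opprB -(sqrrN (y0 - _)) opprB.
have mb : measurable_fun setT (fun z : R => `|z - x| <= 3 * d) by mes.
have hv : L1b mu (fun z => ind (`|z - x| <= 3 * d) * (w z - w y0) ^+ 2) ((6 * d) ^+ 2 * (sg ^+ 2 / (3 / 2 * d))).
  apply: (v_local mw hy mb); first by clra.
  move=> z hz; have := ler_normD (z - x) (x - y0); rewrite addrA subrK (distrC x y0).
  by case/andP: Ay0 => _; clra.
(* Instead of Cauchy-Schwarz, [|t| <= sg + t^2 / (4 sg)]: each of the two terms integrates to
   [6 * d * sg]. *)
have hL : L1b mu (fun z => ind (`|z - x| <= 3 * d) * `|w z - w y0|) (12 * (d * sg)).
  have d3 : 0 <= 3 * d by clra.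
  have := L1bD (L1bZ sg (L1b_itv x d3)) (L1bZ (4 * sg)^-1 hv).
  rewrite !ger0_norm; [|by rewrite invr_ge0; clra|by clra].
  move=> H; apply: (@L1b_weak _ _ _ _ _ _ _ _ (L1b_le1 _ _ H)).
  - apply: eqle; field; apply/andP; split; exact: lt0r_neq0.
  - by mes.
  move=> z; rewrite ger0_norm; last by nn.
  rewrite (distrC x z) mulrCA [sg * _]mulrC -mulrDr; apply: ler_wpM2l; first exact: ind_ge0.
  set t := `|w z - w y0|; rewrite -(real_normK (num_real (w z - w y0))) -/t.
  have e : sg + (4 * sg)^-1 * t ^+ 2 - t = ((2 * sg - t) ^+ 2) / (4 * sg) by field; exact: lt0r_neq0.
  by rewrite -subr_ge0 e; apply: mulr_ge0; [exact: sqr_ge0|rewrite invr_ge0; clra].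
have hL2 : L1b mu (fun z => ind (`|z - x| <= 2 * d) * `|w z - w y0|) (12 * (d * sg)).
  apply: L1b_le1 hL; first by mes.
  move=> z; rewrite ger0_norm; last by nn.
  by apply: ler_wpM2r => //; apply: ind_mono; clra.
have hL3 : L1b mu (fun z => ind (`|z - x| <= 2 * (d / 2)) * `|w z - w y0|) (12 * (d * sg)).
  apply: L1b_le1 hL; first by mes.
  move=> z; rewrite ger0_norm; last by nn.
  by apply: ler_wpM2r => //; apply: ind_mono; clra.
have d20 : 0 < d / 2 by clra.
split.
  have n1 := avg_near mw wM d0 hL2; have n2 := avg_near mw wM d20 hL3.
  rewrite (_ : 12 * (d * sg) / (2 * d) = 6 * sg) in n1; last by field; exact: lt0r_neq0.
  rewrite (_ : 12 * (d * sg) / (2 * (d / 2)) = 12 * sg) in n2; last by field; exact: lt0r_neq0.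
  have := ler_distD (w y0) (avg d w x) (avg (d / 2) w x).
  by rewrite (distrC (w y0)); clra.
move=> y xy; have := avg_lip mw wM d0 hL xy.
by rewrite (_ : 12 * (d * sg) / (2 * d) = 6 * sg) 1?mulrC//; field; exact: lt0r_neq0.
Qed.

(** The slice point lies in the annulus where [w] vanishes, so subtracting [w y0] changes
    nothing. *)
Lemma poincare w c r E : measurable_fun setT w -> 0 < r ->
  (forall x, r < `|x - c| -> w x = 0) -> L1b mu2 (en w) E ->
  L1b mu (fun x => w x ^+ 2) (9 * (r * E)).
Proof.
move=> mw r0 w0 hE.
have hA : L1b mu2 (fun z => ind (Aset c r z.1) * en w z) E.
  have mA : measurable_fun setT (Aset c r) by rewrite /Aset; mes.
  have me := mes_en mw.
  apply: L1b_le2 hE; first by mes.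
  move=> u v /=; rewrite ger0_norm; last by nn.
  by apply: ler_piMl; [exact: en_ge0|exact: ind_le1].
have [y0 [/andP[Ay0 Ay1] hy0]] := pick_A r0 (mes_en mw) (en_ge0 _) hA.
have hy : L1b mu (fun z => (w z - w y0) ^+ 2 / (z - y0) ^+ 2) (E / r).
  by apply: L1b_eq hy0 => z; rewrite /en/= -(sqrrN (w y0 - _)) opprB -(sqrrN (y0 - _)) opprB.
have mb : measurable_fun setT (fun z : R => `|z - c| <= r) by mes.
have : L1b mu (fun z => ind (`|z - c| <= r) * (w z - w y0) ^+ 2) ((3 * r) ^+ 2 * (E / r)).
  apply: (v_local mw hy mb); first by clra.
  move=> z hz; have := ler_normD (z - c) (c - y0); rewrite addrA subrK (distrC c y0).
  by clra.
rewrite (_ : (3 * r) ^+ 2 * (E / r) = 9 * (r * E)); last by field; exact: lt0r_neq0.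
apply: L1b_eq => x; rewrite (w0 y0)// subr0.
by have [h|h] := leP `|x - c| r; rewrite /ind ?mul1r// w0// expr0n/= mulr0.
Qed.

End Avg.

(** * Dyadic scales and the square function of the energy *)

Section Dyadic.
Variable R : realType.
Local Notation mu := (@lebesgue_measure R).
Local Notation mu2 := (mu \x mu)%E.
Implicit Types (g w phi v f : R -> R) (x y c s : R).

Definition dl (r : R) (k : nat) : R := r / 2 ^+ k.

Lemma dl0 r : dl r 0 = r. Proof. by rewrite /dl expr0 divr1. Qed.
Lemma dlS r k : dl r k.+1 = dl r k / 2.
Proof. by rewrite /dl exprS; field; rewrite expf_neq0. Qed.
Lemma dl_gt0 r k : 0 < r -> 0 < dl r k.
Proof. by move=> r0; rewrite divr_gt0// exprn_gt0. Qed.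
Lemma dl_le r k : 0 < r -> dl r k <= r.
Proof.
move=> r0; elim: k => [|k ih]; first by rewrite dl0.
by rewrite dlS; have := dl_gt0 k r0; clra.
Qed.

Lemma sum_shift (X : nat -> R) K :
  \sum_(0 <= m < K) X m.+1 = \sum_(0 <= m < K) X m + X K - X 0%N.
Proof.
elim: K => [|K ih]; first by rewrite !big_geq//; ring.
by rewrite !big_nat_recr//= ih; ring.
Qed.

(** Together with [sum_rec_up] a discrete Hardy inequality. The factor 3/4 is the 3/2 from squaring
    a sum of two terms divided by the 2 from the change of scale; being below one, it can be
    absorbed. *)
Lemma sum_rec_down (X Y : nat -> R) K : (forall m, 0 <= X m) ->
  (forall m, (m < K)%N -> X m <= 3 / 4 * X m.+1 + Y m) ->
  \sum_(0 <= m < K) X m <= 4 * \sum_(0 <= m < K) Y m + 3 * X K.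
Proof.
move=> X0 h; have : \sum_(0 <= m < K) X m <= \sum_(0 <= m < K) (3 / 4 * X m.+1 + Y m).
  by rewrite big_nat [leRHS]big_nat; apply: ler_sum => m /andP[_ /h].
rewrite big_split/= -mulr_sumr sum_shift; have := X0 0%N; clra.
Qed.

Lemma sum_rec_up (X Y : nat -> R) K : (forall m, 0 <= X m) ->
  (forall m, (m < K)%N -> X m.+1 <= 3 / 4 * X m + Y m) ->
  \sum_(0 <= m < K) X m.+1 <= 4 * \sum_(0 <= m < K) Y m + 3 * X 0%N.
Proof.
move=> X0 h; have : \sum_(0 <= m < K) X m.+1 <= \sum_(0 <= m < K) (3 / 4 * X m + Y m).
  by rewrite big_nat [leRHS]big_nat; apply: ler_sum => m /andP[_ /h].
rewrite big_split/= -mulr_sumr sum_shift; have := X0 K; have := X0 0%N; clra.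
Qed.

(** Provides a truncation level, beyond a prescribed one, at which the boundary term of a summation
    over scales is negligible. *)
Lemma small_term (X : nat -> R) S (e : R) K0 : (forall m, 0 <= X m) ->
  (forall K, \sum_(0 <= m < K) X m <= S) -> 0 < e -> exists K, (K0 <= K)%N /\ X K <= e.
Proof.
move=> X0 hS e0; apply: contrapT => /forallNP H.
have hX K : (K0 <= K)%N -> e <= X K.
  by move=> hK; rewrite leNgt; apply/negP => h; apply: (H K); rewrite hK ltW.
have [n hn] : exists n, S < n%:R * e.
  exists (Num.truncn (S / e)).+1; rewrite -ltr_pdivrMr//.
  exact: truncnS_gt.
have := hS (K0 + n)%N; rewrite (@big_cat_nat _ _ _ K0) ?leq_addr//=.
have h1 : 0 <= \sum_(0 <= m < K0) X m by exact: sumr_ge0.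
have h2 : n%:R * e <= \sum_(K0 <= m < K0 + n) X m.
  apply: (@le_trans _ _ (\sum_(K0 <= m < K0 + n) e)).
    by rewrite sumr_const_nat addKn mulr_natl.
  by rewrite big_nat [leRHS]big_nat; apply: ler_sum => m /andP[/hX].
clra.
Qed.

(** The terms grow by the factor 4, so the last admissible one, at most 9, dominates:
    [9 * 4/3 = 12]. Summed over scales, the bands around the diagonal thus reproduce the kernel
    [|x - y|^-2]. *)
Lemma geom_ind (t r : R) (K : nat) : 0 < r -> 0 <= t ->
  \sum_(0 <= k < K) ind (t <= 3 * dl r k) * (t / dl r k) ^+ 2 <= 12.
Proof.
move=> r0 t0.
have h n : \sum_(0 <= k < n) ind (t <= 3 * dl r k) * (t / dl r k) ^+ 2 <= 3^-1 * (t / dl r n) ^+ 2.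
  elim: n => [|n ih]; first by rewrite big_geq//; nn; rewrite invr_ge0.
  rewrite big_nat_recr//= dlS; have dn := dl_gt0 n r0.
  have -> : 3^-1 * (t / (dl r n / 2)) ^+ 2 = 3^-1 * (t / dl r n) ^+ 2 + (t / dl r n) ^+ 2.
    by field; exact: lt0r_neq0.
  by apply: lerD => //; apply: ler_piMl; [exact: sqr_ge0|exact: ind_le1].
elim: K => [|n ih]; first by rewrite big_geq.
have [hn|hn] := boolP (t <= 3 * dl r n).
  apply: le_trans (h n.+1) _; rewrite dlS; have dn := dl_gt0 n r0.
  have -> : 3^-1 * (t / (dl r n / 2)) ^+ 2 = 4 / 3 * (t / dl r n) ^+ 2.
    by field; exact: lt0r_neq0.
  have : t / dl r n <= 3 by rewrite ler_pdivrMr.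
  have : 0 <= t / dl r n by rewrite divr_ge0// ltW.
  by cnra.
by rewrite big_nat_recr//= (indF _ hn) mul0r addr0.
Qed.

Lemma mes_Rint2 (F : R * R -> R) : measurable_fun setT F -> (forall z, 0 <= F z) ->
  measurable_fun setT (fun x => \int[mu]_y F (x, y)).
Proof.
move=> mF F0; rewrite /Rintegral.
apply: (measurableT_comp (f := fine)); first exact: fine_measurable.
apply: (mes_tonelli (f := fun z => (F z)%:E)) => //.
exact/measurable_EFinP.
Qed.

Lemma L1b_fub (F : R * R -> R) c : measurable_fun setT F -> (forall z, 0 <= F z) ->
  (forall x, exists b, L1b mu (fun y => F (x, y)) b) ->
  L1b mu2 F c -> L1b mu (fun x => \int[mu]_y F (x, y)) c.
Proof.
move=> mF F0 hb [_ hF]; split; first exact: mes_Rint2.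
apply: le_trans hF; rewrite tonelli12//; last exact: measurable_absE.
rewrite le_eqVlt; apply/orP; left; apply/eqP; apply: eq_integral => x _.
have [b hx] := hb x.
rewrite ger0_norm; last by apply: Rintegral_ge0.
rewrite /Rintegral fineK; last exact: (integrable_fin_num _ (L1b_int hx)).
by apply: eq_integral => y _; rewrite ger0_norm.
Qed.

(** A Littlewood-Paley decomposition without frequencies. [b k] is the local oscillation at scale
    [dl rho k]; it dominates the deviation of [g] from its average [G k] and the modulus of
    continuity of [G k]. The sum in [lev_S] is the energy as a square function, while [lev_s] and
    [lev_t] are the BMO bounds, uniform in [x]. *)
Record Lev g (G b : nat -> R -> R) (beta : nat -> R) (rho sg M S2 : R) : Prop := MkLev {
  lev_mg : measurable_fun setT g;
  lev_mG : forall k, measurable_fun setT (G k);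
  lev_mb : forall k, measurable_fun setT (b k);
  lev_M : forall x, `|g x| <= M;
  lev_GM : forall k x, `|G k x| <= 2 * M;
  lev_0 : forall x, G 0%N x = 0;
  lev_h : forall k x, `|g x - G k x| <= b k x;
  lev_d : forall k x y, (0 < k)%N -> `|x - y| <= dl rho k ->
    `|G k x - G k y| <= b k x * (`|x - y| / dl rho k);
  lev_s : forall k x y, (0 < k)%N -> `|x - y| <= dl rho k ->
    `|G k x - G k y| <= 6 * sg * (`|x - y| / dl rho k);
  lev_t : forall k x, `|G k.+1 x - G k x| <= 68 * sg;
  lev_b : forall k, L1b mu (fun x => b k x ^+ 2) (beta k);
  lev_S : forall K, \sum_(0 <= k < K) beta k / dl rho k <= S2 }.

(** [b k] is the mean of [|g x - g z|] over a ball of radius [3 dl rho k]. Its square is bounded by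
    Cauchy-Schwarz, and summing over the scales with [geom_ind] rebuilds the energy density. *)
Lemma lev_ex g c rho sg M : measurable_fun setT g -> (forall x, `|g x| <= M) ->
  0 < rho -> 0 < sg -> (forall x, 16 * rho < `|x - c| -> g x = 0) ->
  L1b mu2 (en g) (sg ^+ 2) ->
  exists G b beta, [/\ Lev g G b beta rho sg M (200 * sg ^+ 2),
    forall r, (forall x, r < `|x - c| -> g x = 0) -> forall k x, r + rho < `|x - c| -> G k x = 0 &
    forall k, exists L, forall x y, `|G k x - G k y| <= L * `|x - y| ].
Proof.
move=> mg gM r0 s0 g0 hE.
have M0 : 0 <= M := le_trans (normr_ge0 _) (gM 0).
have me := mes_en mg.
have dk0 k : 0 < dl rho k by exact: dl_gt0.
have hE3 d x : L1b mu2 (fun z => ind (`|z.1 - x| <= 3 * d) * en g z) (sg ^+ 2).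
  apply: L1b_le2 hE; first by mes.
  move=> u v /=; rewrite ger0_norm; last by nn.
  by apply: ler_piMl; [exact: en_ge0|exact: ind_le1].
pose D k x := \int[mu]_z (ind (`|x - z| <= 3 * dl rho k) * `|g x - g z|).
pose I k x := \int[mu]_z (ind (`|x - z| <= 3 * dl rho k) * (g x - g z) ^+ 2).
have hind k x : L1b mu (fun z => ind (`|x - z| <= 3 * dl rho k)) (2 * (3 * dl rho k)).
  by apply: L1b_itv; have := dk0 k; clra.
have dgM x z : `|g x - g z| <= 2 * M.
  by have := ler_normB (g x) (g z); have := gM x; have := gM z; clra.
have hD k x : L1b mu (fun z => ind (`|x - z| <= 3 * dl rho k) * `|g x - g z|) (2 * M * (2 * (3 * dl rho k))).
  have := L1bZ (2 * M) (hind k x); rewrite ger0_norm; last by clra.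
  apply: L1b_le1; first by mes.
  move=> z; rewrite ger0_norm; last by nn.
  by rewrite mulrC; apply: ler_wpM2r => //; exact: ind_ge0.
have hI k x : L1b mu (fun z => ind (`|x - z| <= 3 * dl rho k) * (g x - g z) ^+ 2) ((2 * M) ^+ 2 * (2 * (3 * dl rho k))).
  have := L1bZ ((2 * M) ^+ 2) (hind k x); rewrite ger0_norm; last exact: sqr_ge0.
  apply: L1b_le1; first by mes.
  move=> z; rewrite ger0_norm; last by nn.
  rewrite mulrC; apply: ler_wpM2r; first exact: ind_ge0.
  by rewrite -(real_normK (num_real (g x - g z))) lerXn2r ?nnegrE ?dgM//; clra.
have D0 k x : 0 <= D k x by apply: Rintegral_ge0 => z _; nn.
have I0 k x : 0 <= I k x by apply: Rintegral_ge0 => z _; nn.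
(* Cauchy-Schwarz, from the family of inequalities [2 |d| <= t + d^2 / t] at the optimal [t]. *)
have DI k x : D k x ^+ 2 <= 6 * dl rho k * I k x.
  have key t : 0 < t -> 2 * D k x <= 6 * dl rho k * t + t^-1 * I k x.
    move=> t0.
    have e1 : 6 * dl rho k * t + t^-1 * I k x =
      \int[mu]_z (t * ind (`|x - z| <= 3 * dl rho k) + t^-1 * (ind (`|x - z| <= 3 * dl rho k) * (g x - g z) ^+ 2)).
      rewrite (RintD (L1bZ t (hind k x)) (L1bZ t^-1 (hI k x))) (RintZ _ (hind k x)) (RintZ _ (hI k x)).
      by rewrite Rint_itv -/(I k x)//; [ring|have := dk0 k; clra].
    rewrite e1 -(RintZ 2 (hD k x)).
    apply: (Rint_le (L1bZ 2 (hD k x)) (L1bD (L1bZ t (hind k x)) (L1bZ t^-1 (hI k x)))) => z.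
    rewrite mulrCA [t * _]mulrC [t^-1 * _]mulrCA -mulrDr; apply: ler_wpM2l; first exact: ind_ge0.
    set u := `|g x - g z|; rewrite -(real_normK (num_real (g x - g z))) -/u.
    have e : t + t^-1 * u ^+ 2 - 2 * u = (t - u) ^+ 2 / t by field; exact: lt0r_neq0.
    by rewrite -subr_ge0 e; apply: mulr_ge0; [exact: sqr_ge0|rewrite invr_ge0 ltW].
  have [D00|Dp] := leP (D k x) 0.
    have -> : D k x = 0 by apply/eqP; rewrite eq_le D00 D0.
    by rewrite expr0n/=; have := dk0 k => ?; nn.
  have dk := dk0 k; have d6 : 0 < 6 * dl rho k by clra.
  have tp : 0 < D k x / (6 * dl rho k) by exact: divr_gt0.
  have := key _ tp.
  have -> : 6 * dl rho k * (D k x / (6 * dl rho k)) = D k x by field; exact: lt0r_neq0.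
  have -> : (D k x / (6 * dl rho k))^-1 * I k x = 6 * dl rho k * I k x / D k x.
    by field; apply/andP; split; exact: lt0r_neq0.
  move=> h; have : D k x <= 6 * dl rho k * I k x / D k x by clra.
  by rewrite ler_pdivlMr// expr2.
(* Level 0 is the zero function, so that telescoping sums of differences give [G m] itself. *)
pose G k := if k is 0%N then (fun=> 0) else avg (dl rho k) g.
pose b k := if k is 0%N then (fun x => `|g x|) else (fun x => (2 * dl rho k)^-1 * D k x).
pose F k (z : R * R) := ind (`|z.1 - z.2| <= 3 * dl rho k) * (g z.1 - g z.2) ^+ 2.
have mF k : measurable_fun setT (F k) by rewrite /F; mes.
have F0 k z : 0 <= F k z by rewrite /F; nn.
have hF k : L1b mu2 (F k) ((3 * dl rho k) ^+ 2 * sg ^+ 2).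
  have := L1bZ ((3 * dl rho k) ^+ 2) hE; rewrite ger0_norm; last exact: sqr_ge0.
  apply: L1b_le2 => // x y; rewrite ger0_norm// /F/= /en/=.
  have [h|h] := leP `|x - y| (3 * dl rho k); last by rewrite /ind mul0r; nn.
  rewrite /ind mul1r; have [->|xy] := eqVneq x y; first by rewrite !subrr expr0n/= mul0r mulr0.
  have l2 : 0 < (x - y) ^+ 2 by rewrite exprn_even_gt0//= subr_eq0.
  rewrite mulrCA ler_peMr ?sqr_ge0// ler_pdivlMr// mul1r.
  by rewrite -(real_normK (num_real (x - y))) lerXn2r// nnegrE; have := dk0 k; clra.
pose J k := \int[mu2]_z F k z.
have hJ k : L1b mu2 (F k) (J k) by exact: L1b_self (hF k) (F0 k).
have hIJ k : L1b mu (fun x => I k x) (J k).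
  by apply: (L1b_fub (mF k) (F0 k) _ (hJ k)) => x; eexists; exact: (hI k x).
pose beta k := if k is 0%N then 9 * (16 * rho * sg ^+ 2) else 3 / (2 * dl rho k) * J k.
have mD k : measurable_fun setT (D k).
  apply: (mes_Rint2 (F := fun z => ind (`|z.1 - z.2| <= 3 * dl rho k) * `|g z.1 - g z.2|)); first by mes.
  by move=> z; nn.
have mb k : measurable_fun setT (b k) by case: k => [|k]; rewrite /b; [mes|have mDk := mD k.+1; mes].
exists G, b, beta; split.
- split => //.
  + by case=> [|k]; [exact: mes_cst|exact: (mes_avg mg gM (dk0 _))].
  + by case=> [|k] x; [rewrite normr0; clra|exact: (avg_bnd mg gM (dk0 _))].
  + case=> [|k] x; first by rewrite subr0.
    rewrite distrC /b mulrC.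
    apply: (avg_near mg gM (dk0 _)).
    apply: L1b_le1 (L1b_self (hD k.+1 x) _); first by mes.
      move=> z; rewrite ger0_norm; last by nn.
      rewrite (distrC (g z)) (distrC z); apply: ler_wpM2r => //.
      by apply: ind_mono; have := dk0 k.+1; clra.
    by move=> z; nn.
  + case=> [|k] x y// _ hxy.
    have H : L1b mu (fun z => ind (`|z - x| <= 3 * dl rho k.+1) * `|g z - g x|) (D k.+1 x).
      apply: L1b_le1 (L1b_self (hD k.+1 x) _); first by mes.
        move=> z; rewrite ger0_norm; last by nn.
        by rewrite (distrC (g z)) (distrC z).
      by move=> z; nn.
    apply: (le_trans (avg_lip mg gM (dk0 k.+1) H hxy)); apply: eqle; rewrite /b; ring.
  + case=> [|k] x y// _ hxy.
    by have [_] := avg_osc mg gM (dk0 k.+1) s0 (hE3 (dl rho k.+1) x); apply.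
  + case=> [|k] x; last first.
      have [+ _] := avg_osc mg gM (dk0 k.+1) s0 (hE3 (dl rho k.+1) x).
      by rewrite distrC -dlS; clra.
    (* The step from the zero function to the first average is no oscillation; it is bounded by the
       compact support and [poincare], with [68 = 32 + 36]. *)
    change (`|avg (dl rho 1) g x - 0| <= 68 * sg).
    have r16 : 0 < 16 * rho by clra.
    have P := poincare mg r16 g0 hE.
    have h16 : 0 <= 16 * rho by clra.
    have Q : L1b mu (fun z => ind (`|z - x| <= 2 * dl rho 1) * `|g z - 0|) (68 * (rho * sg)).
      have := L1bD (L1bZ sg (L1b_itv c h16)) (L1bZ (4 * sg)^-1 P).
      rewrite !ger0_norm; [|by rewrite invr_ge0; clra|by clra].
      move=> H; apply: (@L1b_weak _ _ _ _ _ _ _ _ (L1b_le1 _ _ H)).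
      * by apply: eqle; field; exact: lt0r_neq0.
      * by mes.
      move=> z; rewrite subr0 ger0_norm; last by nn.
      have e : sg + (4 * sg)^-1 * g z ^+ 2 - `|g z| = ((2 * sg - `|g z|) ^+ 2) / (4 * sg).
        by rewrite -(real_normK (num_real (g z))); field; exact: lt0r_neq0.
      have e' : `|g z| <= sg + (4 * sg)^-1 * g z ^+ 2.
        by rewrite -subr_ge0 e; apply: mulr_ge0; [exact: sqr_ge0|rewrite invr_ge0; clra].
      rewrite (distrC c); have [hz|hz] := leP `|z - c| (16 * rho).
        apply: le_trans (_ : 1 * `|g z| <= _); first by apply: ler_wpM2r => //; exact: ind_le1.
        by rewrite [ind true]/ind mul1r mulr1.
      by rewrite g0// normr0 mulr0 /ind mulr0 expr0n/= mulr0 addr0.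
    have := avg_near mg gM (dk0 1%N) Q.
    rewrite (_ : 68 * (rho * sg) / (2 * dl rho 1) = 68 * sg)//.
    by rewrite dlS dl0; field; exact: lt0r_neq0.
  + case=> [|k].
      have r16 : 0 < 16 * rho by clra.
      have := poincare mg r16 g0 hE; apply: L1b_eq => x.
      by rewrite /b real_normK// num_real.
    have := L1bZ (3 / (2 * dl rho k.+1)) (hIJ k.+1); have dk := dk0 k.+1.
    rewrite ger0_norm; last by apply: divr_ge0; clra.
    apply: L1b_le1; first by apply: mes_X; exact: mb.
    move=> x; rewrite ger0_norm; last exact: sqr_ge0.
    rewrite /b exprMn; apply: le_trans (ler_wpM2l (sqr_ge0 _) (DI k.+1 x)) _.
    by apply: eqle; field; exact: lt0r_neq0.
  + case=> [|K]; first by rewrite big_geq; last exact: leqnn; apply: mulr_ge0; [exact: ler0n|exact: sqr_ge0].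
    rewrite big_nat_recl//=.
    have -> : \sum_(0 <= k < K) 3 / (2 * dl rho k.+1) * J k.+1 / dl rho k.+1 =
        \int[mu2]_z (\sum_(0 <= k < K) 3 / 2 / (dl rho k.+1) ^+ 2 * F k.+1 z).
      rewrite (Rint_sum _ (fun k => L1bZ (3 / 2 / (dl rho k.+1) ^+ 2) (hJ k.+1))).
      apply: eq_bigr => k _; rewrite (RintZ _ (hJ k.+1)) -/(J k.+1).
      by have dk := dk0 k.+1; field; exact: lt0r_neq0.
    (* [18 = 3/2 * 12] by [geom_ind] started at [rho / 2]. Level 0 contributes [9 * 16 = 144], and
       the total stays below 200. *)
    have : \int[mu2]_z (\sum_(0 <= k < K) 3 / 2 / (dl rho k.+1) ^+ 2 * F k.+1 z) <= 18 * sg ^+ 2.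
      have H := L1bZ 18 hE; rewrite ger0_norm// in H.
      apply: L1b_Rint_le; apply: L1b_le2 H; first by apply: mes_sum => k; have mFk := mF k.+1; mes.
      move=> x y; rewrite ger0_norm; last first.
        by apply: sumr_ge0 => k _; apply: mulr_ge0 => //; apply: mulr_ge0 => //; exact: isq_ge0.
      rewrite /F /en/=; have [->|xy] := eqVneq x y.
        rewrite big1 ?subrr ?expr0n/= ?mul0r ?mulr0// => k _.
        by rewrite !mulr0.
      have l2 : 0 < (x - y) ^+ 2 by rewrite exprn_even_gt0//= subr_eq0.
      have := geom_ind K (_ : 0 < rho / 2) (normr_ge0 (x - y)).
      move=> /(_ _) h; have {}h := h (divr_gt0 r0 (ltr0Sn _ 1)).
      have e k : dl (rho / 2) k = dl rho k.+1 by rewrite dlS /dl; ring.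
      have := ler_wpM2l (_ : 0 <= 3 / 2 * ((g x - g y) ^+ 2 / (x - y) ^+ 2)) h.
      move=> /(_ _) h'; have {}h' := h' (mulr_ge0 (divr_ge0 (ler0n _ 3) (ler0n _ 2)) (en_ge0 g (x, y))).
      apply: le_trans (le_trans _ h') _; last by apply: eqle; field; rewrite subr_eq0.
      rewrite mulr_sumr; apply: ler_sum => k _; rewrite e; apply: eqle.
      have -> : (`|x - y| / dl rho k.+1) ^+ 2 = (x - y) ^+ 2 / (dl rho k.+1) ^+ 2.
        by rewrite exprMn exprVn real_normK// num_real.
      have dk := dk0 k.+1.
      by field; rewrite lt0r_neq0//= subr_eq0.
    rewrite dl0 (_ : 9 * (16 * rho * sg ^+ 2) / rho = 144 * sg ^+ 2); last by field; exact: lt0r_neq0.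
    by have := sqr_ge0 sg; clra.
- move=> r hr [|k] x hx//.
  apply: (avg_supp (dk0 k.+1) hr); rewrite dlS; have := dl_le k r0; clra.
- case=> [|k]; first by exists 0 => x y; rewrite subrr normr0 mul0r.
  by eexists; exact: (avg_glip mg gM (dk0 k.+1)).
Qed.

End Dyadic.

Section Vanish.
Context d (T : measurableType d) (R : realType) (m : {measure set T -> \bar R}).

Lemma L1b_cvg0 (Fn : nat -> T -> R) (H : T -> R) c e :
  (forall n, measurable_fun setT (Fn n)) -> (forall n x, `|Fn n x| <= H x) -> L1b m H c ->
  (forall x, (fun n => Fn n x) @ \oo --> (0 : R)) -> 0 < e ->
  exists n0, forall n, (n0 <= n)%N -> L1b m (Fn n) e.
Proof.
move=> mFn FH hH F0 e0.
have H1 : (\int[m]_x (`|Fn n x|)%:E @[n --> \oo] --> \int[m]_x (cst 0%E) x)%E.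
  apply: (@dominated_cvg _ _ _ m setT measurableT (fun n x => (`|Fn n x|)%:E) (cst 0%E) (EFin \o H)) => //.
  - by move=> n; exact: measurable_absE.
  - move=> x _; apply: cvg_EFin; first by near=> n.
    by rewrite /= -(normr0 R); apply: cvg_norm; exact: F0.
  - exact: L1b_int hH.
  - by move=> n x _ /=; rewrite normr_id lee_fin.
move: H1; rewrite integral0 => /fine_cvgP[_ /cvgrPdist_le/(_ e e0) [n0 _ hn]].
exists n0 => n nn0; split => //.
have fn : (\int[m]_x (`|Fn n x|)%:E)%E \is a fin_num.
  rewrite ge0_fin_numE; last exact: integral_ge0.
  have [_] := L1b_le (mFn n) (FH n) hH; move=> h.
  by apply: le_lt_trans h _; rewrite ltry.
have := hn n nn0; rewrite /= sub0r normrN ger0_norm; last by apply: fine_ge0; exact: integral_ge0.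
by rewrite -lee_fin fineK.
Unshelve. all: by end_near. Qed.

End Vanish.

Section Comp.
Variable R : realType.
Local Notation mu := (@lebesgue_measure R).
Local Notation mu2 := (mu \x mu)%E.
Implicit Types (g w phi v f : R -> R) (x y c s : R).

Lemma dl_small (rho t : R) : 0 < rho -> 0 < t -> exists n0, forall n, (n0 <= n)%N -> dl rho n < t.
Proof.
move=> r0 t0; exists (Num.truncn (rho / t)).+1 => n hn.
rewrite /dl ltr_pdivrMr ?exprn_gt0// -ltr_pdivrMl// mulrC.
apply: (lt_le_trans (truncnS_gt _)).
apply: le_trans (_ : n%:R <= _); first by rewrite ler_nat.
by rewrite -natrX ler_nat ltnW// ltn_expl.
Qed.

(** Controls the pairs closer than the finest scale that a finite dyadic sum resolves. *)
Lemma theta_small g E rho e : measurable_fun setT g -> L1b mu2 (en g) E -> 0 < rho -> 0 < e ->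
  exists n0, forall n, (n0 <= n)%N ->
    L1b mu2 (fun z => ind (`|z.1 - z.2| <= dl rho n) * en g z) e.
Proof.
move=> mg hE r0 e0; have me := mes_en mg.
apply: (@L1b_cvg0 _ _ _ mu2 (fun n z => ind (`|z.1 - z.2| <= dl rho n) * en g z) (en g) E e) => //.
- by move=> n; mes.
- move=> n z; rewrite ger0_norm; last by nn.
  by apply: ler_piMl; [exact: en_ge0|exact: ind_le1].
move=> [x y]; have [->|xy] := eqVneq x y.
  rewrite (_ : (fun n => _) = fun=> 0); first exact: cvg_cst.
  by apply/funext => n; rewrite /en/= !subrr expr0n/= invr0 !mulr0.
have xy0 : 0 < `|x - y| by rewrite normr_gt0 subr_eq0.
have [n0 hn0] := dl_small r0 xy0.
apply/cvgrPdist_le => t t0; exists n0 => // n /= nn0.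
have hF : ~~ (`|x - y| <= dl rho n) by rewrite -ltNge hn0.
by rewrite (indF _ hF) mul0r subrr normr0 ltW.
Qed.

(** Propagates integral bounds from the finest scale [K] to coarser ones. All bounds are produced as
    one sequence, to be summed by [sum_rec_down]. *)
Lemma down_rec (P : nat -> R -> Prop) (Y : nat -> R) K q0 : P K q0 ->
  (forall m q, (m < K)%N -> P m.+1 q -> P m (3 / 2 * q + Y m)) ->
  exists Q, [/\ forall m, (m <= K)%N -> P m (Q m), Q K = q0 &
    forall m, (m < K)%N -> Q m = 3 / 2 * Q m.+1 + Y m].
Proof.
move=> PK hP; pose aux := fix aux j := if j is j'.+1 then 3 / 2 * aux j' + Y (K - j)%N else q0.
exists (fun m => aux (K - m)%N); split.
- move=> m mK.
  have h j : (j <= K)%N -> P (K - j)%N (aux j).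
    elim: j => [|j ih] jK; first by rewrite subn0.
    rewrite /=; apply: hP; first by rewrite ltn_subrL/= (leq_trans _ jK).
    by rewrite subnSK//; apply: ih; exact: ltnW.
  by have := h _ (leq_subr m K); rewrite subKn.
- by rewrite subnn.
- by move=> m mK; rewrite -subnSK//= subnSK// subKn// ltnW.
Qed.

(** Hardy inequality for the sums over finer scales, based on [(S + B)^2 <= 3/2 S^2 + 3 B^2]. *)
Lemma Tsum (b : nat -> R -> R) (beta : nat -> R) rho K : 0 < rho ->
  (forall k, measurable_fun setT (b k)) -> (forall k, L1b mu (fun x => b k x ^+ 2) (beta k)) ->
  exists t, (forall m, (m <= K)%N -> L1b mu (fun x => (\sum_(m <= k < K) b k.+1 x) ^+ 2) (t m)) /\
    \sum_(0 <= m < K) t m / dl rho m <= 6 * \sum_(0 <= m < K) beta m.+1 / dl rho m.+1.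
Proof.
move=> r0 mb hb.
have [|m q mK hq|t [h1 h2 h3]] := @down_rec
  (fun m q => L1b mu (fun x => (\sum_(m <= k < K) b k.+1 x) ^+ 2) q) (fun m => 3 * beta m.+1) K 0.
- by apply: L1b_eq (L1b0 _) => x; rewrite big_geq// expr0n.
- have := L1bD (L1bZ (3 / 2) hq) (L1bZ 3 (hb m.+1)); rewrite !ger0_norm//.
  apply: L1b_le1; first by apply: mes_X; apply: mes_sum => k; exact: mb.
  move=> x; rewrite ger0_norm ?sqr_ge0// big_ltn//.
  set B := b m.+1 x; set S := \sum_(_ <= _ < _) _.
  by have := sqr_ge0 (S - 2 * B); clra.
exists t; split => //.
have t0 m : (m <= K)%N -> 0 <= t m by move=> /h1/L1b_ge0.
have := @sum_rec_down _ (fun m => if (m <= K)%N then t m / dl rho m else 0)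
   (fun m => 3 / 2 * (beta m.+1 / dl rho m.+1)) K.
rewrite leqnn h2 mul0r mulr0 addr0 -mulr_sumr => H.
apply: le_trans (le_trans _ (H _ _)) _; last by clra.
- by apply: eqle; apply: eq_big_nat => m /andP[_ /ltnW ->].
- by move=> m; case: ifP => // /t0 h; rewrite divr_ge0// ltW// dl_gt0.
- move=> m mK; rewrite (ltnW mK) mK h3// dlS; apply: eqle.
  by have := dl_gt0 m r0 => h; field; exact: lt0r_neq0.
Qed.

(** The dual Hardy inequality, for the Lipschitz constants accumulated over coarser scales. *)
Lemma Csum (b : nat -> R -> R) (beta : nat -> R) rho : 0 < rho ->
  (forall k, measurable_fun setT (b k)) -> (forall k, L1b mu (fun x => b k x ^+ 2) (beta k)) ->
  exists t, (forall m, L1b mu (fun x => (\sum_(0 <= k < m) b k.+1 x / dl rho k.+1) ^+ 2) (t m)) /\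
    forall K, \sum_(0 <= m < K) dl rho m.+1 * t m.+1 <= 12 * \sum_(0 <= m < K) beta m.+1 / dl rho m.+1.
Proof.
move=> r0 mb hb.
pose t := fix t m := if m is m'.+1 then 3 / 2 * t m' + 3 * ((dl rho m) ^+ 2)^-1 * beta m else 0.
have h1 m : L1b mu (fun x => (\sum_(0 <= k < m) b k.+1 x / dl rho k.+1) ^+ 2) (t m).
  elim: m => [|m ih]; first by apply: L1b_eq (L1b0 _) => x; rewrite big_geq// expr0n.
  have := L1bD (L1bZ (3 / 2) ih) (L1bZ (3 * ((dl rho m.+1) ^+ 2)^-1) (hb m.+1)).
  rewrite !ger0_norm//; last by rewrite mulr_ge0// isq_ge0.
  apply: L1b_le1.
    by apply: mes_X; apply: mes_sum => k; apply: mes_M; [exact: mb|exact: mes_cst].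
  move=> x; rewrite ger0_norm ?sqr_ge0// big_nat_recr//=.
  set S := \sum_(_ <= _ < _) _; set B := b m.+1 x / dl rho m.+1.
  have -> : 3 * ((dl rho m.+1) ^+ 2)^-1 * b m.+1 x ^+ 2 = 3 * B ^+ 2.
    by rewrite /B; field; exact: lt0r_neq0 (dl_gt0 _ r0).
  by have := sqr_ge0 (S - 2 * B); clra.
exists t; split => // K.
have := @sum_rec_up _ (fun m => dl rho m * t m) (fun m => 3 * (beta m.+1 / dl rho m.+1)) K.
rewrite mulr0 mulr0 addr0 -mulr_sumr => H.
apply: le_trans (H _ _) _; last by apply: eqle; ring.
- by move=> m; rewrite mulr_ge0 ?(L1b_ge0 (h1 m))// ltW// dl_gt0.
- move=> m mK; rewrite [t m.+1]/= dlS; apply: eqle.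
  by have := dl_gt0 m r0 => h; field; exact: lt0r_neq0.
Qed.

(** In the spirit of John-Nirenberg: [g - G m] is not bounded by [sg], but every jump [G m.+1 - G m]
    is. Hence two of the four powers of a jump are traded for [sg^2] and the other two are summed as
    squares. The start of the recursion at level [K] leaves the term with [M], which is small for a
    suitable [K]. *)
Lemma Qsum g G b beta rho sg M S2 K : Lev g G b beta rho sg M S2 -> 0 < rho -> 0 < sg -> 0 <= M ->
  exists Q, (forall m, (m <= K)%N -> L1b mu (fun x => (g x - G m x) ^+ 4) (Q m)) /\
    \sum_(0 <= m < K) Q m / dl rho m <= 10 ^+ 8 * (sg ^+ 2 * S2) + 27 * M ^+ 2 * (beta K / dl rho K).
Proof.
move=> L r0 s0 M0.
have mh k : measurable_fun setT (fun x => g x - G k x).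
  by have mg := lev_mg L; have mG := lev_mG L k; mes.
have hS0 k : 0 <= beta k by exact: L1b_ge0 (lev_b L k).
have [||Q [h1 h2 h3]] := @down_rec
  (fun m q => L1b mu (fun x => (g x - G m x) ^+ 4) q)
  (fun m => 10 ^+ 7 * sg ^+ 2 * (beta m + beta m.+1)) K (9 * M ^+ 2 * beta K).
- have := L1bZ (9 * M ^+ 2) (lev_b L K); rewrite ger0_norm; last by rewrite mulr_ge0// sqr_ge0.
  apply: L1b_le1; first by apply: mes_X.
  move=> x; rewrite ger0_norm; last by rewrite exprn_even_ge0.
  rewrite (_ : (g x - G K x) ^+ 4 = (g x - G K x) ^+ 2 * (g x - G K x) ^+ 2); last by ring.
  have h := lev_h L K x; rewrite -(real_normK (num_real (g x - G K x))).
  have h' : `|g x - G K x| <= 3 * M.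
    by have := ler_normB (g x) (G K x); have := lev_M L x; have := lev_GM L K x; clra.
  have := normr_ge0 (g x - G K x); set u := `|_| in h h' * => u0.
  have e1 : u ^+ 2 <= 9 * M ^+ 2 by cnra.
  have e2 : u ^+ 2 <= b K x ^+ 2 by cnra.
  by apply: ler_pM => //; exact: sqr_ge0.
- move=> m q mK hq.
  have := L1bD (L1bZ (3 / 2) hq) (L1bZ (10 ^+ 7 * sg ^+ 2) (L1bD (lev_b L m) (lev_b L m.+1))).
  rewrite !ger0_norm//; last by rewrite mulr_ge0// sqr_ge0.
  apply: L1b_le1; first by apply: mes_X.
  move=> x; rewrite ger0_norm; last by rewrite exprn_even_ge0.
  have e0 : g x - G m x = (g x - G m.+1 x) + (G m.+1 x - G m x) by ring.
  have t1 := lev_t L m x.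
  have t2 : `|G m.+1 x - G m x| <= b m x + b m.+1 x.
    have -> : G m.+1 x - G m x = (g x - G m x) - (g x - G m.+1 x) by ring.
    by apply: le_trans (ler_normB _ _) _; apply: lerD; exact: lev_h L _ _.
  rewrite e0; move: (g x - G m.+1 x) (G m.+1 x - G m x) t1 t2 => a t t1 t2.
  have b0 : 0 <= b m x by exact: le_trans (lev_h L m x).
  have b1 : 0 <= b m.+1 x by exact: le_trans (lev_h L m.+1 x).
  set B0 := b m x in t2 b0 *; set B1 := b m.+1 x in t2 b1 *.
  have t4 : t ^+ 4 <= 9248 * sg ^+ 2 * (B0 ^+ 2 + B1 ^+ 2).
    have -> : t ^+ 4 = `|t| ^+ 2 * `|t| ^+ 2 by rewrite real_normK ?num_real//; ring.
    have n0 := normr_ge0 t; move: n0 t1 t2; move: `|t| => n n0 t1 t2.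
    have e1 : n ^+ 2 <= 4624 * sg ^+ 2 by cnra.
    have e2 : n ^+ 2 <= 2 * (B0 ^+ 2 + B1 ^+ 2) by have := sqr_ge0 (B0 - B1); cnra.
    have := ler_pM (sqr_ge0 n) (sqr_ge0 n) e1 e2; clra.
  (* The factor 6/5 is taken because its square stays below the factor 3/2 of the recursion. *)
  have s1 : (a + t) ^+ 2 <= 6 / 5 * a ^+ 2 + 6 * t ^+ 2.
    by have := sqr_ge0 (a - 5 * t); clra.
  have s2 : (a + t) ^+ 4 <= 3 / 2 * a ^+ 4 + 900 * t ^+ 4.
    have -> : (a + t) ^+ 4 = (a + t) ^+ 2 * (a + t) ^+ 2 by ring.
    have := ler_pM (sqr_ge0 _) (sqr_ge0 _) s1 s1; have := sqr_ge0 (a ^+ 2 - 120 * t ^+ 2).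
    have a4 : 0 <= a ^+ 4 by rewrite exprn_even_ge0.
    have t40 : 0 <= t ^+ 4 by rewrite exprn_even_ge0.
    by clra.
  have : 0 <= sg ^+ 2 * (B0 ^+ 2 + B1 ^+ 2) by nn.
  have -> : 10 ^+ 7 * sg ^+ 2 * (B0 ^+ 2 + B1 ^+ 2) = 10 ^+ 7 * (sg ^+ 2 * (B0 ^+ 2 + B1 ^+ 2)) by ring.
  rewrite -mulrA in t4; move: (sg ^+ 2 * _) t4 => X t4 X0.
  have : 900 * 9248 * X <= 10 ^+ 7 * X by apply: ler_wpM2r => //; clra.
  by move: t4; clra.
exists Q; split => //.
have Q0 m : (m <= K)%N -> 0 <= Q m by move=> /h1/L1b_ge0.
have := @sum_rec_down _ (fun m => if (m <= K)%N then Q m / dl rho m else 0)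
   (fun m => 10 ^+ 7 * sg ^+ 2 * (beta m / dl rho m) + 10 ^+ 7 * sg ^+ 2 * (2^-1 * (beta m.+1 / dl rho m.+1))) K.
rewrite leqnn h2 big_split/= -!mulr_sumr => H.
have hS := lev_S L K; have hS' : \sum_(0 <= m < K) beta m.+1 / dl rho m.+1 <= S2.
  have := lev_S L K.+1; rewrite big_nat_recl//=.
  have : 0 <= beta 0%N / dl rho 0 by rewrite divr_ge0// ltW// dl_gt0.
  by clra.
apply: le_trans (le_trans _ (H _ _)) _.
- by apply: eqle; apply: eq_big_nat => m /andP[_ /ltnW ->].
- by move=> m; case: ifP => // /Q0 h; rewrite divr_ge0// ltW// dl_gt0.
- move=> m mK; rewrite (ltnW mK) mK h3// dlS; apply: eqle.
  by have := dl_gt0 m r0 => h; field; exact: lt0r_neq0.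
have s2 := sqr_ge0 sg.
have X1 := ler_wpM2l s2 hS; have X2 := ler_wpM2l s2 hS'.
have S20 : 0 <= S2 by have := lev_S L 0%N; rewrite big_geq.
have S3 : 0 <= sg ^+ 2 * S2 by exact: mulr_ge0.
move: X1 X2; set A := \sum_(_ <= _ < _) _; set B := \sum_(_ <= _ < _) _ => X1 X2.
have -> : 4 * (10 ^+ 7 * sg ^+ 2 * A + 10 ^+ 7 * sg ^+ 2 * (2^-1 * B)) =
  10 ^+ 7 * (4 * (sg ^+ 2 * A) + 2 * (sg ^+ 2 * B)) by field.
apply: lerD; last by apply: eqle; ring.
apply: (@le_trans _ _ (10 ^+ 7 * (6 * (sg ^+ 2 * S2)))).
  by apply: ler_wpM2l; [exact: exprn_ge0|clra].
have -> : 10 ^+ 8 = 10 ^+ 7 * 10 :> R by rewrite -exprSr.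
by rewrite -mulrA; apply: ler_wpM2l; [exact: exprn_ge0|clra].
Qed.

End Comp.

(** * The paraproduct and its error *)

Section Comp2.
Variable R : realType.
Local Notation mu := (@lebesgue_measure R).
Local Notation mu2 := (mu \x mu)%E.
Implicit Types (g w phi v f : R -> R) (x y c s : R).

Lemma L1b_both (J : R * R -> R) f c j : measurable_fun setT J ->
  (forall x y, J (x, y) = J (y, x)) ->
  (forall x, L1b mu (fun y => J (x, y)) j) -> L1b mu f c ->
  L1b mu2 (fun z => (f z.1 + f z.2) * J z) (2 * (c * j)).
Proof.
move=> mJ sJ hJ hf; have := L1bD (L1b_ker mJ hJ hf) (L1b_ker2 mJ sJ hJ hf).
rewrite (_ : c * j + c * j = 2 * (c * j)); last by ring.
by apply: L1b_eq => z; ring.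
Qed.

Section pt.
Variables (phi g : R -> R) (Ph p : nat -> R -> R) (pib : nat -> R) (G b : nat -> R -> R)
  (beta : nat -> R) (rho sg M S2 : R).
Hypotheses (Lp : Lev phi Ph p pib rho sg M S2) (Lg : Lev g G b beta rho sg M S2).
Hypotheses (r0 : 0 < rho) (s0 : 0 < sg) (M0 : 0 <= M).

(** Only finitely many levels are kept: a finite sum of products of bounded functions of finite
    energy is again an admissible test function. *)
Definition para K x : R := \sum_(0 <= k < K) (Ph k.+1 x - Ph k x) * (g x - G k.+1 x).
Local Notation S := (68 * sg).
Local Notation C m x := (\sum_(0 <= k < m) b k.+1 x / dl rho k.+1).
Local Notation T m K x := (\sum_(m <= k < K) b k.+1 x).

Lemma telePh m x : \sum_(0 <= k < m) (Ph k.+1 x - Ph k x) = Ph m x.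
Proof. by rewrite telescope_sumr// (lev_0 Lp) subr0. Qed.

(** The sum is split at the scale [m] of the pair. Coarser levels are almost constant between [x]
    and [y], and the factors telescope to [Ph m x * (g x - g y)] with Lipschitz errors; finer levels
    are bounded term by term. The jumps of [Ph] cost [68 * sg] throughout. *)
Lemma para_ptwise K m x y : (m <= K)%N -> (forall k, (k < m)%N -> `|x - y| <= dl rho k.+1) ->
  `|(phi x + phi y) / 2 * (g x - g y) - (para K x - para K y)| <=
  `|(phi x + phi y) / 2 - Ph m x| * `|g x - g y| + S * `|x - y| * (C m x + C m y)
    + S * (T m K x + T m K y).
Proof.
move=> mK hm.
have S0 : 0 <= S by have s0' := s0; clra.
have b0 k u : 0 <= b k u by exact: le_trans (lev_h Lg k u).
pose psi k x := Ph k.+1 x - Ph k x.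
have e1 : para K x - para K y = \sum_(0 <= k < m) (psi k x * (g x - G k.+1 x) - psi k y * (g y - G k.+1 y))
    + \sum_(m <= k < K) (psi k x * (g x - G k.+1 x) - psi k y * (g y - G k.+1 y)).
  by rewrite /para -sumrB (@big_cat_nat _ _ _ m).
have e2 : \sum_(0 <= k < m) (psi k x * (g x - G k.+1 x) - psi k y * (g y - G k.+1 y)) =
    Ph m x * (g x - g y) + \sum_(0 <= k < m) ((g y - G k.+1 y) * (psi k x - psi k y) - psi k x * (G k.+1 x - G k.+1 y)).
  rewrite -(telePh m x) mulr_suml -big_split/=; apply: eq_bigr => k _.
  by rewrite /psi; ring.
have -> : (phi x + phi y) / 2 * (g x - g y) - (para K x - para K y) =
   ((phi x + phi y) / 2 - Ph m x) * (g x - g y)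
   - \sum_(0 <= k < m) ((g y - G k.+1 y) * (psi k x - psi k y) - psi k x * (G k.+1 x - G k.+1 y))
   - \sum_(m <= k < K) (psi k x * (g x - G k.+1 x) - psi k y * (g y - G k.+1 y)).
  by rewrite e1 e2; ring.
apply: le_trans (ler_normB _ _) _; apply: lerD.
  apply: le_trans (ler_normB _ _) _; rewrite normrM; apply: lerD => //.
  apply: le_trans (ler_norm_sum _ _ _) _; rewrite -big_split/= mulr_sumr.
  rewrite big_nat [leRHS]big_nat; apply: ler_sum => k /andP[_ km].
  have hk := hm k km; have dk := dl_gt0 k.+1 r0.
  have q0 : 0 <= `|x - y| / dl rho k.+1 by rewrite divr_ge0// ltW.
  have a1 : `|psi k x - psi k y| <= S * (`|x - y| / dl rho k.+1).
    have -> : psi k x - psi k y = (Ph k.+1 x - Ph k.+1 y) - (Ph k x - Ph k y) by rewrite /psi; ring.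
    have h1 := lev_s Lp (ltn0Sn k) hk.
    have h2 : `|Ph k x - Ph k y| <= 6 * sg * (`|x - y| / dl rho k.+1).
      case: k km hk dk q0 {h1} => [|k] km hk dk q0.
        by rewrite !(lev_0 Lp) subrr normr0 mulr_ge0//; have s0' := s0; clra.
      have hk' : `|x - y| <= dl rho k.+1 by apply: hm; exact: ltnW.
      apply: le_trans (lev_s Lp (ltn0Sn k) hk') _.
      apply: ler_wpM2l; first by have s0' := s0; clra.
      apply: ler_wpM2l => //; rewrite lef_pV2 ?posrE// ?dl_gt0// (dlS _ k.+1).
      by have := dl_gt0 k.+1 r0; clra.
    apply: le_trans (ler_normB _ _) _; have s0' := s0.
    have := mulr_ge0 (ltW s0') q0; clra.
  have a2 : `|psi k x| <= S by exact: (lev_t Lp).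
  have a3 := lev_d Lg (ltn0Sn k) hk.
  have a4 := lev_h Lg k.+1 y.
  apply: le_trans (ler_normB _ _) _; rewrite !normrM.
  have := ler_pM (normr_ge0 _) (normr_ge0 _) a4 a1.
  have := ler_pM (normr_ge0 _) (normr_ge0 _) a2 a3.
  have -> : 68 * sg * `|x - y| * (b k.+1 x / dl rho k.+1 + b k.+1 y / dl rho k.+1) =
    b k.+1 y * (68 * sg * (`|x - y| / dl rho k.+1)) + 68 * sg * (b k.+1 x * (`|x - y| / dl rho k.+1)) by ring.
  by clra.
apply: le_trans (ler_norm_sum _ _ _) _; rewrite -big_split/= mulr_sumr.
apply: ler_sum => k _; apply: le_trans (ler_normB _ _) _; rewrite !normrM mulrDr.
by apply: lerD; apply: ler_pM => //; [exact: (lev_t Lp)|exact: lev_h Lg _ _|exact: (lev_t Lp)|exact: lev_h Lg _ _].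
Qed.

Lemma dlevel (w : R -> R) Gw bw bt m x y : Lev w Gw bw bt rho sg M S2 ->
  ((0 < m)%N -> `|x - y| <= dl rho m) -> `|Gw m x - Gw m y| <= S.
Proof.
move=> L; have s0' := s0; case: m => [_|m /(_ isT) h].
  by rewrite !(lev_0 L) subrr normr0; clra.
apply: le_trans (lev_s L (ltn0Sn m) h) _.
apply: (@le_trans _ _ (6 * sg * 1)); last by clra.
apply: ler_wpM2l; first by clra.
by rewrite ler_pdivrMr ?mul1r// dl_gt0.
Qed.

(** At the scale of the pair the averages at [x] and [y] differ by at most a multiple of [sg], so
    everything reduces to deviations from averages, whose fourth powers [Qsum] sums. *)
Lemma first_ptwise m x y : ((0 < m)%N -> `|x - y| <= dl rho m) ->
  ((phi x + phi y) / 2 - Ph m x) ^+ 2 * (g x - g y) ^+ 2 <=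
  3 * ((phi x - Ph m x) ^+ 4 + (phi y - Ph m y) ^+ 4 + ((g x - G m x) ^+ 4 + (g y - G m y) ^+ 4))
  + 3 * S ^+ 2 * ((phi x - Ph m x) ^+ 2 + (phi y - Ph m y) ^+ 2) + S ^+ 2 * (g x - g y) ^+ 2.
Proof.
move=> hm; have := dlevel Lp hm; have := dlevel Lg hm.
have -> : (phi x + phi y) / 2 - Ph m x = ((phi x - Ph m x) + (phi y - Ph m y) - (Ph m x - Ph m y)) / 2 by field.
have eg : g x - g y = (g x - G m x) - (g y - G m y) + (G m x - G m y) by ring.
move: eg; move: (phi x - Ph m x) (phi y - Ph m y) (Ph m x - Ph m y) => a c e.
move: (g x - G m x) (g y - G m y) (G m x - G m y) => h k q eg hq he.
have S0 : 0 <= S by have s0' := s0; clra.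
have q2 : q ^+ 2 <= S ^+ 2.
  by rewrite -(real_normK (num_real q)) lerXn2r// nnegrE.
have e2 : e ^+ 2 <= S ^+ 2.
  by rewrite -(real_normK (num_real e)) lerXn2r// nnegrE.
have d2 : (g x - g y) ^+ 2 <= 3 * (h ^+ 2 + k ^+ 2 + S ^+ 2).
  rewrite eg; have := sqr_ge0 (h + k); have := sqr_ge0 (h - q); have := sqr_ge0 (k + q); move: q2; clra.
set D := (g x - g y) ^+ 2 in d2 *; have D0 : 0 <= D := sqr_ge0 _.
have A2 : ((a + c - e) / 2) ^+ 2 <= (a ^+ 2 + c ^+ 2) + S ^+ 2.
  by have := sqr_ge0 (a - c); have := sqr_ge0 (a + c + e); have := sqr_ge0 (a + c); have := sqr_ge0 e; move: e2; clra.
apply: le_trans (ler_wpM2r D0 A2) _; rewrite mulrDl; apply: lerD => //.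
have ac0 : 0 <= a ^+ 2 + c ^+ 2 by nn.
apply: le_trans (ler_wpM2l ac0 d2) _.
have := sqr_ge0 (a ^+ 2 - h ^+ 2); have := sqr_ge0 (a ^+ 2 - k ^+ 2);
have := sqr_ge0 (c ^+ 2 - h ^+ 2); have := sqr_ge0 (c ^+ 2 - k ^+ 2); clra.
Qed.

End pt.

Lemma dl_mono (r : R) i j : 0 < r -> (i <= j)%N -> dl r j <= dl r i.
Proof.
move=> r0; elim: j => [|j ih]; first by rewrite leqn0 => /eqP ->.
rewrite leq_eqVlt => /orP[/eqP -> //|/ih h].
by apply: le_trans h; rewrite dlS; have := dl_gt0 j r0; clra.
Qed.

(** The shell [m = 0] also takes all pairs farther apart than [rho], hence the guard on its upper
    bound. *)
Lemma shell_ex (rho : R) K x y : 0 < rho -> `|x - y| <= dl rho K.+1 \/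
  exists m, [/\ (m < K.+1)%N, dl rho m.+1 < `|x - y|, (0 < m)%N -> `|x - y| <= dl rho m &
    forall k, (k < m)%N -> `|x - y| <= dl rho k.+1].
Proof.
move=> r0; elim: K => [|K [ih|[m [h1 h2 h3 h4]]]].
- by have [h|h] := leP `|x - y| (dl rho 1); [left|right; exists 0%N; split].
- have [h|h] := leP `|x - y| (dl rho K.+2); [by left|right].
  exists K.+1; split => // k kK; apply: le_trans ih _.
  exact: dl_mono.
- by right; exists m; split => //; exact: ltnW.
Qed.

Lemma term_le_sum (F : nat -> R) m K : (forall k, 0 <= F k) -> (m < K)%N -> F m <= \sum_(0 <= k < K) F k.
Proof.
move=> F0; elim: K => // K ih; rewrite ltnS leq_eqVlt => /orP[/eqP ->|/ih h];
  rewrite big_nat_recr//=; first by rewrite lerDr sumr_ge0.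
by apply: le_trans h _; rewrite lerDl.
Qed.

Lemma levh2 w G b bt rho sg M S2 k : Lev w G b bt rho sg M S2 ->
  L1b mu (fun x => (w x - G k x) ^+ 2) (bt k).
Proof.
move=> L; apply: L1b_le1 (lev_b L k).
  by have mg := lev_mg L; have mG := lev_mG L k; mes.
move=> x; rewrite ger0_norm ?sqr_ge0// -(real_normK (num_real (w x - G k x))).
by rewrite lerXn2r ?nnegrE ?(lev_h L)//; exact: le_trans (lev_h L k x).
Qed.

Lemma levS' w G b bt rho sg M S2 K : 0 < rho -> Lev w G b bt rho sg M S2 ->
  \sum_(0 <= m < K) bt m.+1 / dl rho m.+1 <= S2.
Proof.
move=> r0 L; have := lev_S L K.+1; rewrite big_nat_recl//=.
have : 0 <= bt 0%N / dl rho 0 by rewrite divr_ge0 ?(L1b_ge0 (lev_b L 0%N))// ltW// dl_gt0.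
by clra.
Qed.

Lemma sq3 (a b c : R) : 0 <= a -> 0 <= b -> 0 <= c -> (a + b + c) ^+ 2 <= 3 * a ^+ 2 + 3 * b ^+ 2 + 3 * c ^+ 2.
Proof.
by move=> *; have := sqr_ge0 (a - b); have := sqr_ge0 (a - c); have := sqr_ge0 (b - c); clra.
Qed.

(** Each pair is charged to its dyadic shell. The deviations collected in [U] are integrated against
    [|x - y|^-2] outside [dl rho m.+1], which gives the weight [1 / dl rho m]; the terms [V] already
    carry the factor [|x - y|^2] and only meet the width of a band. The bracket with [M] is the
    truncation error. *)
Lemma comp_L1b phi g Ph p pib G b beta rho sg M S2 K th :
  Lev phi Ph p pib rho sg M S2 -> Lev g G b beta rho sg M S2 ->
  0 < rho -> 0 < sg -> 0 <= M -> L1b mu2 (en g) (sg ^+ 2) ->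
  L1b mu2 (fun z => ind (`|z.1 - z.2| <= dl rho K.+1) * en g z) th ->
  measurable_fun setT (para g Ph G K.+1) ->
  L1b mu2 (fun z => ((phi z.1 + phi z.2) / 2 * (g z.1 - g z.2)
      - (para g Ph G K.+1 z.1 - para g Ph G K.+1 z.2)) ^+ 2 / (z.1 - z.2) ^+ 2)
    (2 * 10 ^+ 10 * (sg ^+ 2 * S2) + 13872 * sg ^+ 4
      + 4000 * M ^+ 2 * (pib K.+1 / dl rho K.+1 + beta K.+1 / dl rho K.+1 + th)).
Proof.
move=> Lp Lg r0 s0 M0 hE hth mpara.
have mphi := lev_mg Lp; have mg := lev_mg Lg.
pose S := 68 * sg; have S0 : 0 <= S by rewrite /S; clra.
have [Qp [hQp sQp]] := Qsum K.+1 Lp r0 s0 M0.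
have [Qg [hQg sQg]] := Qsum K.+1 Lg r0 s0 M0.
have [t [ht st]] := @Tsum _ b beta rho K.+1 r0 (lev_mb Lg) (lev_b Lg).
have [cc [hc sc]] := @Csum _ b beta rho r0 (lev_mb Lg) (lev_b Lg).
pose C m x := \sum_(0 <= k < m) b k.+1 x / dl rho k.+1.
pose T m x := \sum_(m <= k < K.+1) b k.+1 x.
pose U m x := 9 * ((phi x - Ph m x) ^+ 4 + (g x - G m x) ^+ 4)
   + 9 * S ^+ 2 * (phi x - Ph m x) ^+ 2 + 6 * S ^+ 2 * T m x ^+ 2.
pose V m x := 6 * S ^+ 2 * C m x ^+ 2.
pose u m := 9 * (Qp m + Qg m) + 9 * S ^+ 2 * pib m + 6 * S ^+ 2 * t m.
have U0 m x : 0 <= U m x.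
  have q4 (a : R) : 0 <= a ^+ 4 by rewrite exprn_even_ge0.
  rewrite /U; apply: addr_ge0; last by nn.
  apply: addr_ge0; last by nn.
  by apply: mulr_ge0 => //; apply: addr_ge0.
have V0 m x : 0 <= V m x by rewrite /V; nn.
have hU m : (m <= K.+1)%N -> L1b mu (U m) (u m).
  move=> mK; have := L1bD (L1bD (L1bZ 9 (L1bD (hQp m mK) (hQg m mK)))
    (L1bZ (9 * S ^+ 2) (levh2 m Lp))) (L1bZ (6 * S ^+ 2) (ht m mK)).
  by rewrite !ger0_norm//; nn.
have hV m : L1b mu (V m) (6 * S ^+ 2 * cc m).
  by have := L1bZ (6 * S ^+ 2) (hc m); rewrite ger0_norm//; nn.
pose Uf m z := (U m z.1 + U m z.2) * Jfar (dl rho m.+1) z.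
pose Vn m z := (V m.+1 z.1 + V m.+1 z.2) * Jnear (dl rho m.+1) z.
have Uf0 m z : 0 <= Uf m z by apply: mulr_ge0; [exact: addr_ge0|exact: Jfar_ge0].
have Vn0 m z : 0 <= Vn m z by apply: mulr_ge0; [exact: addr_ge0|exact: Jnear_ge0].
have hUf m : (m < K.+1)%N -> L1b mu2 (Uf m) (8 * (u m / dl rho m)).
  move=> mK; have := L1b_both (mes_Jfar (dl rho m.+1)) (Jfar_sym _)
    (fun x => L1b_Jfar x (dl_gt0 m.+1 r0)) (hU m (ltnW mK)).
  rewrite (_ : 2 * (u m * (2 / dl rho m.+1)) = 8 * (u m / dl rho m))//.
  by rewrite dlS; have := dl_gt0 m r0 => h; field; exact: lt0r_neq0.
have hVn m : L1b mu2 (Vn m) (24 * S ^+ 2 * (dl rho m.+1 * cc m.+1)).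
  have := L1b_both (mes_Jnear (dl rho m.+1)) (Jnear_sym _)
    (fun x => L1b_Jnear x (dl_gt0 m.+1 r0)) (hV m.+1).
  by rewrite (_ : 2 * (_ * _) = 24 * S ^+ 2 * (dl rho m.+1 * cc m.+1))//; ring.
have hUs : L1b mu2 (fun z => \sum_(0 <= m < K.+1) Uf m z) (\sum_(0 <= m < K.+1) 8 * (u m / dl rho m)).
  have := @L1b_sum _ _ _ mu2 _ (index_iota 0 K.+1) (fun m => (m < K.+1)%N) Uf (fun m => 8 * (u m / dl rho m)) hUf.
  have e (F : nat -> R) : \sum_(0 <= i < K.+1 | (i < K.+1)%N) F i = \sum_(0 <= i < K.+1) F i.
    rewrite big_nat_cond [RHS]big_nat_cond; apply: eq_bigl => i.
    by rewrite leq0n/= andbb andbT.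
  by rewrite e; apply: L1b_eq => z; exact: e.
have hVs := @L1b_sum _ _ _ mu2 _ (index_iota 0 K.+1) xpredT Vn _ (fun m _ => hVn m).
have Tot := L1bD (L1bD hUs hVs) (L1bD (L1bZ (3 * S ^+ 2) hE) (L1bZ (27 * M ^+ 2) hth)).
apply: (@L1b_weak _ _ _ _ _ _ _ _ (L1b_le2 _ _ Tot)); last first.
- move=> x y /=; rewrite ger0_norm; last by nn.
  have b0 k q : 0 <= b k q by exact: le_trans (lev_h Lg k q).
  have C0 m q : 0 <= C m q by apply: sumr_ge0 => k _; rewrite divr_ge0// ltW// dl_gt0.
  have T0 m q : 0 <= T m q by apply: sumr_ge0.
  set e := (_ * (g x - g y) - _).
  have kap := isq_ge0 (x - y).
  have sU0 : 0 <= \sum_(0 <= m < K.+1) Uf m (x, y) by apply: sumr_ge0.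
  have sV0 : 0 <= \sum_(0 <= m < K.+1) Vn m (x, y) by apply: sumr_ge0.
  have enE : en g (x, y) = (g x - g y) ^+ 2 * ((x - y) ^+ 2)^-1 by [].
  have dg0 : 0 <= en g (x, y) := en_ge0 _ _.
  have [exy|xy] := eqVneq x y.
    have -> : e ^+ 2 / (x - y) ^+ 2 = 0 by rewrite exy subrr expr0n/= invr0 mulr0.
    apply: addr_ge0; first exact: addr_ge0.
    by apply: addr_ge0; nn.
  have l2 : 0 < (x - y) ^+ 2 by rewrite exprn_even_gt0//= subr_eq0.
  have main m : (m <= K.+1)%N -> (forall k, (k < m)%N -> `|x - y| <= dl rho k.+1) ->
     e ^+ 2 / (x - y) ^+ 2 <= 3 * (((phi x + phi y) / 2 - Ph m x) ^+ 2 * (g x - g y) ^+ 2) / (x - y) ^+ 2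
       + (V m x + V m y) + (6 * S ^+ 2 * T m x ^+ 2 + 6 * S ^+ 2 * T m y ^+ 2) / (x - y) ^+ 2.
    move=> mK hk; have := para_ptwise Lp Lg r0 s0 mK hk; rewrite -/e -/S -/(C m x) -/(C m y) -/(T m x) -/(T m y).
    set A := _ * _; set B := S * _ * _; set D := S * _ => hle.
    have A0 : 0 <= A by apply: mulr_ge0.
    have B0 : 0 <= B by apply: mulr_ge0; [apply: mulr_ge0|apply: addr_ge0].
    have D0 : 0 <= D by apply: mulr_ge0 => //; apply: addr_ge0.
    have e2 : e ^+ 2 <= 3 * A ^+ 2 + 3 * B ^+ 2 + 3 * D ^+ 2.
      apply: le_trans (sq3 A0 B0 D0); rewrite -(real_normK (num_real e)).
      by rewrite lerXn2r// nnegrE; do ! apply: addr_ge0.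
    have EA : A ^+ 2 = ((phi x + phi y) / 2 - Ph m x) ^+ 2 * (g x - g y) ^+ 2.
      by rewrite /A exprMn !real_normK ?num_real.
    have EB : 3 * B ^+ 2 <= (V m x + V m y) * (x - y) ^+ 2.
      have -> : B ^+ 2 = S ^+ 2 * `|x - y| ^+ 2 * (C m x + C m y) ^+ 2 by rewrite /B; ring.
      rewrite real_normK ?num_real// /V.
      have k1 : (C m x + C m y) ^+ 2 <= 2 * (C m x ^+ 2 + C m y ^+ 2) by have := sqr_ge0 (C m x - C m y); clra.
      have := ler_wpM2l (mulr_ge0 (sqr_ge0 S) (ltW l2)) k1; clra.
    have ED : 3 * D ^+ 2 <= 6 * S ^+ 2 * T m x ^+ 2 + 6 * S ^+ 2 * T m y ^+ 2.
      have -> : D ^+ 2 = S ^+ 2 * (T m x + T m y) ^+ 2 by rewrite /D; ring.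
      have k1 : (T m x + T m y) ^+ 2 <= 2 * (T m x ^+ 2 + T m y ^+ 2) by have := sqr_ge0 (T m x - T m y); clra.
      have := ler_wpM2l (sqr_ge0 S) k1; clra.
    rewrite ler_pdivrMr// -EA; set Z := (_ + 6 * S ^+ 2 * T m y ^+ 2) in ED *.
    have -> : (3 * A ^+ 2 / (x - y) ^+ 2 + (V m x + V m y) + Z / (x - y) ^+ 2) * (x - y) ^+ 2
      = 3 * A ^+ 2 + (V m x + V m y) * (x - y) ^+ 2 + Z by field; rewrite subr_eq0.
    by move: e2 EB ED; clra.
  (* Below the finest scale there is no gain: the factor of [g x - g y] is at most [3 * M], and the
     energy near the diagonal pays for it. *)
  have [hK|[m [mK h1 h2 h3]]] := shell_ex K x y r0.
    have hk k : (k < K.+1)%N -> `|x - y| <= dl rho k.+1.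
      by move=> kK; apply: le_trans hK _; exact: dl_mono.
    apply: le_trans (main _ (leqnn _) hk) _.
    have -> : T K.+1 x = 0 by rewrite /T big_geq.
    have -> : T K.+1 y = 0 by rewrite /T big_geq.
    rewrite expr0n/= !mulr0 addr0 mul0r addr0.
    have v1 : V K.+1 x + V K.+1 y <= \sum_(0 <= m < K.+1) Vn m (x, y).
      apply: le_trans (term_le_sum (fun k => Vn0 k (x, y)) (ltnSn K)).
      by rewrite /Vn /Jnear/= hK /ind mulr1.
    have a1 : ((phi x + phi y) / 2 - Ph K.+1 x) ^+ 2 <= 9 * M ^+ 2.
      have n1 : `|(phi x + phi y) / 2 - Ph K.+1 x| <= 3 * M.
        apply: le_trans (ler_normB _ _) _; have := lev_GM Lp K.+1 x.
        have : `|(phi x + phi y) / 2| <= M.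
          rewrite normrM [`|2^-1|]ger0_norm; last by rewrite invr_ge0.
          have := ler_normD (phi x) (phi y); have := lev_M Lp x; have := lev_M Lp y; clra.
        clra.
      rewrite -(real_normK (num_real (_ - Ph K.+1 x))).
      have -> : 9 * M ^+ 2 = (3 * M) ^+ 2 by ring.
      by rewrite lerXn2r ?nnegrE//; clra.
    rewrite hK (_ : ind true = 1)// mul1r.
    have a2 : 3 * (((phi x + phi y) / 2 - Ph K.+1 x) ^+ 2 * (g x - g y) ^+ 2) / (x - y) ^+ 2 <= 27 * M ^+ 2 * en g (x, y).
      have := ler_wpM2r dg0 a1; rewrite enE !mulrA; clra.
    have : 0 <= 3 * S ^+ 2 * en g (x, y) by nn.
    by clra.
  apply: le_trans (main m (ltnW mK) h3) _.
  (* [Vn m] carries [V m.+1] on the pairs closer than [dl rho m.+1]. For [m = 0] the sum [C 0] is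
     empty and nothing has to be paid. *)
  have v1 : V m x + V m y <= \sum_(0 <= m < K.+1) Vn m (x, y).
    case: m mK h1 h2 h3 => [|m] mK h1 h2 h3.
      have c0 q : C 0%N q = 0 by rewrite /C big_geq.
      by rewrite /V !c0 expr0n/= mulr0 addr0.
    apply: le_trans (term_le_sum (fun k => Vn0 k (x, y)) (ltnW mK : (m < K.+1)%N)).
    by rewrite /Vn /Jnear/= h2 // /ind mulr1.
  have fp := first_ptwise Lp Lg r0 s0 h2.
  have u1 : (U m x + U m y) * ((x - y) ^+ 2)^-1 <= \sum_(0 <= m < K.+1) Uf m (x, y).
    apply: le_trans (term_le_sum (fun k => Uf0 k (x, y)) mK).
    by rewrite /Uf /Jfar/= (ltW h1) /ind mul1r.
  have fp' := ler_wpM2r kap fp; rewrite -/S in fp'.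
  have : 0 <= 27 * M ^+ 2 * (ind (`|x - y| <= dl rho K.+1) * en g (x, y)) by nn.
  move: u1 fp'; rewrite /U enE; move: v1; clra.
- by move: mpara; move: (para _ _ _ _) => pf mpf; mes.
rewrite !ger0_norm; [|by nn|by nn].
have -> : \sum_(0 <= m < K.+1) 8 * (u m / dl rho m) =
   72 * (\sum_(0 <= m < K.+1) Qp m / dl rho m) + 72 * (\sum_(0 <= m < K.+1) Qg m / dl rho m)
   + 72 * S ^+ 2 * (\sum_(0 <= m < K.+1) pib m / dl rho m) + 48 * S ^+ 2 * (\sum_(0 <= m < K.+1) t m / dl rho m).
  rewrite !mulr_sumr -!big_split/=; apply: eq_bigr => m _; rewrite /u; ring.
have -> : \sum_(0 <= m < K.+1) 24 * S ^+ 2 * (dl rho m.+1 * cc m.+1) =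
  24 * S ^+ 2 * (\sum_(0 <= m < K.+1) dl rho m.+1 * cc m.+1) by rewrite mulr_sumr.
have hS1 := lev_S Lp K.+1; have hS2 := levS' K.+1 r0 Lg.
have {}sc := sc K.+1.
have S20 : 0 <= S2 by have := lev_S Lp 0%N; rewrite big_geq.
have th0 := L1b_ge0 hth.
have p0 : 0 <= pib K.+1 / dl rho K.+1 by rewrite divr_ge0 ?(L1b_ge0 (lev_b Lp K.+1))// ltW// dl_gt0.
have be0 : 0 <= beta K.+1 / dl rho K.+1 by rewrite divr_ge0 ?(L1b_ge0 (lev_b Lg K.+1))// ltW// dl_gt0.
move: sQp sQg hS1 hS2 sc st p0 be0.
move: (\sum_(0 <= m < K.+1) Qp m / dl rho m) (\sum_(0 <= m < K.+1) Qg m / dl rho m)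
  (\sum_(0 <= m < K.+1) pib m / dl rho m) (\sum_(0 <= m < K.+1) t m / dl rho m)
  (\sum_(0 <= m < K.+1) dl rho m.+1 * cc m.+1) (\sum_(0 <= m < K.+1) beta m.+1 / dl rho m.+1)
  (pib K.+1 / dl rho K.+1) (beta K.+1 / dl rho K.+1) => q1 q2 q3 q4 q5 q6 pp bb sQp sQg hS1 hS2 sc st p0 be0.
have -> : S ^+ 2 = 4624 * sg ^+ 2 by rewrite /S; ring.
have s2 := sqr_ge0 sg; have M2 := sqr_ge0 M.
have w1 : sg ^+ 2 * q3 <= sg ^+ 2 * S2 by apply: ler_wpM2l.
have w2 : sg ^+ 2 * q4 <= sg ^+ 2 * (6 * S2) by apply: ler_wpM2l => //; clra.
have w3 : sg ^+ 2 * q5 <= sg ^+ 2 * (12 * S2) by apply: ler_wpM2l => //; clra.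
have w4 : 0 <= sg ^+ 2 * S2 by exact: mulr_ge0.
have m1 : 0 <= M ^+ 2 * pp by exact: mulr_ge0.
have m2 : 0 <= M ^+ 2 * bb by exact: mulr_ge0.
have m3 : 0 <= M ^+ 2 * th by exact: mulr_ge0.
have -> : sg ^+ 4 = sg ^+ 2 * sg ^+ 2 by ring.
have big1 : 10 ^+ 8 * (sg ^+ 2 * S2) * 200 = 2 * 10 ^+ 10 * (sg ^+ 2 * S2) by ring.
have big2 : 5000 * 5000 * (sg ^+ 2 * S2) <= 10 ^+ 8 * (sg ^+ 2 * S2) by apply: ler_wpM2r; [exact: w4|clear; lra].
move: sQp sQg big1 big2; set X := 10 ^+ 8 * (sg ^+ 2 * S2); set Y := 2 * 10 ^+ 10 * _.
by clearbody X Y; clra.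
Qed.

End Comp2.

(** * Test functions and scale invariant estimates *)

Section GoodFun.
Variable R : realType.
Local Notation mu := (@lebesgue_measure R).
Local Notation mu2 := (mu \x mu)%E.
Implicit Types (g w phi v f : R -> R) (x y c s : R).

(** The class of test functions. Boundedness makes it an algebra and makes [|du|^2 phi] integrable;
    the paraproduct and localized multiples of the solution stay in it. *)
Definition Good f := [/\ measurable_fun setT f, exists M, forall x, `|f x| <= M &
  exists P, L1b mu2 (en f) P].

Lemma Good_lip f (L M c r : R) : (forall x y, `|f x - f y| <= L * `|x - y|) ->
  (forall x, `|f x| <= M) -> 0 < r -> (forall x, r < `|x - c| -> f x = 0) -> Good f.
Proof.
move=> hL hM r0 f0; have mf := lip_mes hL; split => //; first by exists M.
have M0 : 0 <= M := le_trans (normr_ge0 _) (hM 0).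
pose J z := L ^+ 2 * Jnear 1 z + 4 * M ^+ 2 * Jfar 1 z : R.
have mJ : measurable_fun setT J.
  by have := mes_Jnear (1 : R) => m1; have := mes_Jfar (1 : R) => m2; rewrite /J; mes.
have hJ x : L1b mu (fun y => J (x, y)) (`|L ^+ 2| * (2 * 1) + `|4 * M ^+ 2| * (2 / 1)).
  exact: L1bD (L1bZ _ (L1b_Jnear x ltr01)) (L1bZ _ (L1b_Jfar x ltr01)).
have sJ x y : J (x, y) = J (y, x) by rewrite /J Jnear_sym Jfar_sym.
have hi : L1b mu (fun x => ind (`|c - x| <= r)) (2 * r) by apply: L1b_itv; exact: ltW.
eexists; apply: L1b_le2 (L1b_both mJ sJ hJ hi); first exact: mes_en.
move=> x y /=; rewrite ger0_norm ?en_ge0// /en/=.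
have J0 : 0 <= J (x, y) by rewrite /J; apply: addr_ge0; apply: mulr_ge0; nn; rewrite ?Jnear_ge0 ?Jfar_ge0.
have [exy|xy] := eqVneq x y.
  by rewrite -exy in J0 *; rewrite subrr expr0n/= mul0r mulr_ge0// addr_ge0// ind_ge0.
have l2 : 0 < (x - y) ^+ 2 by rewrite exprn_even_gt0//= subr_eq0.
have key : (f x - f y) ^+ 2 / (x - y) ^+ 2 <= J (x, y).
  rewrite /J /Jnear /Jfar/=; have [h|h] := leP `|x - y| 1.
    apply: (@le_trans _ _ (L ^+ 2)); last first.
      by rewrite [ind true]/ind mulr1 lerDl; nn.
    rewrite ler_pdivrMr// -(real_normK (num_real (f x - f y))) -(real_normK (num_real (x - y))) -exprMn.
    by rewrite lerXn2r ?nnegrE//; exact: le_trans (hL x y).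
  rewrite [ind false]/ind mulr0 add0r (ltW h) [ind true]/ind mul1r; apply: ler_wpM2r; first exact: isq_ge0.
  have : `|f x - f y| <= 2 * M by have := ler_normB (f x) (f y); have := hM x; have := hM y; clra.
  rewrite -(real_normK (num_real (f x - f y))) (_ : 4 * M ^+ 2 = (2 * M) ^+ 2); last by ring.
  by move=> h'; rewrite lerXn2r ?nnegrE//; clra.
have [hx|hx] := leP `|c - x| r.
  by apply: le_trans key _; apply: ler_peMl => //; rewrite [ind true]/ind lerDl ind_ge0.
have [hy|hy] := leP `|c - y| r.
  by apply: le_trans key _; apply: ler_peMl => //; rewrite [ind true]/ind lerDr ind_ge0.
by rewrite !f0 ?subrr ?expr0n/= ?mul0r ?addr0 ?mul0r// distrC.
Qed.

Lemma Good_eta c s : 0 < s -> Good (eta c s).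
Proof.
move=> s0; apply: (@Good_lip _ s^-1 1 c (2 * s)).
- by move=> x y; rewrite mulrC; exact: eta_lip.
- by move=> x; rewrite ger0_norm; case/andP: (eta_01 c s x).
- by clra.
- by move=> x h; apply: eta0 => //; exact: ltW.
Qed.

Lemma GoodD f g : Good f -> Good g -> Good (fun x => f x + g x).
Proof.
case=> mf [M1 h1] [P1 e1] [mg [M2 h2] [P2 e2]]; split; first by mes.
  by exists (M1 + M2) => x; apply: le_trans (ler_normD _ _) _; exact: lerD.
eexists; apply: L1b_le2 (L1bD (L1bZ 2 e1) (L1bZ 2 e2)); first by apply: mes_en; mes.
move=> x y; rewrite ger0_norm ?en_ge0// /en/= !mulrA -mulrDl; apply: ler_wpM2r; first exact: isq_ge0.
by have := sqr_ge0 ((f x - f y) - (g x - g y)); clra.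
Qed.

Lemma GoodM f g : Good f -> Good g -> Good (fun x => f x * g x).
Proof.
case=> mf [M1 h1] [P1 e1] [mg [M2 h2] [P2 e2]]; split; first by mes.
  by exists (M1 * M2) => x; rewrite normrM; exact: ler_pM.
eexists; apply: L1b_le2 (L1bD (L1bZ (2 * M2 ^+ 2) e1) (L1bZ (2 * M1 ^+ 2) e2)); first by apply: mes_en; mes.
move=> x y; rewrite ger0_norm ?en_ge0// /en/= !mulrA -mulrDl; apply: ler_wpM2r; first exact: isq_ge0.
have a1 : f x ^+ 2 <= M1 ^+ 2.
  by rewrite -(real_normK (num_real (f x))) lerXn2r ?nnegrE//; exact: le_trans (h1 x).
have a2 : g y ^+ 2 <= M2 ^+ 2.
  by rewrite -(real_normK (num_real (g y))) lerXn2r ?nnegrE//; exact: le_trans (h2 y).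
have -> : f x * g x - f y * g y = f x * (g x - g y) + g y * (f x - f y) by ring.
have := ler_wpM2r (sqr_ge0 (g x - g y)) a1; have := ler_wpM2r (sqr_ge0 (f x - f y)) a2.
by have := sqr_ge0 (f x * (g x - g y) - g y * (f x - f y)); clra.
Qed.

Lemma GoodC (k : R) f : Good f -> Good (fun x => k * f x).
Proof.
case=> mf [M1 h1] [P1 e1]; split; first by mes.
  by exists (`|k| * M1) => x; rewrite normrM; exact: ler_wpM2l.
eexists; apply: L1b_le2 (L1bZ (k ^+ 2) e1); first by apply: mes_en; mes.
by move=> x y; rewrite ger0_norm ?en_ge0// /en/= mulrA -mulrBr exprMn.
Qed.

Lemma Good0 : Good (fun=> 0).
Proof.
split; [exact: mes_cst|by exists 0 => x; rewrite normr0|].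
by exists 0; apply: L1b_eq (L1b0 mu2) => z; rewrite /en subrr expr0n/= mul0r.
Qed.

Lemma Good_sum (s : seq nat) (F : nat -> R -> R) : (forall k, Good (F k)) ->
  Good (fun x => \sum_(k <- s) F k x).
Proof.
move=> h; elim: s => [|k s ih].
  by rewrite (_ : (fun x => _) = fun=> 0); [exact: Good0|apply/funext => x; rewrite big_nil].
rewrite (_ : (fun x => _) = (fun x => F k x + \sum_(i <- s) F i x)); first exact: GoodD.
by apply/funext => x; rewrite big_cons.
Qed.

Lemma GoodB f g : Good f -> Good g -> Good (fun x => f x - g x).
Proof.
move=> hf /(GoodC (-1)) hg; have := GoodD hf hg.
by rewrite (_ : (fun x => f x + _) = (fun x => f x - g x))//; apply/funext => x; rewrite mulN1r.
Qed.

(** The compensated product, with the truncation error hidden in [e]. The number [K] of levels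
    depends on [e], so no bound of [f] by [sg] alone is available; the last two items record what
    replaces it: deviations [h k] whose squares decay geometrically in mean. The right hand side of
    the equation will be tested against them. *)
Lemma comp_est phi g c rho sg M e : measurable_fun setT phi -> measurable_fun setT g ->
  (forall x, `|phi x| <= M) -> (forall x, `|g x| <= M) -> 0 < rho -> 0 < sg ->
  (forall x, 2 * rho < `|x - c| -> phi x = 0) -> (forall x, 16 * rho < `|x - c| -> g x = 0) ->
  L1b mu2 (en phi) (sg ^+ 2) -> L1b mu2 (en g) (sg ^+ 2) -> 0 < e ->
  exists f K (h : nat -> R -> R), [/\ Good f, forall x, 3 * rho < `|x - c| -> f x = 0,
    L1b mu2 (fun z => ((phi z.1 + phi z.2) / 2 * (g z.1 - g z.2) - (f z.1 - f z.2)) ^+ 2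
       / (z.1 - z.2) ^+ 2) (10 ^+ 13 * sg ^+ 4 + e),
    (forall x, `|f x| <= 68 * sg * \sum_(0 <= k < K) `|h k x|) &
    (forall k, [/\ measurable_fun setT (h k), forall x, `|h k x| <= 3 * M &
       L1b mu (fun x => h k x ^+ 2) (200 * sg ^+ 2 * dl rho k.+1)])].
Proof.
move=> mp mg pM gM r0 s0 p0 g0 hp hg e0.
have M0 : 0 <= M := le_trans (normr_ge0 _) (pM 0).
have p0' x : 16 * rho < `|x - c| -> phi x = 0 by move=> h; apply: p0; clra.
have [Ph [p [pib [Lp supP lipP]]]] := lev_ex mp pM r0 s0 p0' hp.
have [G [b [beta [Lg supG lipG]]]] := lev_ex mg gM r0 s0 g0 hg.
(* The truncation error is at most [4000 * M^2 * (2 * e')]; the added 1 covers [M = 0]. *)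
pose e' := e / (10 ^+ 5 * (M ^+ 2 + 1)).
have M2 := sqr_ge0 M.
have D0 : 0 < 10 ^+ 5 * (M ^+ 2 + 1) by apply: mulr_gt0; [exact: exprn_gt0|exact: ltr_wpDl].
have e'0 : 0 < e' by exact: divr_gt0.
have [n0 hn0] := theta_small mg hg r0 e'0.
have bt0 k : 0 <= pib k / dl rho k by rewrite divr_ge0 ?(L1b_ge0 (lev_b Lp k))// ltW// dl_gt0.
have bt0' k : 0 <= beta k / dl rho k by rewrite divr_ge0 ?(L1b_ge0 (lev_b Lg k))// ltW// dl_gt0.
have [K' [hK' hs]] : exists K, (n0.+1 <= K)%N /\ pib K / dl rho K + beta K / dl rho K <= e'.
  apply: (@small_term _ (fun k => pib k / dl rho k + beta k / dl rho k) (200 * sg ^+ 2 + 200 * sg ^+ 2)) => //.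
    by move=> m; exact: addr_ge0.
  by move=> K; rewrite big_split/=; apply: lerD; [exact: lev_S Lp K|exact: lev_S Lg K].
case: K' hK' hs => // K hK hs.
have Gp k : Good (fun x => Ph k.+1 x - Ph k x).
  have gk j : Good (Ph j).
    have [L hL] := lipP j; apply: (@Good_lip _ L (2 * M) c (3 * rho)) => //.
    - by move=> x; exact: lev_GM Lp j x.
    - by clra.
    - by move=> x hx; apply: (supP _ p0); clra.
  exact: GoodB.
have Gg : Good g by split => //; [exists M|exists (sg ^+ 2)].
have Gh k : Good (fun x => g x - G k.+1 x).
  apply: GoodB => //; have [L hL] := lipG k.+1; apply: (@Good_lip _ L (2 * M) c (17 * rho)) => //.
  - by move=> x; exact: lev_GM Lg k.+1 x.
  - by clra.
  - by move=> x hx; apply: (supG _ g0); clra.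
have Gf : Good (para g Ph G K.+1) by apply: Good_sum => k; exact: GoodM.
exists (para g Ph G K.+1), K.+1, (fun k x => g x - G k.+1 x); split => //.
- move=> x hx; rewrite /para big1// => k _.
  by rewrite !(supP _ p0) ?subrr ?mul0r//; clra.
- have mf : measurable_fun setT (para g Ph G K.+1) by case: Gf.
  have hn : L1b mu2 (fun z => ind (`|z.1 - z.2| <= dl rho K.+1) * en g z) e' by apply: hn0; exact: ltnW.
  apply: L1b_weak (comp_L1b Lp Lg r0 s0 M0 hg hn mf).
  have s4 : 0 <= sg ^+ 4 by rewrite exprn_even_ge0.
  have a1 : 4000 * M ^+ 2 * (pib K.+1 / dl rho K.+1 + beta K.+1 / dl rho K.+1 + e') <= e.
    apply: (@le_trans _ _ (4000 * M ^+ 2 * (2 * e'))).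
      rewrite -!(mulrA 4000); apply: ler_wpM2l; first exact: ler0n.
      apply: ler_wpM2l; first exact: M2.
      by move: hs; clear; move: (pib K.+1 / _) (beta K.+1 / _) e' => A B C h; clra.
    have -> : e = 10 ^+ 5 * (M ^+ 2 + 1) * e' by rewrite /e' mulrC divfK//; exact: lt0r_neq0.
    have : 0 <= M ^+ 2 * e' by apply: mulr_ge0 => //; exact: ltW.
    by move: (ltW e'0); clear; clra.
  have -> : 2 * 10 ^+ 10 * (sg ^+ 2 * (200 * sg ^+ 2)) = 400 * 10 ^+ 10 * sg ^+ 4 by ring.
  have a2 : 13872 * sg ^+ 4 <= 10 ^+ 10 * sg ^+ 4 by apply: ler_wpM2r; [exact: s4|clear; lra].
  have a3 : 400 * 10 ^+ 10 * sg ^+ 4 + 10 ^+ 10 * sg ^+ 4 <= 10 ^+ 13 * sg ^+ 4.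
    rewrite -mulrDl; apply: ler_wpM2r; first exact: s4.
    have -> : 10 ^+ 13 = 1000 * 10 ^+ 10 :> R by ring.
    have : 0 <= 10 ^+ 10 :> R by exact: exprn_ge0.
    by move: (10 ^+ 10 : R) => X; clra.
  move: a1 a2 a3; move: (10 ^+ 13 * sg ^+ 4) (400 * 10 ^+ 10 * sg ^+ 4) (10 ^+ 10 * sg ^+ 4) => A B C.
  by clra.
- move=> x; rewrite /para mulr_sumr; apply: le_trans (ler_norm_sum _ _ _) _.
  apply: ler_sum => k _; rewrite normrM; apply: ler_wpM2r => //; exact: lev_t Lp k x.
- move=> k; split.
  + by case: (Gh k).
  + move=> x; have := ler_normB (g x) (G k.+1 x); have := gM x; have := lev_GM Lg k.+1 x; clra.
  + have dk := dl_gt0 k.+1 r0.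
    apply: L1b_weak (levh2 k.+1 Lg).
    rewrite -ler_pdivrMr//; apply: le_trans (lev_S Lg k.+2).
    exact: (term_le_sum bt0').
Qed.

(** Quartic, hence quadratic in the energy. On a shell [g x - g y] is a difference of averages,
    bounded through the BMO estimate, plus two deviations whose fourth powers are summed by
    [Qsum]. *)
Lemma L4_est g c rho sg M e : measurable_fun setT g -> (forall x, `|g x| <= M) -> 0 < rho -> 0 < sg ->
  (forall x, 16 * rho < `|x - c| -> g x = 0) -> L1b mu2 (en g) (sg ^+ 2) -> 0 < e ->
  L1b mu2 (fun z => (g z.1 - g z.2) ^+ 4 / (z.1 - z.2) ^+ 2) (10 ^+ 13 * sg ^+ 4 + e).
Proof.
move=> mg gM r0 s0 g0 hg e0.
have M0 : 0 <= M := le_trans (normr_ge0 _) (gM 0).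
have [G [b [beta [Lg _ _]]]] := lev_ex mg gM r0 s0 g0 hg.
pose e' := e / (10 ^+ 5 * (M ^+ 2 + 1)).
have M2 := sqr_ge0 M.
have D0 : 0 < 10 ^+ 5 * (M ^+ 2 + 1) by apply: mulr_gt0; [exact: exprn_gt0|exact: ltr_wpDl].
have e'0 : 0 < e' by exact: divr_gt0.
have [n0 hn0] := theta_small mg hg r0 e'0.
have bt0' k : 0 <= beta k / dl rho k by rewrite divr_ge0 ?(L1b_ge0 (lev_b Lg k))// ltW// dl_gt0.
have [K' [hK' hs]] := small_term n0.+1 bt0' (lev_S Lg) e'0.
case: K' hK' hs => // K hK hs.
have hth : L1b mu2 (fun z => ind (`|z.1 - z.2| <= dl rho K.+1) * en g z) e' by apply: hn0; exact: ltnW.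
pose S := 68 * sg; have S0 : 0 <= S by rewrite /S; clra.
have [Qg [hQg sQg]] := Qsum K.+1 Lg r0 s0 M0.
pose U m x := 18 * (g x - G m x) ^+ 4 + 9 * S ^+ 2 * (g x - G m x) ^+ 2.
pose u m := 18 * Qg m + 9 * S ^+ 2 * beta m.
have q4 (a : R) : 0 <= a ^+ 4 by rewrite exprn_even_ge0.
have U0 m x : 0 <= U m x.
  by rewrite /U; apply: addr_ge0; [apply: mulr_ge0|nn].
have hU m : (m <= K.+1)%N -> L1b mu (U m) (u m).
  move=> mK; have := L1bD (L1bZ 18 (hQg m mK)) (L1bZ (9 * S ^+ 2) (levh2 m Lg)).
  by rewrite !ger0_norm//; nn.
pose Uf m z := (U m z.1 + U m z.2) * Jfar (dl rho m.+1) z.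
have Uf0 m z : 0 <= Uf m z by apply: mulr_ge0; [exact: addr_ge0|exact: Jfar_ge0].
have hUf m : (m < K.+1)%N -> L1b mu2 (Uf m) (8 * (u m / dl rho m)).
  move=> mK; have := L1b_both (mes_Jfar (dl rho m.+1)) (Jfar_sym _)
    (fun x => L1b_Jfar x (dl_gt0 m.+1 r0)) (hU m (ltnW mK)).
  rewrite (_ : 2 * (u m * (2 / dl rho m.+1)) = 8 * (u m / dl rho m))//.
  by rewrite dlS; have := dl_gt0 m r0 => h; field; exact: lt0r_neq0.
have hUs : L1b mu2 (fun z => \sum_(0 <= m < K.+1) Uf m z) (\sum_(0 <= m < K.+1) 8 * (u m / dl rho m)).
  have := @L1b_sum _ _ _ mu2 _ (index_iota 0 K.+1) (fun m => (m < K.+1)%N) Uf (fun m => 8 * (u m / dl rho m)) hUf.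
  have E (F : nat -> R) : \sum_(0 <= i < K.+1 | (i < K.+1)%N) F i = \sum_(0 <= i < K.+1) F i.
    rewrite big_nat_cond [RHS]big_nat_cond; apply: eq_bigl => i.
    by rewrite leq0n/= andbb andbT.
  by rewrite E; apply: L1b_eq => z; exact: E.
have Tot := L1bD hUs (L1bD (L1bZ (3 * S ^+ 2) hg) (L1bZ (4 * M ^+ 2) hth)).
apply: (@L1b_weak _ _ _ _ _ _ _ _ (L1b_le2 _ _ Tot)); last first.
- move=> x y /=; rewrite ger0_norm; last by apply: mulr_ge0; [exact: q4|exact: isq_ge0].
  have kap := isq_ge0 (x - y).
  have enE : en g (x, y) = (g x - g y) ^+ 2 * ((x - y) ^+ 2)^-1 by [].
  have dg0 : 0 <= en g (x, y) := en_ge0 _ _.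
  have sU0 : 0 <= \sum_(0 <= m < K.+1) Uf m (x, y) by apply: sumr_ge0.
  have p1 : 0 <= 3 * S ^+ 2 * en g (x, y) by nn.
  have p2 : 0 <= 4 * M ^+ 2 * (ind (`|x - y| <= dl rho K.+1) * en g (x, y)) by nn.
  have [hK2|[m [mK h1 h2 h3]]] := shell_ex K x y r0.
    move: p2; rewrite hK2 (_ : ind true = 1)// mul1r => p2.
    have dgM : (g x - g y) ^+ 2 <= 4 * M ^+ 2.
      have : `|g x - g y| <= 2 * M by have := ler_normB (g x) (g y); have := gM x; have := gM y; clra.
      rewrite -(real_normK (num_real (g x - g y))) (_ : 4 * M ^+ 2 = (2 * M) ^+ 2); last by ring.
      by move=> h'; rewrite lerXn2r ?nnegrE//; clra.
    have q : (g x - g y) ^+ 4 / (x - y) ^+ 2 = (g x - g y) ^+ 2 * en g (x, y) by rewrite enE mulrA -exprD.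
    by have := ler_wpM2r dg0 dgM; rewrite q; move: p1 sU0; clear; clra.
  have u1 : (U m x + U m y) * ((x - y) ^+ 2)^-1 <= \sum_(0 <= m < K.+1) Uf m (x, y).
    apply: le_trans (term_le_sum (fun k => Uf0 k (x, y)) mK).
    by rewrite /Uf /Jfar/= (ltW h1) /ind mul1r.
  have key : (g x - g y) ^+ 4 <= U m x + U m y + 3 * S ^+ 2 * (g x - g y) ^+ 2.
    have hq : `|G m x - G m y| <= S := dlevel r0 s0 Lg h2.
    have eg : g x - g y = (g x - G m x) - (g y - G m y) + (G m x - G m y) by ring.
    rewrite /U; move: eg hq; move: (g x - G m x) (g y - G m y) (G m x - G m y) => h k q eg hq.
    have q2 : q ^+ 2 <= S ^+ 2.
      by rewrite -(real_normK (num_real q)) lerXn2r// nnegrE.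
    have d2 : (g x - g y) ^+ 2 <= 3 * (h ^+ 2 + k ^+ 2 + S ^+ 2).
      rewrite eg; have := sqr_ge0 (h + k); have := sqr_ge0 (h - q); have := sqr_ge0 (k + q); move: q2; clra.
    rewrite (_ : (g x - g y) ^+ 4 = (g x - g y) ^+ 2 * (g x - g y) ^+ 2); last by rewrite -exprD.
    set D := (g x - g y) ^+ 2 in d2 *; have D0' : 0 <= D := sqr_ge0 _.
    apply: le_trans (ler_wpM2r D0' d2) _.
    have hk0 : 0 <= h ^+ 2 + k ^+ 2 by nn.
    have := ler_wpM2l hk0 d2; have := sqr_ge0 (h ^+ 2 - k ^+ 2); clra.
  have := ler_wpM2r kap key; rewrite mulrDl -(mulrA (3 * S ^+ 2)) -enE.
  by move: u1 p2; clear; clra.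
- by mes.
rewrite !ger0_norm; [|by nn|by nn].
have -> : \sum_(0 <= m < K.+1) 8 * (u m / dl rho m) =
   144 * (\sum_(0 <= m < K.+1) Qg m / dl rho m) + 72 * S ^+ 2 * (\sum_(0 <= m < K.+1) beta m / dl rho m).
  rewrite !mulr_sumr -!big_split/=; apply: eq_bigr => m _; rewrite /u; ring.
have hS1 := lev_S Lg K.+1.
have be0 := bt0' K.+1.
move: sQg hS1 be0 hs.
move: (\sum_(0 <= m < K.+1) Qg m / dl rho m) (\sum_(0 <= m < K.+1) beta m / dl rho m)
   (beta K.+1 / dl rho K.+1) => q2 q3 bb sQg hS1 be0 hs.
have -> : S ^+ 2 = 4624 * sg ^+ 2 by rewrite /S; ring.
have s2 := sqr_ge0 sg.
have w1 : sg ^+ 2 * q3 <= sg ^+ 2 * (200 * sg ^+ 2) by apply: ler_wpM2l.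
have m2 : M ^+ 2 * bb <= M ^+ 2 * e' by exact: ler_wpM2l.
have m3 : 0 <= M ^+ 2 * e' by apply: mulr_ge0 => //; exact: ltW.
have ee : e = 10 ^+ 5 * (M ^+ 2 + 1) * e' by rewrite /e' mulrC divfK//; exact: lt0r_neq0.
have s4 : 0 <= sg ^+ 4 by exact: q4.
have b1 : 10 ^+ 8 * (sg ^+ 2 * (200 * sg ^+ 2)) = 200 * (10 ^+ 8 * sg ^+ 4) by ring.
rewrite b1 in sQg.
have b2 : 10 ^+ 13 * sg ^+ 4 = 300 * 333 * (10 ^+ 8 * sg ^+ 4) + 100 * (10 ^+ 8 * sg ^+ 4) by ring.
have b3 : 5000 * 5000 * sg ^+ 4 <= 10 ^+ 8 * sg ^+ 4 by apply: ler_wpM2r; [exact: s4|clear; lra].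
rewrite b2; move: sQg b3; move: (10 ^+ 8 * sg ^+ 4) => X sQg b3.
have b4 : sg ^+ 2 * (200 * sg ^+ 2) = 200 * sg ^+ 4 by ring.
rewrite b4 in w1.
have -> : 3 * (4624 * sg ^+ 2) * sg ^+ 2 = 13872 * sg ^+ 4 by ring.
move: sQg w1 m2 m3 ee s4 b3 e'0; clear; lra.
Qed.

End GoodFun.

(** * Solutions and the conservation law *)

Section AlmostEverywhere.
Context d (T : measurableType d) (R : realType) (m : {measure set T -> \bar R}).

Lemma aeS (P Q : T -> Prop) : (forall x, P x -> Q x) -> {ae m, forall x, P x} -> {ae m, forall x, Q x}.
Proof. by move=> h; apply: filterS. Qed.

Lemma aeI (P Q : T -> Prop) : {ae m, forall x, P x} -> {ae m, forall x, Q x} ->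
  {ae m, forall x, P x /\ Q x}.
Proof. by apply: filterS2 => x. Qed.

Lemma ae_all (I : finType) (P : I -> T -> Prop) : (forall i, {ae m, forall x, P i x}) ->
  {ae m, forall x, forall i, P i x}.
Proof. by move=> h; apply: filter_forall. Qed.

Lemma L1b_ae (F G : T -> R) c : measurable_fun setT G -> {ae m, forall x, F x = G x} ->
  L1b m F c -> L1b m G c.
Proof.
move=> mG h [mF Fc]; split => //; apply: le_trans Fc; rewrite le_eqVlt; apply/orP; left; apply/eqP.
apply: ae_eq_integral => //; [exact: measurable_absE|exact: measurable_absE|].
by apply: filterS h => x e _; rewrite e.
Qed.

Lemma Rint_ae (F G : T -> R) : measurable_fun setT F -> measurable_fun setT G ->
  {ae m, forall x, F x = G x} -> \int[m]_x F x = \int[m]_x G x.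
Proof.
move=> mF mG h; congr fine; apply: ae_eq_integral => //; [exact/measurable_EFinP|exact/measurable_EFinP|].
by apply: filterS h => x e _; rewrite /= e.
Qed.

Lemma integral_supp (D : set T) (f : T -> \bar R) : (forall x, ~ D x -> f x = 0%E) ->
  (\int[m]_(x in D) f x = \int[m]_x f x)%E.
Proof.
move=> h; rewrite integral_mkcond; apply: eq_integral => x _; rewrite patchE.
by case: ifPn => // /negP hx; rewrite h// => Dx; apply: hx; rewrite inE.
Qed.

(** True even when the integral of [G] is infinite, since [fine] sends infinities to 0 on both
    sides. The density [dsa2] may be infinite at some points. *)
Lemma Rint_ge0Zr (G : T -> R) (c : R) : measurable_fun setT G -> (forall x, 0 <= G x) ->
  \int[m]_x (G x * c) = fine (\int[m]_x (G x)%:E)%E * c.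
Proof.
move=> mG G0; have pos (k : R) : 0 <= k ->
    (\int[m]_x (G x * k)%:E = (\int[m]_x (G x)%:E) * k%:E)%E.
  move=> k0; rewrite -ge0_integralZr//; last by move=> *; rewrite lee_fin.
  exact/measurable_EFinP.
have fM (x : \bar R) (k : R) : fine (x * k%:E)%E = fine x * k.
  by case: x => [s||]//=; rewrite mul0r ?mulNyr ?mulyr; case: (sgrP k) => //= _; rewrite ?mul0e ?mul1e ?mulN1e.
rewrite /Rintegral; have [c0|c0] := leP 0 c; first by rewrite pos// fM.
have -> : (fun x => (G x * c)%:E) = (fun x => - (G x * (- c))%:E)%E.
  by apply/funext => x; rewrite -EFinN mulrN opprK.
rewrite integral_ge0N; last by move=> x _; rewrite lee_fin mulr_ge0// oppr_ge0 ltW.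
by rewrite pos ?oppr_ge0 1?ltW// fineN fM mulrN opprK.
Qed.

End AlmostEverywhere.

Section AeProduct.
Variable R : realType.
Local Notation mu := (@lebesgue_measure R).
Local Notation mu2 := (mu \x mu)%E.

Lemma ae_fst (P : R -> Prop) : {ae mu, forall x, P x} -> {ae mu2, forall z, P z.1}.
Proof.
case=> A [mA A0 sub]; exists (A `*` setT); split.
- exact: measurableX.
- by apply: (eq_trans (product_measure1E mu mu mA measurableT)); move: A0 => /= ->; rewrite mul0e.
- by move=> z /= h; split => //; exact: sub.
Qed.

Lemma ae_snd (P : R -> Prop) : {ae mu, forall x, P x} -> {ae mu2, forall z, P z.2}.
Proof.
case=> A [mA A0 sub]; exists (setT `*` A); split.
- exact: measurableX.
- by apply: (eq_trans (product_measure1E mu mu measurableT mA)); move: A0 => /= ->; rewrite mule0.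
- by move=> z /= h; split => //; exact: sub.
Qed.

(** Turns the right hand side of the weak formulation, with its [fine] of an inner integral, into a
    double integral: integrability makes the slices finite for almost every [x]. *)
Lemma fubini_ge0Zr (G : R * R -> R) (p : R -> R) c : measurable_fun setT G -> (forall z, 0 <= G z) ->
  measurable_fun setT p -> L1b mu2 (fun z => G z * p z.1) c ->
  [/\ mu.-integrable setT (fun x => (fine (\int[mu]_y (G (x, y))%:E)%E * p x)%:E) &
   (\int[mu]_x (fine (\int[mu]_y (G (x, y))%:E) * p x)%:E = (\int[mu2]_z (G z * p z.1))%:E)%E].
Proof.
move=> mG G0 mp h; have ih := L1b_int h.
have mGx x : measurable_fun setT (fun y => G (x, y)).
  by apply: (measurableT_comp mG); exact: measurable_fun_pair.
pose F (x : R) : \bar R := (\int[mu]_y (G (x, y) * p x)%:E)%E.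
have iF : mu.-integrable setT F := @integrable_fubini_F _ _ _ _ _ mu mu _ ih.
have eF : (\int[mu]_x F x = \int[mu2]_z (G z * p z.1)%:E)%E := @integral12_prod_meas1 _ _ _ _ _ mu mu _ ih.
have fF : {ae mu, forall x, F x = (fine (\int[mu]_y (G (x, y))%:E)%E * p x)%:E}.
  have := @integrable_ae _ _ _ mu _ measurableT F iF.
  by apply: aeS => x /(_ I) fx; rewrite -(Rint_ge0Zr mu (p x) (mGx x))// /Rintegral fineK.
have mH : measurable_fun setT (fun x => (fine (\int[mu]_y (G (x, y))%:E)%E * p x)).
  by apply: mes_M => //; exact: mes_Rint2.
split; last first.
  rewrite -(@ae_eq_integral _ _ _ mu setT _ F) ?eF//.
  - by rewrite /Rintegral fineK//; apply: integrable_fin_num.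
  - by case/integrableP: iF.
  - exact/measurable_EFinP.
  - by apply: (aeS _ fF) => x e _.
apply/integrableP; split; first exact/measurable_EFinP.
case/integrableP: iF => mF; apply: le_lt_trans.
rewrite le_eqVlt; apply/orP; left; apply/eqP; apply: ae_eq_integral => //.
- by apply: measurableT_comp => //; exact/measurable_EFinP.
- by apply: measurableT_comp.
- by apply: (aeS _ fF) => x e _; rewrite e.
Qed.

End AeProduct.

Section Solution.
Variables (R : realType) (N : nat).
Local Notation mu := (@lebesgue_measure R).
Local Notation mu2 := (mu \x mu)%E.
Implicit Types (a : R -> R) (u v m : 'I_N -> R -> R).

Definition D2 u (z : R * R) : R := \sum_(i < N) (u i z.1 - u i z.2) ^+ 2.

(** The weak formulation localized to a ball, component by component, with the quadratic term as a
    double integral and [|u i| <= 1] everywhere instead of almost everywhere. *)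
Record Sol a (Lam : R) u m (x0 r0 : R) : Prop := MkSol {
  sol_k : ker_ok a Lam;
  sol_mu : forall i, measurable_fun setT (u i);
  sol_1 : forall i x, `|u i x| <= 1;
  sol_E : exists E, forall i, L1b mu2 (fun z => ind (`|z.1 - x0| < r0) * en (u i) z) E;
  sol_mm : forall i, exists c, L1b mu (m i) c;
  sol_we : forall i phi, Good phi -> (forall x, r0 <= `|x - x0| -> phi x = 0) ->
    form a (u i) phi = \int[mu2]_z (D2 u z * kk a z * (u i z.1 * phi z.1))
       + \int[mu]_x (m i x * phi x) }.

Lemma D2_ge0 u z : 0 <= D2 u z.
Proof. by apply: sumr_ge0 => i _; exact: sqr_ge0. Qed.

Lemma mes_D2 u : (forall i, measurable_fun setT (u i)) -> measurable_fun setT (D2 u).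
Proof. by move=> h; rewrite /D2; apply: mes_sum => i; have := h i => ?; mes. Qed.

Lemma Sol_L1b_D2 a Lam u x0 r0 : ker_ok a Lam -> (forall i, measurable_fun setT (u i)) ->
  (exists E, forall i, L1b mu2 (fun z => ind (`|z.1 - x0| < r0) * en (u i) z) E) ->
  (forall i x, `|u i x| <= 1) ->
  forall i phi, Good phi -> (forall x, r0 <= `|x - x0| -> phi x = 0) ->
  exists c, L1b mu2 (fun z => D2 u z * kk a z * (u i z.1 * phi z.1)) c.
Proof.
move=> ok mu_ [E hE] u1 i phi [mp [M hM] [P hP]] p0; have mk := mes_kk ok.
have mD := mes_D2 mu_; have mui := mu_ i.
have H := L1bZ (Lam * M) (L1b_sum (index_enum 'I_N) (P := xpredT) (fun j _ => hE j)).
eexists; apply: L1b_le2 H; first by mes.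
move=> x y /=; have M0 : 0 <= M := le_trans (normr_ge0 _) (hM 0).
have [_ L1 _ _] := ok; have /andP[_ k2] := kk_bnd x y ok; have k0 := kk_ge0 (x, y) ok.
have -> : \sum_(j < N) ind (`|x - x0| < r0) * en (u j) (x, y) =
   ind (`|x - x0| < r0) * (D2 u (x, y) / (x - y) ^+ 2).
  by rewrite -mulr_sumr; congr (_ * _); rewrite /D2 mulr_suml.
rewrite normrM (ger0_norm (mulr_ge0 (D2_ge0 u (x, y)) k0)).
have [hx|hx] := ltP `|x - x0| r0; last first.
  by rewrite p0// !mulr0 normr0 mulr0 /ind mul0r mulr0.
rewrite [ind true]/ind mul1r.
have D0 := D2_ge0 u (x, y).
apply: (@le_trans _ _ (D2 u (x, y) * (Lam / (x - y) ^+ 2) * M)); last by apply: eqle; ring.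
apply: ler_pM; [exact: mulr_ge0|by []|exact: ler_wpM2l|].
by rewrite normrM -(mul1r M); apply: ler_pM.
Qed.

(** Lets the solution be replaced by a better representative, in the end by the Hoelder continuous
    one. *)
Lemma Sol_ae a Lam u v m x0 r0 : Sol a Lam u m x0 r0 ->
  (forall i, measurable_fun setT (v i)) -> (forall i x, `|v i x| <= 1) ->
  (forall i, {ae mu, forall x, u i x = v i x}) -> Sol a Lam v m x0 r0.
Proof.
case=> ok mu_ u1 [E hE] mm we mv v1 uv.
have ae2 i : {ae mu2, forall z, u i z.1 = v i z.1 /\ u i z.2 = v i z.2}.
  by exact: aeI (ae_fst (uv i)) (ae_snd (uv i)).
have aeD : {ae mu2, forall z, forall i, u i z.1 = v i z.1 /\ u i z.2 = v i z.2}.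
  exact: ae_all.
have mk := mes_kk ok; have mDu := mes_D2 mu_; have mDv := mes_D2 mv.
split => //.
- exists E => i; apply: L1b_ae (hE i).
    by have := mes_en (mv i) => ?; mes.
  by apply: (aeS _ (ae2 i)) => z [e1 e2]; rewrite /en e1 e2.
- move=> i phi gp p0; have mui := mu_ i; have mvi := mv i; have [mp _ _] := gp.
  rewrite (_ : form a (v i) phi = form a (u i) phi).
    rewrite we//; congr (_ + _); apply: Rint_ae; [by mes|by mes|].
    apply: (aeS _ aeD) => z h; rewrite (proj1 (h i)); congr (_ * _ * _).
    by apply: eq_bigr => j _; rewrite (proj1 (h j)) (proj2 (h j)).
  apply: Rint_ae; [by mes|by mes|].
  by apply: (aeS _ (ae2 i)) => z [e1 e2]; rewrite e1 e2.
Qed.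

End Solution.

(** * From the weak formulation to local solutions *)

Section WeakToSol.
Variables (R : realType) (N : nat).
Local Notation mu := (@lebesgue_measure R).
Local Notation mu2 := (mu \x mu)%E.
Variables (Lam : R) (a : R -> R) (Om : set R) (x0 r : R) (u m : R -> 'I_N -> R).
Hypotheses (N2 : (2 <= N)%N) (ok : ker_ok a Lam) (oOm : open Om) (r0 : 0 < r)
  (sOm : closure (ball x0 (2 * r)) `<=` Om) (hm : Lp_on 1 Om m) (hw : weak_solution a Om u m).

Definition ui (i : 'I_N) x := u x i.
Definition mi (i : 'I_N) x := ind (`|x - x0| < 2 * r) * m x i.
(** On the null set where the norm is not one, [u] is replaced by the first basis vector, so that
    the constraint holds at every point. *)
Definition vi (i : 'I_N) x := if vnorm (u x) == 1 then u x i else if val i == 0%N then 1 else 0.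

Lemma ball_Om x : `|x - x0| < 2 * r -> Om x.
Proof. by move=> h; apply: sOm; apply: subset_closure; rewrite -ball_normE /ball_/= distrC. Qed.

Lemma mes_Om : measurable Om.
Proof. exact: open_measurable. Qed.

Lemma ui_mes i : measurable_fun setT (ui i).
Proof. by case: hw => [[h _] _]; exact: h. Qed.

Lemma vi_sum x : \sum_(i < N) vi i x ^+ 2 = 1.
Proof.
rewrite /vi; case: eqP => [h|_].
  have d0 : 0 <= vdot (u x) (u x) by apply: sumr_ge0 => i _; rewrite -expr2 sqr_ge0.
  have : vnorm (u x) ^+ 2 = 1 by rewrite h expr1n.
  by rewrite /vnorm sqr_sqrtr// /vdot => <-; apply: eq_bigr => i _; rewrite expr2.
case: N N2 => // n _; rewrite big_ord_recl/= expr1n big1 ?addr0// => i _.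
by rewrite /bump/= expr0n.
Qed.

Lemma mes_vi i : measurable_fun setT (vi i).
Proof.
have mu_ j : measurable_fun setT (fun x => u x j) := ui_mes j.
have hv x : vi i x = if (vdot (u x) (u x) <= 1) && (1 <= vdot (u x) (u x)) then u x i
   else if val i == 0%N then 1 else 0.
  rewrite /vi -eq_le; congr (if _ then _ else _).
  have d0 : 0 <= vdot (u x) (u x) by apply: sumr_ge0 => j _; rewrite -expr2 sqr_ge0.
  apply/eqP/eqP => [h|h]; last by rewrite /vnorm h sqrtr1.
  by rewrite -(sqr_sqrtr d0) -/(vnorm (u x)) h expr1n.
rewrite (funext hv) /vdot; have mui := mu_ i; apply: mes_if; [|by []|exact: mes_cst].
have ms : measurable_fun setT (fun x => \sum_(j < N) u x j * u x j).
  by apply: mes_sum => j; have := mu_ j => ?; mes.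
by apply: mes_and; apply: mes_le => //; exact: mes_cst.
Qed.

Lemma vi_1 i x : `|vi i x| <= 1.
Proof.
rewrite -(@ler_pXn2r _ 2)// ?nnegrE// expr1n real_normK ?num_real// -(vi_sum x) (bigD1 i)//= lerDl.
by apply: sumr_ge0 => j _; exact: sqr_ge0.
Qed.

Lemma vi_ae i : {ae mu, forall x, u x i = vi i x}.
Proof.
case: hw => _ [h _]; have h' : {ae mu, forall x, vnorm (u x) = 1} by exact: h.
by apply: (aeS _ h') => x e; rewrite /vi e eqxx.
Qed.

Lemma ui_ae i : {ae mu, forall x, ui i x = vi i x}. Proof. exact: vi_ae. Qed.

Lemma vi_energy : exists E, forall i, L1b mu2 (fun z => ind (`|z.1 - x0| < 2 * r) * en (vi i) z) E.
Proof.
case: hw => [[_ [_ hE]] _]; rewrite /energy in hE.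
exists (fine (\int[@leb2 R]_(z in COmega Om) (en_density u z)%:E)) => i.
have mui := ui_mes i; have men := mes_en mui; have mvi := mes_vi i; have menv := mes_en mvi.
suff H : L1b mu2 (fun z => ind (`|z.1 - x0| < 2 * r) * en (ui i) z)
    (fine (\int[@leb2 R]_(z in COmega Om) (en_density u z)%:E)).
  apply: L1b_ae H; first by mes.
  have := aeI (ae_fst (ui_ae i)) (ae_snd (ui_ae i)); apply: aeS => z [e1 e2].
  by rewrite /en e1 e2.
have mO := mes_Om.
have mC : measurable (COmega Om : set (measurableTypeR R * measurableTypeR R)).
  by rewrite /COmega; apply: measurableC; apply: measurableX; apply: measurableC.
have d0 z : 0 <= en_density u z.
  by apply: mulr_ge0; [apply: sumr_ge0 => j _; rewrite -expr2 sqr_ge0|exact: isq_ge0].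
have md : measurable_fun setT (en_density u).
  rewrite /en_density /vdot; apply: mes_div; last by mes.
  by apply: mes_sum => j; have H := ui_mes j; apply: mes_M;
     apply: mes_B; [exact: (mes_1 H)|exact: (mes_2 H)|exact: (mes_1 H)|exact: (mes_2 H)].
split; first by mes.
rewrite fineK; last first.
  by rewrite ge0_fin_numE//; apply: integral_ge0 => z _; rewrite lee_fin.
rewrite [leRHS]integral_mkcond; apply: ge0_le_integral => //.
- by apply: measurable_absE; mes.
- apply/(measurable_restrictT _ mC)%R; apply: measurable_funTS; exact/measurable_EFinP.
- move=> z _; rewrite patchE; have [zO|zO] := boolP (z \in _); last first.
    have -> : ind (`|z.1 - x0| < 2 * r) = 0 :> R.
      apply/indF/negP => h; move/negP: zO; apply; rewrite inE => -[+ _]; apply.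
      exact: ball_Om.
    by rewrite mul0r normr0.
  rewrite lee_fin ger0_norm; last by nn.
  apply: (@le_trans _ _ (1 * en (ui i) z)); first by apply: ler_wpM2r; [exact: en_ge0|exact: ind_le1].
  rewrite mul1r /en /en_density; apply: ler_wpM2r; first exact: isq_ge0.
  rewrite /vdot (bigD1 i)//= -expr2 lerDl.
  by apply: sumr_ge0 => j _; rewrite -expr2 sqr_ge0.
Qed.

Lemma m_L1b i : exists c, L1b mu (fun x => ind (x \in Om) * m x i) c.
Proof.
have [mm fm] := hm i; have mO := mes_Om.
have mF : measurable_fun setT (fun x => ind (x \in Om) * m x i).
  rewrite (_ : (fun x => _) = ((fun x => m x i) \_ Om)).
    exact/(measurable_restrictT _ mO).
  by apply/funext => x; rewrite patchE /ind; case: ifP; rewrite ?mul1r ?mul0r.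
apply: L1b_ex => //; apply: le_lt_trans fm; rewrite [leRHS]integral_mkcond.
apply: ge0_le_integral => //.
- exact: measurable_absE.
- apply/(measurable_restrictT _ mO); apply/measurable_EFinP.
  by apply: (measurableT_comp (measurable_powR 1)); exact: measurableT_comp.
- move=> x _; rewrite patchE /ind; case: ifP => _; rewrite ?mul1r ?mul0r ?normr0//.
  by rewrite powRr1.
Qed.

Lemma mi_L1b i : exists c, L1b mu (mi i) c.
Proof.
have [c hc] := m_L1b i; exists c.
have mm : measurable_fun setT (mi i).
  rewrite (_ : mi i = fun x => ind (`|x - x0| < 2 * r) * (ind (x \in Om) * m x i)).
    by apply: mes_M; [mes|exact: L1b_meas hc].
  apply/funext => x; rewrite /mi; have [h|h] := ltP `|x - x0| (2 * r); last by rewrite /ind !mul0r.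
  by rewrite [ind (_ \in _)]indT ?mul1r// inE; exact: ball_Om.
apply: L1b_le1 (L1b_norm hc) => // x; rewrite /mi !normrM.
have [h|h] := ltP `|x - x0| (2 * r); last by rewrite {1}/ind normr0 mul0r mulr_ge0.
by rewrite [ind (_ \in _)]indT// inE; exact: ball_Om.
Qed.

Lemma vdot_delta (f : 'I_N -> R) i t : vdot f (fun j => if j == i then t else 0) = f i * t.
Proof. by rewrite /vdot (bigD1 i)//= eqxx big1 ?addr0// => j /negPf ->; rewrite mulr0. Qed.

(** Tests with the field whose only component is [phi], in direction [i]. The weak formulation
    speaks only of test fields for which its integrals converge, hence the two integrability
    hypotheses; they are checked on the normalized representative. *)
Lemma weak_ui i phi : Good phi -> (forall x, 2 * r <= `|x - x0| -> phi x = 0) ->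
  (exists c, L1b mu2 (fun z => D2 ui z * kk a z * (ui i z.1 * phi z.1)) c) ->
  (exists c, L1b mu2 (fun z => (ui i z.1 - ui i z.2) * (phi z.1 - phi z.2) * kk a z) c) ->
  form a (ui i) phi = \int[mu2]_z (D2 ui z * kk a z * (ui i z.1 * phi z.1))
       + \int[mu]_x (mi i x * phi x).
Proof.
move=> gp p0 [c1 h1] [c2 h2]; have [mp [M hM] [P hP]] := gp.
have M0 : 0 <= M := le_trans (normr_ge0 _) (hM 0).
case: (hw) => _ [_ H].
pose Phi (x : R) (j : 'I_N) := if j == i then phi x else 0.
have mO := mes_Om.
have mC : measurable (COmega Om : set (measurableTypeR R * measurableTypeR R)).
  by rewrite /COmega; apply: measurableC; apply: measurableX; apply: measurableC.
have mPhi j : measurable_fun setT (Phi ^~ j).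
  by rewrite /Phi; case: (j == i) => //; exact: mes_cst.
have p0' x : ~ Om x -> phi x = 0.
  by move=> hx; apply: p0; rewrite leNgt; apply/negP => /ball_Om.
have dPhi z j : Phi z.1 j - Phi z.2 j = if j == i then phi z.1 - phi z.2 else 0 :> R.
  by rewrite /Phi; case: ifP; rewrite ?subrr.
have enP z : en_density Phi z = en phi z.
  rewrite /en_density (_ : (fun j => Phi z.1 j - Phi z.2 j) = fun j => if j == i then phi z.1 - phi z.2 else 0);
    last by apply/funext => j; exact: dPhi.
  by rewrite vdot_delta eqxx -expr2.
have lhsE z : lhs_integrand a u Phi z = (ui i z.1 - ui i z.2) * (phi z.1 - phi z.2) * kk a z.
  rewrite /lhs_integrand (_ : (fun j => Phi z.1 j - Phi z.2 j) = fun j => if j == i then phi z.1 - phi z.2 else 0);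
    last by apply/funext => j; exact: dPhi.
  by rewrite vdot_delta /kk mulrA.
have dsE x : dsa2 a u x = (\int[mu]_y (D2 ui (x, y) * kk a (x, y))%:E)%E.
  apply: eq_integral => y _; congr EFin; rewrite /kk/= /D2/= /vdot.
  rewrite (_ : \sum_(j < N) (u x j - u y j) * (u x j - u y j) = \sum_(j < N) (ui j x - ui j y) ^+ 2); last first.
    by apply: eq_bigr => j _; rewrite expr2.
  by ring.
have mui := ui_mes i; have mk := mes_kk ok; have mD := mes_D2 ui_mes.
have [i1 e1] := @fubini_ge0Zr R (fun z => D2 ui z * kk a z) (fun x => ui i x * phi x) c1
  (mes_M mD mk) (fun z => mulr_ge0 (D2_ge0 _ _) (kk_ge0 _ ok)) (mes_M mui mp) h1.
have mphi0 x : mi i x * phi x = ind (x \in Om) * m x i * phi x.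
  have [hx|hx] := ltP `|x - x0| (2 * r); last by rewrite p0 ?mulr0.
  by rewrite /mi hx [ind (_ \in _)]indT ?[ind true]indT// inE; exact: ball_Om.
have [c3 h3] : exists c, L1b mu (fun x => mi i x * phi x) c.
  have [c hc] := mi_L1b i; exists (`|M| * c).
  apply: L1b_le1 (L1bZ M (L1b_norm hc)); first by have := L1b_meas hc => ?; mes.
  by move=> x; rewrite normrM mulrC; apply: ler_wpM2r.
have supp1 z : ~ COmega Om z -> ((lhs_integrand a u Phi z)%:E = 0)%E.
  rewrite lhsE /COmega/= => /contrapT[z1 z2].
  by rewrite !p0'// subrr mulr0 mul0r.
have hH00 : Hhat00 Om Phi.
  split; last by move=> x hx j; rewrite /Phi p0' ?if_same.
  split; first exact: mPhi.
  split.
    move=> j; split; first exact: mPhi.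
    have hx : L1b mu (fun x => `|Phi x j| `^ 2) (M ^+ 2 * (2 * (2 * r))).
      rewrite -(ger0_norm (sqr_ge0 M)).
      apply: L1b_le1 (L1bZ (M ^+ 2) (L1b_itv x0 _)); last by have := r0; clra.
        by have := mPhi j => ?; mes.
      move=> x; rewrite ger0_norm ?powR_ge0// powR_mulrn// /Phi.
      case: ifP => _; last by rewrite normr0 expr0n/=; nn.
      have [hx|hx] := ltP `|x - x0| (2 * r); last by rewrite p0// normr0 expr0n/=; nn.
      rewrite indT ?mulr1; last by rewrite distrC ltW.
      by rewrite lerXn2r ?nnegrE//; exact: hM.
    have [_ hx2] := hx; apply: le_lt_trans (ltry (M ^+ 2 * (2 * (2 * r)))); apply: le_trans hx2.
    by rewrite le_eqVlt; apply/orP; left; apply/eqP; apply: eq_integral => x _; rewrite [in RHS]ger0_norm// powR_ge0.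
  have [_ hP2] := hP; rewrite /energy integral_supp; last first.
    by move=> z; rewrite /COmega/= => h; exfalso; apply: h => -[[]].
  apply: le_lt_trans (ltry P); apply: le_trans hP2.
  by rewrite le_eqVlt; apply/orP; left; apply/eqP; apply: eq_integral => z _; rewrite enP ger0_norm ?en_ge0.
have j1 : (@leb2 R).-integrable (COmega Om) (fun z => (lhs_integrand a u Phi z)%:E).
  apply: (@integrableS _ _ _ _ setT) => //.
  apply: (eq_integrable measurableT) (L1b_int h2) => // z _ /=; by rewrite lhsE.
have pe x : (fine (dsa2 a u x) * vdot (u x) (Phi x))%:E =
   ((fine (\int[mu]_y (D2 ui (x, y) * kk a (x, y))%:E)%E * (ui i x * phi x)))%:E.
  by rewrite dsE vdot_delta.
have j2 : (@leb R).-integrable Om (fun x => (fine (dsa2 a u x) * vdot (u x) (Phi x))%:E).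
  apply: (@integrableS _ _ _ _ setT) => //.
  by apply: (eq_integrable measurableT) i1 => // x _; rewrite -pe.
have me x : Om x -> (vdot (m x) (Phi x))%:E = (mi i x * phi x)%:E.
  by move=> hx; rewrite vdot_delta mphi0 indT ?mul1r// inE.
have j3 : (@leb R).-integrable Om (fun x => (vdot (m x) (Phi x))%:E).
  have HH : (@leb R).-integrable Om (fun x => (mi i x * phi x)%:E).
    by apply: (@integrableS _ _ _ _ setT) => //; exact: L1b_int h3.
  by apply: (eq_integrable _ _ _ _ HH) => [|x /set_mem hx]; [exact: mO|rewrite me].
have := H Phi hH00 j1 j2 j3.
rewrite integral_supp//.
have -> : (\int[@leb R]_(x in Om) (fine (dsa2 a u x) * vdot (u x) (Phi x))%:E =
   (\int[mu2]_z (D2 ui z * kk a z * (ui i z.1 * phi z.1)))%:E)%E.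
  rewrite integral_supp -?e1; last first.
    by move=> x hx; rewrite pe p0'// !mulr0.
  by apply: eq_integral => x _; rewrite pe.
have -> : (\int[@leb R]_(x in Om) (vdot (m x) (Phi x))%:E = (\int[mu]_x (mi i x * phi x))%:E)%E.
  transitivity (\int[@leb R]_(x in Om) (mi i x * phi x)%:E)%E.
    by apply: eq_integral => x /set_mem hx; rewrite me.
  rewrite integral_supp; last by move=> x hx; rewrite p0' ?mulr0.
  by rewrite /Rintegral fineK//; exact: integrable_fin_num (L1b_int h3).
have -> : (\int[@leb2 R]_z (lhs_integrand a u Phi z)%:E = (form a (ui i) phi)%:E)%E.
  rewrite /form /Rintegral fineK; last exact: integrable_fin_num (L1b_int h2).
  by apply: eq_integral => z _; rewrite lhsE.
by rewrite -EFinD => -[].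
Qed.

Lemma weak_Sol : Sol a Lam vi mi x0 (2 * r).
Proof.
have [E hE] := vi_energy.
have mk := mes_kk ok; have mDu := mes_D2 ui_mes; have mDv := mes_D2 mes_vi.
have ae2 i : {ae mu2, forall z, vi i z.1 = ui i z.1 /\ vi i z.2 = ui i z.2}.
  have := aeI (ae_fst (ui_ae i)) (ae_snd (ui_ae i)); by apply: aeS => z [-> ->].
have aeD := ae_all ae2.
split => //; [exact: mes_vi|exact: vi_1|exact: vi_energy|exact: mi_L1b|].
move=> i phi gp p0; have [mp [M hM] [P hP]] := gp.
have mui := ui_mes i; have mvi := mes_vi i.
have eD z : (forall j, vi j z.1 = ui j z.1 /\ vi j z.2 = ui j z.2) ->
    D2 vi z * kk a z * (vi i z.1 * phi z.1) = D2 ui z * kk a z * (ui i z.1 * phi z.1).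
  move=> h; rewrite (proj1 (h i)); congr (_ * _ * _).
  by apply: eq_bigr => j _; rewrite (proj1 (h j)) (proj2 (h j)).
have [c1 h1] := Sol_L1b_D2 ok mes_vi vi_energy vi_1 i gp p0.
have h2 : L1b mu2 (fun z => (vi i z.1 - vi i z.2) * (phi z.1 - phi z.2) * kk a z) (Lam * (E + P / 2)).
  apply: (@form_L1b _ a Lam (vi i) phi (fun x => `|x - x0| < 2 * r)) => //; first by mes.
  by move=> x; rewrite -leNgt; exact: p0.
have eF z : vi i z.1 = ui i z.1 /\ vi i z.2 = ui i z.2 ->
   (vi i z.1 - vi i z.2) * (phi z.1 - phi z.2) * kk a z = (ui i z.1 - ui i z.2) * (phi z.1 - phi z.2) * kk a z.
  by move=> [-> ->].
rewrite (_ : form a (vi i) phi = form a (ui i) phi); last first.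
  by apply: Rint_ae; [mes|mes|apply: (aeS _ (ae2 i)) => z h; rewrite eF].
rewrite weak_ui//.
- by congr (_ + _); apply: Rint_ae; [mes|mes|apply: (aeS _ aeD) => z h; rewrite eD].
- by exists c1; apply: L1b_ae h1; [mes|apply: (aeS _ aeD) => z h; rewrite eD].
- by eexists; apply: L1b_ae h2; [mes|apply: (aeS _ (ae2 i)) => z h; rewrite eF].
Qed.

End WeakToSol.

(** * The conservation law *)

Section ConservationLaw.
Variables (R : realType) (N : nat).
Local Notation mu := (@lebesgue_measure R).
Local Notation mu2 := (mu \x mu)%E.
Variables (a : R -> R) (Lam : R) (u m : 'I_N -> R -> R) (x0 r0 : R).
Hypotheses (HS : Sol a Lam u m x0 r0) (S1 : forall x, \sum_(i < N) u i x ^+ 2 = 1).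

Definition omg i j (z : R * R) := u i z.1 * u j z.2 - u j z.1 * u i z.2.

(** The constraint at both points gives [|u x - u y|^2 = 2 - 2 u x . u y]. This is how the critical
    density becomes a product of [omg] with increments. *)
Lemma omg_sum i x y : \sum_(j < N) omg i j (x, y) * (u j x - u j y) =
  - D2 u (x, y) * ((u i x + u i y) / 2).
Proof.
pose p := \sum_(j < N) u j x * u j y.
have E1 : D2 u (x, y) = 2 - 2 * p.
  rewrite /D2/= (eq_bigr (fun j => u j x ^+ 2 + u j y ^+ 2 - 2 * (u j x * u j y))); last first.
    by move=> j _; ring.
  by rewrite big_split/= sumrN -mulr_sumr big_split/= !S1 -/p; ring.
have -> : \sum_(j < N) omg i j (x, y) * (u j x - u j y) =
   u i x * (p - \sum_(j < N) u j y ^+ 2) - u i y * (\sum_(j < N) u j x ^+ 2 - p).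
  rewrite /p -!sumrB !mulr_sumr -sumrB; apply: eq_bigr => j _; rewrite /omg/=; ring.
by rewrite !S1 E1; field.
Qed.

Lemma omg_le i j x y : `|omg i j (x, y)| <= `|u i x - u i y| + `|u j x - u j y|.
Proof.
have -> : omg i j (x, y) = u j x * (u i x - u i y) - u i x * (u j x - u j y).
  by rewrite /omg/=; ring.
apply: le_trans (ler_normB _ _) _; rewrite !normrM; apply: lerD;
  apply: ler_piMl => //; exact: sol_1 HS _ _.
Qed.

(** In the product rule the increment of [u] is multiplied by [f x], which restricts the pair to the
    ball where the energy is finite. *)
Lemma Good_mul_sol i f : Good f -> (forall x, r0 <= `|x - x0| -> f x = 0) ->
  Good (fun x => f x * u i x).
Proof.
move=> [mf [M hM] [P hP]] f0; have mui := sol_mu HS i; have [E hE] := sol_E HS.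
have M0 : 0 <= M := le_trans (normr_ge0 _) (hM 0).
split; first by mes.
  by exists (M * 1) => x; rewrite normrM; apply: ler_pM => //; exact: sol_1 HS _ _.
eexists; apply: L1b_le2 (L1bD (L1bZ (2 * M ^+ 2) (hE i)) (L1bZ 2 hP)); first by apply: mes_en; mes.
move=> x y; rewrite ger0_norm ?en_ge0// /en/= !mulrA -mulrDl; apply: ler_wpM2r; first exact: isq_ge0.
have -> : f x * u i x - f y * u i y = f x * (u i x - u i y) + u i y * (f x - f y) by ring.
have u2 : u i y ^+ 2 <= 1.
  by rewrite -(real_normK (num_real (u i y))) expr_le1//; exact: sol_1 HS _ _.
have f2 : f x ^+ 2 <= M ^+ 2 * ind (`|x - x0| < r0).
  have [h|h] := ltP `|x - x0| r0; last by rewrite f0// expr0n/= mulr0.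
  rewrite /ind mulr1 -(real_normK (num_real (f x))) lerXn2r ?nnegrE//; exact: hM.
have := ler_wpM2r (sqr_ge0 (u i x - u i y)) f2; have := ler_wpM2r (sqr_ge0 (f x - f y)) u2.
by have := sqr_ge0 (f x * (u i x - u i y) - u i y * (f x - f y)); clra.
Qed.

Lemma form_ex i f : Good f -> (forall x, r0 <= `|x - x0| -> f x = 0) ->
  exists c, L1b mu2 (fun z => (u i z.1 - u i z.2) * (f z.1 - f z.2) * kk a z) c.
Proof.
move=> [mf _ [P hP]] f0; have [E hE] := sol_E HS.
eexists; apply: (form_L1b (b := fun x => `|x - x0| < r0) (sol_k HS) (sol_mu HS i) mf _ _ (hE i) hP).
  by mes.
by move=> x; rewrite -leNgt; exact: f0.
Qed.

Lemma m_ex i f : Good f -> exists c, L1b mu (fun x => m i x * f x) c.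
Proof.
move=> [mf [M hM] _]; have [c hc] := sol_mm HS i; exists (`|M| * c).
apply: L1b_le1 (L1bZ M (L1b_norm hc)); first by have := L1b_meas hc => ?; mes.
by move=> x; rewrite normrM mulrC; apply: ler_wpM2r.
Qed.

(** The equation for [u j] tested with [f * u i] is subtracted from the equation for [u i] tested
    with [f * u j]; the quadratic terms are equal and cancel. *)
Lemma conservation i j f : Good f -> (forall x, r0 <= `|x - x0| -> f x = 0) ->
  \int[mu2]_z (omg i j z * (f z.1 - f z.2) * kk a z) =
  \int[mu]_x (m i x * (f x * u j x)) - \int[mu]_x (m j x * (f x * u i x)).
Proof.
move=> gf f0.
have z0 k x : r0 <= `|x - x0| -> f x * u k x = 0 by move=> h; rewrite f0// mul0r.
have g1 := Good_mul_sol i gf f0; have g2 := Good_mul_sol j gf f0.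
have E1 := sol_we HS j g1 (z0 i); have E2 := sol_we HS i g2 (z0 j).
have [c1 h1] := form_ex j g1 (z0 i); have [c2 h2] := form_ex i g2 (z0 j).
have -> : \int[mu2]_z (omg i j z * (f z.1 - f z.2) * kk a z) =
   form a (u i) (fun x => f x * u j x) - form a (u j) (fun x => f x * u i x).
  rewrite /form -(RintB h2 h1); apply: Rint_ext => z; rewrite /omg; ring.
rewrite E1 E2 (_ : \int[mu2]_z (D2 u z * kk a z * (u i z.1 * (f z.1 * u j z.1))) =
   \int[mu2]_z (D2 u z * kk a z * (u j z.1 * (f z.1 * u i z.1)))); first by ring.
by apply: Rint_ext => z; ring.
Qed.

Lemma omg_ex i j f : Good f -> (forall x, r0 <= `|x - x0| -> f x = 0) ->
  exists c, L1b mu2 (fun z => omg i j z * (f z.1 - f z.2) * kk a z) c.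
Proof.
move=> gf f0.
have z0 k x : r0 <= `|x - x0| -> f x * u k x = 0 by move=> h; rewrite f0// mul0r.
have g1 := Good_mul_sol i gf f0; have g2 := Good_mul_sol j gf f0.
have [c1 h1] := form_ex j g1 (z0 i); have [c2 h2] := form_ex i g2 (z0 j).
eexists; apply: L1b_eq (L1bB h2 h1) => z /=; rewrite /omg; ring.
Qed.

Lemma D2_sym x y : D2 u (x, y) = D2 u (y, x).
Proof. by apply: eq_bigr => i _ /=; rewrite -sqrrN opprB. Qed.

(* The antisymmetric potential [omg] absorbs the quadratic term up to [df] and a quartic remainder. *)
Lemma equation_split i phi (f : 'I_N -> R -> R) : Good phi -> (forall x, r0 <= `|x - x0| -> phi x = 0) ->
  (forall j, Good (f j)) -> (forall j x, r0 <= `|x - x0| -> f j x = 0) ->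
  form a (u i) phi =
    \int[mu2]_z ((4^-1 * D2 u z * (u i z.1 - u i z.2) * (phi z.1 - phi z.2)
      - \sum_(j < N) omg i j z * ((phi z.1 + phi z.2) / 2 * (u j z.1 - u j z.2) - (f j z.1 - f j z.2))) * kk a z)
    + \sum_(j < N) (\int[mu]_x (m j x * (f j x * u i x)) - \int[mu]_x (m i x * (f j x * u j x)))
    + \int[mu]_x (m i x * phi x).
Proof.
move=> gp p0 gf f0; rewrite (sol_we HS)//; congr (_ + _).
have [mp _ _] := gp; have mk := mes_kk (sol_k HS); have mD := mes_D2 (sol_mu HS).
have mui := sol_mu HS i.
have [c1 h1] := Sol_L1b_D2 (sol_k HS) (sol_mu HS) (sol_E HS) (sol_1 HS) i gp p0.
pose F z := D2 u z * kk a z * (u i z.1 * phi z.1).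
have mF : measurable_fun setT F := L1b_meas h1.
(* After symmetrization the mean of [u i * phi] over the two points is the product of the means plus
   a quarter of the product of the increments. The product of the means is what [omg_sum]
   rewrites. *)
have e1 : \int[mu2]_z F z = \int[mu2]_z (2^-1 * (F z + F (z.2, z.1))).
  rewrite (RintZ _ (L1bD h1 (L1b_swap h1))) (RintD h1 (L1b_swap h1)) -/F.
  rewrite (_ : \int[mu2]_z F (z.2, z.1) = \int[mu2]_z F z); [by field|exact: Rint_swap].
have [c2 h2] : exists c, forall j, L1b mu2 (fun z => omg i j z * (f j z.1 - f j z.2) * kk a z) c.
  have [c hc] := choice (fun j => omg_ex i j (gf j) (f0 j)).
  exists (\sum_(j < N) c j) => j; apply: L1b_weak (hc j); rewrite (bigD1 j)//= lerDl.
  by apply: sumr_ge0 => k _; exact: L1b_ge0 (hc k).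
have hs := L1b_sum (index_enum 'I_N) (P := xpredT) (fun j _ => h2 j).
have e2 : \sum_(j < N) (\int[mu]_x (m j x * (f j x * u i x)) - \int[mu]_x (m i x * (f j x * u j x))) =
   - \int[mu2]_z (\sum_(j < N) omg i j z * (f j z.1 - f j z.2) * kk a z).
  rewrite (Rint_sum _ h2) -sumrN; apply: eq_bigr => j _; rewrite (conservation i j (gf j) (f0 j)); ring.
rewrite -/F e1 e2.
have hF := L1bZ 2^-1 (L1bD h1 (L1b_swap h1)).
rewrite (_ : \int[mu2]_z (_ * kk a z) = \int[mu2]_z (2^-1 * (F z + F (z.2, z.1)) + \sum_(j < N) omg i j z * (f j z.1 - f j z.2) * kk a z)).
  by rewrite (RintD hF hs) addrK.
apply: Rint_ext => -[x y] /=; rewrite /F/= -(D2_sym x y) -(kk_sym x y (sol_k HS)).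
have -> : \sum_(j < N) omg i j (x, y) * ((phi x + phi y) / 2 * (u j x - u j y) - (f j x - f j y)) =
  (phi x + phi y) / 2 * (\sum_(j < N) omg i j (x, y) * (u j x - u j y)) - \sum_(j < N) omg i j (x, y) * (f j x - f j y).
  by rewrite mulr_sumr -sumrB; apply: eq_bigr => j _; ring.
by rewrite omg_sum -mulr_suml; field.
Qed.

End ConservationLaw.

Section Pointwise.
Variable R : realType.

Lemma amgm (x y t : R) : 0 < t -> x * y <= t * x ^+ 2 + y ^+ 2 / (4 * t).
Proof.
move=> t0; have -> : t * x ^+ 2 + y ^+ 2 / (4 * t) = x * y + (2 * t * x - y) ^+ 2 / (4 * t).
  by field; exact: lt0r_neq0.
by rewrite lerDl mulr_ge0 ?sqr_ge0// invr_ge0; clra.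
Qed.

(* near pairs: the increments of [u] are those of the cut-off functions *)
Lemma near_ptwise (di dj dp e w t : R) : 0 < t -> `|w| <= `|di| + `|dj| ->
  `|4^-1 * dj ^+ 2 * di * dp| + `|w * e| <=
  dj ^+ 4 + di ^+ 4 + dp ^+ 4 + e ^+ 2 / t + 4 * t * (di ^+ 2 + dj ^+ 2).
Proof.
move=> t0 hw.
have q0 : `|4^-1 * dj ^+ 2 * di * dp| = 4^-1 * dj ^+ 2 * (`|di| * `|dp|).
  have h : 0 <= 4^-1 * dj ^+ 2 by apply: mulr_ge0; [rewrite invr_ge0|exact: sqr_ge0].
  by rewrite -mulrA normrM (ger0_norm h) normrM.
have q1 : `|4^-1 * dj ^+ 2 * di * dp| <= dj ^+ 4 + di ^+ 4 + dp ^+ 4.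
  rewrite q0.
  have a1 : `|di| * `|dp| <= di ^+ 2 + dp ^+ 2.
    have := sqr_ge0 (`|di| - `|dp|); rewrite sqrrB !real_normK ?num_real//.
    have := sqr_ge0 di; have := sqr_ge0 dp; clra.
  have := ler_wpM2l (sqr_ge0 dj) a1.
  have := sqr_ge0 (dj ^+ 2 - di ^+ 2); have := sqr_ge0 (dj ^+ 2 - dp ^+ 2).
  have := sqr_ge0 (dj ^+ 2); have := sqr_ge0 (di ^+ 2); have := sqr_ge0 (dp ^+ 2); clra.
have w2 : w ^+ 2 <= 2 * (di ^+ 2 + dj ^+ 2).
  rewrite -(real_normK (num_real w)); apply: (@le_trans _ _ ((`|di| + `|dj|) ^+ 2)).
    by rewrite lerXn2r ?nnegrE// addr_ge0.
  have := sqr_ge0 (`|di| - `|dj|); rewrite sqrrB sqrrD !real_normK ?num_real//; clra.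
have q2 : `|w * e| <= t * w ^+ 2 + e ^+ 2 / t.
  rewrite normrM; have := amgm `|w| `|e| t0; rewrite !real_normK ?num_real// => h; apply: le_trans h _.
  rewrite lerD2l; apply: ler_wpM2l; first exact: sqr_ge0.
  by rewrite lef_pV2 ?posrE; clra.
have := ler_wpM2l (ltW t0) w2; have d0 := sqr_ge0 di; have d0' := sqr_ge0 dj.
have : 0 <= t * di ^+ 2 by apply: mulr_ge0 => //; exact: ltW.
have : 0 <= t * dj ^+ 2 by apply: mulr_ge0 => //; exact: ltW.
by clra.
Qed.

(* far pairs: one point carries all of [phi], and the increments are merely bounded *)
Lemma far_pair_ptwise (di dj p dg e w t : R) : 0 < t -> `|w| <= `|di| + `|dj| ->
  `|dj| <= 2 -> `|dg| <= 4 ->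
  `|4^-1 * dj ^+ 2 * di * p| + `|w * (e + p / 2 * (dj - dg))| <=
  e ^+ 2 / t + 8 * t * (di ^+ 2 + dj ^+ 2) + 10 * (p ^+ 2 / t).
Proof.
move=> t0 hw hj hg.
have w2 : w ^+ 2 <= 2 * (di ^+ 2 + dj ^+ 2).
  rewrite -(real_normK (num_real w)); apply: (@le_trans _ _ ((`|di| + `|dj|) ^+ 2)).
    by rewrite lerXn2r ?nnegrE// addr_ge0.
  have := sqr_ge0 (`|di| - `|dj|); rewrite sqrrB sqrrD !real_normK ?num_real//; clra.
have p2 : 0 <= p ^+ 2 / t by rewrite divr_ge0 ?sqr_ge0// ltW.
have q0 : `|4^-1 * dj ^+ 2 * di * p| = 4^-1 * dj ^+ 2 * (`|di| * `|p|).
  have h : 0 <= 4^-1 * dj ^+ 2 by apply: mulr_ge0; [rewrite invr_ge0|exact: sqr_ge0].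
  by rewrite -mulrA normrM (ger0_norm h) normrM.
have q1 : `|4^-1 * dj ^+ 2 * di * p| <= t * di ^+ 2 + p ^+ 2 / t.
  rewrite q0.
  have j2 : dj ^+ 2 <= 2 ^+ 2 by rewrite -(real_normK (num_real dj)) lerXn2r ?nnegrE.
  have a1 : 4^-1 * dj ^+ 2 * (`|di| * `|p|) <= `|di| * `|p|.
    rewrite ler_piMl ?mulr_ge0//; clra.
  apply: le_trans a1 _; have := amgm `|di| `|p| t0; rewrite !real_normK ?num_real// => h; apply: le_trans h _.
  rewrite lerD2l invfM mulrCA; have := p2; clra.
have q2 : `|w * (e + p / 2 * (dj - dg))| <= t * w ^+ 2 + e ^+ 2 / t + t * w ^+ 2 + 9 * (p ^+ 2 / t).
  rewrite mulrDr; apply: le_trans (ler_normD _ _) _; rewrite -addrA; apply: lerD.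
    rewrite normrM; have := amgm `|w| `|e| t0; rewrite !real_normK ?num_real// => h; apply: le_trans h _.
    rewrite lerD2l invfM mulrCA; have : 0 <= e ^+ 2 / t by rewrite divr_ge0 ?sqr_ge0// ltW.
    clra.
  have b : `|p / 2 * (dj - dg)| <= 3 * `|p|.
    rewrite !normrM (ger0_norm (_ : 0 <= 2^-1)) ?invr_ge0//.
    have := ler_normB dj dg; have := normr_ge0 p => p0 h.
    have : `|p| * `|dj - dg| <= `|p| * 6 by apply: ler_wpM2l => //; clra.
    clra.
  rewrite normrM; apply: le_trans (ler_wpM2l (normr_ge0 w) b) _.
  have := amgm `|w| (3 * `|p|) t0; rewrite exprMn !real_normK ?num_real// => h; apply: le_trans h _.
  rewrite lerD2l (_ : 3 ^+ 2 * p ^+ 2 / (4 * t) = 9 / 4 * (p ^+ 2 / t)); last by field; exact: lt0r_neq0.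
  by move: p2; clra.
have := ler_wpM2l (ltW t0) w2; have d0 := sqr_ge0 di; have d0' := sqr_ge0 dj.
have : 0 <= t * di ^+ 2 by apply: mulr_ge0 => //; exact: ltW.
have : 0 <= t * dj ^+ 2 by apply: mulr_ge0 => //; exact: ltW.
by clra.
Qed.

End Pointwise.

Section PairEstimate.
Variable R : realType.

(** The supports leave three cases: both points within [8 rho], where the cut-off functions have the
    increments of [u]; one point within [3 rho] and the other beyond [8 rho]; both beyond [3 rho],
    where [phi] and [f] vanish. *)
Lemma pair_ptwise (c rho t x y uix uiy ujx ujy gix giy gjx gjy px py fx fy w : R) :
  let e := (px + py) / 2 * (gjx - gjy) - (fx - fy) in
  let iV := ind (`|x - c| <= 16 * rho) + ind (`|y - c| <= 16 * rho) : R in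
  let fp := (px ^+ 2 + py ^+ 2) * ind (rho <= `|x - y|) in
  0 < rho -> 0 < t -> `|w| <= `|uix - uiy| + `|ujx - ujy| -> `|ujx - ujy| <= 2 -> `|gjx - gjy| <= 4 ->
  (`|x - c| <= 8 * rho -> `|y - c| <= 8 * rho -> gix - giy = uix - uiy /\ gjx - gjy = ujx - ujy) ->
  (2 * rho < `|x - c| -> px = 0) -> (2 * rho < `|y - c| -> py = 0) ->
  (3 * rho < `|x - c| -> fx = 0) -> (3 * rho < `|y - c| -> fy = 0) ->
  `|4^-1 * (ujx - ujy) ^+ 2 * (uix - uiy) * (px - py)|
   + `|w * ((px + py) / 2 * (ujx - ujy) - (fx - fy))| <=
   (gjx - gjy) ^+ 4 + (gix - giy) ^+ 4 + (px - py) ^+ 4 + t^-1 * e ^+ 2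
   + 8 * t * (iV * (uix - uiy) ^+ 2 + iV * (ujx - ujy) ^+ 2) + 10 / t * fp.
Proof.
move=> e iV fp r' t0 hw dj2 dg4 gE hpx hpy hfx hfy.
have ti : 0 <= t^-1 by rewrite invr_ge0 ltW.
have q4 (b : R) : 0 <= b ^+ 4 by rewrite exprn_even_ge0.
have te : 0 <= t^-1 * e ^+ 2 by apply: mulr_ge0 => //; exact: sqr_ge0.
have iV0 : 0 <= iV by apply: addr_ge0; exact: ind_ge0.
have fp0 : 0 <= fp by apply: mulr_ge0; [apply: addr_ge0; exact: sqr_ge0|exact: ind_ge0].
have gg0 : 0 <= (gjx - gjy) ^+ 4 + (gix - giy) ^+ 4 + (px - py) ^+ 4.
  by rewrite !addr_ge0.
have tfp0 : 0 <= 10 / t * fp by apply: mulr_ge0 => //; exact: mulr_ge0.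
have d2i := sqr_ge0 (uix - uiy); have d2j := sqr_ge0 (ujx - ujy).
have tV0 (b : R) : 1 <= iV -> b <= t * ((uix - uiy) ^+ 2 + (ujx - ujy) ^+ 2) ->
    b <= t * (iV * (uix - uiy) ^+ 2 + iV * (ujx - ujy) ^+ 2).
  move=> i1 /le_trans; apply; apply: ler_wpM2l; first exact: ltW.
  by rewrite -mulrDr ler_peMl// addr_ge0.
have [/andP[hx hy]|nb] := boolP ((`|x - c| <= 8 * rho) && (`|y - c| <= 8 * rho)).
  have [gi gj] := gE hx hy.
  have i1 : 1 <= iV.
    by rewrite /iV !indT; [rewrite lerDl|clra|clra].
  have eE : (px + py) / 2 * (ujx - ujy) - (fx - fy) = e.
    by rewrite /e gj.
  rewrite eE gi gj; have := near_ptwise (px - py) e t0 hw.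
  have := tV0 _ i1 (lexx _); rewrite (mulrC (e ^+ 2)).
  have tg : 0 <= t * ((uix - uiy) ^+ 2 + (ujx - ujy) ^+ 2).
    by apply: mulr_ge0; [exact: ltW|exact: addr_ge0].
  by move: tg tfp0; clra.
have far x' y' : `|x' - c| <= 3 * rho -> 8 * rho < `|y' - c| -> rho <= `|x' - y'|.
  move=> h1 h2; have := ler_normD (y' - x') (x' - c); rewrite addrA subrK (distrC y' x'); clra.
have RHS0 : 0 <= 8 * t * (iV * (uix - uiy) ^+ 2 + iV * (ujx - ujy) ^+ 2).
  by apply: mulr_ge0; [apply: mulr_ge0 => //; exact: ltW|apply: addr_ge0; exact: mulr_ge0].
have [hx|hx] := leP `|x - c| (3 * rho).
  have hy : 8 * rho < `|y - c|.
    by rewrite ltNge; apply: contraNN nb => ->; rewrite andbT; clra.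
  have ep : py = 0 by apply: hpy; clra.
  have i1 : 1 <= iV by rewrite /iV (indT _ (b := `|x - c| <= _)); [rewrite lerDl ind_ge0|clra].
  have -> : (px + py) / 2 * (ujx - ujy) - (fx - fy) =
      e + px / 2 * ((ujx - ujy) - (gjx - gjy)) by rewrite /e ep; ring.
  rewrite ep subr0; have := far_pair_ptwise (px) (e) t0 hw dj2 dg4.
  have := tV0 _ i1 (lexx _); rewrite (mulrC (e ^+ 2)) /fp ep indT ?far// expr0n/= addr0 mulr1.
  move: gg0; rewrite ep subr0; clra.
have [hy|hy] := leP `|y - c| (3 * rho).
  have hx8 : 8 * rho < `|x - c|.
    by rewrite ltNge; apply: contraNN nb => ->; rewrite andTb; clra.
  have ep : px = 0 by apply: hpx; clra.
  have i1 : 1 <= iV by rewrite /iV (indT _ (b := `|y - c| <= _)); [rewrite lerDr ind_ge0|clra].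
  have -> : (px + py) / 2 * (ujx - ujy) - (fx - fy) =
      e + py / 2 * ((ujx - ujy) - (gjx - gjy)) by rewrite /e ep; ring.
  rewrite ep sub0r mulrN normrN; have := far_pair_ptwise (py) (e) t0 hw dj2 dg4.
  have := tV0 _ i1 (lexx _).
  rewrite (mulrC (e ^+ 2)) /fp ep indT; last by rewrite distrC far.
  rewrite expr0n/= add0r mulr1; move: gg0; rewrite ep sub0r; clra.
have [e1 e2 e3 e4] : [/\ px = 0, py = 0, fx = 0 & fy = 0].
  by split; [apply: hpx; clra|apply: hpy; clra|exact: hfx|exact: hfy].
have -> : 4^-1 * (ujx - ujy) ^+ 2 * (uix - uiy) * (px - py) = 0 by rewrite e1 e2 subrr mulr0.
have -> : (px + py) / 2 * (ujx - ujy) - (fx - fy) = 0 by rewrite e1 e2 e3 e4 addr0 !mul0r !subr0.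
by rewrite mulr0 normr0 addr0; move: gg0; clra.
Qed.

Lemma qbound_num (X V t rho eA : R) : 0 < t -> 0 < rho -> 0 <= X ->
  X + X + X + t^-1 * X + 8 * t * (V + V + (V + V)) + 10 / t * (2 * (16 * rho ^+ 2 * eA * (2 / rho)))
  <= 4 * X + X / t + 32 * t * V + 640 * (rho * eA) / t.
Proof.
move=> t0 r0 X0; have -> : 10 / t * (2 * (16 * rho ^+ 2 * eA * (2 / rho))) = 640 * (rho * eA) / t.
  by field; rewrite !lt0r_neq0.
by move: (640 * (rho * eA) / t) => Y; rewrite (mulrC t^-1); clra.
Qed.

End PairEstimate.

(** * Decay of the energy *)

Section Step.
Variables (R : realType) (N : nat).
Local Notation mu := (@lebesgue_measure R).
Local Notation mu2 := (mu \x mu)%E.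
Variables (a : R -> R) (Lam : R) (u m : 'I_N -> R -> R) (x0 r0 : R).
Hypotheses (HS : Sol a Lam u m x0 r0) (S1 : forall x, \sum_(i < N) u i x ^+ 2 = 1).

Implicit Types (f phi : R -> R) (c sg : R) (i : 'I_N).

(* The form in which [m] in [L^gam] is used: [B = rho `^ (1 - 1/gam)], [Mg] is [|m|^gam], and [k]
   indexes the height [B / (rho s^k)] at which [m] is truncated. *)
Definition Mhyp (Mg : R -> R) (s p rho B : R) := forall (k : nat) i x,
  `|m i x| <= B / (rho * s ^+ k) + B * p ^+ k * Mg x.

Lemma geom_le (q : R) K : 0 <= q -> q < 1 -> \sum_(0 <= k < K) q ^+ k <= (1 - q)^-1.
Proof.
move=> q0 q1; have q1' : 0 < 1 - q by rewrite subr_gt0.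
have h : \sum_(0 <= k < K) q ^+ k * (1 - q) = 1 - q ^+ K.
  elim: K => [|K ih]; first by rewrite big_nil expr0 subrr.
  by rewrite big_nat_recr//= ih exprSr; ring.
rewrite -[leRHS]mul1r ler_pdivlMr// mulr_suml h lerBlDr lerDl; exact: exprn_ge0.
Qed.

(** The number of levels is not controlled, so level [k] needs a geometric gain: [m] is truncated at
    a height growing like [s^-k]. The bounded part meets the mean square decay of [h k], the excess
    meets the sup bound of [h k] and gains [p^k]. *)
Lemma mu_term i f (h : nat -> R -> R) K c rho sg Mg s p B G : Mhyp Mg s p rho B ->
  0 < s -> s < 1 -> s ^+ 4 = 2^-1 -> 0 <= p -> p < 1 -> 0 < rho -> 0 <= B -> 0 < sg ->
  (forall x, 0 <= Mg x) -> L1b mu Mg G -> measurable_fun setT f ->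
  (forall x, 3 * rho < `|x - c| -> f x = 0) ->
  (forall x, `|f x| <= 68 * sg * \sum_(0 <= k < K) `|h k x|) ->
  (forall k, [/\ measurable_fun setT (h k), forall x, `|h k x| <= 3 * 2 &
       L1b mu (fun x => h k x ^+ 2) (200 * sg ^+ 2 * dl rho k.+1)]) ->
  L1b mu (fun x => m i x * f x) (68 * sg * (B * ((6 + 100 * sg ^+ 2) / (1 - s) + 6 * G / (1 - p)))).
Proof.
move=> hM s0 s1 s4 p0 p1 r0' B0 sg0 Mg0 hG mf f0 hf hh.
have [cm hm] := sol_mm HS i; have mm := L1b_meas hm.
have mh k : measurable_fun setT (h k) by case: (hh k).
have hI : L1b mu (fun x => ind (`|c - x| <= 3 * rho)) (2 * (3 * rho)) by apply: L1b_itv; clra.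
have T k : L1b mu (fun x => B / (rho * s ^+ k) * (s ^+ (2 * k) * ind (`|c - x| <= 3 * rho) + (s ^+ (2 * k))^-1 * h k x ^+ 2)
      + B * p ^+ k * (6 * Mg x)) (B * ((6 + 100 * sg ^+ 2) * s ^+ k + 6 * G * p ^+ k)).
  have [_ _ h2] := hh k.
  have := L1bD (L1bZ (B / (rho * s ^+ k)) (L1bD (L1bZ (s ^+ (2 * k)) hI) (L1bZ (s ^+ (2 * k))^-1 h2)))
     (L1bZ (B * p ^+ k) (L1bZ 6 hG)).
  apply: L1b_weak; have sk := exprn_gt0 k s0; have s2k := exprn_gt0 (2 * k) s0; have pk := exprn_ge0 k p0.
  rewrite !ger0_norm//; [|by apply: mulr_ge0|by rewrite invr_ge0 ltW|exact: ltW|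
    by apply: divr_ge0 => //; apply: mulr_ge0; exact: ltW].
  have e2 : s ^+ (2 * k) = s ^+ k * s ^+ k by rewrite mul2n -addnn exprD.
  (* The reason for a fourth root: the mean square of [h k] decays like [s^(4k)], a weight [s^(2k)]
     in the arithmetic-geometric mean balances it, and after division by [s^k] the level still gains
     [s^k]. *)
  have ed : dl rho k.+1 = rho * (s ^+ k) ^+ 4 / 2.
    by rewrite dlS /dl -exprM mulnC exprM s4 exprVn; ring.
  by rewrite e2 ed; apply: eqle; field; rewrite !lt0r_neq0.
have sT := L1bZ (68 * sg) (@L1b_sum _ _ _ mu _ (index_iota 0 K) xpredT _ _ (fun k _ => T k)).
have sg0' : 0 <= 68 * sg by apply: mulr_ge0 => //; exact: ltW.
apply: (@L1b_weak _ _ _ _ _ _ _ _ (L1b_le1 _ _ sT)).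
- rewrite ger0_norm//; apply: ler_wpM2l => //; rewrite -mulr_sumr; apply: ler_wpM2l => //.
  rewrite big_split/= -!mulr_sumr; apply: lerD; apply: ler_wpM2l; try exact: geom_le.
  + by apply: addr_ge0 => //; apply: mulr_ge0 => //; exact: sqr_ge0.
  + by apply: geom_le => //; exact: ltW.
  + by apply: mulr_ge0 => //; exact: L1b_ge0 hG.
- by mes.
move=> x; rewrite normrM; have [hx|hx] := leP `|c - x| (3 * rho); last first.
  rewrite f0 1?distrC// normr0 mulr0; apply: mulr_ge0 => //; apply: sumr_ge0 => k _.
  have sk := exprn_gt0 k s0; have s2k := exprn_gt0 (2 * k) s0; have pk := exprn_ge0 k p0.
  have Mx := Mg0 x; have h2 := sqr_ge0 (h k x).
  apply: addr_ge0; last by apply: mulr_ge0; [exact: mulr_ge0|exact: mulr_ge0].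
  apply: mulr_ge0; first by apply: divr_ge0 => //; apply: mulr_ge0; exact: ltW.
  by rewrite /ind mulr0 add0r; apply: mulr_ge0 => //; rewrite invr_ge0 ltW.
apply: le_trans (ler_wpM2l (normr_ge0 _) (hf x)) _; rewrite mulrCA; apply: ler_wpM2l => //.
rewrite mulr_sumr; apply: ler_sum => k _; rewrite [ind _]indT// mulr1.
have sk := exprn_gt0 k s0; have s2k := exprn_gt0 (2 * k) s0; have pk := exprn_ge0 k p0.
have [_ h6 _] := hh k; have Mx := Mg0 x.
apply: le_trans (ler_wpM2r (normr_ge0 _) (hM k i x)) _; rewrite mulrDl; apply: lerD.
  apply: ler_wpM2l; first by apply: divr_ge0 => //; apply: mulr_ge0; exact: ltW.
  have := amgm (1 : R) `|h k x| s2k; rewrite mul1r expr1n mulr1 real_normK ?num_real// => H; apply: le_trans H _.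
  rewrite lerD2l invfM mulrCA; have : 0 <= (s ^+ (2 * k))^-1 * h k x ^+ 2.
    by apply: mulr_ge0; [rewrite invr_ge0 ltW|exact: sqr_ge0].
  rewrite (mulrC (h k x ^+ 2)); clra.
rewrite -(mulrA (B * p ^+ k)); apply: ler_wpM2l; first exact: mulr_ge0.
by rewrite mulrC; apply: ler_wpM2r => //; have := h6 x; clra.
Qed.

Lemma mu_phi i phi c rho Mg s p B G : Mhyp Mg s p rho B -> 0 < rho -> 0 <= B ->
  (forall x, 0 <= Mg x) -> L1b mu Mg G -> measurable_fun setT phi -> (forall x, `|phi x| <= 2) ->
  (forall x, 2 * rho < `|x - c| -> phi x = 0) ->
  L1b mu (fun x => m i x * phi x) (B * (8 + 2 * G)).
Proof.
move=> hM r0' B0 Mg0 hG mp p2 p0.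
have [cm hm] := sol_mm HS i; have mm := L1b_meas hm.
have hI : L1b mu (fun x => ind (`|c - x| <= 2 * rho)) (2 * (2 * rho)) by apply: L1b_itv; clra.
have T := L1bD (L1bZ (2 * (B / rho)) hI) (L1bZ (2 * B) hG).
have b1 : 0 <= 2 * (B / rho) by apply: mulr_ge0 => //; apply: divr_ge0 => //; exact: ltW.
have b2 : 0 <= 2 * B by apply: mulr_ge0.
apply: (@L1b_weak _ _ _ _ _ _ _ _ (L1b_le1 _ _ T)).
- by rewrite !ger0_norm//; apply: eqle; field; exact: lt0r_neq0.
- by mes.
move=> x; rewrite normrM; have [hx|hx] := leP `|c - x| (2 * rho); last first.
  rewrite p0 1?distrC// normr0 mulr0 /ind mulr0 add0r; exact: mulr_ge0.
rewrite [ind _]indT// mulr1; have := hM 0%N i x; rewrite !expr0 !mulr1 => H.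
apply: le_trans (ler_pM (normr_ge0 _) (normr_ge0 _) H (p2 x)) _.
by apply: eqle; ring.
Qed.

Section OneBall.
Variables (c rho V t eA : R) (y0 : R) (i : 'I_N).
Hypotheses (rho0 : 0 < rho) (V0 : 0 < V) (t0 : 0 < t) (hc : `|c - x0| + 16 * rho < r0)
  (hV : forall j, L1b mu2 (fun z => ind (`|z.1 - c| <= 16 * rho) * en (u j) z) V)
  (Ay : Aset c rho y0) (eAV : rho * eA <= V)
  (hA : forall j, L1b mu (fun x => (u j x - u j y0) ^+ 2 / (x - y0) ^+ 2) eA).

(** The test function is cut off at [rho], the functions [g j] only at [8 rho], so that near [phi]
    they have the increments of [u]. Both energies are at most [(2 + 8 * 360) * V], hence the
    generous [10^4] in [sg]. *)
Let phi x := eta c rho x * (u i x - u i y0).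
Let g j x := eta c (8 * rho) x * (u j x - u j y0).
Let sg := Num.sqrt (10 ^+ 4 * V).

Lemma sg2 : sg ^+ 2 = 10 ^+ 4 * V.
Proof. by rewrite /sg sqr_sqrtr//; apply: mulr_ge0; [exact: exprn_ge0|exact: ltW]. Qed.

Lemma sg_gt0 : 0 < sg.
Proof. by rewrite sqrtr_gt0; apply: mulr_gt0; [exact: exprn_gt0|exact: V0]. Qed.

Lemma bnd2 j s x : `|eta c s x * (u j x - u j y0)| <= 2.
Proof.
rewrite normrM -[leRHS]mul1r; have /andP[e0 e1] := eta_01 c s x.
apply: ler_pM => //; first by rewrite ger0_norm.
by apply: le_trans (ler_normB _ _) _; have := sol_1 HS j x; have := sol_1 HS j y0; clra.
Qed.

Lemma cut_mes j s : measurable_fun setT (fun x => eta c s x * (u j x - u j y0)).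
Proof. by have := sol_mu HS j => ?; have := mes_eta c s => ?; mes. Qed.

Lemma cut_sg j s : 0 < s -> rho <= s -> s <= 8 * rho ->
  L1b mu2 (en (fun x => eta c s x * (u j x - u j y0))) (sg ^+ 2).
Proof.
move=> s0 rs s8; have := rho0 => r'; have mui := sol_mu HS j.
have hs : L1b mu2 (fun z => ind (`|z.1 - c| <= 2 * s) * en (u j) z) V.
  apply: L1b_le2 (hV j); first by have := mes_en mui => ?; mes.
  move=> x y /=; rewrite ger0_norm; last by nn.
  apply: ler_wpM2r; [exact: en_ge0|apply: ind_mono => h]; clra.
have y2 : `|y0 - c| <= 2 * s by case/andP: Ay => _ h; clra.
apply: L1b_weak (cut_energy mui s0 (hA j) y2 hs).
rewrite sg2; have e0 := L1b_ge0 (hA j).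
have : s * eA <= 8 * rho * eA by apply: ler_wpM2r.
by have := eAV; have := V0; clra.
Qed.

Lemma cut_supp j s x : 0 < s -> 2 * s < `|x - c| -> eta c s x * (u j x - u j y0) = 0.
Proof. by move=> s0 h; rewrite eta0 ?mul0r// ltW. Qed.

Lemma phi_L2 : L1b mu (fun x => phi x ^+ 2) (16 * rho ^+ 2 * eA).
Proof.
have := rho0 => r'; have mui := sol_mu HS i.
have hv := @v_local _ (u i) y0 eA (fun x => `|x - c| <= 2 * rho) (4 * rho) mui (hA i).
apply: (@L1b_weak _ _ _ _ _ _ _ _ (L1b_le1 _ _ (hv _ _ _))).
- by apply: eqle; ring.
- by have := cut_mes i rho; rewrite -/phi => ?; mes.
- move=> x; rewrite ger0_norm ?sqr_ge0// /phi exprMn.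
  have [h|h] := leP `|x - c| (2 * rho); last by rewrite eta0 ?expr0n ?mul0r ?mulr_ge0 ?ind_ge0 ?sqr_ge0// ltW.
  apply: ler_wpM2r; first exact: sqr_ge0.
  by have /andP[e0 e1] := eta_01 c rho x; rewrite /ind expr_le1.
- by mes.
- by clra.
- move=> x hx; have := ler_normD (x - c) (c - y0); rewrite addrA subrK (distrC c).
  by case/andP: Ay => _; clra.
Qed.

(** In this order: quartic integrals, paraproduct error, its factor [omg] weighted by [t], and far
    pairs. *)
Definition qbound : R := N%:R * (4 * (10 ^+ 22 * V ^+ 2) + 10 ^+ 22 * V ^+ 2 / t + 32 * t * V + 640 * (rho * eA) / t).

Lemma one_ball_est : exists (f : 'I_N -> R -> R) (K : 'I_N -> nat) (h : 'I_N -> nat -> R -> R),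
  [/\ forall j, Good (f j), forall j x, 3 * rho < `|x - c| -> f j x = 0,
    forall j x, `|f j x| <= 68 * sg * \sum_(0 <= k < K j) `|h j k x|,
    forall j k, [/\ measurable_fun setT (h j k), forall x, `|h j k x| <= 3 * 2 &
       L1b mu (fun x => h j k x ^+ 2) (200 * sg ^+ 2 * dl rho k.+1)] &
    L1b mu2 (fun z => (4^-1 * D2 u z * (u i z.1 - u i z.2) * (phi z.1 - phi z.2)
      - \sum_(j < N) omg u i j z * ((phi z.1 + phi z.2) / 2 * (u j z.1 - u j z.2) - (f j z.1 - f j z.2))) * kk a z)
      (Lam * qbound)].
Proof.
have r' := rho0; have V' := V0; have t' := t0; have hc' := hc.
have r8 : 0 < 8 * rho by clra.
have ti : 0 <= t^-1 by rewrite invr_ge0 ltW.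
have t8 : 0 <= 8 * t by clra.
have t10 : 0 <= 10 / t by exact: mulr_ge0.
have sg0 := sg_gt0.
have e0 : 0 < V ^+ 2 by exact: exprn_gt0.
have ok := sol_k HS; have [_ L1 _ _] := ok; have mk := mes_kk ok.
have L0 : 0 <= Lam by clra.
have ep : L1b mu2 (en phi) (sg ^+ 2) by apply: cut_sg => //; clra.
have eg j : L1b mu2 (en (g j)) (sg ^+ 2) by apply: cut_sg => //; clra.
have ps x : 2 * rho < `|x - c| -> phi x = 0 by exact: cut_supp.
have gs j x : 16 * rho < `|x - c| -> g j x = 0 by move=> hx; apply: cut_supp => //; clra.
have mp : measurable_fun setT phi := cut_mes i rho.
have mg j : measurable_fun setT (g j) := cut_mes j (8 * rho).
(* The truncation error is allowed to be [V^2], the order of the main term. *)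
have C j := @comp_est R phi (g j) c rho sg 2 (V ^+ 2) mp (mg j) (bnd2 i rho) (bnd2 j (8 * rho)) r' sg0
   ps (gs j) ep (eg j) e0.
have [f hf] := choice C; have [K hK] := choice hf; have [h hh] := choice hK.
exists f, K, h.
have Gf j : Good (f j) by case: (hh j).
have f3 j x : 3 * rho < `|x - c| -> f j x = 0 by case: (hh j) => _ + _ _ _; exact.
split => //; [by move=> j; case: (hh j)|by move=> j; case: (hh j)|].
have Q4 : 10 ^+ 13 * sg ^+ 4 + V ^+ 2 <= 10 ^+ 22 * V ^+ 2.
  have -> : sg ^+ 4 = (10 ^+ 4 * V) ^+ 2 by rewrite -sg2 -exprM.
  rewrite exprMn mulrA -exprM -exprD -[X in _ + X]mul1r -mulrDl; apply: ler_wpM2r; first exact: ltW.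
  rewrite exprSr; have : 1 <= 10 ^+ 21 :> R by apply: exprn_ege1; clra.
  by rewrite (_ : (13 + 4 * 2 = 21)%N)//; move: (10 ^+ 21 : R) => X; clra.
have L4g j : L1b mu2 (fun z => (g j z.1 - g j z.2) ^+ 4 / (z.1 - z.2) ^+ 2) (10 ^+ 22 * V ^+ 2).
  apply: L1b_weak Q4 (L4_est (mg j) (bnd2 j (8 * rho)) r' sg0 (gs j) (eg j) e0).
have ps' x : 16 * rho < `|x - c| -> phi x = 0 by move=> hx; apply: ps; clra.
have L4p : L1b mu2 (fun z => (phi z.1 - phi z.2) ^+ 4 / (z.1 - z.2) ^+ 2) (10 ^+ 22 * V ^+ 2).
  apply: L1b_weak Q4 (L4_est mp (bnd2 i rho) r' sg0 ps' ep e0).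
pose e j z := (phi z.1 + phi z.2) / 2 * (g j z.1 - g j z.2) - (f j z.1 - f j z.2).
have Le j : L1b mu2 (fun z => e j z ^+ 2 / (z.1 - z.2) ^+ 2) (10 ^+ 22 * V ^+ 2).
  by apply: L1b_weak Q4 _; case: (hh j).
have LF := L1b_both (mes_Jfar rho) (Jfar_sym _) (fun x => L1b_Jfar x r') phi_L2.
have LV j := L1bD (hV j) (L1b_swap (hV j)).
have T j := L1bZ Lam (L1bD (L1bD (L1bD (L1bD (L1bD (L4g j) (L4g i)) L4p) (L1bZ t^-1 (Le j)))
   (L1bZ (8 * t) (L1bD (LV i) (LV j)))) (L1bZ (10 / t) LF)).
have sT := @L1b_sum _ _ _ mu2 _ (index_enum 'I_N) xpredT _ _ (fun j _ => T j).
have mui j : measurable_fun setT (u j) := sol_mu HS j.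
have mf j : measurable_fun setT (f j) by case: (Gf j).
apply: (@L1b_weak _ _ _ _ _ _ _ _ (L1b_le2 _ _ sT)).
- rewrite sumr_const card_ord -[X in X <= _]mulr_natr /qbound mulrC (mulrCA Lam).
  apply: ler_wpM2l; first exact: ler0n.
  rewrite (ger0_norm L0) (ger0_norm ti) (ger0_norm t8) (ger0_norm t10).
  by apply: ler_wpM2l => //; apply: qbound_num => //; exact: L1b_ge0 L4p.
- clear sT T LF LV L4g L4p Le Q4 ep eg hh hK hf C.
  have mD := mes_D2 mui; have mi := mui i; apply: mes_M => //; apply: mes_B; first by mes.
  by apply: mes_sum => j; have := mui j => ?; have := mf j => ?; rewrite /omg; mes.
move=> x y /=; clear sT T LF LV L4g L4p Le Q4 ep eg hh hK hf C.
have /andP[_ k2] := kk_bnd x y ok; have k0 := kk_ge0 (x, y) ok.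
rewrite normrM (ger0_norm k0) -mulr_sumr.
have kp := isq_ge0 (x - y).
pose iV := ind (`|x - c| <= 16 * rho) + ind (`|y - c| <= 16 * rho) : R.
pose fp := (phi x ^+ 2 + phi y ^+ 2) * ind (rho <= `|x - y|).
have key j : `|4^-1 * (u j x - u j y) ^+ 2 * (u i x - u i y) * (phi x - phi y)|
   + `|omg u i j (x, y) * ((phi x + phi y) / 2 * (u j x - u j y) - (f j x - f j y))| <=
   (g j x - g j y) ^+ 4 + (g i x - g i y) ^+ 4 + (phi x - phi y) ^+ 4 + t^-1 * e j (x, y) ^+ 2
   + 8 * t * (iV * (u i x - u i y) ^+ 2 + iV * (u j x - u j y) ^+ 2) + 10 / t * fp.
  apply: (@pair_ptwise R c rho) => //.
  - exact: omg_le HS i j x y.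
  - by apply: le_trans (ler_normB _ _) _; have := sol_1 HS j x; have := sol_1 HS j y; move: `|u j x| `|u j y| => A B; clra.
  - have := bnd2 j (8 * rho) x; have := bnd2 j (8 * rho) y; rewrite -!/(g j _) => A B.
    by apply: le_trans (ler_normB _ _) _; move: A B; move: `|g j x| `|g j y| => A B; clra.
  - by move=> hx hy; rewrite /g !eta1//; split; ring.
  - exact: ps.
  - exact: ps.
  - exact: f3.
  - exact: f3.
have S : `|4^-1 * D2 u (x, y) * (u i x - u i y) * (phi x - phi y) - \sum_(j < N) omg u i j (x, y) *
     ((phi x + phi y) / 2 * (u j x - u j y) - (f j x - f j y))| <= \sum_(j < N) (
   (g j x - g j y) ^+ 4 + (g i x - g i y) ^+ 4 + (phi x - phi y) ^+ 4 + t^-1 * e j (x, y) ^+ 2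
   + 8 * t * (iV * (u i x - u i y) ^+ 2 + iV * (u j x - u j y) ^+ 2) + 10 / t * fp).
  have -> : 4^-1 * D2 u (x, y) * (u i x - u i y) * (phi x - phi y) =
     \sum_(j < N) 4^-1 * (u j x - u j y) ^+ 2 * (u i x - u i y) * (phi x - phi y).
    by rewrite /D2/= mulr_sumr !mulr_suml.
  rewrite -sumrB; apply: le_trans (ler_norm_sum _ _ _) _; apply: ler_sum => j _.
  exact: le_trans (ler_normB _ _) (key j).
apply: le_trans (ler_pM (normr_ge0 _) k0 S k2) _.
rewrite mulrCA; apply: ler_wpM2l => //.
rewrite mulr_suml; apply: ler_sum => j _; rewrite /en/= -(sqrrN (y - x)) opprB.
rewrite -(sqrrN (u i y - u i x)) opprB -(sqrrN (u j y - u j x)) opprB /fp /iV /Jfar/=.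
by apply: eqle; ring.
Qed.

End OneBall.

End Step.

Section StepIneq.
Variables (R : realType) (N : nat).
Local Notation mu := (@lebesgue_measure R).
Local Notation mu2 := (mu \x mu)%E.
Variables (a : R -> R) (Lam : R) (u m : 'I_N -> R -> R) (x0 r0 : R).
Hypotheses (HS : Sol a Lam u m x0 r0) (S1 : forall x, \sum_(i < N) u i x ^+ 2 = 1).
Variables (Mg : R -> R) (s p G : R).
Hypotheses (s0 : 0 < s) (s1 : s < 1) (s4 : s ^+ 4 = 2^-1) (p0 : 0 <= p) (p1 : p < 1)
  (Mg0 : forall x, 0 <= Mg x) (hG : L1b mu Mg G).
Implicit Types (c rho V t B : R).

Definition ent (z : R * R) : R := \sum_(j < N) en (u j) z.
Definition nu c rho : R := \int[mu2]_z (ind (`|z.1 - c| <= rho) * ent z).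

Lemma ent_ge0 z : 0 <= ent z. Proof. by apply: sumr_ge0 => j _; exact: en_ge0. Qed.

Lemma mes_ent : measurable_fun setT ent.
Proof. by apply: mes_sum => j; apply: mes_en; exact: sol_mu HS j. Qed.

Lemma ent_L1b : exists E, L1b mu2 (fun z => ind (`|z.1 - x0| < r0) * ent z) E.
Proof.
have [E hE] := sol_E HS.
eexists; apply: L1b_eq (L1b_sum (index_enum 'I_N) (P := xpredT) (fun j _ => hE j)) => z.
by rewrite -mulr_sumr.
Qed.

Lemma ent_loc (b : R -> bool) : measurable_fun setT b -> (forall x, b x -> `|x - x0| < r0) ->
  L1b mu2 (fun z => ind (b z.1) * ent z) (\int[mu2]_z (ind (b z.1) * ent z)).
Proof.
move=> mb hb; have [E hE] := ent_L1b; have me := mes_ent.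
have mb1 : measurable_fun setT (fun z : R * R => b z.1) := measurableT_comp mb (@mes_fst R).
apply: (@L1b_self _ _ _ _ _ E); last by move=> z; apply: mulr_ge0; [exact: ind_ge0|exact: ent_ge0].
apply: L1b_le2 hE; first by mes.
move=> x y /=; rewrite ger0_norm; last by apply: mulr_ge0; [exact: ind_ge0|exact: ent_ge0].
by apply: ler_wpM2r; [exact: ent_ge0|exact: ind_mono (hb x)].
Qed.

Lemma nuS_sum (b : R -> bool) : measurable_fun setT b -> (forall x, b x -> `|x - x0| < r0) ->
  \sum_(i < N) nuS (u i) b = \int[mu2]_z (ind (b z.1) * ent z).
Proof.
move=> mb hb; have [E hE] := sol_E HS.
have mb1 : measurable_fun setT (fun z : R * R => b z.1) := measurableT_comp mb (@mes_fst R).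
have h i : L1b mu2 (fun z => ind (b z.1) * en (u i) z) E.
  apply: L1b_le2 (hE i); first by have := mes_en (sol_mu HS i) => ?; mes.
  move=> x y /=; rewrite ger0_norm; last by nn.
  by apply: ler_wpM2r; [exact: en_ge0|exact: ind_mono (hb x)].
rewrite /nuS -(Rint_sum _ h); apply: Rint_ext => z; by rewrite -mulr_sumr.
Qed.

Lemma ball_in c rho x : `|c - x0| + rho < r0 -> `|x - c| <= rho -> `|x - x0| < r0.
Proof. by move=> h1 h2; have := ler_normD (x - c) (c - x0); rewrite addrA subrK; clra. Qed.

Lemma nu_L1b c rho : `|c - x0| + rho < r0 ->
  L1b mu2 (fun z => ind (`|z.1 - c| <= rho) * ent z) (nu c rho).
Proof. by move=> h; apply: (ent_loc (b := fun x => `|x - c| <= rho)) => [|x]; [mes|exact: ball_in]. Qed.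

Lemma nu_mono c c' rho rho' : `|c - c'| + rho <= rho' -> `|c' - x0| + rho' < r0 -> nu c rho <= nu c' rho'.
Proof.
move=> h h'; apply: Rint_le (nu_L1b _) (nu_L1b h') _.
  have := ler_normD (c - c') (c' - x0); rewrite addrA subrK; clra.
move=> z; apply: ler_wpM2r; first exact: ent_ge0.
apply: ind_mono => hz; have := ler_normD (z.1 - c) (c - c'); rewrite addrA subrK; clra.
Qed.

Lemma nu_ge0 c rho : `|c - x0| + rho < r0 -> 0 <= nu c rho.
Proof. by move=> h; exact: L1b_ge0 (nu_L1b h). Qed.

Definition Cm : R := 68 * 100 * ((6 + 10 ^+ 6) / (1 - s) + 6 * G / (1 - p)).

(** Hole filling bounds the form from below, the split equation bounds it from above; the results
    are added over the components. [V <= 1] makes the constant of the right hand side uniform. *)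
Lemma step_ineq c rho V t B : 0 < rho -> 0 < V -> V <= 1 -> 0 < t -> `|c - x0| + 16 * rho < r0 ->
  Mhyp m Mg s p rho B -> 0 <= B ->
  L1b mu2 (fun z => ind (`|z.1 - c| <= 16 * rho) * ent z) V ->
  forall nA, nA = \int[mu2]_z (ind (Aset c rho z.1) * ent z) ->
  (4 * Lam)^-1 * nu c rho <= Lam * (4 + 192 * N%:R) * nA
    + N%:R * (Lam * (N%:R * (4 * (10 ^+ 22 * V ^+ 2) + 10 ^+ 22 * V ^+ 2 / t + 32 * t * V + 640 * nA / t)))
    + N%:R * (2 * N%:R * Cm + 8 + 2 * G) * B.
Proof.
move=> rho0 V0 V1 t0 hc hM B0 hV nA nAE.
have ok := sol_k HS; have [_ L1 _ _] := ok; have me := mes_ent.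
have L0 : 0 <= Lam by clra.
have hc' : `|c - x0| + 2 * rho < r0 by clra.
have mA : measurable_fun setT (Aset c rho) by rewrite /Aset; mes.
have hAb x : Aset c rho x -> `|x - x0| < r0 by case/andP=> _; apply: ball_in hc'.
have hA := ent_loc mA hAb; rewrite -nAE in hA.
have nAV : nA <= V.
  have V' := L1b_self hV (fun z => mulr_ge0 (ind_ge0 _ _) (ent_ge0 z)).
  rewrite nAE; apply: le_trans (L1b_Rint_le hV); rewrite nAE in hA; apply: Rint_le hA V' _.
  move=> z; apply: ler_wpM2r; first exact: ent_ge0.
  by apply: ind_mono => /andP[_ h]; clra.
(* The slice is chosen for the total energy, so a single [y0] serves all components. *)
have [y0 [Ay hy]] := pick_A rho0 me ent_ge0 hA.
set eA := nA / rho in hy; have eE : rho * eA = nA by rewrite /eA mulrC divfK// lt0r_neq0.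
have hyj j : L1b mu (fun x => (u j x - u j y0) ^+ 2 / (x - y0) ^+ 2) eA.
  have muj := sol_mu HS j; apply: L1b_le1 hy; first by mes.
  move=> x; rewrite ger0_norm; last by nn.
  rewrite /ent (bigD1 j)//= {1}/en/= -(sqrrN (x - y0)) opprB -(sqrrN (u j x - _)) opprB lerDl.
  by apply: sumr_ge0 => k _; exact: en_ge0.
have hVj j : L1b mu2 (fun z => ind (`|z.1 - c| <= 16 * rho) * en (u j) z) V.
  apply: L1b_le2 hV; first by have := mes_en (sol_mu HS j) => ?; mes.
  move=> x y /=; rewrite ger0_norm; last by nn.
  apply: ler_wpM2l; first exact: ind_ge0.
  by rewrite /ent (bigD1 j)//= lerDl; apply: sumr_ge0 => k _; exact: en_ge0.
have eAV : rho * eA <= V by rewrite eE.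
pose sg := Num.sqrt (10 ^+ 4 * V).
have sgp : 0 < sg := sg_gt0 V0.
have sg100 : sg <= 100.
  rewrite -(@ler_pXn2r _ 2)// ?nnegrE//; last exact: ltW.
  rewrite (sg2 V0).
  have -> : 100 ^+ 2 = 10 ^+ 4 :> R by ring.
  by rewrite ler_piMr// exprn_ge0.
have G0 := L1b_ge0 hG.
have Cm_le : 68 * sg * (B * ((6 + 100 * sg ^+ 2) / (1 - s) + 6 * G / (1 - p))) <= Cm * B.
  have i1 : 0 <= (1 - s)^-1 by rewrite invr_ge0 subr_ge0 ltW.
  have i2 : 0 <= (1 - p)^-1 by rewrite invr_ge0 subr_ge0 ltW.
  have b1 : 6 + 100 * sg ^+ 2 <= 6 + 10 ^+ 6.
    have -> : 10 ^+ 6 = 100 * 100 ^+ 2 :> R by ring.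
    by rewrite lerD2l ler_wpM2l// lerXn2r ?nnegrE//; exact: ltW.
  rewrite /Cm -[leRHS]mulrA [X in _ <= _ * X]mulrC; apply: ler_pM.
  - by apply: mulr_ge0 => //; exact: ltW.
  - apply: mulr_ge0 => //; apply: addr_ge0; apply: mulr_ge0 => //.
      by apply: addr_ge0 => //; apply: mulr_ge0 => //; exact: sqr_ge0.
    exact: mulr_ge0.
  - exact: ler_wpM2l.
  - by apply: ler_wpM2l => //; rewrite lerD2r; apply: ler_wpM2r.
have per i : (4 * Lam)^-1 * nuS (u i) (fun x => `|x - c| <= rho) <= Lam * (4 * nuS (u i) (Aset c rho) + 192 * nA)
    + Lam * (N%:R * (4 * (10 ^+ 22 * V ^+ 2) + 10 ^+ 22 * V ^+ 2 / t + 32 * t * V + 640 * nA / t))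
    + (2 * N%:R * Cm + 8 + 2 * G) * B.
  have h2 : L1b mu2 (fun z => ind (`|z.1 - c| <= 2 * rho) * en (u i) z) V.
    apply: L1b_le2 (hVj i); first by have := mes_en (sol_mu HS i) => ?; mes.
    move=> x y /=; rewrite ger0_norm; last by nn.
    by apply: ler_wpM2r; [exact: en_ge0|apply: ind_mono => h; clra].
  have HF := hole_filling ok (sol_mu HS i) rho0 Ay (hyj i) h2; rewrite eE in HF.
  pose phi x := eta c rho x * (u i x - u i y0).
  have gphi : Good phi.
    split; [exact: cut_mes HS c y0 i rho|by exists 2 => x; exact: bnd2 HS c y0 i rho x|].
    exists (sg ^+ 2); apply: (@cut_sg _ _ _ _ _ _ _ _ HS c rho V eA y0) => //; clra.
  have [f [K [h [Gf f3 fb fh TT]]]] := one_ball_est HS i rho0 V0 t0 hc hVj Ay eAV hyj.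
  have out x : r0 <= `|x - x0| -> 3 * rho < `|x - c|.
    by move=> hx; have := ler_normD (x - c) (c - x0); rewrite addrA subrK; clra.
  have ph0 x : 2 * rho < `|x - c| -> phi x = 0 by exact: cut_supp.
  have phi0 x : r0 <= `|x - x0| -> phi x = 0 by move=> /out hx; apply: ph0; clra.
  have f0 j x : r0 <= `|x - x0| -> f j x = 0 by move=> /out; exact: f3.
  have ES := equation_split HS S1 i gphi phi0 Gf f0.
  have mt k j l : `|\int[mu]_x (m k x * (f j x * u l x))| <= Cm * B.
    apply: le_trans (L1b_Rint _) Cm_le.
    have mfj : measurable_fun setT (f j) by case: (Gf j).
    have mul := sol_mu HS l.
    apply: (@mu_term _ _ _ _ _ _ _ _ HS k (fun x => f j x * u l x) (h j) (K j) c) => //.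
    - by mes.
    - by move=> x hx; rewrite f3// mul0r.
    - move=> x; apply: le_trans (fb j x); rewrite normrM ler_piMr//; exact: sol_1 HS _ _.
  have mp : `|\int[mu]_x (m i x * phi x)| <= B * (8 + 2 * G).
    apply: L1b_Rint; apply: (@mu_phi _ _ _ _ _ _ _ _ HS i phi c rho Mg s p) => //.
    - by case: gphi.
    - by move=> x; exact: bnd2 HS c y0 i rho x.
  have Q := L1b_Rint TT; rewrite /qbound eE in Q.
  have Sm : \sum_(j < N) (\int[mu]_x (m j x * (f j x * u i x)) - \int[mu]_x (m i x * (f j x * u j x))) <= N%:R * (2 * (Cm * B)).
    rewrite -[in leRHS](card_ord N) mulrC mulr_natr -sumr_const; apply: ler_sum => j _.
    have := mt j j i; have := mt i j j; rewrite !ler_norml => /andP[? ?] /andP[? ?]; clra.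
  move: HF; rewrite -/phi ES; move: Q mp; rewrite !ler_norml => /andP[_ Q] /andP[_ mp] HF.
  move: Sm Q mp HF; set A1 := \int[mu2]_z _; set A2 := \sum_(j < N) _; set A3 := \int[mu]_x _.
  set A4 := Lam * (N%:R * _).
  move: (nuS (u i) _) (nuS (u i) _) => n1 n2 Sm Q mp HF.
  have e1 : (2 * N%:R * Cm + 8 + 2 * G) * B = N%:R * (2 * (Cm * B)) + B * (8 + 2 * G) by ring.
  by rewrite e1; move: Sm Q mp HF; move: (N%:R * (2 * (Cm * B))) (B * (8 + 2 * G)) (Lam * (4 * n2 + 192 * nA)) ((4 * Lam)^-1 * n1) => X1 X2 X3 X4; clra.
have mB : measurable_fun setT (fun x : R => `|x - c| <= rho) by mes.
have hBb x : `|x - c| <= rho -> `|x - x0| < r0 by apply: ball_in; clra.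
rewrite /nu -(nuS_sum mB hBb) mulr_sumr; apply: le_trans (ler_sum _ (fun i _ => per i)) _.
rewrite !big_split/= !sumr_const card_ord -!mulr_sumr big_split/= -mulr_sumr (nuS_sum mA hAb) -nAE sumr_const card_ord.
move: (4 * (10 ^+ 22 * V ^+ 2) + 10 ^+ 22 * V ^+ 2 / t + 32 * t * V + 640 * nA / t) Cm => Q D.
rewrite -(mulr_natr (192 * nA)) -(mulr_natr (Lam * (N%:R * Q))) -(mulr_natr ((2 * N%:R * D + 8 + 2 * G) * B)).
by apply: eqle; ring.
Qed.

Lemma nu_split c rho : `|c - x0| + 2 * rho < r0 -> 0 < rho ->
  nu c rho + \int[mu2]_z (ind (Aset c rho z.1) * ent z) <= nu c (2 * rho).
Proof.
move=> h rho0.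
have mA : measurable_fun setT (Aset c rho) by rewrite /Aset; mes.
have hAb x : Aset c rho x -> `|x - x0| < r0 by case/andP=> _; apply: ball_in h.
have h1 : `|c - x0| + rho < r0 by clra.
have hA := ent_loc mA hAb; have hB := nu_L1b h1.
rewrite /nu -(RintD hB hA); apply: Rint_le (L1bD hB hA) (nu_L1b h) _ => z.
rewrite -mulrDl; apply: ler_wpM2r; first exact: ent_ge0.
rewrite /Aset; have [h3|h3] := leP `|z.1 - c| rho.
  by rewrite (indT _ (b := _ <= 2 * rho)) /ind/= ?addr0//; clra.
by rewrite andTb {1}/ind add0r.
Qed.

(** The terms in [t V] and [V^2] are made at most a quarter of [V] each, by the choice of [t] and by
    the threshold [e0]. Adding [K1] times the inner energy to both sides then gives the ratio
    [(K1 + 1/2) / (1 + K1)]. *)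
Lemma decay_one : (0 < N)%N -> exists th e0 C, [/\ 0 <= th, th < 1, 0 < e0, 0 <= C &
  forall c rho B, 0 < rho -> `|c - x0| + 16 * rho < r0 -> Mhyp m Mg s p rho B -> 0 <= B ->
    nu c (16 * rho) <= e0 -> nu c rho <= th * nu c (16 * rho) + C * B].
Proof.
move=> N0; have ok := sol_k HS; have [_ L1 _ _] := ok.
have s1' := s1; have p1' := p1.
have Lp : 0 < Lam by clra.
have Np : 0 < N%:R :> R by rewrite ltr0n.
have G0 := L1b_ge0 hG.
pose K2 := 4 * Lam ^+ 2 * N%:R ^+ 2; have K2p : 0 < K2.
  by rewrite /K2; apply: mulr_gt0; [apply: mulr_gt0 => //|]; exact: exprn_gt0.
(* Chosen so that [32 * t * K2 = 1/4]. *)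
pose t := (128 * K2)^-1; have t0 : 0 < t by rewrite invr_gt0; apply: mulr_gt0.
pose K1 := 4 * Lam ^+ 2 * (4 + 192 * N%:R) + K2 * 640 / t.
have K1p : 0 <= K1.
  apply: addr_ge0; last by apply: divr_ge0; [apply: mulr_ge0; [exact: ltW|exact: ler0n]|exact: ltW].
  apply: mulr_ge0; first by apply: mulr_ge0 => //; exact: sqr_ge0.
  by apply: addr_ge0 => //; apply: mulr_ge0 => //; exact: ltW.
pose K3 := K2 * (10 ^+ 22 * (4 + t^-1)).
have K3p : 0 < K3.
  apply: mulr_gt0 => //; apply: mulr_gt0; first exact: exprn_gt0.
  by apply: addr_gt0 => //; rewrite invr_gt0.
pose e0 := Num.min 1 (4 * K3)^-1.
have e0p : 0 < e0 by rewrite lt_min ltr01/= invr_gt0; apply: mulr_gt0.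
have Cm0 : 0 <= Cm.
  have i1 : 0 <= (1 - s)^-1 by rewrite invr_ge0; clra.
  have i2 : 0 <= (1 - p)^-1 by rewrite invr_ge0; clra.
  apply: mulr_ge0; first exact: mulr_ge0.
  by apply: addr_ge0; apply: mulr_ge0 => //; exact: mulr_ge0.
pose C := 4 * Lam * (N%:R * (2 * N%:R * Cm + 8 + 2 * G)).
have C0 : 0 <= C.
  rewrite /C; apply: mulr_ge0; first by apply: mulr_ge0 => //; exact: ltW.
  apply: mulr_ge0; first exact: ltW.
  apply: addr_ge0; last exact: mulr_ge0.
  by apply: addr_ge0 => //; apply: mulr_ge0 => //; apply: mulr_ge0 => //; exact: ltW.
have K11 : 0 < 1 + K1 by clra.
exists ((K1 + 2^-1) / (1 + K1)), e0, C; split => //.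
- by apply: divr_ge0; clra.
- by rewrite ltr_pdivrMr//; clra.
move=> c rho B rho0 hc hM B0 hV.
have h2 : `|c - x0| + 2 * rho < r0 by clra.
have V0' := nu_ge0 hc; have sp := nu_split h2 rho0.
have m1 : nu c (2 * rho) <= nu c (16 * rho) by apply: nu_mono => //; rewrite subrr normr0; clra.
set nA := \int[mu2]_z _ in sp.
have nA0 : 0 <= nA.
  apply: (@L1b_ge0 _ _ _ mu2); apply: (ent_loc (b := Aset c rho)); first by rewrite /Aset; mes.
  by move=> x /andP[_]; apply: ball_in h2.
have [V0|Vn0] := ltP 0 (nu c (16 * rho)); last first.
  have -> : nu c (16 * rho) = 0 by clra.
  have : 0 <= C * B by exact: mulr_ge0.
  by rewrite mulr0 add0r; clra.
set V := nu c (16 * rho) in V0 V0' m1 hV *.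
have V1 : V <= 1 by apply: le_trans hV _; rewrite ge_min lexx.
have := step_ineq rho0 V0 V1 t0 hc hM B0 (nu_L1b hc) (erefl nA).
move/(ler_wpM2l (_ : 0 <= 4 * Lam)) => /(_ (ltW (mulr_gt0 (ltr0Sn _ 3) Lp))).
rewrite mulVKf; last by rewrite lt0r_neq0// mulr_gt0.
have -> : 4 * Lam * (Lam * (4 + 192 * N%:R) * nA + N%:R * (Lam * (N%:R * (4 * (10 ^+ 22 * V ^+ 2) + 10 ^+ 22 * V ^+ 2 / t + 32 * t * V + 640 * nA / t))) + N%:R * (2 * N%:R * Cm + 8 + 2 * G) * B) =
   K1 * nA + K3 * V * V + K2 * 32 * t * V + C * B by rewrite /K1 /K2 /K3 /C /K2; ring.
have -> : K2 * 32 * t * V = 4^-1 * V by rewrite /t; field; exact: lt0r_neq0.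
have w3 : K3 * V * V <= 4^-1 * V.
  apply: ler_wpM2r => //.
  have : V <= (4 * K3)^-1 by apply: le_trans hV _; rewrite ge_min lexx orbT.
  move/(ler_wpM2l (ltW K3p))/le_trans; apply; apply: eqle; field; exact: lt0r_neq0.
have wA : K1 * nA <= K1 * (V - nu c rho) by apply: ler_wpM2l => //; clra.
move=> H; rewrite mulrAC -(ler_pM2r K11) mulrDl divfK ?lt0r_neq0//.
have CB : C * B <= C * B * (1 + K1) by apply: ler_peMr; [exact: mulr_ge0|rewrite lerDl].
by move: H w3 wA CB; clear; move: (K3 * V * V) (K1 * nA) (C * B) => A1 A2 A3; clra.
Qed.

End StepIneq.

(** * Iteration lemmas and geometric limits *)

Section Growth.
Variable R : realType.
Implicit Types (th C bet d b e : R).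

Lemma powR_split (b x t : R) : 0 < b -> 0 <= x -> (b * x) `^ t = b `^ t * x `^ t.
Proof. by move=> b0 x0; rewrite powRM// ltW. Qed.

Lemma powR_exp_le (x s t : R) : 0 < x -> x <= 1 -> s <= t -> x `^ t <= x `^ s.
Proof. by move=> x0 x1 st; apply: ger_powR => //; rewrite x0. Qed.

Lemma powR_base_le (x y t : R) : 0 <= x -> x <= y -> 0 <= t -> x `^ t <= y `^ t.
Proof. by move=> x0 xy t0; apply: ge0_ler_powR; rewrite ?nnegrE//; exact: le_trans xy. Qed.

Lemma small_exponent th b bet : 0 <= th -> th < 1 -> 1 < b -> 0 < bet ->
  exists tau, [/\ 0 < tau, tau <= bet & th * b `^ tau <= (1 + th) / 2].
Proof.
move=> th0 th1 b1 bet0; have [->|thn] := eqVneq th 0.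
  by exists bet; split => //; rewrite mul0r; clra.
have thp : 0 < th by rewrite lt_def thn.
pose y := (1 + th) / (2 * th).
have y1 : 1 < y by rewrite /y ltr_pdivlMr; clra.
have lb : 0 < ln b by rewrite ln_gt0.
have ly : 0 < ln y by rewrite ln_gt0.
exists (Num.min bet (ln y / ln b)); split.
- by rewrite lt_min bet0 divr_gt0.
- by rewrite ge_min lexx.
- have -> : (1 + th) / 2 = th * y by rewrite /y; field; exact: lt0r_neq0.
  apply: ler_wpM2l => //; apply: (@le_trans _ _ (b `^ (ln y / ln b))).
    by apply: ler_powR; [exact: ltW|rewrite ge_min lexx orbT].
  have b0 : 0 < b by clra.
  rewrite /powR gt_eqF// divfK ?gt_eqF// lnK ?posrE//; clra.
Qed.

(** Induction on the number of dilations by [b] needed to reach [d]; the condition on [th * b^tau]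
    lets the power law reproduce itself. [A] is chosen before [f], so it serves all centres at
    once. *)
Lemma decay_pow_exact th C tau d b e0 : 0 <= th -> 0 <= C -> 0 < tau -> 0 < d -> 0 <= e0 -> 1 < b ->
  th * b `^ tau < 1 ->
  exists2 A, 0 < A & forall f : R -> R,
    (forall rho, 0 < rho -> rho <= d -> f rho <= e0) ->
    (forall rho, 0 < rho -> b * rho <= d -> f rho <= th * f (b * rho) + C * rho `^ tau) ->
    forall rho, 0 < rho -> rho <= d -> f rho <= A * rho `^ tau.
Proof.
move=> th0 C0 t0 d0 e00 b1 ht; have b0 : 0 < b by clra.
pose A := e0 * (b / d) `^ tau + C / (1 - th * b `^ tau) + 1.
have th' : 0 < 1 - th * b `^ tau by clra.
have A1 : 0 <= e0 * (b / d) `^ tau by rewrite mulr_ge0// powR_ge0.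
have A2 : 0 <= C / (1 - th * b `^ tau) by rewrite divr_ge0// ltW.
have Ap : 0 < A by rewrite /A; clra.
exists A => // f he hr.
have key n : forall rho, 0 < rho -> rho <= d -> d / b ^+ n < rho -> f rho <= A * rho `^ tau.
  elim: n => [|n ih] rho r0 rd; first by rewrite expr0 divr1; clra.
  have [hb|hb] := leP (b * rho) d; last first.
    move=> _; apply: le_trans (he _ r0 rd) _.
    have x1 : 1 <= b * rho / d by rewrite ler_pdivlMr// mul1r ltW.
    have p1 : 1 <= (b * rho / d) `^ tau.
      have e1 : 1 `^ tau = 1 :> R by rewrite powR1.
      by rewrite -[leLHS]e1; apply: powR_base_le => //; exact: ltW.
    apply: (@le_trans _ _ (e0 * (b / d) `^ tau * rho `^ tau)).
      rewrite -mulrA -powRM; [|by rewrite divr_ge0// ltW|exact: ltW].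
      by rewrite (_ : b / d * rho = b * rho / d); [exact: ler_peMr|ring].
    by apply: ler_wpM2r; [exact: powR_ge0|rewrite /A; clra].
  move=> hn; apply: le_trans (hr _ r0 hb) _.
  have br0 : 0 < b * rho by exact: mulr_gt0.
  have hbn : d / b ^+ n < b * rho.
    have bn := exprn_gt0 n b0; move: hn; rewrite exprS !ltr_pdivrMr ?mulr_gt0//.
    by rewrite mulrA (mulrC rho).
  have := ih _ br0 hb hbn; rewrite powR_split//; last exact: ltW.
  move/(ler_wpM2l th0) => h1; apply: le_trans (lerD h1 (lexx _)) _.
  have -> : th * (A * (b `^ tau * rho `^ tau)) + C * rho `^ tau = (A * (th * b `^ tau) + C) * rho `^ tau by ring.
  apply: ler_wpM2r; first exact: powR_ge0.
  have : C <= (1 - th * b `^ tau) * A.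
    have -> : C = (1 - th * b `^ tau) * (C / (1 - th * b `^ tau)).
      by rewrite mulrC divfK// lt0r_neq0.
    by apply: ler_wpM2l; [exact: ltW|rewrite /A; clra].
  clra.
move=> rho r0 rd.
have [n hn] : exists n, d / b ^+ n < rho.
  have bi : `|b^-1| < 1 by rewrite ger0_norm ?invr_ge0 ?invf_lt1//; exact: ltW.
  have /cvgrPdist_lt /(_ (rho / d)) := cvg_expr bi.
  rewrite divr_gt0// => /(_ isT) [n _ /(_ n (leqnn n))] /=.
  rewrite sub0r normrN ger0_norm ?exprn_ge0 ?invr_ge0 1?ltW// => h.
  by exists n; rewrite mulrC -ltr_pdivlMr// -exprVn.
exact: (key n).
Qed.

Lemma decay_pow th C bet d b e0 : 0 <= th -> th < 1 -> 0 <= C -> 0 < bet -> 0 < d -> d <= 1 -> 0 <= e0 -> 1 < b ->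
  exists tau A, [/\ 0 < tau, tau <= bet, 0 < A & forall f : R -> R,
    (forall rho, 0 < rho -> rho <= d -> f rho <= e0) ->
    (forall rho, 0 < rho -> b * rho <= d -> f rho <= th * f (b * rho) + C * rho `^ bet) ->
    forall rho, 0 < rho -> rho <= d -> f rho <= A * rho `^ tau].
Proof.
move=> th0 th1 C0 bet0 d0 d1 e00 b1.
have [tau [t0 tb ht]] := small_exponent th0 th1 b1 bet0.
have ht' : th * b `^ tau < 1 by clra.
have [A A0 H] := decay_pow_exact th0 C0 t0 d0 e00 b1 ht'.
exists tau, A; split => // f he hr; apply: H => // rho r0 rd; apply: le_trans (hr _ r0 rd) _.
rewrite lerD2l; apply: ler_wpM2l => //; apply: powR_exp_le => //.
by apply: le_trans d1; apply: le_trans rd; rewrite ler_peMl//; exact: ltW.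
Qed.

Lemma clamp_lip (l b x y : R) :
  `|Num.max l (Num.min b x) - Num.max l (Num.min b y)| <= `|x - y|.
Proof.
have h1 := ler_norm (x - y); have h2 := ler_norm (y - x); rewrite (distrC y x) in h2.
have m : `|Num.min b x - Num.min b y| <= `|x - y|.
  by rewrite /Num.min /Order.min; case: ltP => ?; case: ltP => ?; rewrite ler_norml; apply/andP; split; clra.
apply: le_trans m; move: (Num.min b x) (Num.min b y) => {h1 h2}x' y'.
have h1 := ler_norm (x' - y'); have h2 := ler_norm (y' - x'); rewrite (distrC y' x') in h2.
by rewrite /Num.max /Order.max; case: ltP => ?; case: ltP => ?; rewrite ler_norml; apply/andP; split; clra.
Qed.

(** Nested intervals around [g k] of half-width [C q^k / (1 - q)]; the supremum of their left ends
    lies in all of them, which gives the rate together with the limit. *)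
Lemma geo_lim (g : nat -> R) (C q : R) : 0 <= q -> q < 1 -> (forall k, `|g k.+1 - g k| <= C * q ^+ k) ->
  exists l, forall k, `|g k - l| <= C * q ^+ k / (1 - q).
Proof.
move=> q0 q1 hg; have q' : 0 < 1 - q by clra.
have C0 : 0 <= C by have := hg 0%N; rewrite expr0 mulr1; exact: le_trans.
pose e k := C * q ^+ k / (1 - q).
have eS k : e k.+1 = e k - C * q ^+ k.
  by rewrite /e exprS; field; exact: lt0r_neq0.
have mono n k : g k - e k <= g (n + k)%N - e (n + k)%N /\ g (n + k)%N + e (n + k)%N <= g k + e k.
  elim: n => [|n [ih1 ih2]]; first by rewrite add0n.
  by rewrite addSn eS; have := hg (n + k)%N; rewrite ler_norml => /andP[]; clra.
have e_ge0 k : 0 <= e k by rewrite /e divr_ge0 ?mulr_ge0 ?exprn_ge0// ltW.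
have cross j k : g j - e j <= g k + e k.
  have [h|h] := leqP j k.
    by have [] := mono (k - j)%N j; rewrite subnK//; have := e_ge0 k; clra.
  by have [_] := mono (j - k)%N k; rewrite subnK 1?ltnW//; have := e_ge0 j; clra.
pose S := [set y | exists k, y = g k - e k].
have hS : has_sup S.
  split; first by exists (g 0%N - e 0%N), 0%N.
  by exists (g 0%N + e 0%N) => _ [k ->]; exact: cross.
exists (sup S) => k; rewrite -/(e k) ler_norml; apply/andP; split.
  have : sup S <= g k + e k by apply: ge_sup; [case: hS|move=> _ [j ->]; exact: cross].
  clra.
have : g k - e k <= sup S by apply: ub_le_sup; [case: hS|exists k].
clra.
Qed.

End Growth.

Section AvgAe.
Variable R : realType.
Local Notation mu := (@lebesgue_measure R).
Local Notation mu2 := (mu \x mu)%E.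

Lemma avg_ae (w : R -> R) (M d : R) : measurable_fun setT w -> (forall x, `|w x| <= M) -> 0 < d ->
  {ae mu, forall x, forall e, 0 < e -> exists k0, forall k, (k0 <= k)%N -> `|avg (dl d k) w x - w x| <= e}.
Proof.
move=> mw wM d0; have M0 : 0 <= M := le_trans (normr_ge0 _) (wM 0).
have li : locally_integrable setT w.
  split => //; first exact: openT.
  move=> K _ cK; have mK : measurable K := compact_measurable cK.
  apply: (@le_lt_trans _ _ (\int[mu]_(x in K) M%:E)%E).
    apply: ge0_le_integral => //.
    - by apply/measurable_EFinP; apply: measurableT_comp => //; apply: measurable_funTS.
    - by move=> x _; rewrite lee_fin.
  by rewrite integral_cst// lte_mul_pinfty//; exact: compact_finite_measure.
apply: (aeS _ (lebesgue_differentiation li)) => x hx e e0.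
have e3 : 0 < e / 3 by clra.
have [rr rrp hr] : exists2 r, 0 < r & forall t, 0 < t -> t < r -> (davg w x t <= (e / 3)%:E)%E.
  have /fine_cvgP[hfin /cvgrPdist_le/(_ _ e3) hd] := hx.
  have [r r0 H] := filterI hfin hd; exists r => // t t0 tr.
  have [] := H t _ _ => //=; first by rewrite sub0r normrN ger0_norm// ltW.
  move=> h1 h2; rewrite -(fineK h1) lee_fin; move: h2; rewrite sub0r normrN; exact: le_trans (ler_norm _).
have r3 : 0 < rr / 3 by clra.
have [k0 hk] := dl_small d0 r3; exists k0 => k kk.
have dk := dl_gt0 k d0; have lk := hk _ kk.
set t := dl d k in dk lk *.
have t3 : 0 < 3 * t by clra.
have := hr _ t3 _; rewrite /davg /iavg (lebesgue_measure_ball _ (ltW t3)).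
rewrite inver mulrn_eq0/= gt_eqF// lee_pdivrMl ?mulrn_wgt0// -EFinM => H.
have mc : measurable_fun setT (fun z => w z - w x) by mes.
have D : L1b mu (fun z => ind (`|z - x| <= 2 * t) * `|w z - w x|) ((3 * t) *+ 2 * (e / 3)).
  split; first by mes.
  apply: le_trans (H _); last by clra.
  rewrite [leRHS]integral_mkcond; apply: ge0_le_integral => //.
  - by apply: measurable_absE; mes.
  - apply/(measurable_restrictT _ (measurable_ball x (3 * t))).
    by apply: measurable_funTS; apply: measurable_absE; exact: mc.
  - move=> z _; rewrite patchE normrM normr_id.
    have [h|h] := leP `|z - x| (2 * t); last first.
      by rewrite /ind normr0 mul0r; case: ifP => // _; rewrite lee_fin.
    rewrite mem_set; last by rewrite /= -ball_normE /ball_/= distrC; clra.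
    by rewrite /ind normr1 mul1r.
apply: le_trans (avg_near mw wM dk D) _.
by rewrite ler_pdivrMr; [rewrite mulr2n; clra|clra].
Qed.

End AvgAe.

Section Decay.
Variables (R : realType) (N : nat).
Local Notation mu := (@lebesgue_measure R).
Local Notation mu2 := (mu \x mu)%E.
Variables (a : R -> R) (Lam : R) (u m : 'I_N -> R -> R) (x0 r0 : R).
Hypotheses (HS : Sol a Lam u m x0 r0).
Implicit Types (c rho : R).

(** Absolute continuity of the energy, uniform in the centre: all balls must start the iteration at
    one common radius. *)
Lemma nu_small e : 0 < e -> exists2 d, 0 < d & forall c rho, 0 <= rho -> rho <= d -> `|c - x0| + rho < r0 ->
  nu u c rho <= e.
Proof.
move=> e0; have [E hE] := ent_L1b HS; have me := mes_ent HS.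
pose H (z : R * R) := ind (`|z.1 - x0| < r0) * ent u z.
have mH : measurable_fun setT H by rewrite /H; mes.
have H0 z : 0 <= H z by apply: mulr_ge0; [exact: ind_ge0|exact: ent_ge0].
(* The part of the density above height [n] or with second point beyond [n] has small integral; the
   rest is at most [n] on a strip of area of order [n * rho]. *)
pose F (n : nat) (z : R * R) := H z * (1 - ind (H z <= n%:R) * ind (`|0 - z.2| <= n%:R)).
have i01 (n : R) z : 0 <= (1 - ind (H z <= n) * ind (`|0 - z.2| <= n) : R) <= 1.
  have := ind_ge0 R (H z <= n); have := ind_ge0 R (`|0 - z.2| <= n).
  have := ind_le1 R (H z <= n); have := ind_le1 R (`|0 - z.2| <= n) => h1 h2 h3 h4.
  have := mulr_ge0 h4 h3; have := ler_pM h4 h3 h2 h1; clra.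
have e2 : 0 < e / 2 by clra.
have [n0 hn] : exists n0, forall n, (n0 <= n)%N -> L1b mu2 (F n) (e / 2).
  apply: (@L1b_cvg0 _ _ _ mu2 F H E) => //.
  - by move=> n; rewrite /F; mes.
  - move=> n z; have /andP[h1 h2] := i01 n%:R z.
    by rewrite normrM (ger0_norm (H0 z)) (ger0_norm h1) ler_piMr.
  - move=> z; apply/cvgrPdist_le => t t0.
    pose k := Num.trunc (Num.max (H z) `|z.2|); exists k.+1 => // n /= kn.
    have hk : Num.max (H z) `|z.2| <= n%:R.
      apply: (@le_trans _ _ k.+1%:R); last by rewrite ler_nat.
      by apply: ltW; rewrite /k truncnS_gt.
    move: hk; rewrite ge_max => /andP[h1 h2].
    by rewrite /F h1 !sub0r !normrN h2 /ind mulr1 subrr mulr0 normr0 ltW.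
have hF := hn _ (leqnn n0).
have n_ge0 : 0 <= n0%:R :> R by exact: ler0n.
pose d := e / (8 * (n0%:R + 1) ^+ 2).
have D0 : 0 < 8 * (n0%:R + 1) ^+ 2 :> R by apply: mulr_gt0 => //; apply: exprn_gt0; clra.
exists d; first exact: divr_gt0.
move=> c rho rho0 rd hc.
have hJ (x : R) : L1b mu (fun y => ind (`|0 - (x, y).2| <= n0%:R)) (2 * n0%:R) by exact: L1b_itv.
have hi : L1b mu (fun x => ind (`|c - x| <= rho)) (2 * rho) by exact: L1b_itv.
have T := L1bD hF (L1bZ n0%:R (@L1b_ker _ (fun z => ind (`|0 - z.2| <= n0%:R)) _ _ _ _ hJ hi)).
have mJ : measurable_fun setT (fun z : R * R => ind (`|0 - z.2| <= n0%:R) : R) by mes.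
apply: (@le_trans _ _ (e / 2 + `|n0%:R| * (2 * rho * (2 * n0%:R)))).
  apply: le_trans (L1b_Rint_le (T mJ)); apply: Rint_le (nu_L1b HS hc) (T mJ) _.
  move=> z; rewrite /F; set hz := H z.
  have [h1|h1] := leP `|z.1 - c| rho; last first.
    rewrite [ind false]/ind mul0r; apply: addr_ge0.
      by apply: mulr_ge0; [exact: H0|case/andP: (i01 n0%:R z)].
    by apply: mulr_ge0 => //; apply: mulr_ge0; exact: ind_ge0.
  have -> : ind true * ent u z = hz.
    by rewrite /hz /H indT// (indT _ (b := _ < r0))//; exact: ball_in hc h1.
  rewrite (distrC c) h1 [ind true]/ind mul1r.
  have [h2|h2] := leP hz n0%:R; last first.
    by rewrite [ind false]/ind mul0r subr0 mulr1 lerDl mulr_ge0// ind_ge0.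
  rewrite [ind true]/ind mul1r; have := H0 z; rewrite -/hz => hz0.
  by rewrite /ind; case: ifP => _; rewrite ?subrr ?subr0 ?mulr0 ?mulr1 ?addr0 ?add0r.
rewrite ger0_norm//.
have : (n0%:R + 1) ^+ 2 * rho <= (n0%:R + 1) ^+ 2 * d by apply: ler_wpM2l => //; exact: sqr_ge0.
have -> : (n0%:R + 1) ^+ 2 * d = e / 8 by rewrite /d; field; rewrite lt0r_neq0//; clra.
have : 0 <= n0%:R * rho by exact: mulr_ge0.
by move: rho0; clra.
Qed.

Hypothesis (S1 : forall x, \sum_(i < N) u i x ^+ 2 = 1) (N0 : (0 < N)%N).
Variables (Mg : R -> R) (s p G bet r1 : R).
Hypotheses (s0 : 0 < s) (s1 : s < 1) (s4 : s ^+ 4 = 2^-1) (p0 : 0 <= p) (p1 : p < 1)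
  (Mg0 : forall x, 0 <= Mg x) (hG : L1b mu Mg G) (bet0 : 0 < bet) (r1r0 : r1 < r0)
  (hM : forall rho, 0 < rho -> Mhyp m Mg s p rho (rho `^ bet)).

Lemma nu_decay : exists tau A d, [/\ 0 < tau, tau <= bet, 0 < A, 0 < d <= 1 &
  forall c rho, `|c - x0| <= r1 -> 0 < rho -> rho <= d ->
    `|c - x0| + rho < r0 /\ nu u c rho <= A * rho `^ tau].
Proof.
have r1r0' := r1r0.
have [th [e0 [C [th0 th1 e00 C0 H]]]] := decay_one HS S1 s0 s1 s4 p0 p1 Mg0 hG N0.
have [d1 d10 h1] := nu_small e00.
pose d := Num.min (Num.min d1 1) ((r0 - r1) / 2).
have d0 : 0 < d by rewrite !lt_min d10 ltr01/=; clra.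
have dd1 : d <= d1 by rewrite !ge_min lexx.
have d1' : d <= 1 by rewrite !ge_min lexx !orbT.
have dr : d <= (r0 - r1) / 2 by rewrite ge_min lexx orbT.
have b1 : (1 : R) < 16 by clra.
have [tau [A [t0 tb A0 HA]]] := decay_pow th0 th1 C0 bet0 d0 d1' (ltW e00) b1.
exists tau, A, d; split; rewrite ?d0 ?d1'//.
move=> c rho hc rho0 rd; have hin : `|c - x0| + rho < r0 by clra.
split => //; apply: HA => // t tp td.
  by apply: h1; [exact: ltW|clra|clra].
have e16 : nu u c (16 * t) <= e0 by apply: h1; clra.
by apply: H => //; [clra|exact: hM|exact: powR_ge0].
Qed.

End Decay.

Section HolderRep.
Variable R : realType.
Local Notation mu := (@lebesgue_measure R).
Local Notation mu2 := (mu \x mu)%E.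
Implicit Types (c rho : R).

(* The representative is the uniform limit of the averages of [w] at dyadic scales. *)
Lemma holder_rep (w : R -> R) (M A d tau x0 r1 : R) : measurable_fun setT w -> (forall x, `|w x| <= M) ->
  0 < A -> 0 < d -> 0 < tau -> 0 < r1 ->
  (forall c rho, `|c - x0| <= r1 -> 0 < rho -> rho <= d ->
    L1b mu2 (fun z => ind (`|z.1 - c| <= rho) * en w z) (A * rho `^ tau)) ->
  exists v : R -> R, [/\ measurable_fun setT v, forall x, `|v x| <= M, {ae mu, forall x, w x = v x} &
    exists C, forall x y, `|x - x0| <= r1 -> `|y - x0| <= r1 -> `|v x - v y| <= C * `|x - y| `^ (tau / 2)].
Proof.
move=> mw wM A0 d0 t0 r10 hE.
have M0 : 0 <= M := le_trans (normr_ge0 _) (wM 0).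
have d3 : 0 < d / 3 by clra.
pose dk k := dl (d / 3) k.
have dkp k : 0 < dk k := dl_gt0 k d3.
pose q : R := 2^-1 `^ (tau / 2).
have q0 : 0 < q by apply: powR_gt0; rewrite invr_gt0.
have q1 : q < 1.
  have e1 : 1 `^ (tau / 2) = 1 :> R by rewrite powR1.
  by rewrite -e1; apply: gt0_ltr_powR; rewrite ?nnegrE; clra.
pose S := Num.sqrt (A * d `^ tau).
have Ad : 0 < A * d `^ tau by rewrite mulr_gt0// powR_gt0.
have S0 : 0 < S by rewrite sqrtr_gt0.
have qk k : q ^+ k = (2^-1 ^+ k) `^ (tau / 2).
  have h2 : 0 <= 2^-1 :> R by rewrite invr_ge0.
  by rewrite /q -(powR_mulrn k (powR_ge0 _ _)) -(powR_mulrn k h2) powRAC.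
have hk k : (S * q ^+ k) ^+ 2 = A * (3 * dk k) `^ tau.
  rewrite exprMn sqr_sqrtr ?ltW// /dk /dl (_ : 3 * (d / 3 / 2 ^+ k) = 2^-1 ^+ k * d); last first.
    have h2 : 2 ^+ k != 0 :> R by rewrite expf_neq0.
    by rewrite exprVn; move: (2 ^+ k : R) h2 => X h2; field.
  rewrite powRM ?exprn_ge0 ?invr_ge0 ?ltW// qk -(powR_mulrn 2) ?powR_ge0// -powRrM.
  by rewrite divfK//; ring.
have osc k x : `|x - x0| <= r1 -> [/\ `|avg (dk k) w x - avg (dk k.+1) w x| <= 18 * (S * q ^+ k) &
     forall y, `|x - y| <= dk k -> `|avg (dk k) w x - avg (dk k) w y| <= 6 * (S * q ^+ k) * (`|x - y| / dk k)].
  move=> hx; rewrite (_ : dk k.+1 = dk k / 2); last exact: dlS.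
  apply: (@avg_osc _ w M (dk k) x (S * q ^+ k)) => //; first by rewrite mulr_gt0// exprn_gt0.
  rewrite hk; apply: hE => //; first by have := dkp k; clra.
  by have := dl_le k d3; rewrite -/(dk k); clra.
have lim x : exists l, `|x - x0| <= r1 -> forall k, `|avg (dk k) w x - l| <= 18 * S * q ^+ k / (1 - q).
  have [hx|hx] := leP `|x - x0| r1; last by exists 0.
  have G k : `|avg (dk k.+1) w x - avg (dk k) w x| <= 18 * S * q ^+ k.
    by have [h _] := osc k x hx; rewrite distrC -mulrA.
  by have [l hl] := geo_lim (g := fun k => avg (dk k) w x) (ltW q0) q1 G; exists l.
have [v0 hv0] := choice lim.
pose K := 18 * S / (1 - q).
have q' : 0 < 1 - q by clra.
have K0 : 0 < K by rewrite divr_gt0// mulr_gt0.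
have hv x k : `|x - x0| <= r1 -> `|avg (dk k) w x - v0 x| <= K * q ^+ k.
  by move=> hx; apply: le_trans (hv0 x hx k) _; apply: eqle; rewrite /K; ring.
pose C1 := (2 * K + 6 * S) * (6 / d) `^ (tau / 2).
pose C2 := (2 * K + 4 * M) * (3 / d) `^ (tau / 2).
have C10 : 0 <= C1 by rewrite /C1; apply: mulr_ge0; [clra|exact: powR_ge0].
have C20 : 0 <= C2 by rewrite /C2; apply: mulr_ge0; [clra|exact: powR_ge0].
have Hol x y : `|x - x0| <= r1 -> `|y - x0| <= r1 -> `|v0 x - v0 y| <= (C1 + C2) * `|x - y| `^ (tau / 2).
  move=> hx hy; have P0 := powR_ge0 `|x - y| (tau / 2).
  have P1 : 0 <= C1 * `|x - y| `^ (tau / 2) by exact: mulr_ge0.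
  have P2 : 0 <= C2 * `|x - y| `^ (tau / 2) by exact: mulr_ge0.
  have tri k (D : R) : `|avg (dk k) w x - avg (dk k) w y| <= D -> `|v0 x - v0 y| <= 2 * (K * q ^+ k) + D.
    move=> hD; have h1 := hv x k hx; have h2 := hv y k hy.
    have -> : v0 x - v0 y = - (avg (dk k) w x - v0 x) + (avg (dk k) w x - avg (dk k) w y) + (avg (dk k) w y - v0 y) by ring.
    by apply: le_trans (ler_normD _ _) _; have := ler_normD (- (avg (dk k) w x - v0 x)) (avg (dk k) w x - avg (dk k) w y); rewrite normrN; clra.
  rewrite mulrDl; have [exy|xy] := eqVneq x y; first by rewrite exy !subrr !normr0 addr_ge0// mulr_ge0// powR_ge0.
  have l0 : 0 < `|x - y| by rewrite normr_gt0 subr_eq0.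
  have [hd|hd] := leP `|x - y| (d / 3); last first.
    have := tri 0%N (4 * M) _; rewrite expr0 mulr1 => /(_ _) T.
    have {}T : `|v0 x - v0 y| <= 2 * K + 4 * M.
      apply: T; have b1 := avg_bnd mw wM (dkp 0%N) x; have b2 := avg_bnd mw wM (dkp 0%N) y.
      by apply: le_trans (ler_normB _ _) _; clra.
    have : 1 <= (3 / d * `|x - y|) `^ (tau / 2).
      have e1 : 1 `^ (tau / 2) = 1 :> R by rewrite powR1.
      rewrite -{1}e1; apply: powR_base_le => //; last by clra.
      by rewrite mulrAC ler_pdivlMr//; clra.
    rewrite powRM//; last by rewrite divr_ge0// ltW.
    have KM : 0 <= 2 * K + 4 * M by clra.
    move/(ler_wpM2l KM); rewrite mulr1 => H2.
    have E2 : (2 * K + 4 * M) * ((3 / d) `^ (tau / 2) * `|x - y| `^ (tau / 2)) = C2 * `|x - y| `^ (tau / 2) by rewrite /C2; ring.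
    by rewrite E2 in H2; apply: le_trans T _; apply: le_trans H2 _; rewrite lerDr.
  have [n0 hn0] := dl_small d3 l0.
  pose P k := dk k < `|x - y|.
  have exP : exists k, P k by exists n0; apply: hn0.
  case: (ex_minnP exP) => -[|k] Pk mink; first by move: Pk; rewrite /P /dk dl0; clra.
  have hk1 : `|x - y| <= dk k.
    by rewrite leNgt; apply/negP => /mink; rewrite ltnn.
  have [_ o] := osc k x hx; have := o y hk1 => o1.
  have {o1}T := tri k _ o1.
  have r1' : `|x - y| / dk k <= 1 by rewrite ler_pdivrMr// mul1r.
  have qk0 : 0 < S * q ^+ k by rewrite mulr_gt0// exprn_gt0.
  have T2 : `|v0 x - v0 y| <= (2 * K + 6 * S) * q ^+ k.
    apply: le_trans T _; have : 6 * (S * q ^+ k) * (`|x - y| / dk k) <= 6 * (S * q ^+ k) * 1.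
      by apply: ler_wpM2l => //; apply: mulr_ge0 => //; exact: ltW.
    clra.
  have qle : q ^+ k <= (6 / d) `^ (tau / 2) * `|x - y| `^ (tau / 2).
    rewrite -powRM ?normr_ge0//; last by rewrite divr_ge0// ltW.
    rewrite qk; apply: powR_base_le; [by rewrite exprn_ge0// invr_ge0| |clra].
    move: Pk; rewrite /P /dk dlS /dl -exprVn => Pk.
    by rewrite mulrAC ler_pdivlMr//; clra.
  have KS : 0 <= 2 * K + 6 * S by clra.
  have E1 : (2 * K + 6 * S) * ((6 / d) `^ (tau / 2) * `|x - y| `^ (tau / 2)) = C1 * `|x - y| `^ (tau / 2) by rewrite /C1; ring.
  by have := ler_wpM2l KS qle; rewrite E1 => H2; apply: le_trans T2 _; apply: le_trans H2 _; rewrite lerDl.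
have vb x : `|x - x0| <= r1 -> `|v0 x| <= 2 * M + K.
  move=> hx; have := hv x 0%N hx; have := avg_bnd mw wM (dkp 0%N) x; rewrite expr0 mulr1 => h1 h2.
  by have := ler_normB (avg (dk 0%N) w x) (avg (dk 0%N) w x - v0 x); rewrite opprB addrC subrK; clra.
(* The limit [v0] is controlled only on the ball; composed with the projection onto the ball it is
   continuous on the line, hence measurable. *)
pose cl x := Num.max (x0 - r1) (Num.min (x0 + r1) x).
(* [v0] agrees with [w] only almost everywhere; the truncation makes the bound [M] hold everywhere
   and preserves the modulus of continuity. *)
pose trunc y : R := Num.max (- M) (Num.min M y).
have clb x : `|cl x - x0| <= r1.
  rewrite /cl ler_norml; apply/andP; split.
    by rewrite lerBrDr addrC le_max lexx.
  by rewrite lerBlDr ge_max; apply/andP; split; [clra|rewrite addrC ge_min lexx].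
have clid x : `|x - x0| <= r1 -> cl x = x.
  by rewrite /cl ler_norml => /andP[h1 h2]; rewrite min_r ?max_r//; clra.
have mcl : measurable_fun setT (fun x => v0 (cl x)).
  apply: continuous_measurable_fun => x; apply/cvgrPdist_le => e e0.
  pose C := C1 + C2 + 1; have C0 : 0 < C by rewrite /C; clra.
  pose dd := (e / C) `^ (2 / tau).
  have eC : 0 < e / C by exact: divr_gt0.
  have dd0 : 0 < dd by apply: powR_gt0.
  near=> y.
  have hxy : `|x - y| <= dd by near: y; apply: cvgr_dist_le.
  have clip : `|cl x - cl y| <= `|x - y| := clamp_lip _ _ x y.
  apply: le_trans (Hol _ _ (clb x) (clb y)) _.
  apply: (@le_trans _ _ (C * dd `^ (tau / 2))).
    apply: ler_pM; [clra|exact: powR_ge0|rewrite /C; clra|].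
    by apply: powR_base_le => //; [exact: le_trans hxy|clra].
  rewrite /dd -powRrM (_ : 2 / tau * (tau / 2) = 1); last by field; exact: lt0r_neq0.
  rewrite powRr1; last exact: ltW.
  by rewrite mulrC divfK// lt0r_neq0.
pose v x := if `|x - x0| <= r1 then trunc (v0 (cl x)) else w x.
have trM y : `|trunc y| <= M.
  rewrite /trunc ler_norml; apply/andP; split; first by rewrite le_max lexx.
  by rewrite ge_max; apply/andP; split; [clra|rewrite ge_min lexx].
have trid y : `|y| <= M -> trunc y = y.
  by rewrite /trunc ler_norml => /andP[h1 h2]; rewrite min_r// max_r.
have trlip y z : `|trunc y - trunc z| <= `|y - z| := clamp_lip _ _ y z.
exists v; split.
- rewrite /v; apply: mes_if => //; first by mes.
  by rewrite /trunc; mes.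
- by move=> x; rewrite /v; case: ifP.
- apply: (aeS _ (avg_ae mw wM d3)) => x hx; rewrite /v; case: ifPn => // hb; rewrite clid//.
  suff -> : v0 x = w x by rewrite trid.
  apply/eqP; rewrite -subr_eq0 -normr_le0; apply/ler_addgt0Pl => e e0; rewrite addr0.
  have e2 : 0 < e / 2 by clra.
  have [k0 hk0] := hx _ e2.
  have qq : `|q| < 1 by rewrite ger0_norm// ltW.
  have eK : 0 < e / (2 * K) by rewrite divr_gt0// mulr_gt0.
  have /cvgrPdist_lt /(_ _ eK)[k1 _ hk1] := cvg_expr qq.
  pose k := maxn k0 k1.
  have h1 := hk0 k (leq_maxl _ _); have h2 := hk1 k (leq_maxr _ _).
  have h3 := hv x k hb.
  rewrite /= sub0r normrN in h2; rewrite ger0_norm in h2; last exact: exprn_ge0 (ltW q0).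
  have h4 : K * q ^+ k <= e / 2.
    by have := ler_wpM2l (ltW K0) (ltW h2); rewrite (_ : K * (e / (2 * K)) = e / 2)//; field; rewrite lt0r_neq0.
  have := ler_normB (avg (dk k) w x - w x) (avg (dk k) w x - v0 x).
  by rewrite opprB addrC addrA subrK; rewrite -/(dk k) in h1; clra.
- exists (C1 + C2) => x y hx hy; rewrite /v hx hy !clid//.
  exact: le_trans (trlip _ _) (Hol _ _ hx hy).
Unshelve. all: by end_near. Qed.

End HolderRep.

(** * Localization, linear theory and bootstrap *)

Section Spline.
Variable R : realType.
Local Notation mu := (@lebesgue_measure R).
Local Notation mu2 := (mu \x mu)%E.

Definition clamp01 (t : R) : R := Num.max 0 (Num.min 1 t).
(** Quadratic spline rising from 0 to 1 on [0, 2], the primitive of the hat function. Unlike [eta]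
    it has second differences of order [h^2], which the equation for a cut-off needs. *)
Definition spl (t : R) : R := clamp01 t ^+ 2 / 2 + clamp01 (t - 1) - clamp01 (t - 1) ^+ 2 / 2.
Definition sqp (t : R) : R := Num.max 0 t ^+ 2.

Lemma maxE s : Num.max 0 s = if s <= 0 then 0 else s :> R.
Proof. by rewrite /Num.max /Order.max ltNge; case: (s <= 0). Qed.

(** Reduces second differences of the spline to those of a squared positive part. *)
Lemma splE t : spl t = (sqp t - 2 * sqp (t - 1) + sqp (t - 2)) / 2.
Proof.
rewrite /spl /sqp /clamp01.
case: (clamp_cases t) => -[h1 ->]; case: (clamp_cases (t - 1)) => -[h2 ->];
rewrite !maxE; (case: ifPn => g1; case: ifPn => g2; case: ifPn => g3); rewrite ?expr0n ?expr1n/=;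
try (by field); try (exfalso; clra); try cnra.
Qed.

Lemma sqp_d2 t h : `|sqp (t + h) + sqp (t - h) - 2 * sqp t| <= 2 * h ^+ 2.
Proof.
rewrite /sqp !maxE; case: ifPn => h1; case: ifPn => h2; case: ifPn => h3;
rewrite ?expr0n/= ler_norml; apply/andP; split; cnra.
Qed.

Lemma spl_d2 t h : `|spl (t + h) + spl (t - h) - 2 * spl t| <= 4 * h ^+ 2.
Proof.
have -> : spl (t + h) + spl (t - h) - 2 * spl t =
  ((sqp (t + h) + sqp (t - h) - 2 * sqp t) - 2 * (sqp (t - 1 + h) + sqp (t - 1 - h) - 2 * sqp (t - 1))
   + (sqp (t - 2 + h) + sqp (t - 2 - h) - 2 * sqp (t - 2))) / 2.
  by rewrite !splE (addrAC t h (-1)) (addrAC t (-h) (-1)) (addrAC t h (-2)) (addrAC t (-h) (-2)); field.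
have := sqp_d2 t h; rewrite ler_norml => /andP[a1 a2].
have := sqp_d2 (t - 1) h; rewrite ler_norml => /andP[b1 b2].
have := sqp_d2 (t - 2) h; rewrite ler_norml => /andP[c1 c2].
by rewrite ler_norml; apply/andP; split; clra.
Qed.

Lemma clamp01_01 t : 0 <= clamp01 t <= 1.
Proof. by rewrite /clamp01; case: (clamp_cases t) => -[h ->]; rewrite ?lexx ?ler01//. Qed.

Lemma spl_lip t s : `|spl t - spl s| <= 2 * `|t - s|.
Proof.
have h1 := clamp_lip 0 1 t s; have h2 := clamp_lip 0 1 (t - 1) (s - 1).
rewrite (_ : t - 1 - (s - 1) = t - s) in h2; last by ring.
have := clamp01_01 t; have := clamp01_01 s; have := clamp01_01 (t - 1); have := clamp01_01 (s - 1).
rewrite /spl; rewrite -!/(clamp01 _) in h1 h2; move: h1 h2.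
move: (clamp01 t) (clamp01 s) (clamp01 (t - 1)) (clamp01 (s - 1)) `|t - s| => A B C D l h1 h2 hD hC hB hA.
have -> : A ^+ 2 / 2 + C - C ^+ 2 / 2 - (B ^+ 2 / 2 + D - D ^+ 2 / 2) =
   (A - B) * ((A + B) / 2) + (C - D) * (1 - (C + D) / 2) by field.
apply: le_trans (ler_normD _ _) _; rewrite (normrM (A - B)) (normrM (C - D)).
have a1 : `|(A + B) / 2| <= 1 by rewrite ler_norml; clra.
have a2 : `|1 - (C + D) / 2| <= 1 by rewrite ler_norml; clra.
have := ler_wpM2l (normr_ge0 (A - B)) a1; have := ler_wpM2l (normr_ge0 (C - D)) a2; clra.
Qed.

Lemma spl_0 t : t <= 0 -> spl t = 0.
Proof. by move=> h; rewrite splE /sqp !max_l; [rewrite expr0n/=; field|clra|clra|clra]. Qed.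

Lemma spl_1 t : 2 <= t -> spl t = 1.
Proof. by move=> h; rewrite splE /sqp !max_r; [field|clra|clra|clra]. Qed.

Lemma spl_01 t : 0 <= spl t <= 1.
Proof.
have := clamp01_01 t; have := clamp01_01 (t - 1).
have mono : clamp01 (t - 1) = 0 \/ clamp01 t = 1.
  rewrite /clamp01; case: (clamp_cases t) => -[h1 ->]; case: (clamp_cases (t - 1)) => -[h2 ->]; try (by left); try (by right); clra.
rewrite /spl; case: mono => ->; move: (clamp01 t) (clamp01 (t - 1)) => A C; rewrite ?expr0n ?expr1n/= => /andP[? ?] /andP[? ?];
  apply/andP; split; cnra.
Qed.

Record cutoff (chi : R -> R) (x0 ra rb L : R) : Prop := MkCut {
  cut_01 : forall x, 0 <= chi x <= 1;
  cut_1 : forall x, `|x - x0| <= ra -> chi x = 1;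
  cut_0 : forall x, rb <= `|x - x0| -> chi x = 0;
  cut_lip : forall x y, `|chi x - chi y| <= L * `|x - y|;
  cut_d2 : forall x h, `|chi (x + h) + chi (x - h) - 2 * chi x| <= L * h ^+ 2 }.

Lemma cutoff_ex x0 ra rb : 0 < ra -> ra < rb -> exists chi L, 0 < L /\ cutoff chi x0 ra rb L.
Proof.
move=> ra0 rab; pose w := (rb - ra) / 2; have w0 : 0 < w by rewrite /w; clra.
pose k := rb / w; have k2 : 2 <= k by rewrite /k ler_pdivlMr// /w; clra.
(* Since [k >= 2], at least one of the two splines equals 1 at every point, so the sum acts as a
   product. The transition layer has width [2 w], the length of the ramp of [spl] after scaling. *)
pose chi x := spl (k + (x - x0) / w) + spl (k - (x - x0) / w) - 1.
have iw : 0 < w^-1 by rewrite invr_gt0.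
have scale (x b : R) : b * w <= `|x - x0| -> b <= `|(x - x0) / w|.
  by rewrite normrM (gtr0_norm iw) ler_pdivlMr.
exists chi, (4 * w^-1 + 8 * w^-1 ^+ 2); split.
  by rewrite addr_gt0// mulr_gt0// exprn_gt0.
have p1 : 0 <= 4 * w^-1 by rewrite mulr_ge0// ltW.
have p2 : 0 <= 8 * w^-1 ^+ 2 by rewrite mulr_ge0// exprn_ge0// ltW.
have cs t : 0 <= spl (k + t) + spl (k - t) - 1 <= 1.
  have [h|h] := leP 0 t.
    by rewrite (spl_1 (_ : 2 <= k + t)); [rewrite (_ : 1 + spl (k - t) - 1 = spl (k - t)); [exact: spl_01|ring]|clra].
  by rewrite (spl_1 (_ : 2 <= k - t)); [rewrite addrK; exact: spl_01|clra].
split.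
- by move=> x; exact: cs.
- move=> x hx; have : `|(x - x0) / w| <= k - 2.
    rewrite normrM (gtr0_norm iw) ler_pdivrMr// mulrBl /k divfK ?lt0r_neq0// /w; clra.
  rewrite ler_norml => /andP[h1 h2]; rewrite /chi !spl_1; clra.
- move=> x hx; have := scale x k; rewrite /k divfK ?lt0r_neq0// -/k => /(_ hx).
  rewrite /chi; move: ((x - x0) / w) => t.
  have [h|h] := leP 0 t; [rewrite ger0_norm//|rewrite ltr0_norm//] => ht.
    by rewrite spl_1 ?spl_0; clra.
  by rewrite (@spl_0 (k + t)) ?(@spl_1 (k - t)); clra.
- move=> x y; rewrite /chi.
  have -> : spl (k + (x - x0) / w) + spl (k - (x - x0) / w) - 1 - (spl (k + (y - x0) / w) + spl (k - (y - x0) / w) - 1) =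
    (spl (k + (x - x0) / w) - spl (k + (y - x0) / w)) + (spl (k - (x - x0) / w) - spl (k - (y - x0) / w)) by ring.
  apply: le_trans (ler_normD _ _) _.
  have := spl_lip (k + (x - x0) / w) (k + (y - x0) / w); have := spl_lip (k - (x - x0) / w) (k - (y - x0) / w).
  have -> : k + (x - x0) / w - (k + (y - x0) / w) = (x - y) / w by field; exact: lt0r_neq0.
  have -> : k - (x - x0) / w - (k - (y - x0) / w) = - ((x - y) / w) by field; exact: lt0r_neq0.
  rewrite normrN normrM (gtr0_norm iw) mulrDl; have := mulr_ge0 p2 (normr_ge0 (x - y)); clra.
- move=> x h; rewrite /chi.
  have e1 : (x + h - x0) / w = (x - x0) / w + h / w by field; exact: lt0r_neq0.
  have e2 : (x - h - x0) / w = (x - x0) / w - h / w by field; exact: lt0r_neq0.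
  rewrite e1 e2; set t := (x - x0) / w.
  have d1 := spl_d2 (k + t) (h / w); have d2 := spl_d2 (k - t) (h / w).
  have -> : spl (k + (t + h / w)) + spl (k - (t + h / w)) - 1 + (spl (k + (t - h / w)) + spl (k - (t - h / w)) - 1)
     - 2 * (spl (k + t) + spl (k - t) - 1) = (spl (k + t + h / w) + spl (k + t - h / w) - 2 * spl (k + t))
       + (spl (k - t + h / w) + spl (k - t - h / w) - 2 * spl (k - t)).
    have -> : k + (t + h / w) = k + t + h / w by ring.
    have -> : k - (t + h / w) = k - t - h / w by ring.
    have -> : k + (t - h / w) = k + t - h / w by ring.
    have -> : k - (t - h / w) = k - t + h / w by ring.
    ring.
  apply: le_trans (ler_normD _ _) _; rewrite (mulrDl (4 / w)).
  have -> : 8 * w^-1 ^+ 2 * h ^+ 2 = 4 * (h / w) ^+ 2 + 4 * (h / w) ^+ 2 by ring.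
  have := mulr_ge0 p1 (sqr_ge0 h); clra.
Qed.

End Spline.

(** * The form on a cut-off function *)

Section Commutator.
Variable R : realType.
Local Notation mu := (@lebesgue_measure R).
Local Notation mu2 := (mu \x mu)%E.
Implicit Types (a f psi phi chi : R -> R).

Lemma measurable_refl2 : measurable_fun setT (fun z : R * R => (z.1, 2 * z.1 - z.2)).
Proof. by apply: measurable_fun_pair; mes. Qed.

Lemma integral_refl2 (f : R * R -> \bar R) : measurable_fun setT f ->
  (forall z, 0 <= f z)%E -> (\int[mu2]_z f (z.1, (2 * z.1 - z.2)%R) = \int[mu2]_z f z)%E.
Proof.
move=> mf f0; rewrite (tonelli12 (f := fun z => f (z.1, 2 * z.1 - z.2)%R))//; last first.
  by apply: (measurableT_comp mf); exact: measurable_refl2.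
rewrite (tonelli12 mf f0); apply: eq_integral => x _ /=.
have m1 : measurable_fun setT (fun y => f (x, y)) by exact: measurable_pair1.
have m2 : measurable_fun setT (fun y : R => f (x, (y + 2 * x)%R)).
  by apply: (measurableT_comp m1); mes.
rewrite -(integral_shift (2 * x) m1)//; rewrite -(integral_opp m2)//.
by apply: eq_integral => y _; congr (f (x, _)); rewrite addrC.
Qed.

Lemma L1b_refl2 (F : R * R -> R) c : L1b mu2 F c -> L1b mu2 (fun z => F (z.1, 2 * z.1 - z.2)) c.
Proof. move=> H; exact: (@L1b_inv R _ _ mu2 (fun z => (z.1, 2 * z.1 - z.2)) measurable_refl2 integral_refl2 F c H). Qed.

Lemma Rint_refl2 (F : R * R -> R) : measurable_fun setT F ->
  \int[mu2]_z F (z.1, 2 * z.1 - z.2) = \int[mu2]_z F z.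
Proof. move=> H; exact: (@Rint_inv R _ _ mu2 (fun z => (z.1, 2 * z.1 - z.2)) integral_refl2 F H). Qed.

Variables (a chi : R -> R) (Lam L x0 ra rb : R).
Hypotheses (ok : ker_ok a Lam) (hchi : cutoff chi x0 ra rb L) (rb0 : 0 < rb) (L0 : 0 < L).

Lemma cut_mes_chi : measurable_fun setT chi.
Proof. exact: lip_mes (cut_lip hchi). Qed.

Lemma cut_Good : Good chi.
Proof.
apply: (@Good_lip _ _ L 1 x0 rb) => //; first exact: cut_lip hchi.
  by move=> x; rewrite ger0_norm; case/andP: (cut_01 hchi x).
by move=> x h; apply: (cut_0 hchi); exact: ltW.
Qed.

Lemma cut_norm1 x : `|chi x| <= 1.
Proof. by rewrite ger0_norm; case/andP: (cut_01 hchi x). Qed.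

Lemma dcut_sq x y : (chi x - chi y) ^+ 2 / (x - y) ^+ 2 <= L ^+ 2 * Jnear 1 (x, y) + 4 * Jfar 1 (x, y).
Proof.
have [exy|xy] := eqVneq x y.
  by rewrite exy !subrr expr0n/= mul0r addr_ge0// mulr_ge0 ?sqr_ge0 ?Jnear_ge0 ?Jfar_ge0.
have l2 : 0 < (x - y) ^+ 2 by rewrite exprn_even_gt0//= subr_eq0.
rewrite /Jnear /Jfar/=; have [h|h] := leP `|x - y| 1.
  apply: (@le_trans _ _ (L ^+ 2)); last by rewrite [ind true]/ind mulr1 lerDl; nn.
  rewrite ler_pdivrMr// -(real_normK (num_real (chi x - chi y))) -(real_normK (num_real (x - y))) -exprMn.
  by rewrite lerXn2r ?nnegrE//; [apply: mulr_ge0 => //; exact: ltW|exact: cut_lip hchi x y].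
rewrite [ind false]/ind mulr0 add0r (ltW h) [ind true]/ind mul1r; apply: ler_wpM2r; first exact: isq_ge0.
have h1 := cut_01 hchi x; have h2 := cut_01 hchi y; cnra.
Qed.

(* By symmetry of [a] only second differences of [chi] enter, and they kill the singularity of the kernel. *)
Lemma form_cut psi c : Good psi -> L1b mu psi c ->
  `|form a chi psi| <= Lam * (2 * L + 8) * c.
Proof.
move=> gpsi hc; have [mp [M hM] [P hP]] := gpsi; have c0 := L1b_ge0 hc.
have mk := mes_kk ok; have [_ L1 _ _] := ok; have mc := cut_mes_chi.
have Lp : 0 <= Lam by clra.
have [_ _ [Pc hPc]] := cut_Good.
have hE : L1b mu2 (fun z => ind true * en chi z) Pc.
  by apply: L1b_eq hPc => z; rewrite indT// mul1r.
have FL : L1b mu2 (fun z => (chi z.1 - chi z.2) * (psi z.1 - psi z.2) * kk a z) (Lam * (Pc + P / 2)).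
  by apply: (form_L1b (b := xpredT) ok mc mp _ _ hE hP) => //; exact: measurable_cst.
pose F z := (chi z.1 - chi z.2) * (psi z.1 - psi z.2) * kk a z.
have mF : measurable_fun setT F := L1b_meas FL.
(* A first difference of the cut-off is not integrable against the kernel. Removing a band around
   the diagonal makes each term integrable before terms are rearranged; the band itself contributes
   arbitrarily little. *)
pose near n (z : R * R) := ind (`|z.1 - z.2| <= dl 1 n) : R.
have mn n : measurable_fun setT (near n) by rewrite /near; mes.
apply/ler_addgt0Pl => e e0.
have [n0 hn] : exists n0, forall n, (n0 <= n)%N -> L1b mu2 (fun z => near n z * F z) e.
  apply: (@L1b_cvg0 _ _ _ mu2 (fun n z => near n z * F z) (fun z => `|F z|) _ e _ _ (L1b_norm FL)) => //.
  - by move=> n; exact: (mes_M (mn n) mF).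
  - by move=> n z; rewrite normrM ger0_norm ?ind_ge0// ler_piMl// ind_le1.
  - move=> z; apply/cvgrPdist_le => t t0; have [ez|nz] := eqVneq z.1 z.2.
      by exists 0%N => // n _ /=; rewrite /F ez subrr !mul0r mulr0 subrr normr0 ltW.
    have l0 : 0 < `|z.1 - z.2| by rewrite normr_gt0 subr_eq0.
    have [k hk] := dl_small (ltr01 : 0 < (1 : R)) l0; exists k => // n /= kn.
    by rewrite /near indF -?ltNge ?hk// mul0r subrr normr0 ltW.
have hN := hn _ (leqnn n0); set nr := near n0 in hN; have mnr : measurable_fun setT nr := mn n0.
have FF : L1b mu2 (fun z => F z - nr z * F z) (Lam * (Pc + P / 2) + e) := L1bB FL hN.
have E1 : form a chi psi = \int[mu2]_z (nr z * F z) + \int[mu2]_z (F z - nr z * F z).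
  by rewrite (RintB FL hN) addrC subrK.
have nrs x y : nr (x, y) = nr (y, x) by rewrite /nr /near/= distrC.
pose kf z := (1 - nr z) * kk a z.
have mkf : measurable_fun setT kf by rewrite /kf; mes.
have kf0 z : 0 <= kf z.
  by apply: mulr_ge0; [rewrite subr_ge0 ind_le1|exact: kk_ge0 ok].
have kfs x y : kf (x, y) = kf (y, x) by rewrite /kf nrs (kk_sym x y ok).
have dp : 0 < dl 1 n0 :> R by exact: dl_gt0.
have kfle x y : kf (x, y) <= Lam * Jfar (dl 1 n0) (x, y).
  have /andP[_ k2] := kk_bnd x y ok; rewrite /kf /nr /near /Jfar/=.
  have [h|h] := leP `|x - y| (dl 1 n0).
    by rewrite /ind subrr mul0r; apply: mulr_ge0 => //; apply: mulr_ge0; [case: ifP|exact: isq_ge0].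
  by rewrite (ltW h) /ind subr0 !mul1r.
have Lk : L1b mu2 (fun z => psi z.1 * kf z) (c * (Lam * (2 / dl 1 n0))).
  apply: L1b_ker => // x; have := L1bZ Lam (L1b_Jfar x dp); rewrite (ger0_norm Lp).
  apply: L1b_le1; first by exact: (measurableT_comp mkf (measurable_fun_pair _ _)).
  by move=> y; rewrite ger0_norm// ; exact: kfle.
pose H z := (chi z.1 - chi z.2) * (psi z.1 * kf z).
have LH : L1b mu2 H (2 * (c * (Lam * (2 / dl 1 n0)))).
  have := L1bZ 2 (L1b_norm Lk); rewrite ger0_norm//; apply: L1b_le2; first by rewrite /H; mes.
  move=> x y; rewrite /H normrM; apply: ler_wpM2r => //=.
  by apply: le_trans (ler_normB _ _) _; have := cut_norm1 x; have := cut_norm1 y; clra.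
(* Exchanging the two points moves [psi] to the first one. *)
have E2 : \int[mu2]_z (F z - nr z * F z) = \int[mu2]_z (2 * H z).
  have mH := L1b_meas LH.
  rewrite (_ : \int[mu2]_z (2 * H z) = \int[mu2]_z (H z + H (z.2, z.1))).
    apply: Rint_ext => -[x y]; rewrite /H/= -(kfs x y) /F /kf/=; ring.
  rewrite (RintD LH (L1b_swap LH)) (RintZ 2 LH) (_ : \int[mu2]_z H (z.2, z.1) = \int[mu2]_z H z); last exact: Rint_swap.
  ring.
(* Reflecting the second point in the first preserves the kernel and completes the difference of
   [chi] to a second difference centred at the first point. *)
have E3 : \int[mu2]_z (2 * H z) = \int[mu2]_z (H z + H (z.1, 2 * z.1 - z.2)).
  have mH := L1b_meas LH.
  rewrite (RintD LH (L1b_refl2 LH)) (RintZ 2 LH) (_ : \int[mu2]_z H (z.1, 2 * z.1 - z.2) = \int[mu2]_z H z); last exact: Rint_refl2.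
  ring.
have hJ x : L1b mu (fun y => Lam * (L * Jnear 1 (x, y) + 4 * Jfar 1 (x, y))) (Lam * (2 * L + 8)).
  have := L1bZ Lam (L1bD (L1bZ L (L1b_Jnear x ltr01)) (L1bZ 4 (L1b_Jfar x ltr01))).
  by apply: L1b_weak; rewrite !ger0_norm ?(ltW L0)//; apply: ler_wpM2l => //; clra.
have mJn := mes_Jnear (1 : R); have mJf := mes_Jfar (1 : R).
have mJ : measurable_fun setT (fun z : R * R => Lam * (L * Jnear 1 z + 4 * Jfar 1 z)).
  by apply: mes_M; [exact: mes_cst|apply: mes_D; apply: mes_M => //; exact: mes_cst].
have LB := L1b_ker mJ hJ (L1b_norm hc).
have LS : L1b mu2 (fun z => H z + H (z.1, 2 * z.1 - z.2)) (c * (Lam * (2 * L + 8))).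
  apply: L1b_le2 LB; first exact: L1b_meas (L1bD LH (L1b_refl2 LH)).
  move=> x y /=; rewrite /H/=.
  have kr : kf (x, 2 * x - y) = kf (x, y).
    have e1 : x - (2 * x - y) = - (x - y) by ring.
    rewrite /kf /nr /near /kk/= e1 normrN sqrrN; congr (_ * (_ / _)).
    by case: ok => _ _ sa _; rewrite -sa.
  rewrite kr -mulrDl mulrC normrM normrM (ger0_norm (kf0 _)) -mulrA; apply: ler_wpM2l => //.
  have [exy|xy] := eqVneq x y.
    rewrite exy (_ : chi y - chi y + (chi y - chi (2 * y - y)) = 0) ?normr0 ?mulr0; last first.
      by rewrite (_ : 2 * y - y = y) ?subrr ?addr0//; ring.
    by apply: mulr_ge0 => //; apply: addr_ge0; apply: mulr_ge0 => //; rewrite ?Jnear_ge0 ?Jfar_ge0// ltW.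
  have l2 : 0 < (x - y) ^+ 2 by rewrite exprn_even_gt0//= subr_eq0.
  have kk2 : kf (x, y) <= Lam / (x - y) ^+ 2.
    have /andP[_ k2] := kk_bnd x y ok; apply: le_trans k2; rewrite /kf ler_piMl//; first exact: kk_ge0 ok.
    by rewrite lerBlDr lerDl ind_ge0.
  set D := chi x - chi y + _.
  have D4 : `|D| <= 4.
    have -> : D = (chi x + chi x) - (chi y + chi (2 * x - y)) by rewrite /D; ring.
    apply: le_trans (ler_normB _ _) _; have := ler_normD (chi x) (chi x); have := ler_normD (chi y) (chi (2 * x - y)).
    by have := cut_norm1 x; have := cut_norm1 y; have := cut_norm1 (2 * x - y); clra.
  have D2' : `|D| <= L * (x - y) ^+ 2.
    have e1 : x + (y - x) = y by ring.
    have e2 : x - (y - x) = 2 * x - y by ring.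
    have eD : chi y + chi (2 * x - y) - 2 * chi x = - D by rewrite /D; ring.
    have := cut_d2 hchi x (y - x); rewrite e1 e2 eD normrN -(sqrrN (y - x)) opprB; exact.
  apply: le_trans (ler_wpM2r (normr_ge0 D) kk2) _; rewrite -mulrA; apply: ler_wpM2l => //.
  rewrite mulrC ler_pdivrMr// /Jnear /Jfar/=; have [h|h] := leP `|x - y| 1.
    apply: le_trans D2' _; apply: ler_wpM2r; first exact: ltW.
    by rewrite [ind true]/ind mulr1 lerDl; nn.
  rewrite (ltW h) /ind mulr0 add0r mul1r divfK ?lt0r_neq0//.
rewrite E1 E2 E3; apply: le_trans (ler_normD _ _) _; apply: lerD; first exact: L1b_Rint.
by rewrite mulrC; exact: L1b_Rint LS.
Qed.

End Commutator.

Section LocalizedEquation.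
Variables (R : realType) (N : nat).
Local Notation mu := (@lebesgue_measure R).
Local Notation mu2 := (mu \x mu)%E.
Variables (a chi : R -> R) (Lam L : R) (u m : 'I_N -> R -> R) (x0 r0 ra rb : R).
Hypotheses (HS : Sol a Lam u m x0 r0) (hchi : cutoff chi x0 ra rb L) (rb0 : 0 < rb) (L0 : 0 < L)
  (rbr : rb <= r0).

(** The product rule: the form on [chi * u i] is the form on [u i] tested with [chi * phi], plus the
    form on [chi] tested with [phi * u i], minus a product of increments of [chi] and [u i]. These
    are bounded by the equation, by [form_cut], and by the energy densities of [u] and [chi]. *)
Lemma localized i phi c1 c2 c3 : Good phi -> (forall x, r0 <= `|x - x0| -> phi x = 0) ->
  L1b mu2 (fun z => `|phi z.1| * ent u z) c1 -> L1b mu (fun x => m i x * phi x) c2 -> L1b mu phi c3 ->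
  `|form a (fun x => chi x * u i x) phi| <= 2 * Lam * c1 + c2 + Lam * (2 * L ^+ 2 + 2 * L + 16) * c3.
Proof.
move=> gp p0 h1 h2 h3; have ok := sol_k HS; have [_ L1 _ _] := ok; have Lp : 0 <= Lam by clra.
have gc := cut_Good hchi rb0; have [mp [M hM] [P hP]] := gp.
have mc := cut_mes_chi hchi; have mui := sol_mu HS i; have mk := mes_kk ok; have me := mes_ent HS.
have gcp := GoodM gc gp.
have cp0 x : r0 <= `|x - x0| -> chi x * phi x = 0 by move=> /p0 ->; rewrite mulr0.
have [e1 he1] := form_ex HS i gcp cp0.
have gup := Good_mul_sol HS i gp p0.
have [_ _ [Pc hPc]] := gc.
have hE : L1b mu2 (fun z => ind true * en chi z) Pc.
  by apply: L1b_eq hPc => z; rewrite indT// mul1r.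
have [mup [Mup hMup] [Pup hPup]] := gup.
have he2 : L1b mu2 (fun z => (chi z.1 - chi z.2) * (phi z.1 * u i z.1 - phi z.2 * u i z.2) * kk a z) (Lam * (Pc + Pup / 2)).
  by apply: (form_L1b (b := xpredT) ok mc mup _ _ hE hPup) => //; exact: measurable_cst.
pose X z := (chi z.1 - chi z.2) * (phi z.1 + phi z.2) * (u i z.1 - u i z.2) * kk a z.
have ent_i z : en (u i) z <= ent u z.
  by rewrite /ent (bigD1 i)//= lerDl; apply: sumr_ge0 => j _; exact: en_ge0.
have hJ x : L1b mu (fun y => L ^+ 2 * Jnear 1 (x, y) + 4 * Jfar 1 (x, y)) (2 * L ^+ 2 + 8).
  have := L1bD (L1bZ (L ^+ 2) (L1b_Jnear x ltr01)) (L1bZ 4 (L1b_Jfar x ltr01)).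
  by apply: L1b_weak; rewrite !ger0_norm ?sqr_ge0//; clra.
have mJn := mes_Jnear (1 : R); have mJf := mes_Jfar (1 : R).
have mJ : measurable_fun setT (fun z : R * R => L ^+ 2 * Jnear 1 z + 4 * Jfar 1 z).
  by apply: mes_D; apply: mes_M => //; exact: mes_cst.
have LJ := L1b_ker mJ hJ (L1b_norm h3).
have LX0 := L1bZ (Lam / 2) (L1bD h1 LJ).
have hX : L1b mu2 X (Lam * (c1 + c3 * (2 * L ^+ 2 + 8))).
  apply: (@L1b_weak _ _ _ _ _ _ _ _ (L1b_le2 _ _ (L1bD LX0 (L1b_swap LX0)))).
  - by rewrite ger0_norm; clra.
  - by rewrite /X; mes.
  move=> x y /=; rewrite /X normrM normrM normrM (ger0_norm (kk_ge0 _ ok)).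
  have /andP[_ k2] := kk_bnd x y ok.
  have kp := isq_ge0 (x - y).
  (* The square of the increment of [chi] goes into a kernel with bounded row integrals, that of
     [u i] into [ent]. *)
  have am : `|chi x - chi y| * `|u i x - u i y| <= ((chi x - chi y) ^+ 2 + (u i x - u i y) ^+ 2) / 2.
    by have := sqr_ge0 (`|chi x - chi y| - `|u i x - u i y|); rewrite sqrrB !real_normK ?num_real//; clra.
  have b1 := dcut_sq hchi L0 x y; have b2 := dcut_sq hchi L0 y x.
  have e3 := ent_i (x, y); have e4 := ent_i (y, x); rewrite /en/= in e3 e4.
  rewrite -(sqrrN (y - x)) opprB -(sqrrN (u i y - u i x)) opprB in e4.
  rewrite -(sqrrN (y - x)) opprB -(sqrrN (chi y - chi x)) opprB in b2.
  set J1 := L ^+ 2 * Jnear 1 (x, y) + _ in b1 *; set J2 := L ^+ 2 * Jnear 1 (y, x) + _ in b2 *.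
  set k := ((x - y) ^+ 2)^-1 in kp b1 b2 e3 e4 k2 *.
  have am2 := ler_wpM2r kp am.
  have px := normr_ge0 (phi x); have py := normr_ge0 (phi y).
  have f1 : `|phi x| * (`|chi x - chi y| * `|u i x - u i y| * k) <= `|phi x| * ((J1 + ent u (x, y)) / 2).
    by apply: ler_wpM2l => //; clra.
  have f2 : `|phi y| * (`|chi x - chi y| * `|u i x - u i y| * k) <= `|phi y| * ((J2 + ent u (y, x)) / 2).
    by apply: ler_wpM2l => //; clra.
  have t := ler_normD (phi x) (phi y).
  set cc := `|chi x - chi y| in f1 f2 *; set uu := `|u i x - u i y| in f1 f2 *.
  have cu0 : 0 <= cc * uu by apply: mulr_ge0; exact: normr_ge0.
  rewrite -[X in _ * X * _ * _]/(`|phi x + phi y|); have K0 := kk_ge0 (x, y) ok.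
  move: K0 k2; set K := kk a (x, y) => K0 k2.
  apply: (@le_trans _ _ ((cc * uu) * ((`|phi x| + `|phi y|) * (Lam * k)))).
    have -> : cc * `|phi x + phi y| * uu * K = cc * uu * (`|phi x + phi y| * K) by ring.
    by apply: ler_wpM2l => //; apply: ler_pM.
  have -> : cc * uu * ((`|phi x| + `|phi y|) * (Lam * k)) = Lam * (`|phi x| * (cc * uu * k) + `|phi y| * (cc * uu * k)) by ring.
  apply: le_trans (ler_wpM2l Lp (lerD f1 f2)) _.
  by apply: eqle; field.
have E : form a (fun x => chi x * u i x) phi = form a (u i) (fun x => chi x * phi x)
    + form a chi (fun x => phi x * u i x) - \int[mu2]_z X z.
  rewrite /form -(RintD he1 he2) -(RintB (L1bD he1 he2) hX); apply: Rint_ext => z; rewrite /X; ring.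
have w1 := sol_we HS i gcp cp0.
have b1 : `|form a (u i) (fun x => chi x * phi x)| <= Lam * c1 + c2.
  rewrite w1; apply: le_trans (ler_normD _ _) _; apply: lerD; apply: L1b_Rint.
    have := L1bZ Lam h1; rewrite (ger0_norm Lp); apply: L1b_le2.
      have mD := mes_D2 (sol_mu HS); by mes.
    move=> x y /=; rewrite normrM (ger0_norm (mulr_ge0 (D2_ge0 _ _) (kk_ge0 _ ok))).
    have /andP[_ k2] := kk_bnd x y ok.
    have -> : Lam * (`|phi x| * ent u (x, y)) = D2 u (x, y) * (Lam / (x - y) ^+ 2) * `|phi x|.
      by rewrite /ent /D2 /en/= -mulr_suml; ring.
    apply: ler_pM => //; [by apply: mulr_ge0; [exact: D2_ge0|exact: kk_ge0 ok]| |].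
      by apply: ler_wpM2l => //; exact: D2_ge0.
    rewrite normrM -[leRHS]mul1r; apply: ler_pM => //; first exact: sol_1 HS _ _.
    by rewrite normrM -[leRHS]mul1r; apply: ler_pM => //; exact: cut_norm1 hchi x.
  apply: L1b_le1 (L1b_norm h2); first by have [c hc] := m_ex HS i gcp; exact: L1b_meas hc.
  by move=> x; rewrite !normrM; apply: ler_wpM2l => //; rewrite ler_piMl//; exact: cut_norm1 hchi x.
have h3' : L1b mu (fun x => phi x * u i x) c3.
  apply: L1b_le1 (L1b_norm h3) => // x; rewrite normrM ler_piMr//; exact: sol_1 HS _ _.
have b2 := form_cut ok hchi rb0 L0 gup h3'.
have b3 := L1b_Rint hX.
rewrite E; apply: le_trans (ler_normB _ _) _; apply: le_trans (lerD (ler_normD _ _) (lexx _)) _.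
have -> : 2 * Lam * c1 + c2 + Lam * (2 * L ^+ 2 + 2 * L + 16) * c3 =
  (Lam * c1 + c2) + Lam * (2 * L + 8) * c3 + Lam * (c1 + c3 * (2 * L ^+ 2 + 8)) by ring.
exact: lerD (lerD b1 b2) b3.
Qed.

End LocalizedEquation.

(** * Increments and linear energy estimates *)

Section Shift.
Variable R : realType.
Local Notation mu := (@lebesgue_measure R).
Local Notation mu2 := (mu \x mu)%E.
Implicit Types (a f w W phi : R -> R) (h : R).

Lemma Good_shift f h : Good f -> Good (fun x => f (x + h)).
Proof.
case=> mf [M hM] [P hP]; split; [by mes|by exists M => x|exists P].
apply: L1b_eq (L1b_shift2 h hP) => z; rewrite /en/=; congr (_ / _ ^+ 2); ring.
Qed.

Lemma form_good_L1b a Lam w phi : ker_ok a Lam -> Good w -> Good phi ->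
  exists c, L1b mu2 (fun z => (w z.1 - w z.2) * (phi z.1 - phi z.2) * kk a z) c.
Proof.
move=> ok [mw _ [E hE]] [mp _ [P hP]]; exists (Lam * (E + P / 2)).
have hE' : L1b mu2 (fun z => ind true * en w z) E by apply: L1b_eq hE => z; rewrite indT// mul1r.
by apply: (form_L1b (b := xpredT) ok mw mp _ _ hE' hP) => //; exact: measurable_cst.
Qed.

(** The kernel depends only on the difference of the points, so a translation of [W] is an opposite
    translation of the test function. *)
Lemma form_diff a Lam W phi h : ker_ok a Lam -> Good W -> Good phi ->
  form a (fun x => W (x + h) - W x) phi = form a W (fun x => phi (x - h)) - form a W phi.
Proof.
move=> ok gW gp.
have [c1 h1] := form_good_L1b ok (Good_shift h gW) gp.
have [c2 h2] := form_good_L1b ok gW gp.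
have [c3 h3] := form_good_L1b ok gW (Good_shift (- h) gp).
have E3 : form a W (fun x => phi (x - h)) =
   \int[mu2]_z ((W (z.1 + h) - W (z.2 + h)) * (phi z.1 - phi z.2) * kk a z).
  rewrite /form -(Rint_shift2 h (L1b_meas h3)); apply: Rint_ext => z /=.
  have -> : kk a (z.1 + h, z.2 + h) = kk a z.
    by rewrite /kk/= (_ : z.1 + h - (z.2 + h) = z.1 - z.2)//; ring.
  by rewrite !addrK.
by rewrite E3 /form -(RintB h1 h2); apply: Rint_ext => z; ring.
Qed.

End Shift.

Section Energy.
Variable R : realType.
Local Notation mu := (@lebesgue_measure R).
Local Notation mu2 := (mu \x mu)%E.
Variables (a v : R -> R) (Lam m : R).
Hypotheses (ok : ker_ok a Lam) (gv : Good v) (m0 : 0 <= m) (vm : forall x, `|v x| <= m).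
Implicit Types (c rho s D : R).

Lemma en_eta_L1b c rho : 0 < rho -> L1b mu2 (en (eta c rho)) 32.
Proof.
move=> r0; have hi : L1b mu (fun x => ind (`|c - x| <= 2 * rho)) (2 * (2 * rho)) by apply: L1b_itv; clra.
have H := L1b_both (mes_Jmix rho) (Jmix_sym _) (fun x => L1b_Jmix x r0) hi.
apply: (@L1b_weak _ _ _ _ _ _ _ _ (L1b_le2 _ _ H)).
- by apply: eqle; field; exact: lt0r_neq0.
- by apply: mes_en; exact: mes_eta.
move=> x y /=; rewrite ger0_norm ?en_ge0//.
have J0 := Jmix_ge0 rho (x, y); have hd := deta_sq c x y r0; rewrite -/(en (eta c rho) (x, y)) in hd.
have [hx|hx] := leP `|c - x| (2 * rho).
  by apply: le_trans hd _; apply: ler_peMl => //; rewrite [ind true]/ind lerDl ind_ge0.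
have [hy|hy] := leP `|c - y| (2 * rho).
  by apply: le_trans hd _; apply: ler_peMl => //; rewrite [ind true]/ind lerDr ind_ge0.
by rewrite /en/= !eta0 ?subrr ?expr0n/= ?mul0r ?addr0 ?mul0r// distrC ltW.
Qed.

(** Rests on the identity [(s - t)(p^2 s - q^2 t) = (p s - q t)^2 - s t (p - q)^2], with [p], [q]
    the values of the cut-off. *)
Lemma caccioppoli c rho D X : 0 < rho ->
  form a v (fun x => eta c rho x ^+ 2 * v x) <= D ->
  L1b mu2 (fun z => `|v z.1 * v z.2| * en (eta c rho) z) X ->
  L1b mu2 (en (fun x => eta c rho x * v x)) (Lam * (D + Lam * X)).
Proof.
move=> r0 hD he; have [_ L1 _ _] := ok; have Lp : 0 < Lam by clra.
have ge := Good_eta c r0.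
have gev := GoodM ge gv; have g2 : Good (fun x => eta c rho x ^+ 2 * v x).
  by have := GoodM (GoodM ge ge) gv; rewrite (_ : (fun x => _) = (fun x => eta c rho x ^+ 2 * v x)).
have [cF hF] := form_good_L1b ok gv g2.
have [_ _ [P hP]] := gev; have hP' := L1b_self hP (fun z => en_ge0 _ z).
apply: L1b_weak hP'.
have key : Lam^-1 * (\int[mu2]_z en (fun x => eta c rho x * v x) z) <= D + Lam * X.
  have T := L1bD hF (L1bZ Lam he).
  rewrite -(RintZ _ hP); apply: (@le_trans _ _ (\int[mu2]_z ((v z.1 - v z.2) * (eta c rho z.1 ^+ 2 * v z.1 - eta c rho z.2 ^+ 2 * v z.2) * kk a z + Lam * (`|v z.1 * v z.2| * en (eta c rho) z)))).
    apply: Rint_le (L1bZ _ hP) T _ => -[x y]/=; rewrite /en/=.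
    have /andP[k1 k2] := kk_bnd x y ok; set K := kk a (x, y) in k1 k2 *; set k := ((x - y) ^+ 2)^-1 in k1 k2 *.
    have kp : 0 <= k := isq_ge0 _.
    set p := eta c rho x; set q := eta c rho y; set s := v x; set t := v y.
    have -> : (s - t) * (p ^+ 2 * s - q ^+ 2 * t) = (p * s - q * t) ^+ 2 - s * t * (p - q) ^+ 2 by ring.
    have st : s * t <= `|s * t| := ler_norm _.
    have K0 : 0 <= K := kk_ge0 _ ok.
    have A1 := ler_wpM2l (sqr_ge0 (p * s - q * t)) k1.
    have A2 : s * t * (p - q) ^+ 2 * K <= `|s * t| * (p - q) ^+ 2 * (Lam * k).
      apply: (@le_trans _ _ (`|s * t| * (p - q) ^+ 2 * K)).
        by apply: ler_wpM2r => //; apply: ler_wpM2r => //; exact: sqr_ge0.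
      by apply: ler_wpM2l => //; apply: mulr_ge0 => //; exact: sqr_ge0.
    move: A1 A2; rewrite -!/(k); clra.
  rewrite (RintD hF (L1bZ _ he)) (RintZ _ he); apply: lerD => //.
  by apply: ler_wpM2l; [exact: ltW|exact: L1b_Rint_le].
by rewrite mulrC ler_pdivrMr// mulrC in key.
Qed.

Lemma cacc_ball c rho D : 0 < rho ->
  form a v (fun x => eta c rho x ^+ 2 * v x) <= D ->
  L1b mu2 (fun z => ind (`|z.1 - c| <= rho / 2) * en v z) (Lam * (D + 32 * Lam * m ^+ 2) + 16 * m ^+ 2).
Proof.
move=> r0 hD; have [mv _ _] := gv; have r2 : 0 < rho / 2 by clra.
have X : L1b mu2 (fun z => `|v z.1 * v z.2| * en (eta c rho) z) (m ^+ 2 * 32).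
  rewrite -[X in L1b _ _ (X * _)](ger0_norm (sqr_ge0 m)); apply: L1b_le2 (L1bZ (m ^+ 2) (en_eta_L1b c r0)).
    by have := mes_en (mes_eta c rho) => ?; mes.
  move=> x y /=; rewrite ger0_norm; last by nn.
  apply: ler_wpM2r; first exact: en_ge0.
  by rewrite normrM expr2; apply: ler_pM => //; exact: vm.
have H := caccioppoli r0 hD X; rewrite (_ : Lam * (D + Lam * (m ^+ 2 * 32)) = Lam * (D + 32 * Lam * m ^+ 2)) in H; last by ring.
have hi : L1b mu (fun x => ind (`|c - x| <= rho / 2)) (2 * (rho / 2)) by apply: L1b_itv; exact: ltW.
have F := L1bZ (4 * m ^+ 2) (L1b_ker (mes_Jfar (rho / 2)) (fun x => L1b_Jfar x r2) hi).
apply: (@L1b_weak _ _ _ _ _ _ _ _ (L1b_le2 _ _ (L1bD H F))).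
- rewrite lerD2l ger0_norm; last by rewrite mulr_ge0// sqr_ge0.
  by apply: eqle; field; exact: lt0r_neq0.
- by have := mes_en mv => ?; mes.
move=> x y /=; rewrite ger0_norm; last by nn.
have f0 : 0 <= 4 * m ^+ 2 * (ind (`|c - x| <= rho / 2) * Jfar (rho / 2) (x, y)).
  by apply: mulr_ge0; [rewrite mulr_ge0// sqr_ge0|rewrite mulr_ge0 ?ind_ge0 ?Jfar_ge0].
have e0 := en_ge0 (fun x => eta c rho x * v x) (x, y).
have [hx|hx] := leP `|x - c| (rho / 2); last by rewrite {1}/ind mul0r addr_ge0.
rewrite {1}/ind mul1r; have [hy|hy] := leP `|y - c| rho.
  rewrite {1}/en/= (_ : (v x - v y) ^+ 2 / (x - y) ^+ 2 = en (fun x => eta c rho x * v x) (x, y)); first by rewrite lerDl.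
  by rewrite /en/= !eta1 ?mul1r//; clra.
rewrite (distrC c) hx /ind mul1r /Jfar/= indT; last first.
  by have := ler_normD (y - x) (x - c); rewrite addrA subrK (distrC y x); clra.
rewrite mul1r; apply: ler_wpDl => //; rewrite /en/= ; apply: ler_wpM2r; first exact: isq_ge0.
have : `|v x - v y| <= 2 * m by apply: le_trans (ler_normB _ _) _; have := vm x; have := vm y; clra.
rewrite -(real_normK (num_real (v x - v y))) (_ : 4 * m ^+ 2 = (2 * m) ^+ 2); last by ring.
by move=> h'; rewrite lerXn2r ?nnegrE// mulr_ge0.
Qed.

Definition nuv c s : R := nuS v (fun x => `|x - c| <= s).

Lemma nuS_L1b (b : R -> bool) : measurable_fun setT b ->
  L1b mu2 (fun z => ind (b z.1) * en v z) (nuS v b).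
Proof.
move=> mb; have [mv _ [P hP]] := gv.
have mb1 : measurable_fun setT (fun z : R * R => b z.1) := measurableT_comp mb (@mes_fst R).
apply: (@L1b_self _ _ _ _ _ P); last by move=> z; nn.
apply: L1b_le2 hP; first by have := mes_en mv => ?; mes.
by move=> x y /=; rewrite ger0_norm; [rewrite ler_piMl ?en_ge0 ?ind_le1|nn].
Qed.

Lemma nuv_L1b c s : L1b mu2 (fun z => ind (`|z.1 - c| <= s) * en v z) (nuv c s).
Proof. by apply: (@nuS_L1b (fun x => `|x - c| <= s)); mes. Qed.

(** Hole filling for the linear problem: [(28 * Lam)^2] is [4 * Lam * Lam * (4 + 192)], because the
    slice point makes the tail at most the energy of the annulus. *)
Lemma hole_step c s D : 0 < s ->
  0 <= D -> (forall y, form a v (fun x => eta c s x * (v x - v y)) <= D) ->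
  nuv c s <= (28 * Lam) ^+ 2 / (1 + (28 * Lam) ^+ 2) * nuv c (2 * s) + 4 * Lam * D.
Proof.
move=> s0 Dp hD; have [mv _ [P hP]] := gv; have [_ L1 _ _] := ok; have Lp : 0 < Lam by clra.
have mA : measurable_fun setT (Aset c s) by rewrite /Aset; mes.
have hA := nuS_L1b mA; set nA := nuS v (Aset c s) in hA.
have [y0 [Ay hy]] := pick_A s0 (mes_en mv) (en_ge0 v) hA.
have hy' : L1b mu (fun x => (v x - v y0) ^+ 2 / (x - y0) ^+ 2) (nA / s).
  apply: L1b_eq hy => x; rewrite /en/= -(sqrrN (x - y0)) opprB -(sqrrN (v x - v y0)) opprB//.
have := hole_filling ok mv s0 Ay hy' (nuv_L1b c (2 * s)); rewrite -/nA -/(nuv c s).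
rewrite (_ : s * (nA / s) = nA); last by rewrite mulrC divfK// lt0r_neq0.
move/le_trans/(_ (hD y0)) => H.
have split2 : nuv c s + nA <= nuv c (2 * s).
  rewrite /nuv /nA /nuS -(RintD (nuv_L1b c s) hA).
  apply: Rint_le (L1bD (nuv_L1b c s) hA) (nuv_L1b c (2 * s)) _ => z.
  rewrite -mulrDl; apply: ler_wpM2r; first exact: en_ge0.
  rewrite /Aset; have [h3|h3] := leP `|z.1 - c| s.
    by rewrite (indT _ (b := _ <= 2 * s)) /ind/= ?addr0//; clra.
  by rewrite andTb {1}/ind add0r.
have nB0 : 0 <= nuv c s := L1b_ge0 (nuv_L1b c s).
have D0 : 0 <= nA := L1b_ge0 hA.
set n1 := nuv c s in H split2 nB0 *; set n2 := nuv c (2 * s) in split2 *.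
have H2 : n1 <= (28 * Lam) ^+ 2 * nA + 4 * Lam * D.
  have L4 : 0 < 4 * Lam by clra.
  have := ler_wpM2l (ltW L4) H; rewrite mulrBr mulVKf ?lt0r_neq0//; clra.
set K := (28 * Lam) ^+ 2 in H2 *; have K0 : 0 <= K := sqr_ge0 _.
have K1 : 0 < 1 + K by clra.
have wA : K * nA <= K * (n2 - n1) by apply: ler_wpM2l => //; clra.
rewrite -(ler_pM2r K1) mulrDl mulrAC divfK ?lt0r_neq0//.
have LD : 0 <= 4 * Lam * D by rewrite !mulr_ge0// ltW.
have : 4 * Lam * D <= 4 * Lam * D * (1 + K) by rewrite ler_peMr//; clra.
by move: H2 wA; clra.
Qed.

End Energy.

Section Sequences.
Variable R : realType.

(** The ratio [p] lies strictly above both [th] and [q], which rules out the resonance factor [k]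
    that would appear for [th = q]. *)
Lemma seq_decay (x : nat -> R) (th q D X : R) : 0 <= th -> th < 1 -> 0 <= q -> q < 1 -> 0 <= D -> 0 <= X ->
  x 0%N <= X -> (forall k, x k.+1 <= th * x k + D * q ^+ k) ->
  let p0 := Num.max th q in let p := (1 + p0) / 2 in
  forall k, x k <= (X + D / (p - p0)) * p ^+ k.
Proof.
move=> th0 th1 q0 q1 D0 X0 hX hx p0 p.
have a1 : th <= p0 by rewrite le_max lexx.
have a2 : q <= p0 by rewrite le_max lexx orbT.
have a3 : p0 < 1 by rewrite gt_max th1.
have pp : 0 < p - p0 by rewrite /p; clra.
have p_ge0 : 0 <= p by rewrite /p; clra.
have Dp : 0 <= D / (p - p0) by rewrite divr_ge0// ltW.
elim=> [|k ih]; first by rewrite expr0 mulr1; clra.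
apply: le_trans (hx k) _; set A := X + D / (p - p0) in ih *.
have qk : q ^+ k <= p ^+ k by rewrite lerXn2r ?nnegrE//; rewrite /p; clra.
have pk : 0 <= p ^+ k by rewrite exprn_ge0.
apply: (@le_trans _ _ (th * (A * p ^+ k) + D * p ^+ k)).
  by apply: lerD; apply: ler_wpM2l.
have -> : th * (A * p ^+ k) + D * p ^+ k = (th * A + D) * p ^+ k by ring.
rewrite exprS mulrA; apply: ler_wpM2r => //.
have A0 : 0 <= A by rewrite /A; clra.
have h1 : th * A <= p0 * A by apply: ler_wpM2r.
have h2 : D <= (p - p0) * A.
  rewrite {1}(_ : D = (p - p0) * (D / (p - p0))); last by rewrite mulrC divfK// lt0r_neq0.
  by apply: ler_wpM2l; [exact: ltW|rewrite /A; clra].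
by clra.
Qed.

Local Notation mu := (@lebesgue_measure R).
Local Notation mu2 := (mu \x mu)%E.

Lemma avg_cont (v : R -> R) M d x : measurable_fun setT v -> (forall x, `|v x| <= M) -> 0 < d ->
  (forall e, 0 < e -> exists2 dd, 0 < dd & forall z, `|z - x| <= dd -> `|v z - v x| <= e) ->
  forall e, 0 < e -> exists k0, forall k, (k0 <= k)%N -> `|avg (dl d k) v x - v x| <= e.
Proof.
move=> mv vM d0 hc e e0; have e2 : 0 < e / 2 by clra.
have [dd dd0 H] := hc _ e2; have dd2 : 0 < dd / 2 by clra.
have [k0 hk0] := dl_small d0 dd2; exists k0 => k kk.
have dk := dl_gt0 k d0; have := hk0 _ kk; set t := dl d k in dk * => lt.
have hI : L1b mu (fun z => ind (`|x - z| <= 2 * t)) (2 * (2 * t)) by apply: L1b_itv; clra.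
have D : L1b mu (fun z => ind (`|z - x| <= 2 * t) * `|v z - v x|) (e / 2 * (2 * (2 * t))).
  rewrite -[X in L1b _ _ (X * _)](ger0_norm (ltW e2)); apply: L1b_le1 (L1bZ (e / 2) hI); first by mes.
  move=> z; rewrite ger0_norm; last by nn.
  rewrite (distrC x); have [h|h] := leP `|z - x| (2 * t); last by rewrite /ind mul0r mulr0.
  by rewrite /ind mul1r mulr1; apply: H; clra.
apply: le_trans (avg_near mv vM dk D) _; rewrite ler_pdivrMr; clra.
Qed.

(** Campanato's argument at a single scale. Continuity makes the averages converge at every point,
    so the estimate holds at the given two points and not only off a null set. *)
Lemma telescope2 (v : R -> R) M d S q n : measurable_fun setT v -> (forall x, `|v x| <= M) -> 0 < d ->
  0 < S -> 0 < q -> q < 1 ->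
  (forall x e, 0 < e -> exists2 dd, 0 < dd & forall z, `|z - x| <= dd -> `|v z - v x| <= e) ->
  forall x y, `|x - y| <= dl d n ->
  (forall k, L1b mu2 (fun z => ind (`|z.1 - x| <= 3 * dl d k) * en v z) ((S * q ^+ k) ^+ 2)) ->
  (forall k, L1b mu2 (fun z => ind (`|z.1 - y| <= 3 * dl d k) * en v z) ((S * q ^+ k) ^+ 2)) ->
  `|v x - v y| <= (36 / (1 - q) + 6) * S * q ^+ n.
Proof.
move=> mv vM d0 S0 q0 q1 cv x y xy hx hy; have q' : 0 < 1 - q by clra.
have osc x' (H : forall k, L1b mu2 (fun z => ind (`|z.1 - x'| <= 3 * dl d k) * en v z) ((S * q ^+ k) ^+ 2)) k :
    [/\ `|avg (dl d k) v x' - avg (dl d k.+1) v x'| <= 18 * (S * q ^+ k) &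
     forall y, `|x' - y| <= dl d k -> `|avg (dl d k) v x' - avg (dl d k) v y| <= 6 * (S * q ^+ k) * (`|x' - y| / dl d k)].
  rewrite dlS; apply: (@avg_osc _ v M (dl d k) x' (S * q ^+ k)) => //; first exact: dl_gt0.
  by rewrite mulr_gt0// exprn_gt0.
have lim x' (H : forall k, L1b mu2 (fun z => ind (`|z.1 - x'| <= 3 * dl d k) * en v z) ((S * q ^+ k) ^+ 2)) :
    `|avg (dl d n) v x' - v x'| <= 18 * S * q ^+ n / (1 - q).
  have G k : `|avg (dl d k.+1) v x' - avg (dl d k) v x'| <= 18 * S * q ^+ k.
    by have [h _] := osc _ H k; rewrite distrC -mulrA.
  have [l hl] := geo_lim (g := fun k => avg (dl d k) v x') (ltW q0) q1 G.
  suff -> : v x' = l by exact: hl.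
  apply/eqP; rewrite -subr_eq0 -normr_le0; apply/ler_addgt0Pl => e e0; rewrite addr0.
  have e2 : 0 < e / 2 by clra.
  have [k0 hk0] := avg_cont mv vM d0 (cv x') e2.
  have qq : `|q| < 1 by rewrite ger0_norm// ltW.
  pose K := 18 * S / (1 - q); have K0 : 0 < K by rewrite divr_gt0// mulr_gt0.
  have eK : 0 < e / (2 * K) by rewrite divr_gt0// mulr_gt0.
  have /cvgrPdist_lt /(_ _ eK)[k1 _ hk1] := cvg_expr qq.
  pose k := maxn k0 k1.
  have h1 := hk0 k (leq_maxl _ _); have h2 := hk1 k (leq_maxr _ _).
  have h3 := hl k.
  rewrite /= sub0r normrN in h2; rewrite ger0_norm in h2; last exact: exprn_ge0 (ltW q0).
  have h4 : 18 * S * q ^+ k / (1 - q) <= e / 2.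
    rewrite (_ : 18 * S * q ^+ k / (1 - q) = K * q ^+ k); last by rewrite /K; ring.
    by have := ler_wpM2l (ltW K0) (ltW h2); rewrite (_ : K * (e / (2 * K)) = e / 2)//; field; rewrite lt0r_neq0.
  have := ler_normB (avg (dl d k) v x' - l) (avg (dl d k) v x' - v x').
  rewrite (_ : avg (dl d k) v x' - l - (avg (dl d k) v x' - v x') = v x' - l); last by ring.
  by clra.
have [_ o] := osc x hx n; have o1 := o y xy.
have dn := dl_gt0 n d0.
have r1 : `|x - y| / dl d n <= 1 by rewrite ler_pdivrMr// mul1r.
have Sq : 0 < S * q ^+ n by rewrite mulr_gt0// exprn_gt0.
have o2 : 6 * (S * q ^+ n) * (`|x - y| / dl d n) <= 6 * (S * q ^+ n).
  by rewrite ler_piMr// mulr_ge0// ltW.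
have l1 := lim x hx; have l2 := lim y hy.
have -> : v x - v y = - (avg (dl d n) v x - v x) + (avg (dl d n) v x - avg (dl d n) v y) + (avg (dl d n) v y - v y) by ring.
apply: le_trans (ler_normD _ _) _; have := ler_normD (- (avg (dl d n) v x - v x)) (avg (dl d n) v x - avg (dl d n) v y).
rewrite normrN (_ : (36 / (1 - q) + 6) * S * q ^+ n = 2 * (18 * S * q ^+ n / (1 - q)) + 6 * (S * q ^+ n)); last by field; exact: lt0r_neq0.
by clra.
Qed.

End Sequences.

(** * Hoelder exponent of a linear equation *)

Section Linear.
Variable R : realType.
Local Notation mu := (@lebesgue_measure R).
Local Notation mu2 := (mu \x mu)%E.
Variables (a W : R -> R) (Lam x0 rb r1 G sig d : R).
Implicit Types (phi : R -> R) (c rho h m : R).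
Hypotheses (ok : ker_ok a Lam) (gW : Good W) (W1 : forall x, `|W x| <= 1)
  (Wsupp : forall x, rb < `|x - x0| -> W x = 0) (rbr : rb < r1) (rb0 : 0 < rb)
  (G0 : 0 <= G) (sig0 : 0 < sig) (sig1 : sig < 1) (d0 : 0 < d)
  (dual : forall phi m c rho, Good phi -> 0 < rho -> rho <= d -> `|c - x0| <= r1 ->
     (forall x, `|phi x| <= m) -> (forall x, rho < `|x - c| -> phi x = 0) ->
     `|form a W phi| <= m * G * rho `^ sig)
  (cont : forall x e, 0 < e -> exists2 dd, 0 < dd & forall z, `|z - x| <= dd -> `|W z - W x| <= e).

Definition inc h x := W (x + h) - W x.

Lemma inc_Good h : Good (inc h).
Proof. by apply: GoodB => //; exact: Good_shift. Qed.

Lemma dual_inc h phi m c rho : 0 < h -> `|c - x0| + h <= r1 -> Good phi -> 0 < rho -> rho <= d ->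
  (forall x, `|phi x| <= m) -> (forall x, rho < `|x - c| -> phi x = 0) ->
  `|form a (inc h) phi| <= 2 * m * G * rho `^ sig.
Proof.
move=> h0 hc gp r0 rd pm p0.
have gs : Good (fun x => phi (x - h)) := Good_shift (- h) gp.
have d1 : `|form a W phi| <= m * G * rho `^ sig by apply: (dual gp r0 rd _ pm p0); clra.
have d2 : `|form a W (fun x => phi (x - h))| <= m * G * rho `^ sig.
  apply: (dual (c := c + h) gs r0 rd _ (fun x => pm (x - h))).
    by rewrite -addrA (addrC h) addrA; apply: le_trans (ler_normD _ _) _; rewrite (gtr0_norm h0).
  by move=> x; rewrite opprD addrA => hx; apply: p0; rewrite addrAC.
rewrite (form_diff h ok gW gp); apply: le_trans (ler_normB _ _) _; clra.
Qed.

Section OneIncrement.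
Variables (h m : R).
Hypotheses (h0 : 0 < h) (m0 : 0 < m) (vm : forall x, `|inc h x| <= m).

Let v := inc h.
Let th := (28 * Lam) ^+ 2 / (1 + (28 * Lam) ^+ 2).
Let q0 : R := 2^-1 `^ sig.

Lemma th_01 : 0 <= th /\ th < 1.
Proof.
have K := sqr_ge0 (28 * Lam); rewrite /th; move: ((28 * Lam) ^+ 2) K => X K.
by split; [apply: divr_ge0; clra|rewrite ltr_pdivrMr; clra].
Qed.

Lemma q0_01 : 0 <= q0 /\ q0 < 1.
Proof.
split; first exact: powR_ge0.
have e1 : 1 `^ sig = 1 :> R by rewrite powR1.
have := sig0 => s0.
by rewrite -e1; apply: gt0_ltr_powR; rewrite ?nnegrE; clra.
Qed.

(** Caccioppoli bounds the energy of the increment at radius [r0] by its supremum; hole filling then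
    makes it decay from scale to scale. *)
Lemma nuv_scales c r0 : 0 < r0 -> 4 * r0 <= d -> `|c - x0| + h <= r1 ->
  let p0 := Num.max th q0 in let p := (1 + p0) / 2 in
  forall k, L1b mu2 (fun z => ind (`|z.1 - c| <= dl r0 k) * en v z)
    ((192 * Lam ^+ 2 + 32 * Lam / (p - p0)) * (m ^+ 2 + m * G * r0 `^ sig) * p ^+ k).
Proof.
move=> r00 r0d hc p0 p k.
have [_ L1 _ _] := ok; have Lp : 0 < Lam by clra.
have gv := inc_Good h; have m0' := ltW m0.
have [t0 t1] := th_01; have [q00 q01] := q0_01; have s0 := sig0; have s1 := sig1.
have G0' := G0.
pose Y := m ^+ 2 + m * G * r0 `^ sig.
have P0 : 0 <= m * G * r0 `^ sig by rewrite !mulr_ge0// powR_ge0.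
have Y0 : 0 <= Y by rewrite /Y addr_ge0// sqr_ge0.
have ge1 c' s (s0' : 0 < s) : Good (eta c' s) := Good_eta c' s0'.
have X0 : nuv v c r0 <= 192 * Lam ^+ 2 * Y.
  have r2 : 0 < 2 * r0 by clra.
  have g2 : Good (fun x => eta c (2 * r0) x ^+ 2 * v x).
    by have := GoodM (GoodM (ge1 c _ r2) (ge1 c _ r2)) gv; rewrite (_ : (fun x => _) = (fun x => eta c (2 * r0) x ^+ 2 * v x)).
  have D : form a v (fun x => eta c (2 * r0) x ^+ 2 * v x) <= 8 * (m * G * r0 `^ sig).
    apply: le_trans (ler_norm _) _; apply: le_trans (dual_inc (m := m) (c := c) (rho := 4 * r0) h0 hc g2 _ r0d _ _) _.
    - by clra.
    - move=> x; rewrite normrM -[leRHS]mul1r; apply: ler_pM => //.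
      by rewrite ger0_norm ?sqr_ge0// expr_le1//; case/andP: (eta_01 c (2 * r0) x).
    - by move=> x hx; rewrite eta0 ?expr0n ?mul0r//=; clra.
    rewrite powR_split//; last exact: ltW.
    have p4 : 4 `^ sig <= 4 :> R.
      by rewrite -[leRHS](@powRr1 _ 4)//; apply: ler_powR; clra.
    have := ler_wpM2r P0 p4; clra.
  have := cacc_ball ok gv m0' vm r2 D; rewrite (_ : 2 * r0 / 2 = r0); last by field.
  move/L1b_Rint_le => H; apply: le_trans H _.
  have LL : Lam <= Lam ^+ 2 by rewrite expr2 ler_peMl// ltW.
  have L2 : 1 <= Lam ^+ 2 by clra.
  have M2 := sqr_ge0 m.
  have z1 := ler_wpM2r P0 LL; have z2 := ler_wpM2r M2 L2.
  have z3 : 0 <= Lam ^+ 2 * (m * G * r0 `^ sig) by rewrite mulr_ge0// sqr_ge0.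
  have z4 : 0 <= Lam ^+ 2 * m ^+ 2 by rewrite mulr_ge0// sqr_ge0.
  rewrite /Y; move: z1 z2 z3 z4; move: (m * G * r0 `^ sig) => Z; clra.
have rec j : nuv v c (dl r0 j.+1) <= th * nuv v c (dl r0 j) + 32 * Lam * Y * q0 ^+ j.
  have sp := dl_gt0 j.+1 r00; have e2 : dl r0 j = 2 * dl r0 j.+1 by rewrite dlS; field.
  have sd : dl r0 j <= r0 by exact: dl_le.
  pose D := 4 * (m * G * dl r0 j `^ sig).
  have D0 : 0 <= D by rewrite /D !mulr_ge0// powR_ge0.
  have HD y : form a v (fun x => eta c (dl r0 j.+1) x * (v x - v y)) <= D.
    have gk : Good (fun x => eta c (dl r0 j.+1) x * (v x - v y)).
      have -> : (fun x => eta c (dl r0 j.+1) x * (v x - v y)) =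
          (fun x => eta c (dl r0 j.+1) x * v x - v y * eta c (dl r0 j.+1) x) by apply/funext => x; ring.
      by apply: GoodB; [exact: GoodM (ge1 _ _ sp) gv|exact: GoodC (ge1 _ _ sp)].
    apply: le_trans (ler_norm _) _; apply: le_trans (dual_inc (m := 2 * m) (c := c) (rho := dl r0 j) h0 hc gk _ _ _ _) _.
    - exact: dl_gt0.
    - by clra.
    - move=> x; rewrite normrM -[leRHS]mul1r; apply: ler_pM => //.
        by rewrite ger0_norm; case/andP: (eta_01 c (dl r0 j.+1) x).
      by apply: le_trans (ler_normB _ _) _; have := vm x; have := vm y; rewrite -!/(v _); clra.
    - by move=> x; rewrite e2 => hx; rewrite eta0 ?mul0r// ltW.
    by apply: eqle; rewrite /D; ring.
  have := hole_step ok gv sp D0 HD; rewrite -e2 -/th => H; apply: le_trans H _; rewrite lerD2l /D.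
  have -> : dl r0 j `^ sig = r0 `^ sig * q0 ^+ j.
    have h2 : 0 <= 2^-1 :> R by rewrite invr_ge0.
    rewrite /dl -exprVn powRM ?exprn_ge0//; last exact: ltW.
    by rewrite /q0 -(powR_mulrn j (powR_ge0 _ _)) -(powR_mulrn j h2) powRAC.
  have qj : 0 <= q0 ^+ j by rewrite exprn_ge0.
  have -> : 4 * Lam * (4 * (m * G * (r0 `^ sig * q0 ^+ j))) = 16 * Lam * (m * G * r0 `^ sig) * q0 ^+ j by ring.
  apply: ler_wpM2r => //; rewrite -!(mulrA _ Lam); apply: ler_pM => //; [by rewrite mulr_ge0// ltW|clra|].
  by apply: ler_wpM2l; [exact: ltW|rewrite /Y lerDr sqr_ge0].
have X1 : 0 <= 192 * Lam ^+ 2 * Y by apply: mulr_ge0 => //; apply: mulr_ge0; [exact: ler0n|exact: sqr_ge0].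
have D1 : 0 <= 32 * Lam * Y by apply: mulr_ge0 => //; apply: mulr_ge0; [exact: ler0n|exact: ltW].
have x0' : nuv v c (dl r0 0) <= 192 * Lam ^+ 2 * Y by rewrite dl0.
have := seq_decay t0 t1 q00 q01 D1 X1 x0' rec => /(_ k); rewrite -/p0 -/p => H.
apply: L1b_weak (nuv_L1b gv c (dl r0 k)); apply: le_trans H _.
by apply: eqle; rewrite -/Y; ring.
Qed.

Lemma inc_cont x e : 0 < e -> exists2 dd, 0 < dd & forall z, `|z - x| <= dd -> `|v z - v x| <= e.
Proof.
move=> e0; have e2 : 0 < e / 2 by clra.
have [d1 d10 H1] := cont x e2; have [d2 d20 H2] := cont (x + h) e2.
exists (Num.min d1 d2); first by rewrite lt_min d10.
move=> z; rewrite le_min => /andP[z1 z2]; rewrite /v /inc.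
have := H1 _ z1; have := H2 (z + h); rewrite (_ : z + h - (x + h) = z - x); last by ring.
move=> /(_ z2) a1 a2.
have -> : W (z + h) - W z - (W (x + h) - W x) = (W (z + h) - W (x + h)) - (W z - W x) by ring.
by apply: le_trans (ler_normB _ _) _; clra.
Qed.

(** The increment is examined from a radius [2^n] times larger than [h] down to [h]. The [n] scales
    in between yield the factor [q^n], which can be made as small as desired at the price of [2^n]
    in front of [h]. *)
Lemma second_difference n x : 12 * (2 ^+ n * h) <= d -> `|x - x0| + 2 * h <= r1 ->
  forall p0 p q, p0 = Num.max th q0 -> p = (1 + p0) / 2 -> q = Num.sqrt p ->
  `|inc h (x + h) - inc h x| <= (36 / (1 - q) + 6) * Num.sqrt (192 * Lam ^+ 2 + 32 * Lam / (p - p0))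
     * (m + G * (3 * (2 ^+ n * h)) `^ sig) * q ^+ n.
Proof.
move=> hd hx p0 p q Ep0 Ep Eq; have [_ L1 _ _] := ok; have Lp : 0 < Lam by clra.
have h0' := h0; have G0' := G0.
have [t0 t1] := th_01; have [q00 q01] := q0_01.
have a1 : th <= p0 by rewrite Ep0 le_max lexx.
have a3 : p0 < 1 by rewrite Ep0 gt_max t1.
have pp : 0 < p - p0 by rewrite Ep; clra.
have p_gt0 : 0 < p by rewrite Ep; clra.
have p_lt1 : p < 1 by rewrite Ep; clra.
have qp : 0 < q by rewrite Eq sqrtr_gt0.
have q2 : q ^+ 2 = p by rewrite Eq sqr_sqrtr// ltW.
have ql : q < 1 by rewrite -(@ltr_pXn2r _ 2)// ?nnegrE ?ltW// q2 expr1n.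
pose A := 192 * Lam ^+ 2 + 32 * Lam / (p - p0).
have A0 : 0 < A.
  by apply: addr_gt0; [apply: mulr_gt0; [exact: ltr0n|exact: exprn_gt0]|apply: divr_gt0 => //; exact: mulr_gt0].
pose r0 := 3 * (2 ^+ n * h).
have two : 0 < 2 ^+ n :> R by rewrite exprn_gt0.
have r00 : 0 < r0 by rewrite /r0 !mulr_gt0.
have r0d : 4 * r0 <= d by rewrite /r0; clra.
pose B := m + G * r0 `^ sig.
have B0 : 0 < B by rewrite /B ltr_wpDr// mulr_ge0// powR_ge0.
pose S := Num.sqrt A * B.
have S0 : 0 < S by rewrite mulr_gt0// sqrtr_gt0.
have r3 : 0 < r0 / 3 by rewrite divr_gt0.
have hn : dl (r0 / 3) n = h by rewrite /dl /r0; move: (2 ^+ n : R) two => X X0; field; exact: lt0r_neq0.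
have d3 k : 3 * dl (r0 / 3) k = dl r0 k.
  by rewrite /dl; have := exprn_gt0 k (ltr0n R 2); move: (2 ^+ k : R) => X X0; field; exact: lt0r_neq0.
have Hc c : `|c - x0| + h <= r1 -> forall k, L1b mu2 (fun z => ind (`|z.1 - c| <= 3 * dl (r0 / 3) k) * en v z) ((S * q ^+ k) ^+ 2).
  move=> hc k; rewrite d3; move: (nuv_scales r00 r0d hc k) => /=; rewrite -Ep0 -Ep; apply: L1b_weak.
  rewrite exprMn /S exprMn sqr_sqrtr; last exact: ltW.
  rewrite -exprM mulnC exprM q2; apply: ler_wpM2r; first by rewrite exprn_ge0// ltW.
  rewrite -/A; apply: ler_wpM2l; first exact: ltW.
  have : 0 <= G * r0 `^ sig by rewrite mulr_ge0// powR_ge0.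
  rewrite /B -mulrA; move: (G * r0 `^ sig) => X X0.
  have mX : 0 <= m * X by rewrite mulr_ge0// ltW.
  by have := sqr_ge0 X; move: mX; clra.
have gv := inc_Good h; have [mv _ _] := gv.
have hx1 : `|x - x0| + h <= r1 by clra.
have hx2 : `|x + h - x0| + h <= r1.
  have : `|x + h - x0| <= `|x - x0| + `|h| by rewrite addrAC; exact: ler_normD.
  by rewrite (gtr0_norm h0); clra.
have xy : `|x + h - x| <= dl (r0 / 3) n by rewrite hn addrC addKr gtr0_norm.
have := telescope2 mv vm r3 S0 qp ql inc_cont xy (Hc _ hx2) (Hc _ hx1).
by rewrite /S -/v -/A -/r0 -/B -!mulrA.
Qed.

End OneIncrement.

(** Let [f h] be the supremum of the increments of step [h]. An increment of step [h] is half one of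
    step [2 h] minus half a second difference, and the latter is at most [del * f h + K * h^sig].
    Hence [f h] is at most [f (2 h) / (2 - del)] plus a multiple of [h^sig], and for small [del] the
    power [h^sig] itself survives the iteration. *)
Lemma linear_holder : exists C, forall x y, `|W x - W y| <= C * `|x - y| `^ sig.
Proof.
have [_ L1 _ _] := ok; have s0 := sig0; have s1 := sig1; have d0' := d0; have rbr' := rbr; have G0' := G0.
pose th : R := (28 * Lam) ^+ 2 / (1 + (28 * Lam) ^+ 2); pose q0 : R := 2^-1 `^ sig.
pose p0 := Num.max th q0; pose p := (1 + p0) / 2; pose q := Num.sqrt p.
pose B := (36 / (1 - q) + 6) * Num.sqrt (192 * Lam ^+ 2 + 32 * Lam / (p - p0)).
have two_s : 2 `^ sig < 2 :> R.
  have l2 : 0 < ln (2 : R) by rewrite ln_gt0; clra.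
  by rewrite -ltr_ln ?posrE ?powR_gt0// ln_powR; cnra.
have two_1 : 1 <= 2 `^ sig :> R.
  by rewrite -[leLHS](@powRr0 _ 2); apply: ler_powR; clra.
(* Then [2^sig / (2 - del) < 1], which [decay_pow_exact] asks for with exponent [sig]. *)
pose del := (2 - 2 `^ sig) / 2; have del0 : 0 < del by rewrite /del; clra.
have del1 : del <= 1 / 2 by rewrite /del; clra.
have [t0 t1] := th_01; have [q00 q01] := q0_01; rewrite -/th in t0 t1; rewrite -/q0 in q00 q01.
have a3 : p0 < 1 by rewrite gt_max t1.
have a1 : 0 <= p0 by rewrite le_max t0.
have p_gt0 : 0 < p by rewrite /p; clra.
have qp : 0 < q by rewrite sqrtr_gt0.
have q2 : q ^+ 2 = p by rewrite sqr_sqrtr// ltW.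
have ql : q < 1 by rewrite -(@ltr_pXn2r _ 2)// ?nnegrE ?ltW// q2 expr1n /p; clra.
have B0 : 0 <= B by rewrite /B mulr_ge0 ?sqrtr_ge0// addr_ge0// divr_ge0//; clra.
have [n hn] : exists n, B * q ^+ n <= del.
  have qq : `|q| < 1 by rewrite ger0_norm// ltW.
  have eB : 0 < del / (B + 1) by rewrite divr_gt0//; clra.
  have /cvgrPdist_lt /(_ _ eB)[k1 _ /(_ k1 (leqnn k1))] := cvg_expr qq.
  rewrite /= sub0r normrN ger0_norm ?(exprn_ge0 _ (ltW qp))// => h2; exists k1.
  apply: (@le_trans _ _ (B * (del / (B + 1)))); first by apply: ler_wpM2l => //; exact: ltW.
  by rewrite mulrCA ler_piMr// ?(ltW del0)// ler_pdivrMr; clra.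
have two : 0 < 2 ^+ n :> R by rewrite exprn_gt0.
pose h1 := Num.min (d / (12 * 2 ^+ n)) ((r1 - rb) / 5).
have h10 : 0 < h1 by rewrite lt_min divr_gt0 ?mulr_gt0//=; clra.
pose K := del * (G * (3 * 2 ^+ n) `^ sig).
have K0 : 0 <= K by apply: mulr_ge0; [exact: ltW|apply: mulr_ge0 => //; exact: powR_ge0].
have D2W h m x : 0 < h -> h <= h1 -> 0 < m -> (forall x, `|inc h x| <= m) ->
    `|inc h (x + h) - inc h x| <= del * m + K * h `^ sig.
  move=> h0 hh m0 vm; have R0 : 0 <= del * m + K * h `^ sig.
    by apply: addr_ge0; apply: mulr_ge0; [exact: ltW|exact: ltW|exact: K0|exact: powR_ge0].
  have hd : 12 * (2 ^+ n * h) <= d.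
    have : h <= d / (12 * 2 ^+ n) by apply: le_trans hh _; rewrite ge_min lexx.
    by rewrite ler_pdivlMr ?mulr_gt0//; clra.
  have hr : h <= (r1 - rb) / 5 by apply: le_trans hh _; rewrite ge_min lexx orbT.
  (* Outside this range [second_difference] does not apply, but as [h <= (r1 - rb) / 5] the points
     [x], [x + h] and [x + 2 h] all miss the support of [W]. *)
  have [hx|hx] := leP (`|x - x0| + 2 * h) r1.
    have := second_difference h0 m0 vm hd hx (erefl p0) (erefl p) (erefl q); rewrite -/B => H; apply: le_trans H _.
    have -> : 3 * (2 ^+ n * h) = 3 * 2 ^+ n * h by ring.
    rewrite [(3 * 2 ^+ n * h) `^ _]powRM; [|by rewrite mulr_ge0// ltW|exact: ltW].
    rewrite mulrAC; set X := m + _.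
    have X0 : 0 <= X by rewrite /X addr_ge0 ?mulr_ge0 ?powR_ge0// ltW.
    apply: le_trans (ler_wpM2r X0 hn) _; apply: eqle; rewrite /X /K; ring.
  have far t : 0 <= t -> t <= 2 * h -> W (x + t) = 0.
    move=> t0' t2; apply: Wsupp; have := ler_normD (x + t - x0) (- t).
    by rewrite (_ : x + t - x0 - t = x - x0); [rewrite normrN (ger0_norm t0'); clra|ring].
  have e0 : W x = 0 by have := far 0; rewrite addr0; apply; clra.
  have e1 : W (x + h) = 0 by apply: far; clra.
  have e2 : W (x + h + h) = 0 by rewrite -addrA; apply: far; clra.
  by rewrite /inc e0 e1 e2 !subrr normr0.
pose f h := sup [set y | exists x, y = `|inc h x|].
have inc2 h x : `|inc h x| <= 2.
  by apply: le_trans (ler_normB _ _) _; have := W1 (x + h); have := W1 x; clra.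
have hs h : has_sup [set y | exists x, y = `|inc h x|].
  by split; [exists `|inc h 0|, 0|exists 2 => _ [x ->]].
have fub h x : `|inc h x| <= f h by apply: ub_le_sup; [case: (hs h)|exists x].
have fle h (M : R) : (forall x, `|inc h x| <= M) -> f h <= M.
  by move=> H; apply: ge_sup; [case: (hs h)|move=> _ [x ->]].
have f0 h : 0 <= f h := le_trans (normr_ge0 _) (fub h 0).
have rec h : 0 < h -> 2 * h <= h1 -> f h <= (2 - del)^-1 * f (2 * h) + K * h `^ sig.
  move=> h0 hh; have hh' : h <= h1 by clra.
  have P0 := powR_ge0 h sig; have KP := mulr_ge0 K0 P0.
  have main : f h <= f (2 * h) / 2 + (del * f h + K * h `^ sig) / 2.
    apply/ler_addgt0Pl => e e0; apply: fle => x.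
    (* The estimate needs a positive bound on the increments, while [f h] may vanish. *)
    have fm : 0 < f h + e by have := f0 h; clra.
    have vm y : `|inc h y| <= f h + e by have := fub h y; clra.
    have := D2W h _ x h0 hh' fm vm => H.
    have -> : inc h x = inc (2 * h) x / 2 - (inc h (x + h) - inc h x) / 2.
      by rewrite /inc (_ : x + 2 * h = x + h + h); [field|ring].
    apply: le_trans (ler_normB _ _) _; rewrite !normrM (ger0_norm (_ : 0 <= 2^-1)) ?invr_ge0//.
    have := fub (2 * h) x; have : del * e <= e by rewrite ler_piMl//; clra.
    clra.
  have d2 : 0 < 2 - del by clra.
  rewrite -(ler_pM2l d2) mulrDr mulrA mulfV ?mul1r ?lt0r_neq0//.
  have : K * h `^ sig <= (2 - del) * (K * h `^ sig) by rewrite ler_peMl//; clra.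
  clra.
have ht : (2 - del)^-1 * 2 `^ sig < 1 by rewrite mulrC ltr_pdivrMr /del; clra.
have di : 0 <= (2 - del)^-1 by rewrite invr_ge0; clra.
have two_gt1 : (1 : R) < 2 by clra.
have two_ge0 : (0 : R) <= 2 by clra.
have [A A0 HA] := decay_pow_exact di K0 s0 h10 two_ge0 two_gt1 ht.
have HF h : 0 < h -> h <= h1 -> f h <= A * h `^ sig.
  by apply: HA => // h' _ _; exact: fle.
pose C := A + 2 / h1 `^ sig.
have C2 : 0 <= 2 / h1 `^ sig by rewrite divr_ge0// powR_ge0.
exists C => x y; wlog xy : x y / x <= y.
  move=> H; have [h|h] := leP x y; first exact: H.
  by rewrite distrC (distrC x); apply: H; exact: ltW.
have [->|nxy] := eqVneq x y; first by rewrite !subrr normr0 mulr_ge0 ?powR_ge0// /C addr_ge0// ltW.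
have h0 : 0 < y - x by rewrite subr_gt0 lt_neqAle nxy.
rewrite distrC (distrC x) (gtr0_norm h0).
have -> : W y - W x = inc (y - x) x by rewrite /inc (_ : x + (y - x) = y)//; ring.
have P0 := powR_ge0 (y - x) sig.
apply: le_trans (fub _ _) _; have [hh|hh] := leP (y - x) h1.
  apply: le_trans (HF _ h0 hh) _; apply: ler_wpM2r => //; rewrite /C lerDl//.
apply: (@le_trans _ _ 2); first exact: fle.
rewrite /C mulrDl; apply: ler_wpDl; first by rewrite mulr_ge0// ltW.
have P1 : 0 < h1 `^ sig by exact: powR_gt0.
rewrite mulrAC ler_pdivlMr// ler_wpM2l//; apply: powR_base_le; exact: ltW.
Qed.

End Linear.

(** * From Hoelder continuity to energy decay *)

Section Tail.
Variable R : realType.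
Local Notation mu := (@lebesgue_measure R).
Local Notation mu2 := (mu \x mu)%E.
Implicit Types (s rho : R).

Definition Ct s : R := 4 / (1 - 2 `^ (s - 1)) + 2.

Lemma two_pow_lt1 s : s < 1 -> 2 `^ (s - 1) < 1 :> R.
Proof.
move=> s1; have l2 : 0 < ln (2 : R) by rewrite ln_gt0; clra.
by rewrite -ltr_ln ?posrE ?powR_gt0// ln_powR ln1; cnra.
Qed.

Lemma Ct_ge0 s : s < 1 -> 0 <= Ct s.
Proof. by move=> /two_pow_lt1 h; rewrite /Ct addr_ge0// divr_ge0// subr_ge0 ltW. Qed.

Lemma powR_m1 (x s : R) : 0 < x -> x `^ (s - 1) = x `^ s / x.
Proof.
move=> x0; rewrite powRD; last by rewrite (gt_eqF x0) implybT.
by rewrite powR_inv1// ltW.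
Qed.

(** A sum of far kernels over dyadic radii from [rho] to 1, with the value of [|x - y|^s] frozen on
    each shell, plus the kernel beyond distance 1. The row integrals form a geometric series of
    ratio [2^(s - 1)]. *)
Lemma tail_kernel s rho : 0 <= s -> s < 1 -> 0 < rho -> rho <= 1 ->
  exists J : R * R -> R, [/\ measurable_fun setT J, forall z, 0 <= J z, forall x y, J (x, y) = J (y, x),
    forall x, L1b mu (fun y => J (x, y)) (Ct s * rho `^ (s - 1)) &
    forall x y, rho <= `|x - y| -> Num.min 1 (`|x - y| `^ s) / (x - y) ^+ 2 <= J (x, y)].
Proof.
move=> s0 s1 r0 r1; have t1 := two_pow_lt1 s1; have t0 : 0 < 2 `^ (s - 1) :> R by exact: powR_gt0.
set t := 2 `^ (s - 1) in t0 t1.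
have [K hK] : exists K, 1 <= 2 ^+ K * rho.
  have [n0 hn] := dl_small (ltr01 : 0 < (1 : R)) r0; exists n0.
  have := hn _ (leqnn n0); rewrite /dl ltr_pdivrMr ?exprn_gt0// mulrC; exact: ltW.
pose w k := (2 ^+ k.+1 * rho) `^ s.
have X0 k : 0 < 2 ^+ k * rho by rewrite mulr_gt0// exprn_gt0.
pose J z := \sum_(0 <= k < K) w k * Jfar (2 ^+ k * rho) z + Jfar 1 z.
have w0 k : 0 <= w k by exact: powR_ge0.
exists J; split.
- rewrite /J; apply: mes_D; last exact: mes_Jfar.
  by apply: mes_sum => k; apply: mes_M; [exact: mes_cst|exact: mes_Jfar].
- move=> z; rewrite /J addr_ge0 ?Jfar_ge0//; apply: sumr_ge0 => k _.
  by rewrite mulr_ge0 ?Jfar_ge0.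
- move=> x y; rewrite /J Jfar_sym; congr (_ + _); apply: eq_bigr => k _; by rewrite Jfar_sym.
- move=> x; have hs := @L1b_sum _ _ _ mu _ (index_iota 0 K) xpredT _ _ (fun k _ => L1bZ (w k) (L1b_Jfar x (X0 k))).
  apply: (@L1b_weak _ _ _ _ _ _ _ _ (L1bD hs (L1b_Jfar x ltr01))).
  have rs : 1 <= rho `^ (s - 1).
    by rewrite -[leLHS](@powRr0 _ rho); apply: powR_exp_le => //; clra.
  have -> : \sum_(0 <= k < K) `|w k| * (2 / (2 ^+ k * rho)) = 2 * 2 `^ s * rho `^ (s - 1) * \sum_(0 <= k < K) t ^+ k.
    rewrite mulr_sumr; apply: eq_bigr => k _; rewrite ger0_norm// /w exprS -mulrA powR_split//; last exact: ltW.
    have -> : t ^+ k = (2 ^+ k) `^ (s - 1).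
      by rewrite /t -(powR_mulrn k (powR_ge0 _ _)) -[X in _ = X `^ _](powR_mulrn k (ler0n _ _)) powRAC.
    rewrite -(mulrA (2 * 2 `^ s)).
    have -> : rho `^ (s - 1) * (2 ^+ k) `^ (s - 1) = (2 ^+ k * rho) `^ s / (2 ^+ k * rho).
      by rewrite mulrC -powRM ?exprn_ge0// ?(ltW r0)// powR_m1.
    ring.
  have s2 : 2 `^ s <= 2 :> R by rewrite -[leRHS](@powRr1 _ 2)//; apply: ler_powR; clra.
  have g := geom_le K (ltW t0) t1; have g0 : 0 <= \sum_(0 <= k < K) t ^+ k by apply: sumr_ge0 => k _; exact: exprn_ge0 (ltW t0).
  have rs0 := powR_ge0 rho (s - 1).
  rewrite /Ct [in leRHS]mulrDl divr1; apply: lerD; last by clra.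
  rewrite -/t mulrAC; apply: ler_pM => //; first by rewrite !mulr_ge0// powR_ge0.
  by apply: ler_pM => //; clra.
move=> x y h; rewrite /J; have l0 : 0 < `|x - y| by clra.
have isq := isq_ge0 (x - y).
have S0 : 0 <= \sum_(0 <= k < K) w k * Jfar (2 ^+ k * rho) (x, y).
  by apply: sumr_ge0 => k _; rewrite mulr_ge0 ?Jfar_ge0.
have [hl|hl] := leP 1 `|x - y|.
  apply: ler_wpDl => //; rewrite /Jfar/= hl /ind mul1r -[leRHS]mul1r; apply: ler_wpM2r; first exact: isq.
  by rewrite ge_min lexx.
apply: ler_wpDr; first exact: Jfar_ge0.
have exP : exists n, `|x - y| < 2 ^+ n * rho by exists K; clra.
case: (ex_minnP exP) => -[|k] Pk mink; first by move: Pk; rewrite expr0 mul1r; clra.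
have lk : 2 ^+ k * rho <= `|x - y| by rewrite leNgt; apply/negP => /mink; rewrite ltnn.
have kK : (k < K)%N by apply: mink; clra.
apply: le_trans (term_le_sum (fun j => mulr_ge0 (w0 j) (Jfar_ge0 (2 ^+ j * rho) (x, y))) kK).
rewrite /Jfar/= lk /ind mul1r; apply: ler_wpM2r => //.
rewrite ge_min; apply/orP; right; rewrite /w; apply: powR_base_le => //; exact: ltW.
Qed.

End Tail.

Section HolderEnergy.
Variable R : realType.
Local Notation mu := (@lebesgue_measure R).
Local Notation mu2 := (mu \x mu)%E.
Variables (a W : R -> R) (Lam x0 r1 G sg tau d C : R).
Implicit Types (phi : R -> R) (c rho h m : R).
Hypotheses (ok : ker_ok a Lam) (gW : Good W) (W1 : forall x, `|W x| <= 1)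
  (G0 : 0 <= G) (sg0 : 0 < sg) (sg1 : 2 * sg < 1) (sgt : sg <= tau) (d0 : 0 < d) (d1 : d <= 1)
  (dual : forall phi m c rho, Good phi -> 0 < rho -> rho <= d -> `|c - x0| <= r1 ->
     (forall x, `|phi x| <= m) -> (forall x, rho < `|x - c| -> phi x = 0) ->
     `|form a W phi| <= m * G * rho `^ tau)
  (Hol : forall x y, `|W x - W y| <= C * `|x - y| `^ sg).

(** The doubling: in Caccioppoli's inequality for [W - W c] the cut-off terms are quadratic in an
    oscillation of order [rho^sg], and the right hand side gives [rho^sg * rho^tau] with
    [sg <= tau]. *)
Lemma holder_energy : exists2 A, 0 <= A & forall c rho, `|c - x0| <= r1 -> 0 < rho -> 4 * rho <= d ->
  L1b mu2 (fun z => ind (`|z.1 - c| <= rho) * en W z) (A * rho `^ (2 * sg)).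
Proof.
have [_ L1 _ _] := ok; have Lp : 0 <= Lam by clra.
have s0 := sg0; have s1 := sg1; have st := sgt; have d0' := d0; have d1' := d1; have G0' := G0.
have sl1 : sg < 1 by clra.
(* The value 2 covers distant pairs, where only [|W| <= 1] is used. *)
pose C' := Num.max 2 C.
have C2 : 2 <= C' by rewrite le_max lexx.
have CC : C <= C' by rewrite le_max lexx orbT.
have dW x y : `|W x - W y| <= C' * Num.min 1 (`|x - y| `^ sg).
  have [h|h] := leP 1 (`|x - y| `^ sg).
    by rewrite mulr1; apply: le_trans (ler_normB _ _) _; have := W1 x; have := W1 y; clra.
  by apply: le_trans (Hol x y) _; apply: ler_wpM2r => //; exact: powR_ge0.
have Cp : 0 <= C' by clra.
have k1 := Ct_ge0 sl1; have k2 := Ct_ge0 s1.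
pose A := Lam * (4 * (C' * G) + Lam * (32 * C' ^+ 2 * (8 + Ct sg))) + C' ^+ 2 * (2 * Ct (2 * sg)).
have A0 : 0 <= A.
  apply: addr_ge0; apply: mulr_ge0 => //; [|exact: sqr_ge0|exact: mulr_ge0].
  apply: addr_ge0; first by rewrite !mulr_ge0.
  by rewrite !mulr_ge0 ?sqr_ge0// addr_ge0.
exists A => // c rho hc r0 rd.
pose Rr := 2 * rho; have R0 : 0 < Rr by rewrite /Rr; clra.
have R1 : Rr <= 1 by rewrite /Rr; clra.
pose v x := W x - W c.
have gv : Good v.
  case: gW => mW [M hM] [P hP]; split; first by rewrite /v; mes.
    by exists (M + M) => x; apply: le_trans (ler_normB _ _) _; exact: lerD.
  by exists P; apply: L1b_eq hP => z; rewrite /en /v; congr (_ ^+ 2 / _); ring.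
have [mv _ _] := gv; have [mW _ _] := gW.
pose q := (2 * Rr) `^ sg; have q0 : 0 <= q by exact: powR_ge0.
have vloc x : `|x - c| <= 2 * Rr -> `|v x| <= C' * q.
  move=> hx; apply: le_trans (dW x c) _; apply: ler_wpM2l => //; rewrite ge_min; apply/orP; right.
  by apply: powR_base_le => //; exact: ltW.
have q2 : q * q <= 4 * rho `^ (2 * sg).
  have RR : 0 < 2 * Rr by clra.
  rewrite /q -powRD; last by rewrite (gt_eqF RR) implybT.
  rewrite (_ : sg + sg = 2 * sg); last by ring.
  rewrite /Rr mulrA (_ : 2 * 2 * rho = 4 * rho); last by ring.
  rewrite powR_split//; last exact: ltW.
  apply: ler_wpM2r; first exact: powR_ge0.
  by rewrite -[leRHS](@powRr1 _ 4)//; apply: ler_powR; clra.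
have ge := Good_eta c R0.
have g2 : Good (fun x => eta c Rr x ^+ 2 * v x).
  by have := GoodM (GoodM ge ge) gv; rewrite (_ : (fun x => _) = (fun x => eta c Rr x ^+ 2 * v x)).
have D : form a v (fun x => eta c Rr x ^+ 2 * v x) <= C' * G * (q * q).
  have -> : form a v (fun x => eta c Rr x ^+ 2 * v x) = form a W (fun x => eta c Rr x ^+ 2 * v x).
    by apply: Rint_ext => z; congr (_ * _ * _); rewrite /v; ring.
  apply: le_trans (ler_norm _) _; apply: le_trans (dual (m := C' * q) (c := c) (rho := 2 * Rr) g2 _ _ hc _ _) _.
  - by clra.
  - by rewrite /Rr; clra.
  - move=> x; rewrite normrM; have [hx|hx] := leP `|x - c| (2 * Rr); last first.
      by rewrite eta0 ?expr0n/= ?normr0 ?mul0r ?mulr_ge0// ltW.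
    rewrite -[leRHS]mul1r; apply: ler_pM => //; last exact: vloc.
    by rewrite ger0_norm ?sqr_ge0// expr_le1//; case/andP: (eta_01 c Rr x).
  - by move=> x hx; rewrite eta0 ?expr0n ?mul0r//= ltW.
  have -> : C' * q * G * (2 * Rr) `^ tau = C' * G * (q * (2 * Rr) `^ tau) by ring.
  apply: ler_wpM2l; first exact: mulr_ge0.
  by apply: ler_wpM2l => //; apply: powR_exp_le => //; rewrite /Rr; clra.
have [J [mJ J0 sJ hJ Jb]] := tail_kernel (ltW s0) sl1 R0 R1.
(* One factor [|v|] is at most [C' * q] on the support of the cut-off; the other exceeds this by the
   Hoelder modulus of the pair, which costs the tail kernel [J] for distant pairs. *)
pose Q z := C' ^+ 2 * q * (2 * q * Jmix Rr z + J z).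
have mM := mes_Jmix Rr.
have mQ : measurable_fun setT Q.
  by apply: mes_M; [exact: mes_cst|apply: mes_D => //; apply: mes_M => //; exact: mes_cst].
have Q0 z : 0 <= Q z.
  by rewrite /Q mulr_ge0 ?mulr_ge0 ?sqr_ge0// addr_ge0// !mulr_ge0// Jmix_ge0.
have sQ x y : Q (x, y) = Q (y, x) by rewrite /Q Jmix_sym sJ.
have hQ x : L1b mu (fun y => Q (x, y)) (C' ^+ 2 * q * ((8 + Ct sg) * (q / Rr))).
  have := L1bZ (C' ^+ 2 * q) (L1bD (L1bZ (2 * q) (L1b_Jmix x R0)) (hJ x)).
  have cq : 0 <= C' ^+ 2 * q by rewrite mulr_ge0// sqr_ge0.
  apply: L1b_weak; rewrite !ger0_norm//; last by rewrite mulr_ge0.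
  apply: ler_wpM2l => //; rewrite [in leRHS]mulrDl; apply: lerD; first by apply: eqle; field; exact: lt0r_neq0.
  apply: ler_wpM2l => //; rewrite powR_m1//; apply: ler_wpM2r; first by rewrite invr_ge0 ltW.
  by apply: powR_base_le; [exact: ltW|clra|exact: ltW].
have hi : L1b mu (fun x => ind (`|c - x| <= 2 * Rr)) (2 * (2 * Rr)) by apply: L1b_itv; clra.
have X : L1b mu2 (fun z => `|v z.1 * v z.2| * en (eta c Rr) z) (8 * C' ^+ 2 * (8 + Ct sg) * (q * q)).
  apply: (@L1b_weak _ _ _ _ _ _ _ _ (L1b_le2 _ _ (L1b_both mQ sQ hQ hi))).
  - by apply: eqle; field; exact: lt0r_neq0.
  - by have := mes_en (mes_eta c Rr) => ?; mes.
  move=> x y /=; rewrite ger0_norm; last by nn.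
  have half x' y' : `|c - x'| <= 2 * Rr -> `|v x' * v y'| * en (eta c Rr) (x', y') <= Q (x', y').
    move=> hx; rewrite distrC in hx; have vx := vloc _ hx.
    have vy : `|v y'| <= C' * q + C' * Num.min 1 (`|x' - y'| `^ sg).
      have -> : v y' = v x' - (W x' - W y') by rewrite /v; ring.
      by apply: le_trans (ler_normB _ _) _; apply: lerD => //; exact: dW.
    have Jm := Jmix_ge0 Rr (x', y'); have hd := deta_sq c x' y' R0.
    have mn : 0 <= Num.min 1 (`|x' - y'| `^ sg) by rewrite le_min ler01 powR_ge0.
    have e0 : 0 <= en (eta c Rr) (x', y') := en_ge0 _ _.
    rewrite normrM; apply: (@le_trans _ _ (C' * q * (C' * q + C' * Num.min 1 (`|x' - y'| `^ sg)) * en (eta c Rr) (x', y'))).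
      by apply: ler_wpM2r => //; apply: ler_pM.
    have cq0 : 0 <= C' ^+ 2 * q by rewrite mulr_ge0// sqr_ge0.
    have -> : C' * q * (C' * q + C' * Num.min 1 (`|x' - y'| `^ sg)) * en (eta c Rr) (x', y') =
      C' ^+ 2 * q * (q * en (eta c Rr) (x', y') + Num.min 1 (`|x' - y'| `^ sg) * en (eta c Rr) (x', y')) by ring.
    apply: ler_wpM2l => //.
    have z1 : q * en (eta c Rr) (x', y') <= q * Jmix Rr (x', y') by apply: ler_wpM2l.
    have z2 : Num.min 1 (`|x' - y'| `^ sg) * en (eta c Rr) (x', y') <= q * Jmix Rr (x', y') + J (x', y').
      have [hl|hl] := leP `|x' - y'| Rr.
        apply: ler_wpDr; first exact: J0.
        apply: ler_pM => //; rewrite ge_min; apply/orP; right; apply: powR_base_le => //; [clra|exact: ltW].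
      apply: ler_wpDl; first by rewrite mulr_ge0.
      apply: le_trans (Jb _ _ (ltW hl)); apply: ler_wpM2l => //.
      rewrite /en/= -[leRHS]mul1r; apply: ler_wpM2r; first exact: isq_ge0.
      have := eta_01 c Rr x'; have := eta_01 c Rr y'; cnra.
    by clra.
  have [hx|hx] := leP `|c - x| (2 * Rr).
    apply: le_trans (half _ _ hx) _; apply: ler_peMl => //; by rewrite [ind true]/ind lerDl ind_ge0.
  have [hy|hy] := leP `|c - y| (2 * Rr).
    have H := half _ x hy; rewrite -(sQ x y) (mulrC (v y)) in H.
    apply: (@le_trans _ _ (Q (x, y))); last by apply: ler_peMl => //; rewrite [ind true]/ind lerDr ind_ge0.
    apply: le_trans H; apply: eqle; congr (_ * _).
    by rewrite /en/= -(sqrrN (x - y)) opprB -(sqrrN (eta c Rr x - _)) opprB.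
  by rewrite /en/= !eta0 ?subrr ?expr0n/= ?mul0r ?mulr0 ?addr0 ?mul0r// distrC ltW.
have H := caccioppoli ok gv R0 D X.
have s20 : 0 <= 2 * sg by clra.
have r11 : rho <= 1 by clra.
have [J2 [mJ2 J20 sJ2 hJ2 Jb2]] := tail_kernel s20 s1 r0 r11.
have hi2 : L1b mu (fun x => ind (`|c - x| <= rho)) (2 * rho) by apply: L1b_itv; clra.
have F := L1bZ (C' ^+ 2) (L1b_ker mJ2 hJ2 hi2).
apply: (@L1b_weak _ _ _ _ _ _ _ _ (L1b_le2 _ _ (L1bD H F))).
- rewrite (ger0_norm (sqr_ge0 C')) powR_m1//.
  have -> : 2 * rho * (Ct (2 * sg) * (rho `^ (2 * sg) / rho)) = 2 * Ct (2 * sg) * rho `^ (2 * sg) by field; exact: lt0r_neq0.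
  rewrite /A [in leRHS]mulrDl; apply: lerD; last by apply: eqle; ring.
  rewrite -[leRHS]mulrA; apply: ler_wpM2l => //.
  have cg : 0 <= C' * G by exact: mulr_ge0.
  have cc : 0 <= Lam * (8 * C' ^+ 2 * (8 + Ct sg)) by rewrite !mulr_ge0 ?sqr_ge0// addr_ge0.
  have := ler_wpM2l cg q2; have := ler_wpM2l cc q2; clra.
- by have := mes_en mW => ?; mes.
move=> x y /=; rewrite ger0_norm; last by nn.
have F0 : 0 <= C' ^+ 2 * (ind (`|c - x| <= rho) * J2 (x, y)) by rewrite !mulr_ge0 ?sqr_ge0 ?ind_ge0.
have E0 := en_ge0 (fun x => eta c Rr x * v x) (x, y).
have [hx|hx] := leP `|x - c| rho; last by rewrite {1}/ind mul0r addr_ge0.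
rewrite {1}/ind mul1r; have [hy|hy] := leP `|y - c| Rr.
  apply: ler_wpDr => //; apply: eqle; rewrite /en/= !eta1 ?mul1r//; last by rewrite /Rr; clra.
  by rewrite /v; congr (_ ^+ 2 / _); ring.
apply: ler_wpDl => //; rewrite (distrC c) hx /ind mul1r.
have hl : rho <= `|x - y|.
  by have := ler_normD (y - x) (x - c); rewrite addrA subrK (distrC y x); move: hy; rewrite /Rr; clra.
apply: (@le_trans _ _ (C' ^+ 2 * (Num.min 1 (`|x - y| `^ (2 * sg)) / (x - y) ^+ 2))); last first.
  by apply: ler_wpM2l; [exact: sqr_ge0|exact: Jb2].
rewrite /en/= mulrA; apply: ler_wpM2r; first exact: isq_ge0.
rewrite -(real_normK (num_real (W x - W y))); apply: (@le_trans _ _ ((C' * Num.min 1 (`|x - y| `^ sg)) ^+ 2)).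
  by rewrite lerXn2r ?nnegrE ?mulr_ge0 ?le_min ?ler01 ?powR_ge0.
rewrite exprMn; apply: ler_wpM2l; first exact: sqr_ge0.
have e2 : `|x - y| `^ (2 * sg) = (`|x - y| `^ sg) ^+ 2.
  by rewrite mulrC powRrM powR_mulrn// powR_ge0.
rewrite e2; have P0 := powR_ge0 `|x - y| sg; move: (`|x - y| `^ sg) P0 => X1 X10.
have [h|h] := leP 1 X1; first by rewrite expr1n le_min lexx; apply: exprn_ege1.
by rewrite le_min lexx andbT expr_le1// ltW.
Qed.

End HolderEnergy.

(** * Bootstrap of the decay exponent *)

Section Bootstrap.
Variables (R : realType) (N : nat).
Local Notation mu := (@lebesgue_measure R).
Local Notation mu2 := (mu \x mu)%E.
Variables (a : R -> R) (Lam : R) (u m : 'I_N -> R -> R) (x0 r0 : R).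
Variables (Mg : R -> R) (s p G bet R1 C0 al : R).
Implicit Types (c rho tau r : R) (phi : R -> R).
Hypotheses (HS : Sol a Lam u m x0 r0) (Mg0 : forall x, 0 <= Mg x) (hG : L1b mu Mg G)
  (bet0 : 0 < bet) (bet1 : bet < 1) (R1r : R1 < r0)
  (hM : forall rho, 0 < rho -> Mhyp m Mg s p rho (rho `^ bet))
  (C00 : 0 <= C0) (al0 : 0 < al)
  (cu : forall i x y, `|x - x0| <= R1 -> `|y - x0| <= R1 -> `|u i x - u i y| <= C0 * `|x - y| `^ al).

Definition QQ tau r := exists A d, [/\ 0 <= A, 0 < d, d <= 1 &
  forall c rho, `|c - x0| <= r -> 0 < rho -> rho <= d ->
    `|c - x0| + rho < r0 /\ nu u c rho <= A * rho `^ tau].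

Section CutOff.
Variables (chi : R -> R) (L ra rb r A d tau : R).
Hypotheses (hchi : cutoff chi x0 ra rb L) (L0 : 0 < L) (ra0 : 0 < ra) (rab : ra < rb) (rbr : rb < r)
  (rR : r <= R1) (tau0 : 0 < tau) (taub : tau <= bet) (A0 : 0 <= A) (d0 : 0 < d) (d1 : d <= 1)
  (hQ : forall c rho, `|c - x0| <= r -> 0 < rho -> rho <= d ->
    `|c - x0| + rho < r0 /\ nu u c rho <= A * rho `^ tau).

Definition Wi (i : 'I_N) x := chi x * u i x.
Definition Gc : R := 2 * Lam * A + (2 + G) + 2 * (Lam * (2 * L ^+ 2 + 2 * L + 16)).

Lemma Wi_1 i x : `|Wi i x| <= 1.
Proof.
rewrite normrM -[leRHS]mul1r; apply: ler_pM => //; [exact: cut_norm1 hchi x|exact: sol_1 HS _ _].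
Qed.

Lemma chi_0 x : r0 <= `|x - x0| -> chi x = 0.
Proof. by move=> h; apply: (cut_0 hchi); have := R1r; have := rR; have := rbr; clra. Qed.

Lemma Wi_Good i : Good (Wi i).
Proof.
apply: (Good_mul_sol HS i _ chi_0); apply: (cut_Good hchi).
by have := ra0; have := rab; clra.
Qed.

Lemma Gc_ge0 : 0 <= Gc.
Proof.
have [_ L1 _ _] := sol_k HS; have G0 := L1b_ge0 hG; have Lp : 0 <= Lam by clra.
rewrite /Gc; apply: addr_ge0; first by apply: addr_ge0; [rewrite !mulr_ge0//|clra].
rewrite !mulr_ge0//; apply: addr_ge0 => //; apply: addr_ge0; first by rewrite mulr_ge0// sqr_ge0.
by rewrite mulr_ge0// ltW.
Qed.

(** Decay of the energy is a Morrey bound for the right hand side of the localized equation. The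
    term with [m] uses the truncation of index 0, and the commutator is of order
    [rho <= rho^tau]. *)
Lemma dual_Wi i phi mm c rho : Good phi -> 0 < rho -> rho <= d -> `|c - x0| <= r ->
  (forall x, `|phi x| <= mm) -> (forall x, rho < `|x - c| -> phi x = 0) ->
  `|form a (Wi i) phi| <= mm * Gc * rho `^ tau.
Proof.
move=> gp rho0 rd hc pm p0; have [hin hnu] := hQ hc rho0 rd.
have [_ L1 _ _] := sol_k HS; have G0 := L1b_ge0 hG; have Lp : 0 <= Lam by clra.
have mm0 : 0 <= mm := le_trans (normr_ge0 _) (pm 0).
have [mp _ _] := gp; have me := mes_ent HS.
have p0' x : r0 <= `|x - x0| -> phi x = 0.
  by move=> hx; apply: p0; have := ler_normD (x - c) (c - x0); rewrite addrA subrK; clra.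
have h1 : L1b mu2 (fun z => `|phi z.1| * ent u z) (mm * nu u c rho).
  rewrite -(ger0_norm mm0); apply: L1b_le2 (L1bZ mm (nu_L1b HS hin)); first by mes.
  move=> x y /=; rewrite ger0_norm; last by rewrite mulr_ge0 ?ent_ge0.
  rewrite mulrA; apply: ler_wpM2r; first exact: ent_ge0.
  have [h|h] := leP `|x - c| rho; last by rewrite p0// normr0 /ind mulr0.
  by rewrite /ind mulr1.
have hi : L1b mu (fun x => ind (`|c - x| <= rho)) (2 * rho) by apply: L1b_itv; exact: ltW.
have h3 : L1b mu phi (mm * (2 * rho)).
  rewrite -(ger0_norm mm0); apply: L1b_le1 (L1bZ mm hi) => // x.
  rewrite (distrC c); have [h|h] := leP `|x - c| rho; last by rewrite p0// normr0 /ind mulr0.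
  by rewrite /ind mulr1.
set B := rho `^ bet; have B0 : 0 <= B by exact: powR_ge0.
have h2 : L1b mu (fun x => m i x * phi x) (mm * ((2 + G) * B)).
  have b1 : 0 <= B / rho by rewrite divr_ge0// ltW.
  have T := L1bZ mm (L1bD (L1bZ (B / rho) hi) (L1bZ B hG)).
  apply: (@L1b_weak _ _ _ _ _ _ _ _ (L1b_le1 _ _ T)).
  - by rewrite !ger0_norm//; apply: eqle; field; exact: lt0r_neq0.
  - by have [c' hc'] := sol_mm HS i; have := L1b_meas hc' => ?; mes.
  move=> x; rewrite normrM (distrC c); have [h|h] := leP `|x - c| rho; last first.
    by rewrite p0// normr0 mulr0 /ind mulr0 add0r !mulr_ge0.
  rewrite /ind mulr1 mulrC; have := hM rho0 0%N i x; rewrite !expr0 !mulr1 -/B => H.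
  by apply: ler_pM.
have rb0 : 0 < rb by have := ra0; have := rab; clra.
apply: le_trans (localized HS hchi rb0 L0 gp p0' h1 h2 h3) _.
have P0 := powR_ge0 rho tau; have r1 : rho <= 1 by have := d1; clra.
have q1 : B <= rho `^ tau by apply: powR_exp_le.
have q2 : rho <= rho `^ tau.
  rewrite -{1}(@powRr1 _ rho); last exact: ltW.
  by apply: powR_exp_le => //; have := bet1; have := taub; clra.
have Kp : 0 <= Lam * (2 * L ^+ 2 + 2 * L + 16).
  rewrite mulr_ge0//; apply: addr_ge0 => //; apply: addr_ge0; first by rewrite mulr_ge0// sqr_ge0.
  by rewrite mulr_ge0// ltW.
set K := Lam * (2 * L ^+ 2 + 2 * L + 16) in Kp *.
have -> : 2 * Lam * (mm * nu u c rho) + mm * ((2 + G) * B) + K * (mm * (2 * rho)) =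
  mm * (2 * Lam * nu u c rho + (2 + G) * B + 2 * K * rho) by ring.
rewrite -[leRHS]mulrA; apply: ler_wpM2l => //; rewrite /Gc -/K.
have L2 : 0 <= 2 * Lam by rewrite mulr_ge0.
have G2 : 0 <= 2 + G by clra.
have K2 : 0 <= 2 * K by rewrite mulr_ge0.
have z1 := ler_wpM2l L2 hnu; have z2 := ler_wpM2l G2 q1; have z3 := ler_wpM2l K2 q2.
have -> : (2 * Lam * A + (2 + G) + 2 * K) * rho `^ tau = 2 * Lam * (A * rho `^ tau) + (2 + G) * rho `^ tau + 2 * K * rho `^ tau by ring.
exact: lerD (lerD z1 z2) z3.
Qed.

Lemma Wi_cont i x e : 0 < e -> exists2 dd, 0 < dd & forall z, `|z - x| <= dd -> `|Wi i z - Wi i x| <= e.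
Proof.
move=> e0; have rbr' := rbr; have rR' := rR; have L0' := L0; have C00' := C00; have al0' := al0.
pose dl0 := (r - rb) / 2; have dl00 : 0 < dl0 by rewrite /dl0; clra.
have [hx|hx] := leP `|x - x0| (rb + dl0); last first.
  exists (dl0 / 2); first by clra.
  move=> z hz; have hz0 : rb <= `|z - x0|.
    by have := ler_normD (x - z) (z - x0); rewrite addrA subrK (distrC x z); clra.
  have hx0 : rb <= `|x - x0| by clra.
  by rewrite /Wi (cut_0 hchi hz0) (cut_0 hchi hx0) !mul0r subrr normr0 ltW.
pose t := (e / (2 * (C0 + 1))) `^ al^-1.
have Cp : 0 < 2 * (C0 + 1) by clra.
have t0 : 0 < t by apply: powR_gt0; exact: divr_gt0.
exists (Num.min dl0 (Num.min (e / (2 * L)) t)).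
  by rewrite !lt_min dl00 t0 divr_gt0// mulr_gt0.
move=> z; rewrite !le_min => /andP[z1 /andP[z2 z3]].
have hz : `|z - x0| <= R1.
  by have := ler_normD (z - x) (x - x0); rewrite addrA subrK; move: hx; rewrite /dl0; rewrite /dl0 in z1; clra.
have hx' : `|x - x0| <= R1 by move: hx; rewrite /dl0; clra.
have -> : Wi i z - Wi i x = (chi z - chi x) * u i z + chi x * (u i z - u i x) by rewrite /Wi; ring.
apply: le_trans (ler_normD _ _) _; rewrite !normrM.
have y1 : `|chi z - chi x| * `|u i z| <= e / 2.
  apply: (@le_trans _ _ (L * `|z - x| * 1)).
    by apply: ler_pM => //; [exact: cut_lip hchi z x|exact: sol_1 HS _ _].
  by rewrite mulr1; move: z2; rewrite ler_pdivlMr; clra.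
have y2 : `|chi x| * `|u i z - u i x| <= e / 2.
  apply: (@le_trans _ _ (1 * (C0 * t `^ al))).
    apply: ler_pM => //; first exact: cut_norm1 hchi x.
    apply: le_trans (cu i hz hx') _; apply: ler_wpM2l => //; apply: powR_base_le => //; exact: ltW.
  rewrite mul1r /t -powRrM mulVf ?lt0r_neq0// powRr1; last by rewrite divr_ge0// ltW.
  apply: (@le_trans _ _ ((C0 + 1) * (e / (2 * (C0 + 1))))).
    by apply: ler_wpM2r; [rewrite divr_ge0// ltW|clra].
  by apply: eqle; field; rewrite lt0r_neq0//; clra.
clra.
Qed.

Lemma Wi_holder i : exists C, forall x y, `|Wi i x - Wi i y| <= C * `|x - y| `^ tau.
Proof.
have b1 := bet1; have tb := taub.
apply: (@linear_holder _ a (Wi i) Lam x0 rb r Gc tau d (sol_k HS) (Wi_Good i) (Wi_1 i)) => //.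
- by move=> x hx; rewrite /Wi (cut_0 hchi) ?mul0r// ltW.
- exact: Gc_ge0.
- by clra.
- by move=> phi mm c rho gp h1 h2 h3 h4 h5; exact: (dual_Wi i gp h1 h2 h3 h4 h5).
- by move=> x e e0; exact: Wi_cont.
Qed.

(** [u] and its cut-off agree on the ball of radius [ra]; the remaining pairs are at distance at
    least [del] and contribute only order [rho]. *)
Lemma boot_Q r' : 0 < r' -> r' < ra -> QQ (Num.min (2 * tau) bet) r'.
Proof.
move=> r'0 r'a; have b1 := bet1; have b0 := bet0; have tb := taub; have t0 := tau0; have d0' := d0; have d1' := d1.
have rab' := rab; have rbr' := rbr; have rR' := rR; have R1r' := R1r.
(* Capping at [bet / 2] keeps [2 * sg <= bet < 1], as the tail integral requires. *)
pose sg := Num.min tau (bet / 2).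
have sg0 : 0 < sg by rewrite lt_min t0; clra.
have sgt : sg <= tau by rewrite ge_min lexx.
have sgb : sg <= bet / 2 by rewrite ge_min lexx orbT.
have e2 : 2 * sg = Num.min (2 * tau) bet.
  by rewrite /sg minr_pMr// (_ : 2 * (bet / 2) = bet)//; field.
have s21 : 2 * sg < 1 by clra.
have HE i : exists A', 0 <= A' /\ forall c rho, `|c - x0| <= r -> 0 < rho -> 4 * rho <= d ->
    L1b mu2 (fun z => ind (`|z.1 - c| <= rho) * en (Wi i) z) (A' * rho `^ (2 * sg)).
  have [C hC] := Wi_holder i.
  have hC' x y : `|Wi i x - Wi i y| <= (`|C| + 2) * `|x - y| `^ sg.
    have P0 := powR_ge0 `|x - y| sg; have [h|h] := leP `|x - y| 1.
      apply: le_trans (hC x y) _; apply: (@le_trans _ _ (`|C| * `|x - y| `^ tau)).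
        by apply: ler_wpM2r; [exact: powR_ge0|exact: ler_norm].
      have [h0|h0] := eqVneq x y.
        rewrite h0 !subrr normr0 !powR0 ?mulr0//; exact: lt0r_neq0.
      apply: ler_pM; [exact: normr_ge0|exact: powR_ge0|clra|apply: powR_exp_le => //].
      by rewrite normr_gt0 subr_eq0.
    apply: (@le_trans _ _ 2).
      by apply: le_trans (ler_normB _ _) _; have := Wi_1 i x; have := Wi_1 i y; clra.
    have : 1 <= `|x - y| `^ sg.
      have e1 : 1 `^ sg = 1 :> R by rewrite powR1.
      by rewrite -e1; apply: powR_base_le => //; exact: ltW.
    have := mulr_ge0 (normr_ge0 C) P0; clra.
  have [A' A'0 H] := @holder_energy _ a (Wi i) Lam x0 r Gc sg tau d (`|C| + 2) (sol_k HS) (Wi_Good i) (Wi_1 i)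
     Gc_ge0 sg0 s21 sgt d0 d1 (fun phi mm c rho g1 g2 g3 g4 g5 g6 => dual_Wi i g1 g2 g3 g4 g5 g6) hC'.
  by exists A'.
have [A' hA'] := choice HE.
pose del := (ra - r') / 2; have del0 : 0 < del by rewrite /del; clra.
pose AA := \sum_(i < N) (A' i + 16 / del).
have sum_ge0 : 0 <= AA.
  by apply: sumr_ge0 => i _; apply: addr_ge0; [case: (hA' i)|rewrite divr_ge0// ltW].
pose dd := Num.min (d / 4) del.
exists AA, dd; split => //.
- by rewrite lt_min del0 andbT; clra.
- by rewrite ge_min; apply/orP; left; clra.
move=> c rho hc rho0; rewrite le_min => /andP[rd rdel]; rewrite -e2.
have hin : `|c - x0| + rho < r0 by rewrite /del in rdel; clra.
split => //.
have hi : L1b mu (fun x => ind (`|c - x| <= rho)) (2 * rho) by apply: L1b_itv; exact: ltW.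
have F := L1bZ 4 (L1b_ker (mes_Jfar del) (fun x => L1b_Jfar x del0) hi).
have per i : L1b mu2 (fun z => ind (`|z.1 - c| <= rho) * en (u i) z) ((A' i + 16 / del) * rho `^ (2 * sg)).
  have [A'0 H] := hA' i; have hcr : `|c - x0| <= r by clra.
  have r4 : 4 * rho <= d by clra.
  apply: (@L1b_weak _ _ _ _ _ _ _ _ (L1b_le2 _ _ (L1bD (H c rho hcr rho0 r4) F))).
  - rewrite ger0_norm// [in leRHS]mulrDl lerD2l.
    have -> : 4 * (2 * rho * (2 / del)) = 16 / del * rho by field; exact: lt0r_neq0.
    apply: ler_wpM2l; first by rewrite divr_ge0// ltW.
    rewrite -{1}(@powRr1 _ rho); last exact: ltW.
    by apply: powR_exp_le => //; clra.
  - by have := mes_en (sol_mu HS i) => ?; mes.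
  move=> x y /=; rewrite ger0_norm; last by nn.
  have F0 : 0 <= 4 * (ind (`|c - x| <= rho) * Jfar del (x, y)) by apply: mulr_ge0 => //; apply: mulr_ge0; [exact: ind_ge0|exact: Jfar_ge0].
  have [hx|hx] := leP `|x - c| rho; last by rewrite {1 2}/ind !mul0r add0r.
  rewrite {1 2}/ind !mul1r; have hxx : `|x - x0| <= r' + del.
    by have := ler_normD (x - c) (c - x0); rewrite addrA subrK; clra.
  have [hy|hy] := leP `|y - x0| ra.
    apply: ler_wpDr => //; apply: eqle; rewrite /en/= /Wi !(cut_1 hchi) ?mul1r//.
    by move: hxx; rewrite /del; clra.
  apply: ler_wpDl; first exact: en_ge0.
  rewrite (distrC c) hx /ind mul1r /Jfar/= indT; last first.
    by have := ler_normD (y - x) (x - x0); rewrite addrA subrK (distrC y x); move: hxx; rewrite /del; clra.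
  rewrite mul1r /en/=; apply: ler_wpM2r; first exact: isq_ge0.
  have : `|u i x - u i y| <= 2.
    by apply: le_trans (ler_normB _ _) _; have := sol_1 HS i x; have := sol_1 HS i y; clra.
  move=> h2; rewrite -(real_normK (num_real (u i x - u i y))) (_ : 4 = 2 ^+ 2 :> R); last by ring.
  by rewrite lerXn2r ?nnegrE.
have tot := L1b_sum (index_enum 'I_N) (P := xpredT) (fun i _ => per i).
rewrite -mulr_suml -/AA in tot.
have := L1b_Rint_le tot; rewrite /nu; apply: le_trans; apply: eqle; apply: Rint_ext => z.
by rewrite /ent mulr_sumr.
Qed.

End CutOff.

Lemma boot_step tau r r' : 0 < tau -> tau <= bet -> r <= R1 -> 0 < r' -> r' < r -> QQ tau r ->
  QQ (Num.min (2 * tau) bet) r'.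
Proof.
move=> t0 tb rR r'0 r'r [A [d [A0 d0 d1 H]]].
have ra0 : 0 < (2 * r' + r) / 3 by clra.
have rab : (2 * r' + r) / 3 < (r' + 2 * r) / 3 by clra.
have [chi [L [L0 hchi]]] := cutoff_ex x0 ra0 rab.
by apply: (boot_Q hchi L0 ra0 rab _ rR t0 tb A0 d0 d1 H) => //; clra.
Qed.

(** Every doubling loses some radius; the previous exponent is used on the midpoint between [r'] and
    [r]. *)
Lemma boot_iter tau r n : 0 < tau -> tau <= bet -> r <= R1 -> QQ tau r ->
  forall r', 0 < r' -> r' < r -> QQ (Num.min (2 ^+ n * tau) bet) r'.
Proof.
move=> t0 tb rR hQ; elim: n => [|n ih] r' r'0 r'r.
  rewrite expr0 mul1r min_l//; case: hQ => A [d [A0 d0 d1 H]]; exists A, d; split => //.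
  by move=> c rho hc; apply: H; clra.
have two : 0 < 2 ^+ n :> R by rewrite exprn_gt0.
have b0 := bet0.
have rm0 : 0 < (r' + r) / 2 by clra.
have rm1 : (r' + r) / 2 < r by clra.
have := ih _ rm0 rm1; set t := Num.min _ _ => hm.
have tp : 0 < t by rewrite lt_min b0 mulr_gt0.
have tb' : t <= bet by rewrite ge_min lexx orbT.
have e : Num.min (2 * t) bet = Num.min (2 ^+ n.+1 * tau) bet.
  by rewrite /t minr_pMr// -minA (min_r (_ : bet <= 2 * bet)) ?exprS ?mulrA//; clra.
by rewrite -e; apply: (boot_step tp tb' _ r'0 _ hm); clra.
Qed.

Lemma boot_full tau r r' : 0 < tau -> tau <= bet -> r <= R1 -> QQ tau r -> 0 < r' -> r' < r -> QQ bet r'.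
Proof.
move=> t0 tb rR hQ r'0 r'r.
have [n hn] : exists n, bet <= 2 ^+ n * tau.
  have [n0 hn] := dl_small bet0 t0; exists n0.
  have := hn _ (leqnn n0); rewrite /dl ltr_pdivrMr ?exprn_gt0// mulrC; exact: ltW.
by have := boot_iter n t0 tb rR hQ r'0 r'r; rewrite min_r.
Qed.

Lemma boot_P tau r r' : 0 < tau -> tau <= bet -> r <= R1 -> QQ tau r -> 0 < r' -> r' < r ->
  exists C, forall i x y, `|x - x0| <= r' -> `|y - x0| <= r' -> `|u i x - u i y| <= C * `|x - y| `^ tau.
Proof.
move=> t0 tb rR [A [d [A0 d0 d1 H]]] r'0 r'r.
have rab : r' < (r' + r) / 2 by clra.
have [chi [L [L0 hchi]]] := cutoff_ex x0 r'0 rab.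
have rb : (r' + r) / 2 < r by clra.
have W i := Wi_holder hchi L0 r'0 rab rb rR t0 tb A0 d0 d1 H i.
have [C hC] := choice W; exists (\sum_(i < N) `|C i|) => i x y hx hy.
have := hC i x y; rewrite /Wi !(cut_1 hchi) ?mul1r// => h; apply: le_trans h _.
apply: ler_wpM2r; first exact: powR_ge0.
by apply: le_trans (ler_norm _) _; rewrite (bigD1 i)//= lerDl sumr_ge0.
Qed.

End Bootstrap.

Section HolderSol.
Variables (R : realType) (N : nat).
Local Notation mu := (@lebesgue_measure R).
Local Notation mu2 := (mu \x mu)%E.
Variables (a : R -> R) (Lam : R) (u m : 'I_N -> R -> R) (x0 r0 : R).
Variables (Mg : R -> R) (s p G bet r1 : R).

Lemma nu_ae (v : 'I_N -> R -> R) c rho : (forall i, measurable_fun setT (u i)) ->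
  (forall i, measurable_fun setT (v i)) -> (forall i, {ae mu, forall x, u i x = v i x}) ->
  nu u c rho = nu v c rho.
Proof.
move=> hmu hmv uv.
have h (w : 'I_N -> R -> R) : (forall i, measurable_fun setT (w i)) ->
    measurable_fun setT (fun z : R * R => ind (`|z.1 - c| <= rho) * ent w z).
  by move=> mw; apply: mes_M; [mes|apply: mes_sum => j; exact: mes_en].
apply: Rint_ae; [exact: h|exact: h|].
have ae2 i : {ae mu2, forall z, u i z.1 = v i z.1 /\ u i z.2 = v i z.2}.
  by exact: aeI (ae_fst (uv i)) (ae_snd (uv i)).
apply: (aeS _ (ae_all ae2)) => z hz; congr (_ * _); apply: eq_bigr => i _.
by rewrite /en; have [-> ->] := hz i.
Qed.

Lemma holder_sol : Sol a Lam u m x0 r0 -> (forall x, \sum_(i < N) u i x ^+ 2 = 1) -> (0 < N)%N ->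
  0 < s -> s < 1 -> s ^+ 4 = 2^-1 -> 0 <= p -> p < 1 -> (forall x, 0 <= Mg x) -> L1b mu Mg G ->
  0 < bet -> bet < 1 -> 0 < r1 -> r1 < r0 ->
  (forall rho, 0 < rho -> Mhyp m Mg s p rho (rho `^ bet)) ->
  exists v, [/\ Sol a Lam v m x0 r0, forall i, {ae mu, forall x, u i x = v i x}, QQ v x0 r0 bet r1 &
    exists C, 0 <= C /\ forall i x y, `|x - x0| <= r1 -> `|y - x0| <= r1 -> `|v i x - v i y| <= C * `|x - y| `^ bet].
Proof.
move=> HS S1 N0 s0 s1 s4 p0 p1 Mg0 hG b0 b1 r10 r1r hM.
(* The chain is [r1 < R2 < R1 < r0]: some positive exponent on [R1], full energy decay on [R2], full
   Hoelder exponent on [r1]. *)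
have Rr : (r1 + 2 * r0) / 3 < r0 by clra.
have rR2 : (2 * r1 + r0) / 3 < (r1 + 2 * r0) / 3 by clra.
have R20 : 0 < (2 * r1 + r0) / 3 by clra.
have r1R : r1 < (2 * r1 + r0) / 3 by clra.
have R10 : 0 < (r1 + 2 * r0) / 3 by clra.
move: Rr rR2 R20 r1R R10; set R1 := (r1 + 2 * r0) / 3; set R2 := (2 * r1 + r0) / 3 => Rr rR2 R20 r1R R10.
have [tau [A [d [t0 tb A0 /andP[d0 d1] H]]]] := nu_decay HS S1 N0 s0 s1 s4 p0 p1 Mg0 hG b0 Rr hM.
have hE i c rho : `|c - x0| <= R1 -> 0 < rho -> rho <= d ->
    L1b mu2 (fun z => ind (`|z.1 - c| <= rho) * en (u i) z) (A * rho `^ tau).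
  move=> h1 h2 h3; have [h4 h5] := H _ _ h1 h2 h3.
  apply: (L1b_weak h5); apply: L1b_le2 (nu_L1b HS h4).
    by have := mes_en (sol_mu HS i) => ?; mes.
  move=> x y /=; rewrite ger0_norm; last by nn.
  apply: ler_wpM2l; first exact: ind_ge0.
  by rewrite /ent (bigD1 i)//= lerDl; apply: sumr_ge0 => j _; exact: en_ge0.
have rep i := holder_rep (sol_mu HS i) (sol_1 HS i) A0 d0 t0 R10 (hE i).
have {rep}[v rep] := choice rep.
have mv i : measurable_fun setT (v i) by case: (rep i).
have v1 i x : `|v i x| <= 1 by case: (rep i).
have uv i : {ae mu, forall x, u i x = v i x} by case: (rep i).
have {rep}rep i : exists C, forall x y, `|x - x0| <= R1 -> `|y - x0| <= R1 ->
   `|v i x - v i y| <= C * `|x - y| `^ (tau / 2) by case: (rep i).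
have {rep}[C hC] := choice rep.
have HV := Sol_ae HS mv v1 uv.
have cv i x y : `|x - x0| <= R1 -> `|y - x0| <= R1 ->
    `|v i x - v i y| <= (\sum_(i < N) `|C i|) * `|x - y| `^ (tau / 2).
  move=> hx hy; apply: le_trans (hC i x y hx hy) _; apply: ler_wpM2r; first exact: powR_ge0.
  by apply: le_trans (ler_norm _) _; rewrite (bigD1 i)//= lerDl sumr_ge0.
have C0 : 0 <= \sum_(i < N) `|C i| by apply: sumr_ge0.
have t20 : 0 < tau / 2 by clra.
have Q : QQ v x0 r0 tau R1.
  exists A, d; split => //; first exact: ltW.
  move=> c rho h1 h2 h3; have [h4 h5] := H _ _ h1 h2 h3; split => //.
  by rewrite -(nu_ae _ _ (sol_mu HS) mv uv).
have Q2 := boot_full HV Mg0 hG b0 b1 Rr hM C0 t20 cv t0 tb (lexx _) Q R20 rR2.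
have [K hK] := boot_P HV Mg0 hG b1 Rr hM C0 t20 cv b0 (lexx _) (ltW rR2) Q2 r10 r1R.
exists v; split => //.
  case: Q2 => A' [d' [? ? ? H']]; exists A', d'; split => // c rho hc.
  by apply: H'; apply: le_trans (ltW r1R).
exists `|K|; split => // i x y hx hy; apply: le_trans (hK i x y hx hy) _.
by apply: ler_wpM2r; [exact: powR_ge0|exact: ler_norm].
Qed.

End HolderSol.

(** * Truncation of the right hand side *)

Section Young.
Variables (R : realType) (N : nat).
Local Notation mu := (@lebesgue_measure R).

Lemma powR_lt1 (x e : R) : 0 < x -> x < 1 -> 0 < e -> x `^ e < 1.
Proof.
move=> x0 x1 e0; rewrite -[ltRHS](_ : 1 `^ e = 1); last by rewrite powR1.
by apply: gt0_ltr_powR; rewrite ?nnegrE// ltW.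
Qed.

Lemma fourth_root : exists s : R, [/\ 0 < s, s < 1 & s ^+ 4 = 2^-1].
Proof.
exists (2^-1 `^ 4^-1); have h : (0 : R) < 2^-1 by rewrite invr_gt0.
split; first exact: powR_gt0.
  by apply: powR_lt1 => //; rewrite ?invr_gt0 ?invf_lt1//; clra.
rewrite -powR_mulrn ?powR_ge0// -powRrM mulVf ?powRr1 ?invr_ge0//.
Qed.

(** Above the height [lam] one has [|m| <= lam^(1 - gam) * |m|^gam]. As [lam = rho^(-1/gam) * s^-k],
    the factor is [rho^(1 - 1/gam)] times [s^(k (gam - 1))], which explains both [B] and [p]. *)
Lemma Mhyp_Lp (m : 'I_N -> R -> R) s gam : 0 < s -> 1 < gam ->
  forall rho, 0 < rho -> Mhyp m (fun x => \sum_(i < N) `|m i x| `^ gam) s (s `^ (gam - 1)) rho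
    (rho `^ (1 - gam^-1)).
Proof.
move=> s0 g1 rho rho0 k i x; have g0 : 0 < gam by clra.
have sk : 0 < s ^+ k by rewrite exprn_gt0.
set B := rho `^ _; have B0 : 0 < B by exact: powR_gt0.
set lam := B / (rho * s ^+ k); have l0 : 0 < lam by rewrite divr_gt0// mulr_gt0.
set Mg := \sum_(j < N) _.
have Mi : `|m i x| `^ gam <= Mg.
  by rewrite /Mg (bigD1 i)//= lerDl; apply: sumr_ge0 => j _; exact: powR_ge0.
have pk : 0 <= B * (s `^ (gam - 1)) ^+ k by rewrite mulr_ge0 ?exprn_ge0 ?powR_ge0// ltW.
have [h|h] := leP `|m i x| lam.
  by apply: le_trans h _; rewrite lerDl mulr_ge0// (le_trans _ Mi)// powR_ge0.
apply: le_trans (_ : B * s `^ (gam - 1) ^+ k * Mg <= _); last by rewrite lerDr ltW.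
apply: le_trans (ler_wpM2l pk Mi).
have t1 : 1 <= `|m i x| / lam by rewrite ler_pdivlMr// mul1r ltW.
have le1 : `|m i x| / lam <= (`|m i x| / lam) `^ gam.
  by rewrite -{1}[`|m i x| / lam]powRr1 ?(le_trans _ t1)//; apply: ler_powR => //; exact: ltW.
have -> : B * s `^ (gam - 1) ^+ k = lam `^ (1 - gam).
  have e : lam = rho `^ (- gam^-1) * s `^ (- k%:R).
    rewrite /lam /B powRD; last by apply/implyP => _; rewrite gt_eqF.
    rewrite powRr1 ?(ltW rho0)// invfM !powRN powR_mulrn ?(ltW s0)//.
    by field; rewrite !gt_eqF ?powR_gt0.
  rewrite e powRM ?powR_ge0// -!powRrM -powR_mulrn ?powR_ge0// -powRrM /B.
  congr (_ `^ _ * _ `^ _); last by ring.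
  by rewrite mulrBr mulr1 mulNr opprK mulVf ?gt_eqF// addrC.
have := le1; rewrite powRM ?invr_ge0 ?(ltW l0)// ler_pdivrMr// => /le_trans; apply; apply: eqle.
rewrite powRD; last by apply/implyP => _; rewrite gt_eqF.
rewrite powRr1 ?(ltW l0)// -(powR_inv1 (ltW l0)) -powRrM mulN1r; ring.
Qed.

End Young.

Section HolderMain.
Variables (R : realType) (N : nat).
Local Notation mu := (@lebesgue_measure R).
Variables (Lam : R) (a : R -> R) (Om : set R) (x0 r : R) (u m : R -> 'I_N -> R).
Hypotheses (N2 : (2 <= N)%N) (ok : ker_ok a Lam) (oOm : open Om) (r0 : 0 < r)
  (sOm : closure (ball x0 (2 * r)) `<=` Om) (hm : Lp_on 1 Om m) (hw : weak_solution a Om u m).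

Lemma ballP (c rho x : R) : ball c rho x <-> `|x - c| < rho.
Proof. by rewrite -ball_normE /ball_/= distrC. Qed.

Lemma Lp_L1b gam i : 0 < gam -> Lp_on gam (ball x0 (2 * r)) m ->
  exists c, L1b mu (fun x => `|mi x0 r m i x| `^ gam) c.
Proof.
move=> g0 h; have [mm fm] := h i; have [c0 hc0] := mi_L1b oOm sOm hm i.
have mO : measurable (ball x0 (2 * r) : set R) by exact: measurable_ball.
have mF : measurable_fun setT (fun x => `|mi x0 r m i x| `^ gam).
  by have := L1b_meas hc0 => ?; mes.
apply: L1b_ex => //; apply: le_lt_trans fm; rewrite [leRHS]integral_mkcond.
apply: ge0_le_integral => //.
- exact: measurable_absE.
- apply/(measurable_restrictT _ mO); apply/measurable_EFinP.
  by apply: (measurableT_comp (measurable_powR gam)); exact: measurableT_comp.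
- move=> x _; rewrite patchE /mi ger0_norm ?powR_ge0//.
  case: ifPn => [|]; rewrite ?inE ?notin_setE ballP => hx; first by rewrite indT// mul1r.
  by rewrite indF ?mul0r ?normr0 ?powR0 ?gt_eqF//; apply/negP.
Qed.

Lemma good_rep gam r1 : 1 < gam -> Lp_on gam (ball x0 (2 * r)) m -> 0 < r1 -> r1 < 2 * r ->
  exists v, [/\ Sol a Lam v (mi x0 r m) x0 (2 * r), forall i, {ae mu, forall x, u x i = v i x},
    QQ v x0 (2 * r) (1 - gam^-1) r1 &
    exists C, 0 <= C /\ forall i x y, `|x - x0| <= r1 -> `|y - x0| <= r1 ->
      `|v i x - v i y| <= C * `|x - y| `^ (1 - gam^-1)].
Proof.
move=> g1 hg r10 r1r; have [s [s0 s1 s4]] := fourth_root R.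
have g0 : 0 < gam by clra.
have HS := weak_Sol N2 ok oOm r0 sOm hm hw.
have [c hc] := choice (fun i => Lp_L1b i g0 hg).
have hG := L1b_sum (index_enum 'I_N) (P := xpredT) (fun i _ => hc i).
have N0 : (0 < N)%N by exact: leq_trans N2.
have gi : gam^-1 < 1 by rewrite invf_lt1.
have gi0 : 0 < gam^-1 by rewrite invr_gt0.
have p1 : s `^ (gam - 1) < 1 by apply: powR_lt1 => //; clra.
have b0 : 0 < 1 - gam^-1 by clra.
have b1 : 1 - gam^-1 < 1 by clra.
have M0 x : 0 <= \sum_(i < N) `|mi x0 r m i x| `^ gam by apply: sumr_ge0 => i _; exact: powR_ge0.
have [v [HV uv Q C]] := holder_sol HS (vi_sum u N2) N0 s0 s1 s4 (powR_ge0 _ _) p1 M0 hG b0 b1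
  r10 r1r (Mhyp_Lp _ s0 g1).
exists v; split => // i.
have := aeI (vi_ae hw i) (uv i); by apply: aeS => x [-> ->].
Qed.

Lemma vnorm_le (f : 'I_N -> R) K : 0 <= K -> (forall i, `|f i| <= K) -> vnorm f <= Num.sqrt N%:R * K.
Proof.
move=> K0 h; rewrite /vnorm -[X in _ <= _ * X](ger0_norm K0) -sqrtr_sqr -sqrtrM ?ler0n// ler_sqrt; last first.
  by rewrite mulr_ge0 ?sqr_ge0.
rewrite /vdot; apply: le_trans (_ : \sum_(i < N) K ^+ 2 <= _).
  apply: ler_sum => i _; rewrite -expr2 -real_normK ?num_real//.
  by rewrite ler_sqr ?nnegrE ?normr_ge0.
by rewrite sumr_const card_ord mulr_natl.
Qed.

Lemma holder_main gam : 1 < gam -> Lp_on gam (ball x0 (2 * r)) m ->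
  holder_on (1 - gam^-1) (ball x0 r) u.
Proof.
move=> g1 hg; have r12 : r < 2 * r by have := r0; clra.
have [v [_ uv _ [C [C0 hC]]]] := good_rep g1 hg r0 r12.
exists (fun x i => v i x); split.
  by have h := ae_all uv; apply: (aeS _ h) => x e _ i; rewrite e.
exists (Num.sqrt N%:R * C) => x y /ballP hx /ballP hy; rewrite -mulrA.
by apply: vnorm_le => [|i]; [rewrite mulr_ge0// powR_ge0|apply: hC; exact: ltW].
Qed.

End HolderMain.

(** * Square integrability of the derivative *)

Section BoundedCompact.
Variable R : realType.
Local Notation mu := (@lebesgue_measure R).
Local Notation mu2 := (mu \x mu)%E.
Implicit Types (f g : R -> R) (h k : R).

(** Stable under products and translations, and always integrable, so the identities for difference
    operators need no integrability conditions. *)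
Definition BC f := measurable_fun setT f /\
  exists M K, (forall x, `|f x| <= M) /\ forall x, K < `|x| -> f x = 0.
Definition I1 f : R := \int[mu]_x f x.

Lemma BC_D f g : BC f -> BC g -> BC (fun x => f x + g x).
Proof.
move=> [mf [M [K [fM fK]]]] [mg [M' [K' [gM gK]]]]; split; first by mes.
exists (M + M'), (Num.max K K'); split => x; first by apply: le_trans (ler_normD _ _) _; exact: lerD.
by rewrite gt_max => /andP[h1 h2]; rewrite fK// gK// addr0.
Qed.

Lemma BC_M f g : BC f -> BC g -> BC (fun x => f x * g x).
Proof.
move=> [mf [M [K [fM fK]]]] [mg [M' [K' [gM gK]]]]; split; first by mes.
exists (M * M'), K; split => x; first by rewrite normrM; exact: ler_pM.
by move=> h1; rewrite fK// mul0r.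
Qed.

Lemma BC_Z k f : BC f -> BC (fun x => k * f x).
Proof.
move=> [mf [M [K [fM fK]]]]; split; first by mes.
exists (`|k| * M), K; split => x; first by rewrite normrM; exact: ler_wpM2l.
by move=> h1; rewrite fK// mulr0.
Qed.

Lemma BC_N f : BC f -> BC (fun x => - f x).
Proof. by move=> /(BC_Z (-1)); congr BC; apply/funext => x; rewrite mulN1r. Qed.

Lemma BC_B f g : BC f -> BC g -> BC (fun x => f x - g x).
Proof. by move=> hf /BC_N; exact: BC_D. Qed.

Lemma BC_shift h f : BC f -> BC (fun x => f (x + h)).
Proof.
move=> [mf [M [K [fM fK]]]]; split; first by mes.
exists M, (K + `|h|); split => x // hx; apply: fK.
by have := ler_normB (x + h) h; rewrite addrK; clra.
Qed.

Lemma BC_X2 f : BC f -> BC (fun x => f x ^+ 2).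
Proof. by move=> h; exact: BC_M. Qed.

Lemma BC_0 : BC (fun=> 0).
Proof. by split; [mes|exists 0, 0; split => // x; rewrite normr0]. Qed.

Lemma BC_sum (s : seq nat) (F : nat -> R -> R) : (forall i, BC (F i)) -> BC (fun x => \sum_(i <- s) F i x).
Proof.
move=> h; elim: s => [|i s ih].
  by have := BC_0; congr BC; apply/funext => x; rewrite big_nil.
by have := BC_D (h i) ih; congr BC; apply/funext => x; rewrite big_cons.
Qed.

Lemma BC_L1b f : BC f -> exists c, L1b mu f c.
Proof.
move=> [mf [M [K [fM fK]]]].
have hi : L1b mu (fun x => ind (`|0 - x| <= `|K|)) (2 * `|K|) by apply: L1b_itv.
eexists; apply: L1b_le1 (L1bZ M hi) => // x; rewrite sub0r normrN.
have [h|h] := leP `|x| `|K|; first by rewrite indT// mulr1.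
by rewrite fK ?normr0 ?indF -?ltNge ?mulr0//; apply: le_lt_trans h; exact: ler_norm.
Qed.

Lemma I1D f g : BC f -> BC g -> I1 (fun x => f x + g x) = I1 f + I1 g.
Proof. by move=> /BC_L1b[? h1] /BC_L1b[? h2]; exact: RintD h1 h2. Qed.
Lemma I1B f g : BC f -> BC g -> I1 (fun x => f x - g x) = I1 f - I1 g.
Proof. by move=> /BC_L1b[? h1] /BC_L1b[? h2]; exact: RintB h1 h2. Qed.
Lemma I1Z k f : BC f -> I1 (fun x => k * f x) = k * I1 f.
Proof. by move=> /BC_L1b[? h1]; exact: RintZ h1. Qed.
Lemma I1_ext f g : f =1 g -> I1 f = I1 g. Proof. by move=> e; apply: Rint_ext. Qed.
Lemma I1_shift h f : BC f -> I1 (fun x => f (x + h)) = I1 f.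
Proof. by move=> [mf _]; exact: Rint_shift. Qed.
Lemma I1_le f g : BC f -> BC g -> (forall x, f x <= g x) -> I1 f <= I1 g.
Proof. by move=> /BC_L1b[? h1] /BC_L1b[? h2]; exact: Rint_le h1 h2. Qed.
Lemma I1_ge0 f : (forall x, 0 <= f x) -> 0 <= I1 f.
Proof. by move=> h; exact: Rintegral_ge0. Qed.
Lemma I1_sum (s : seq nat) (F : nat -> R -> R) : (forall i, BC (F i)) ->
  I1 (fun x => \sum_(i <- s) F i x) = \sum_(i <- s) I1 (F i).
Proof. by move=> h; have [c hc] := choice (fun i => BC_L1b (h i)); exact: (Rint_sum _ hc). Qed.

(** Expand and translate each of the products so that the steps change sides. *)
Lemma second_diff f g h k : BC f -> BC g ->
  I1 (fun x => (f (x - h) - f x) * (g (x - k) - g x)) = I1 (fun x => (f (x + k) - f x) * (g (x + h) - g x)).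
Proof.
move=> bf bg; have b s t := BC_M (BC_shift s bf) (BC_shift t bg).
have b0 s := BC_M (BC_shift s bf) bg; have b1 s := BC_M bf (BC_shift s bg); have b2 := BC_M bf bg.
have ex s t : I1 (fun x => (f (x + s) - f x) * (g (x + t) - g x)) =
    I1 (fun x => f (x + s) * g (x + t)) - I1 (fun x => f (x + s) * g x) - (I1 (fun x => f x * g (x + t))
      - I1 (fun x => f x * g x)).
  rewrite -I1B// -I1B//  -I1B//; [|exact: BC_B|exact: BC_B].
  by apply: I1_ext => x; ring.
rewrite !ex -(I1_shift (- (h + k)) (b k h)) -(I1_shift (- k) (b0 k)) -(I1_shift (- h) (b1 h)).
have -> : I1 (fun x => f (x - (h + k) + k) * g (x - (h + k) + h)) = I1 (fun x => f (x - h) * g (x - k)).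
  by apply: I1_ext => x; congr (f _ * g _); ring.
have -> : I1 (fun x => f (x - k + k) * g (x - k)) = I1 (fun x => f x * g (x - k)).
  by apply: I1_ext => x; rewrite subrK.
have -> : I1 (fun x => f (x - h) * g (x - h + h)) = I1 (fun x => f (x - h) * g x).
  by apply: I1_ext => x; rewrite subrK.
by ring.
Qed.

Lemma parallelogram f h : BC f ->
  I1 (fun x => (f (x + h) - f x) ^+ 2) + I1 (fun x => (f (x + h) + f x) ^+ 2) = 4 * I1 (fun x => f x ^+ 2).
Proof.
move=> bf; have bh := BC_shift h bf; have b2 := BC_X2 bf; have bh2 := BC_X2 bh.
rewrite -I1D; [|by apply: BC_X2; exact: BC_B|by apply: BC_X2; exact: BC_D].
have -> : 4 * I1 (fun x => f x ^+ 2) = 2 * I1 (fun x => f (x + h) ^+ 2) + 2 * I1 (fun x => f x ^+ 2).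
  by rewrite (I1_shift h b2); ring.
rewrite -!I1Z// -I1D; [|exact: BC_Z|exact: BC_Z]; apply: I1_ext => x; ring.
Qed.

(* [d 0 <= 6 d i + 4 d (2 i)] since [f] and its [i]-th translate are as far apart as the [i]-th and
   the [2i]-th translates; averaging over [i] turns the variance identity into a bound on [d 0]. *)
Lemma average_dist f h P : BC f -> (0 < P)%N -> forall g,
  g = (fun x => (2 * P)%:R^-1 * \sum_(0 <= i < 2 * P) f (x + h * i%:R)) ->
  I1 (fun x => (f x - g x) ^+ 2) <= 20 * (I1 (fun x => f x ^+ 2) - I1 (fun x => g x ^+ 2)).
Proof.
move=> bf P0 g ge; set M := (2 * P)%N in ge *.
have M0 : 0 < M%:R :> R by rewrite ltr0n muln_gt0.
have bs i := BC_shift (h * i%:R) bf.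
have bg : BC g by rewrite ge; apply: BC_Z; exact: BC_sum.
pose d i := I1 (fun x => (f (x + h * i%:R) - g x) ^+ 2).
have bd i : BC (fun x => (f (x + h * i%:R) - g x) ^+ 2) by apply: BC_X2; exact: BC_B.
have d0 i : 0 <= d i by apply: I1_ge0 => x; exact: sqr_ge0.
have var : \sum_(0 <= i < M) d i = M%:R * (I1 (fun x => f x ^+ 2) - I1 (fun x => g x ^+ 2)).
  rewrite -I1_sum// mulrBr -(I1Z _ (BC_X2 bg)).
  have -> : M%:R * I1 (fun x => f x ^+ 2) = I1 (fun x => \sum_(0 <= i < M) f (x + h * i%:R) ^+ 2).
    rewrite I1_sum => [|i]; last by apply: BC_X2.
    rewrite (eq_bigr (fun=> I1 (fun x => f x ^+ 2))); last first.
      by move=> i _; rewrite (I1_shift (h * i%:R) (BC_X2 bf)).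
    by rewrite sumr_const_nat subn0 mulr_natl.
  rewrite -I1B; [|by apply: BC_sum => i; exact: BC_X2|by apply: BC_Z; exact: BC_X2].
  apply: I1_ext => x.
  have E : \sum_(0 <= i < M) f (x + h * i%:R) = M%:R * g x by rewrite ge mulrA divff ?mul1r// gt_eqF.
  rewrite (eq_bigr (fun i => f (x + h * i%:R) ^+ 2 - 2 * g x * f (x + h * i%:R) + g x ^+ 2)); last first.
    by move=> i _; ring.
  rewrite big_split/= sumrB -mulr_sumr E sumr_const_nat subn0 -mulr_natl; ring.
have step i : d 0%N <= 6 * d i + 4 * d (2 * i)%N.
  have b1 : BC (fun x => (f (x + h * i%:R) - f x) ^+ 2) by apply: BC_X2; exact: BC_B.
  have h1 : d 0%N <= 2 * d i + 2 * I1 (fun x => (f (x + h * i%:R) - f x) ^+ 2).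
    rewrite -!I1Z// -I1D; [|exact: BC_Z|exact: BC_Z].
    apply: I1_le => //; first by apply: BC_D; exact: BC_Z.
    move=> x; rewrite mulr0 addr0; move: (f _) (g x) (f x) => p q r; apply: (@le_sub_sq _ (2 * p - q - r)); ring.
  have h2 : I1 (fun x => (f (x + h * i%:R) - f x) ^+ 2) <= 2 * d (2 * i)%N + 2 * d i.
    rewrite -(I1_shift (h * i%:R) b1) -!I1Z// -I1D; [|exact: BC_Z|exact: BC_Z].
    apply: I1_le; [exact: BC_shift b1|by apply: BC_D; exact: BC_Z|].
    move=> x; rewrite -addrA -mulr2n (_ : h * i%:R *+ 2 = h * (2 * i)%:R); last by rewrite natrM; ring.
    move: (f _) (g x) (f _) => p q r; apply: (@le_sub_sq _ (p + r - 2 * q)); ring.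
  by clra.
have ev n : \sum_(0 <= i < n) d (2 * i)%N <= \sum_(0 <= i < 2 * n) d i.
  elim: n => [|n ih]; first by rewrite muln0 !big_geq.
  by rewrite mulnS add2n !big_nat_recr//= -addrA lerD// lerDl.
have lo n : \sum_(0 <= i < n) d i <= \sum_(0 <= i < 2 * n) d i.
  have nn2 : (n <= 2 * n)%N by rewrite leq_pmull.
  by rewrite [leRHS](big_cat_nat _ (n := n))//= lerDl; apply: sumr_ge0.
have tot : P%:R * d 0%N <= 10 * (M%:R * (I1 (fun x => f x ^+ 2) - I1 (fun x => g x ^+ 2))).
  rewrite -var; have := ev P; have := lo P; rewrite -/M => h1 h2.
  have : \sum_(0 <= i < P) d 0%N <= \sum_(0 <= i < P) (6 * d i + 4 * d (2 * i)%N) by apply: ler_sum => i _.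
  rewrite sumr_const_nat subn0 -mulr_natl big_split/= -!mulr_sumr; clra.
have Pp : 0 < P%:R :> R by rewrite ltr0n.
have -> : I1 (fun x => (f x - g x) ^+ 2) = d 0%N by apply: I1_ext => x; rewrite mulr0 addr0.
rewrite -(ler_pM2l Pp); apply: le_trans tot _; rewrite /M natrM; apply: eqle; ring.
Qed.

Lemma L1b_shift1 h (F : R * R -> R) c : L1b mu2 F c -> L1b mu2 (fun z => F (z.1 + h, z.2)) c.
Proof.
move=> [mF Fc].
have ms : measurable_fun setT (fun z : R * R => (z.1 + h, z.2)).
  by apply: measurable_fun_pair; mes.
split; first exact: measurableT_comp mF ms.
apply: le_trans Fc; rewrite le_eqVlt; apply/orP; left; apply/eqP.
have ge0 (G : R * R -> R) z : (0 <= (`|G z|)%:E)%E by rewrite lee_fin.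
rewrite (tonelli21 (measurable_absE mF) (ge0 F)).
apply: etrans (tonelli21 (measurable_absE (measurableT_comp mF ms)) (ge0 _)) _.
apply: eq_integral => y _.
apply: (integral_shift h (f := fun x => (`|F (x, y)|)%:E)) => [|//].
by apply: measurable_absE; exact: measurableT_comp mF (measurable_pair2 y).
Qed.

(** A third point [z] within [h] of [x] is inserted between [x] and [x + h] and averaged over an
    interval of length [2 h]. *)
Lemma diff_energy v h c : BC v -> 0 < h -> L1b mu2 (fun z => ind (`|z.1 - z.2| <= 2 * h) * (v z.1 - v z.2) ^+ 2) c ->
  I1 (fun x => (v (x + h) - v x) ^+ 2) <= 2 / h * c.
Proof.
move=> bv h0 hc; have mv : measurable_fun setT v by case: bv.
have H := L1bZ 2 (L1bD (L1b_shift1 h hc) hc).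
have : L1b mu2 (fun z => (v (z.1 + h) - v z.1) ^+ 2 * ind (`|z.1 - z.2| <= h)) (`|2| * (c + c)).
  apply: L1b_le2 H; first by mes.
  move=> x z /=; rewrite ger0_norm; last by nn.
  have [l|l] := leP `|x - z| h; last by rewrite mulr0; nn.
  have -> : `|x - z| <= 2 * h by clra.
  have -> : `|x + h - z| <= 2 * h.
    by rewrite -addrA [h - z]addrC addrA; have := ler_normD (x - z) h; rewrite (ger0_norm (ltW h0)); clra.
  rewrite /ind !mul1r mulr1; move: (v (x + h)) (v x) (v z) => p q r; apply: (@le_sub_sq _ (p + q - 2 * r)); ring.
move/L1b_fub; case.
- by mes.
- by move=> z; nn.
- by move=> x; eexists; exact: (L1bZ ((v (x + h) - v x) ^+ 2) (L1b_itv x (ltW h0))).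
move=> m1 m2; have K : L1b mu (fun x => 2 * h * (v (x + h) - v x) ^+ 2) (`|2| * (c + c)).
  split; first by mes.
  apply: le_trans m2; apply: ge0_le_integral => //; first by apply: measurable_absE; mes.
    exact: measurable_absE.
  move=> x _; rewrite /= (RintZ _ (c := 2 * h)); last by apply: L1b_itv; exact: ltW.
  by rewrite Rint_itv ?(ltW h0)// mulrC.
have b2 : BC (fun x => (v (x + h) - v x) ^+ 2) by apply: BC_X2; apply: BC_B => //; exact: BC_shift.
have e := I1Z (2 * h) b2; have := L1b_Rint_le K; rewrite -/(I1 _) e (ger0_norm (ler0n R 2)) => hh.
have h20 : 0 < 2 * h by clra.
rewrite -(ler_pM2l h20); apply: le_trans hh _; apply: eqle; field; exact: lt0r_neq0.
Qed.

(** One half of the Besov description of the energy: by [geom_ind] the bands of the dyadic steps add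
    up to at most 12 times the energy density. *)
Lemma diff_sum_energy v h0 E n : BC v -> 0 < h0 -> L1b mu2 (en v) E ->
  \sum_(0 <= j < n) (dl h0 j)^-1 * I1 (fun x => (v (x + dl h0 j) - v x) ^+ 2) <= 24 * E.
Proof.
move=> bv h00 hE; have mv : measurable_fun setT v by case: bv.
have me := mes_en mv.
pose psi j (z : R * R) := ind (`|z.1 - z.2| <= 3 * dl h0 j) * (`|z.1 - z.2| / dl h0 j) ^+ 2 * en v z.
have mpsi j : measurable_fun setT (psi j) by rewrite /psi; mes.
have psi0 j z : 0 <= psi j z by rewrite /psi; nn.
have L j : L1b mu2 (psi j) (\int[mu2]_z psi j z).
  apply: (@L1b_self _ _ _ _ _ (`|9| * E)) => //; apply: L1b_le2 (L1bZ 9 hE) => // x y.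
  rewrite ger0_norm// /psi/=; apply: ler_wpM2r; first exact: en_ge0.
  have dj := dl_gt0 j h00; have [l|l] := leP `|x - y| (3 * dl h0 j); last by rewrite mul0r.
  have t3 : `|x - y| / dl h0 j <= 3 by rewrite ler_pdivrMr.
  have t0 : 0 <= `|x - y| / dl h0 j by rewrite divr_ge0 ?(ltW dj).
  by rewrite mul1r; move: (_ / _) t3 t0 => t; cnra.
have S : \sum_(0 <= j < n) \int[mu2]_z psi j z <= 12 * E.
  rewrite -(Rint_sum _ L).
  have hs : L1b mu2 (fun z => \sum_(0 <= j < n) psi j z) (`|12| * E).
    apply: L1b_le2 (L1bZ 12 hE); first by apply: mes_sum.
    move=> x y; rewrite ger0_norm; last by apply: sumr_ge0.
    rewrite /psi -mulr_suml; apply: ler_wpM2r; first exact: en_ge0.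
    exact: geom_ind.
  by have := L1b_Rint_le hs; rewrite (ger0_norm (ler0n R 12)).
apply: le_trans (_ : \sum_(0 <= j < n) 2 * \int[mu2]_z psi j z <= _); last by rewrite -mulr_sumr; clra.
apply: ler_sum => j _; have dj := dl_gt0 j h00.
rewrite mulrC ler_pdivrMr//.
have : L1b mu2 (fun z => ind (`|z.1 - z.2| <= 2 * dl h0 j) * (v z.1 - v z.2) ^+ 2) (`|dl h0 j ^+ 2| * \int[mu2]_z psi j z).
  apply: L1b_le2 (L1bZ (dl h0 j ^+ 2) (L j)); first by mes.
  move=> x y; rewrite ger0_norm; last by nn.
  rewrite /psi /en /=; have [l|l] := leP `|x - y| (2 * dl h0 j); last by rewrite mul0r; nn; rewrite ?invr_ge0 ?(ltW dj).
  have l3 : `|x - y| <= 3 * dl h0 j by clra.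
  rewrite l3 /ind !mul1r.
  have [->|ne] := eqVneq x y; first by rewrite subrr expr0n/= !mul0r !mulr0.
  have e : `|x - y| ^+ 2 = (x - y) ^+ 2 by rewrite real_normK ?num_real.
  apply: eqle; rewrite [(`|x - y| / _) ^+ 2]expr_div_n e; field; rewrite subr_eq0 ne gt_eqF//.
move=> /(diff_energy bv dj); rewrite (ger0_norm (sqr_ge0 _)); congr (_ <= _); field; exact: lt0r_neq0.
Qed.

End BoundedCompact.

Section Levi.
Context d (T : measurableType d) (R : realType) (m : {measure set T -> \bar R}).

(** Monotone convergence with a real valued limit: where the limit is infinite, a null set, [fine]
    replaces it by 0. *)
Lemma L1b_levi (Fn : nat -> T -> R) c : (forall n, L1b m (Fn n) c) -> (forall n x, 0 <= Fn n x) ->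
  (forall n x, Fn n x <= Fn n.+1 x) ->
  exists F, [/\ L1b m F c, forall x, 0 <= F x & {ae m, forall x, forall n, Fn n x <= F x}].
Proof.
move=> hF F0 Fi; pose g n x := (Fn n x)%:E.
have mg n : measurable_fun setT (g n) by apply/measurable_EFinP; exact: L1b_meas (hF n).
have gi x : {homo g^~ x : n p / (n <= p)%N >-> (n <= p)%E}.
  move=> n p /subnK <-; elim: (p - n)%N => // k ih; apply: le_trans ih _.
  by rewrite lee_fin addSn.
have gc x : cvg (g^~ x @ \oo) by exact: ereal_nondecreasing_is_cvgn.
pose G x := limn (g^~ x).
have mG : measurable_fun setT G.
  by apply: (emeasurable_fun_cvg g) => // x _; exact: gc.
have gG n x : (g n x <= G x)%E by rewrite /G (cvg_lim _ (ereal_nondecreasing_cvgn (gi x)))//; apply: ereal_sup_ubound; exists n.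
have G0 x : (0 <= G x)%E by apply: le_trans (gG 0%N x); rewrite lee_fin.
have Gc : (\int[m]_x G x <= c%:E)%E.
  have h := @cvg_monotone_convergence _ _ _ m setT measurableT g mg (fun n x _ => F0 n x) (fun x _ => gi x).
  rewrite -(cvg_lim _ h)//; apply: lime_le; first exact: cvgP h.
  apply: nearW => n; have [_] := hF n; apply: le_trans; rewrite le_eqVlt; apply/orP; left; apply/eqP.
  by apply: eq_integral => x _; rewrite ger0_norm.
have iG : m.-integrable setT G.
  apply/integrableP; split => //; apply: le_lt_trans (ltry c); apply: le_trans Gc.
  by rewrite le_eqVlt; apply/orP; left; apply/eqP; apply: eq_integral => x _; rewrite gee0_abs.
exists (fun x => fine (G x)); split.
- split; first exact: (measurableT_comp (fine_measurable _)).
  apply: le_trans Gc; apply: ge0_le_integral => //.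
    by apply: measurable_absE; exact: (measurableT_comp (fine_measurable _)).
  move=> x _; rewrite ger0_norm ?fine_ge0//.
  by case: (G x) (G0 x) => [r| |]//=; rewrite leey.
- by move=> x; exact: fine_ge0.
- have := integrable_ae measurableT iG; apply: filterS => x /(_ Logic.I) fx n.
  by rewrite -lee_fin fineK//; exact: gG.
Qed.

Lemma L1b_ae_le (F G : T -> R) c : measurable_fun setT G -> {ae m, forall x, `|G x| <= F x} ->
  L1b m F c -> L1b m G c.
Proof.
move=> mG h [mF Fc]; split => //; apply: le_trans Fc; apply: ae_ge0_le_integral => //.
- exact: measurable_absE.
- exact: measurable_absE.
- by apply: filterS h => x e _; rewrite lee_fin; apply: le_trans e (ler_norm _).
Qed.

Lemma L1b_mono (Fn : nat -> T -> R) F c : measurable_fun setT F -> (forall n, L1b m (Fn n) c) ->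
  (forall n x, 0 <= Fn n x) -> (forall n x, Fn n x <= Fn n.+1 x) ->
  (forall x, exists n, Fn n x = F x) -> L1b m F c.
Proof.
move=> mF hF F0 Fi e; have [G [hG _ GF]] := L1b_levi hF F0 Fi.
apply: L1b_ae_le hG => //; apply: filterS GF => x h; have [n <-] := e x.
by rewrite ger0_norm.
Qed.

End Levi.

(** * A weight for the energy density and decay of increments *)

Section Kernel.
Variable R : realType.
Local Notation mu := (@lebesgue_measure R).
Local Notation mu2 := (mu \x mu)%E.

(** The weight for Cauchy-Schwarz in [ent_term]. It is integrable at 0, and
    [t^(3/2) / (t^3 * kap t) = kap t]: increments of mean square [t^(3/2)] lead back to the same
    integrable weight. *)
Definition kap (t : R) : R := t `^ (- (3 / 4)).
Definition Jq (d : R) (z : R * R) : R := ind (`|z.1 - z.2| <= d) * kap `|z.1 - z.2|.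

Lemma kap_ge0 t : 0 <= kap t. Proof. exact: powR_ge0. Qed.
Lemma mes_kap : measurable_fun setT kap. Proof. by rewrite /kap; mes. Qed.
Lemma kap_mono (s t : R) : 0 < s -> s <= t -> kap t <= kap s.
Proof.
move=> s0 st; rewrite /kap !powRN lef_pV2 ?posrE ?powR_gt0 ?(lt_le_trans s0)//.
by apply: powR_base_le; clra.
Qed.

Lemma Jq_L1b d : 0 < d -> exists c, forall x, L1b mu (fun y => Jq d (x, y)) c.
Proof.
move=> d0; pose q : R := 2^-1 `^ (4^-1).
have q0 : 0 <= q by exact: powR_ge0.
have q1 : q < 1 by apply: powR_lt1; rewrite ?invr_gt0//; clra.
have dq k : dl d k * kap (dl d k.+1) = 2 * d `^ 4^-1 * (q * q ^+ k).
  have dk := dl_gt0 k.+1 d0.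
  have -> : dl d k = 2 * dl d k.+1 by rewrite dlS; field.
  rewrite -mulrA /kap -{1}[dl d k.+1](powRr1 (ltW dk)) -powRD; last by apply/implyP => _; rewrite gt_eqF.
  rewrite -mulrA -exprS (_ : 1 + _ = 4^-1); last by field.
  have -> : dl d k.+1 = d * 2^-1 ^+ k.+1 by rewrite /dl exprVn.
  by rewrite powRM ?exprn_ge0 ?invr_ge0 ?(ltW d0)// -powR_mulrn ?invr_ge0// powRAC powR_mulrn ?powR_ge0.
pose c := 2 * (2 * d `^ 4^-1 * (q * (1 - q)^-1)).
have c0 : 0 <= c by rewrite !mulr_ge0 ?powR_ge0 ?invr_ge0//; clra.
exists c => x; pose Fn n y := ind (dl d n < `|x - y|) * Jq d (x, y).
have mk := mes_kap.
have Fn0 n y : 0 <= Fn n y by rewrite /Fn /Jq !mulr_ge0 ?ind_ge0 ?kap_ge0.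
have mJ : measurable_fun setT (fun y => Jq d (x, y)) by rewrite /Jq/=; mes.
apply: (@L1b_mono _ _ R mu Fn).
- exact: mJ.
- move=> n; have H : L1b mu (fun y => \sum_(0 <= k < n) kap (dl d k.+1) * ind (`|x - y| <= dl d k))
     (\sum_(0 <= k < n) `|kap (dl d k.+1)| * (2 * dl d k)).
    by apply: L1b_sum => k _; apply: L1bZ; apply: L1b_itv; apply: ltW; exact: dl_gt0.
  apply: (@L1b_weak _ _ _ _ _ _ _ _ (L1b_le1 _ _ H)).
  + rewrite (eq_bigr (fun k => 2 * (2 * d `^ 4^-1 * (q * q ^+ k)))); last first.
      by move=> k _; rewrite ger0_norm ?kap_ge0// -dq; ring.
    rewrite -!mulr_sumr /c; do 3! (apply: ler_wpM2l; first by rewrite ?mulr_ge0 ?powR_ge0).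
    exact: geom_le.
  + by rewrite /Fn; mes.
  + move=> y; rewrite ger0_norm//; elim: n {H} => [|n ih].
      rewrite big_geq// /Fn /Jq dl0/=; have [h|h] := ltP d `|x - y|; last by rewrite mul0r.
      by rewrite !mul0r mulr0.
    rewrite big_nat_recr//=; have dn := dl_gt0 n.+1 d0.
    have [h|h] := leP `|x - y| (dl d n); last first.
      rewrite mulr0 addr0; apply: le_trans ih; rewrite /Fn indT ?indT//.
      by rewrite dlS; have := dl_gt0 n d0; clra.
    rewrite mulr1 -[leLHS]add0r; apply: lerD; first by apply: le_trans ih.
    rewrite /Fn; have [h'|h'] := ltP (dl d n.+1) `|x - y|; last by rewrite mul0r kap_ge0.
    rewrite mul1r /Jq/=; apply: le_trans (kap_mono dn (ltW h')).
    by rewrite ler_piMl ?kap_ge0 ?ind_le1.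
- exact: Fn0.
- move=> n y; apply: ler_wpM2r; first by rewrite /Jq mulr_ge0 ?ind_ge0 ?kap_ge0.
  by apply: ind_mono; apply: le_lt_trans; rewrite dlS; have := dl_gt0 n d0; clra.
- move=> y; have [xy|ne] := eqVneq x y.
    have e : - (3 / 4) != 0 :> R by apply/eqP; clra.
    by exists 0%N; rewrite /Fn /Jq xy /kap/= subrr normr0 (powR0 e) ?mulr0 ?mul0r ?mulr0.
  have l0 : 0 < `|x - y| by rewrite normr_gt0 subr_eq0.
  have [n hn] := dl_small d0 l0; exists n.
  by rewrite /Fn indT ?mul1r//; exact: hn.
Qed.

Lemma L1b_shear (F : R * R -> R) c : measurable_fun setT F ->
  L1b mu2 (fun z => F (z.1, z.2 + z.1)) c -> L1b mu2 F c.
Proof.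
move=> mF [mF' Fc]; split => //; apply: le_trans Fc; rewrite le_eqVlt; apply/orP; left; apply/eqP.
have ge0 (G : R * R -> R) z : (0 <= (`|G z|)%:E)%E by rewrite lee_fin.
rewrite (tonelli12 (measurable_absE mF) (ge0 F)).
apply: etrans _ (esym (tonelli12 (measurable_absE mF') (ge0 _))).
apply: eq_integral => x _; apply/esym.
apply: (integral_shift x (f := fun y => (`|F (x, y)|)%:E)) => [|//].
exact: (measurable_pair1 x (measurable_absE mF)).
Qed.

Lemma form_E a Lam (v : R -> R) : ker_ok a Lam -> Good v -> L1b mu2 (en v) (Lam * form a v v).
Proof.
move=> ok gv; have [mv _ _] := gv; have [c hc] := form_good_L1b ok gv gv.
have [_ L1 _ _] := ok; have Lp : 0 < Lam by clra.
have hs := L1b_self hc (fun z => mulr_ge0 (mulr_ge0 _ _) (kk_ge0 z ok)).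
have {}hs : L1b mu2 (fun z => (v z.1 - v z.2) * (v z.1 - v z.2) * kk a z) (form a v v).
  by apply: L1b_self hc _ => z; rewrite -expr2 mulr_ge0 ?sqr_ge0//; exact: kk_ge0 ok.
have := L1bZ Lam hs; rewrite (ger0_norm (ltW Lp)); apply: L1b_le2; first exact: mes_en.
move=> x y; rewrite ger0_norm ?en_ge0// /en/=; have /andP[h _] := kk_bnd x y ok.
rewrite -expr2 mulrCA; apply: ler_wpM2l; first exact: sqr_ge0.
by rewrite -(ler_pM2l (_ : 0 < Lam^-1)) ?invr_gt0// mulrA mulVf ?mul1r// gt_eqF.
Qed.

(* [4 N(h) = N(2h) + |D_h D_h W|^2], and testing with [D_h W] gains the extra half power of [h] in
   the last term. *)
Lemma N_decay a Lam (W : R -> R) K F1 x0 rb rc : ker_ok a Lam -> Good W -> BC W -> 0 <= K -> 0 <= F1 ->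
  (forall x y, (W x - W y) ^+ 2 <= K * `|x - y|) ->
  (forall x, rb < `|x - x0| -> W x = 0) -> rb < rc ->
  (forall phi M, Good phi -> (forall x, `|phi x| <= M) -> (forall x, rc < `|x - x0| -> phi x = 0) ->
    `|form a W phi| <= M * F1) ->
  exists A d, [/\ 0 < A, 0 < d & forall h, 0 < h -> h <= d ->
    I1 (fun x => (W (x + h) - W x) ^+ 2) <= A * h `^ (3 / 2)].
Proof.
move=> ok gW bW K0 F0 hK Ws rbc dual.
have [_ L1 _ _] := ok; have Lp : 0 < Lam by clra.
have d0 : 0 < rc - rb by clra.
pose f h := I1 (fun x => inc W h x ^+ 2).
pose C := 12 * Lam * F1 * Num.sqrt K.
have C0 : 0 <= C by rewrite /C !mulr_ge0 ?sqrtr_ge0// ltW.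
have e0 : 0 <= 4 * I1 (fun x => W x ^+ 2) by rewrite mulr_ge0//; apply: I1_ge0 => x; exact: sqr_ge0.
(* The recursion has factor 1/4 from [2 h] to [h], so any power below 2 would survive; 3/2 is what
   the last term provides. *)
have th : 4^-1 * 2 `^ (3 / 2) < 1 :> R.
  have : (2 : R) `^ (3 / 2) < 2 `^ 2.
    rewrite /powR !gt_eqF//; rewrite ltr_expR ltr_pM2r ?ln_gt0; clra.
  by rewrite (powR_mulrn 2)// => h; clra.
have t0 : (0 : R) < 3 / 2 by clra.
have th0 : (0 : R) <= 4^-1 by clra.
have b1 : (1 : R) < 2 by clra.
have [A A0 HA] := decay_pow_exact th0 C0 t0 d0 e0 b1 th.
exists A, (rc - rb); split => //; apply: (HA f).
  move=> h h0 hd; have := parallelogram h bW; rewrite /f /inc => <-.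
  by rewrite lerDl; apply: I1_ge0 => x; exact: sqr_ge0.
move=> h h0 hd; have binc : BC (inc W h) by apply: BC_B => //; exact: BC_shift.
have ginc := inc_Good gW h.
have pl := parallelogram h binc.
have E1 : I1 (fun x => (inc W h (x + h) + inc W h x) ^+ 2) = f (2 * h).
  apply: I1_ext => x; congr (_ ^+ 2); rewrite /inc.
  by rewrite (_ : x + h + h = x + 2 * h); ring.
suff E2 : I1 (fun x => (inc W h (x + h) - inc W h x) ^+ 2) <= 4 * (C * h `^ (3 / 2)).
  by move: pl; rewrite E1 -/(f h); clra.
have vm x : `|inc W h x| <= Num.sqrt (K * h).
  rewrite -sqrtr_sqr ler_wsqrtr//; apply: le_trans (hK _ _) _.
  by rewrite [x + h]addrC addrK ger0_norm ?(ltW h0).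
have nx x : `|x + h - x0| <= `|x - x0| + h.
  by rewrite addrAC; have := ler_normD (x - x0) h; rewrite (ger0_norm (ltW h0)).
have nx' x : `|x - x0| <= `|x + h - x0| + h.
  by have := ler_normB (x + h - x0) h; rewrite (ger0_norm (ltW h0)) addrAC addrK.
have vs x : rc < `|x - x0| -> inc W h x = 0.
  by move=> hx; rewrite /inc !Ws ?subrr//; have := nx' x; clra.
have vs' x : rc < `|x - x0| -> inc W h (x - h) = 0.
  by move=> hx; rewrite /inc subrK !Ws ?subrr//; have := nx (x - h); rewrite subrK; clra.
have F : `|form a (inc W h) (inc W h)| <= 2 * (Num.sqrt (K * h) * F1).
  rewrite /inc (form_diff h ok gW ginc).
  have q1 := dual _ _ ginc vm vs.
  have q2 := dual _ _ (Good_shift (- h) ginc) (fun x => vm (x - h)) vs'.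
  by apply: le_trans (ler_normB _ _) _; clra.
have := diff_sum_energy 1 binc h0 (form_E ok ginc); rewrite big_nat1 dl0 => S.
have {}S : I1 (fun x => (inc W h (x + h) - inc W h x) ^+ 2) <= h * (24 * (Lam * (2 * (Num.sqrt (K * h) * F1)))).
  rewrite -ler_pdivrMl//; apply: le_trans S _; apply: ler_wpM2l => //; apply: ler_wpM2l; first exact: ltW.
  by apply: le_trans F; exact: ler_norm.
apply: le_trans S _; apply: eqle.
have -> : h `^ (3 / 2) = h * Num.sqrt h.
  rewrite (_ : 3 / 2 = 1 + 2^-1); last by field.
  rewrite powRD; last by apply/implyP => _; rewrite gt_eqF.
  by rewrite powRr1 ?(ltW h0)// powR12_sqrt// ltW.
by rewrite sqrtrM// /C; ring.
Qed.

End Kernel.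

Ltac nnx := repeat first [ exact: kap_ge0 | exact: Jfar_ge0 | progress nn | rewrite invr_ge0 ].

(** * The right hand side as a functional on square integrable functions *)

Section SquareDual.
Variables (R : realType) (N : nat).
Local Notation mu := (@lebesgue_measure R).
Local Notation mu2 := (mu \x mu)%E.
Variables (a : R -> R) (Lam : R) (u m : 'I_N -> R -> R) (x0 r0 r1 K : R) (M2 : 'I_N -> R).
Hypotheses (HS : Sol a Lam u m x0 r0) (r1r : r1 < r0) (K0 : 0 <= K)
  (hu : forall i x y, `|x - x0| <= r1 -> `|y - x0| <= r1 -> (u i x - u i y) ^+ 2 <= K * `|x - y|)
  (hm2 : forall i, L1b mu (fun x => m i x ^+ 2) (M2 i)).
Implicit Types (phi : R -> R) (i j : 'I_N).

Lemma supp_BC phi c rho : Good phi -> (forall x, rho < `|x - c| -> phi x = 0) -> BC phi.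
Proof.
move=> [mp [M hM] _] p0; split => //; exists M, (`|c| + rho); split => // x hx.
by apply: p0; have := ler_normD (x - c) c; rewrite subrK; clra.
Qed.

Lemma L1b_sq phi : BC phi -> L1b mu (fun x => phi x ^+ 2) (I1 (fun x => phi x ^+ 2)).
Proof.
by move=> /BC_X2/BC_L1b[c hc]; apply: (L1b_self hc) => x; exact: sqr_ge0.
Qed.

Lemma L1b_abs_sq phi rc lam : 0 < rc -> 0 < lam -> BC phi -> (forall x, rc < `|x - x0| -> phi x = 0) ->
  L1b mu (fun x => phi x) (2^-1 * (lam * I1 (fun x => phi x ^+ 2)) + rc / lam).
Proof.
move=> rc0 l0 bp p0; have [mp _] := bp; have hp := L1b_sq bp.
have hi := L1b_itv x0 (ltW rc0).
have := L1bD (L1bZ (2^-1 * lam) hp) (L1bZ (2^-1 / lam) hi).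
rewrite !ger0_norm; [|by rewrite divr_ge0 ?(ltW l0)//; clra|by rewrite mulr_ge0 ?(ltW l0)//; clra] => H.
apply: (@L1b_weak _ _ _ _ _ _ _ _ (L1b_le1 _ _ H)) => //.
  by apply: eqle; field; exact: lt0r_neq0.
move=> x; rewrite -[(phi x) ^+ 2]real_normK ?num_real// distrC.
have [h|h] := leP `|x - x0| rc; last by rewrite p0// normr0; nn; rewrite ?invr_ge0 ?(ltW l0)//; clra.
have := @amgm _ `|phi x| 1 (lam / 2) (divr_gt0 l0 (ltr0Sn _ _)); rewrite !mulr1 => /le_trans; apply.
by rewrite /ind; apply: eqle; field; exact: lt0r_neq0.
Qed.

Section Cut.
Variables (chi : R -> R) (L ra rb : R).
Hypotheses (hchi : cutoff chi x0 ra rb L) (L0 : 0 < L) (ra0 : 0 < ra) (rab : ra < rb) (rbr : rb < r1).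

Lemma cut_hol : exists K', 0 <= K' /\ forall i x y, (Wi u chi i x - Wi u chi i y) ^+ 2 <= K' * `|x - y|.
Proof.
have ra0' := ra0; have rab' := rab; have rbr' := rbr; have K0' := K0; have L0' := L0.
have iv : 0 < (r1 - rb)^-1 by rewrite invr_gt0; clra.
have LL : 0 <= 2 * L ^+ 2 * (2 * r1) by rewrite !mulr_ge0 ?sqr_ge0//; clra.
have S i x y : `|x - x0| <= r1 -> (Wi u chi i x - Wi u chi i y) ^+ 2 <=
    (2 * K + 2 * L ^+ 2 * (2 * r1) + (r1 - rb)^-1) * `|x - y|.
  move=> hx; have l0 := normr_ge0 (x - y).
  have [hy|hy] := leP `|y - x0| r1.
    have l2 : `|x - y| <= 2 * r1 by have := ler_distD x0 x y; rewrite (distrC x0 y); clra.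
    have A1 : (Wi u chi i x - Wi u chi i y) ^+ 2 <= 2 * (u i x - u i y) ^+ 2 + 2 * (chi x - chi y) ^+ 2.
      rewrite /Wi (_ : _ - _ = chi x * (u i x - u i y) + u i y * (chi x - chi y)); last by ring.
      apply: le_trans (_ : 2 * (chi x * (u i x - u i y)) ^+ 2 + 2 * (u i y * (chi x - chi y)) ^+ 2 <= _).
        by move: (chi x * _) (u i y * _) => p q; apply: (@le_sub_sq _ (p - q)); ring.
      by apply: lerD; apply: ler_wpM2l => //; rewrite exprMn ler_piMl ?sqr_ge0// -real_normK ?num_real//;
        rewrite expr_le1//; [exact: cut_norm1 hchi x|exact: sol_1 HS i y].
    have A2 : (chi x - chi y) ^+ 2 <= L ^+ 2 * (2 * r1) * `|x - y|.
      rewrite -real_normK ?num_real//; apply: le_trans (_ : (L * `|x - y|) ^+ 2 <= _).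
        by rewrite ler_sqr ?nnegrE ?mulr_ge0 ?(ltW L0)//; exact: cut_lip hchi x y.
      by rewrite exprMn -mulrA; apply: ler_wpM2l; [exact: sqr_ge0|rewrite expr2; exact: ler_wpM2r].
    have A3 := hu i hx hy; have A4 : 0 <= (r1 - rb)^-1 * `|x - y| by rewrite mulr_ge0// ltW.
    rewrite (_ : _ * `|x - y| = 2 * (K * `|x - y|) + 2 * (L ^+ 2 * (2 * r1) * `|x - y|) + (r1 - rb)^-1 * `|x - y|).
      by move: (L ^+ 2 * (2 * r1) * `|x - y|) (K * `|x - y|) ((r1 - rb)^-1 * `|x - y|) A1 A2 A3 A4 => *; clra.
    by ring.
  rewrite /Wi (cut_0 hchi (x := y)) ?mul0r ?subr0; last by clra.
  have [h|h] := leP rb `|x - x0|.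
    by rewrite (cut_0 hchi h) mul0r expr0n/= mulr_ge0//; clra.
  have l1 : r1 - rb <= `|x - y| by have := ler_distD x y x0; rewrite (distrC y x); clra.
  apply: le_trans (_ : 1 <= _).
    rewrite -real_normK ?num_real// expr_le1// normrM.
    by rewrite mulr_ile1//; [exact: cut_norm1 hchi x|exact: sol_1 HS i x].
  apply: le_trans (_ : (r1 - rb)^-1 * `|x - y| <= _); last by apply: ler_wpM2r => //; clra.
  by rewrite -ler_pdivrMl ?invr_gt0 ?invrK ?mulr1//; clra.
exists (2 * K + 2 * L ^+ 2 * (2 * r1) + (r1 - rb)^-1); split; first by clra.
move=> i x y; have [hx|hx] := leP `|x - x0| r1; first exact: S.
have [hy|hy] := leP `|y - x0| r1; first by rewrite -sqrrN opprB distrC; exact: S.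
rewrite /Wi !(cut_0 hchi) ?mul0r ?subrr ?expr0n/= ?mulr_ge0//; clra.
Qed.

Lemma cut_far0 x : r0 <= `|x - x0| -> chi x = 0.
Proof. by move=> h; apply: (cut_0 hchi); have := r1r; have := rbr; clra. Qed.

Lemma W_Good i : Good (Wi u chi i).
Proof.
by apply: (Good_mul_sol HS i _ cut_far0); apply: (cut_Good hchi); have := ra0; have := rab; clra.
Qed.

Lemma W_supp i x : rb < `|x - x0| -> Wi u chi i x = 0.
Proof. by move=> h; rewrite /Wi (cut_0 hchi) ?mul0r// ltW. Qed.

Lemma W_BC i : BC (Wi u chi i).
Proof. exact: (supp_BC (W_Good i) (W_supp i)). Qed.

Lemma dualM i rc : 0 < rc -> rc < r0 -> exists F1, 0 <= F1 /\ forall phi M, Good phi ->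
  (forall x, `|phi x| <= M) -> (forall x, rc < `|x - x0| -> phi x = 0) ->
  `|form a (Wi u chi i) phi| <= M * F1.
Proof.
move=> rc0 rcr; have [cm hcm] := sol_mm HS i.
have hb : `|x0 - x0| + rc < r0 by rewrite subrr normr0 add0r.
have hn := nu_L1b HS hb; have hi := L1b_itv x0 (ltW rc0).
have [_ L1 _ _] := sol_k HS; have Lp : 0 < Lam by clra.
pose F1 := 2 * Lam * nu u x0 rc + cm + Lam * (2 * L ^+ 2 + 2 * L + 16) * (2 * rc).
have F0 : 0 <= F1.
  have := L1b_ge0 hn; have := L1b_ge0 hcm => ? ?; have LL := ltW L0.
  by rewrite /F1; nn; rewrite ?(ltW Lp).
exists F1; split => // phi M gp hM p0.
have M0 : 0 <= M := le_trans (normr_ge0 _) (hM 0); have [mp _ _] := gp.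
have rb0 : 0 < rb by have := ra0; have := rab; clra.
have me := mes_ent HS; have [mm _] := hcm.
have h1 : L1b mu2 (fun z => `|phi z.1| * ent u z) (M * nu u x0 rc).
  rewrite -[X in L1b _ _ (X * _)](ger0_norm M0); apply: L1b_le2 (L1bZ M hn); first by mes.
  move=> x y /=; rewrite ger0_norm; last by rewrite mulr_ge0 ?ent_ge0.
  rewrite mulrA; apply: ler_wpM2r; first exact: ent_ge0.
  by have [h|h] := leP `|x - x0| rc; [rewrite mulr1|rewrite p0// normr0 mulr0].
have h2 : L1b mu (fun x => m i x * phi x) (M * cm).
  rewrite -[X in L1b _ _ (X * _)](ger0_norm M0); apply: L1b_le1 (L1bZ M (L1b_norm hcm)); first by mes.
  by move=> x; rewrite normrM mulrC; apply: ler_wpM2r.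
have h3 : L1b mu (fun x => phi x) (M * (2 * rc)).
  rewrite -[X in L1b _ _ (X * _)](ger0_norm M0); apply: L1b_le1 (L1bZ M hi) => // x.
  by rewrite distrC; have [h|h] := leP `|x - x0| rc; [rewrite mulr1|rewrite p0// normr0 mulr0].
apply: le_trans (localized HS hchi rb0 L0 gp _ h1 h2 h3) _.
  by move=> x hx; apply: p0; clra.
by apply: eqle; rewrite /F1; ring.
Qed.

Lemma N_cut i : exists A d, [/\ 0 < A, 0 < d & forall h, 0 < h -> h <= d ->
    I1 (fun x => (Wi u chi i (x + h) - Wi u chi i x) ^+ 2) <= A * h `^ (3 / 2)].
Proof.
have ra0' := ra0; have rab' := rab; have rbr' := rbr; have r1r' := r1r.
have [K' [K'0 hK]] := cut_hol.
have c0 : 0 < r1 by clra.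
have [F1 [F10 hF]] := dualM i c0 r1r.
exact: (N_decay (sol_k HS) (W_Good i) (W_BC i) K'0 F10 (hK i) (@W_supp i) rbr hF).
Qed.

End Cut.

(** Near the diagonal, with [D] the squared increment and [t] the distance, [|phi| D / t^2] is split
    by the weight [lam * kap t]. The remaining [D^2 / (t^4 kap t)] is linear in [D] after
    [D <= K' t]; integrating along lines of constant [t] leaves the mean square increments bounded
    by [N_cut]. *)
Lemma ent_term j rc : 0 < rc -> rc < r1 -> exists C, 0 <= C /\ forall lam phi, 0 < lam -> Good phi ->
  (forall x, rc < `|x - x0| -> phi x = 0) ->
  L1b mu2 (fun z => `|phi z.1| * en (u j) z) (C * (lam * I1 (fun x => phi x ^+ 2) + lam^-1)).
Proof.
move=> rc0 rcr.
have ra0 : 0 < (2 * rc + r1) / 3 by clra.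
have rab : (2 * rc + r1) / 3 < (rc + 2 * r1) / 3 by clra.
have rbr : (rc + 2 * r1) / 3 < r1 by clra.
have [W [A [d [K' [[K'0 A0 d0] hK hN bW eW]]]]] : exists W A d K', [/\ [/\ 0 <= K', 0 < A & 0 < d],
    forall x y, (W x - W y) ^+ 2 <= K' * `|x - y|, forall h, 0 < h -> h <= d ->
    I1 (fun x => (W (x + h) - W x) ^+ 2) <= A * h `^ (3 / 2), BC W &
    forall x, `|x - x0| <= (2 * rc + r1) / 3 -> W x = u j x].
  have [chi [L [L0 hchi]]] := cutoff_ex x0 ra0 rab.
  have [K' [K'0 hK]] := cut_hol hchi L0 ra0 rab rbr.
  have [A [d [A0 d0 hN]]] := N_cut hchi L0 ra0 rab rbr j.
  exists (Wi u chi j), A, d, K'; split => //; first exact: W_BC hchi ra0 rab rbr j.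
  by move=> x hx; rewrite /Wi (cut_1 hchi hx) mul1r.
have mW : measurable_fun setT W by case: bW.
pose de := Num.min d ((r1 - rc) / 3).
have de0 : 0 < de by rewrite lt_min d0 divr_gt0//; clra.
have ded : de <= d by rewrite ge_min lexx.
have der : de <= (r1 - rc) / 3 by rewrite ge_min lexx orbT.
have [cJ hJ] := Jq_L1b de0; have cJ0 := L1b_ge0 (hJ 0).
have mk : measurable_fun setT (@kap R) := @mes_kap R.
pose F2 (z : R * R) := ind (`|z.1 - z.2| <= de) * ((W z.1 - W z.2) ^+ 2 / (`|z.1 - z.2| ^+ 3 * kap `|z.1 - z.2|)).
have mF2 : measurable_fun setT F2 by rewrite /F2; mes.
have hF2 : L1b mu2 F2 (A * cJ).
  apply: L1b_shear => //.
  have hg : L1b mu (fun t => A * Jq de (0, t)) (A * cJ).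
    by rewrite -[X in L1b _ _ (X * _)](ger0_norm (ltW A0)); apply: L1bZ; exact: hJ.
  apply: (L1b_tonelli' _ _ hg).
    by rewrite /F2/=; mes.
  move=> t; rewrite /F2/=.
  pose k := ind (`|t| <= de) / (`|t| ^+ 3 * kap `|t|).
  have k0 : 0 <= k by rewrite /k divr_ge0 ?ind_ge0 ?mulr_ge0 ?kap_ge0 ?exprn_ge0.
  have bt : BC (fun x => W (x + t) - W x) by apply: BC_B => //; exact: BC_shift.
  have := L1bZ k (L1b_sq bt); rewrite (ger0_norm k0) => -[_ h].
  apply: le_trans (_ : (k * I1 (fun x => (W (x + t) - W x) ^+ 2))%:E <= _)%E.
    apply: le_trans h; rewrite le_eqVlt; apply/orP; left; apply/eqP.
    apply: eq_integral => x _; congr (`|_|)%:E; rewrite /k [t + x]addrC.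
    by rewrite (_ : x - (x + t) = - t) ?normrN -?[(W x - _) ^+ 2]sqrrN ?opprB; ring.
  rewrite lee_fin /Jq/= sub0r normrN /k.
  have [ht|ht] := leP `|t| de; last by rewrite !mul0r mulr0.
  rewrite !mul1r; have [t0|t0] := eqVneq t 0.
    by rewrite t0 normr0 expr0n/= mul0r invr0 mul0r mulr_ge0 ?kap_ge0// ltW.
  have tp : 0 < `|t| by rewrite normr_gt0.
  have kp : 0 < kap `|t| by rewrite /kap powR_gt0.
  have hI : I1 (fun x => (W (x + t) - W x) ^+ 2) <= A * `|t| `^ (3 / 2).
    have td : `|t| <= d by clra.
    apply: le_trans (hN _ tp td); have [tt|tt] := leP 0 t; first by rewrite ger0_norm.
    rewrite ltr0_norm// -(I1_shift (- t) (BC_X2 bt)); apply: eqle; apply: I1_ext => x.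
    by rewrite subrK -sqrrN opprB.
  rewrite ler_pdivrMl; last by rewrite mulr_gt0 ?exprn_gt0.
  apply: le_trans hI _; apply: eqle.
  have -> : `|t| `^ (3 / 2) = `|t| ^+ 3 * (kap `|t| * kap `|t|).
    rewrite /kap -powRD; last by apply/implyP => _; rewrite gt_eqF.
    rewrite -powR_mulrn// -powRD; last by apply/implyP => _; rewrite gt_eqF.
    by congr (_ `^ _); field.
  ring.
pose C := cJ / 2 * (1 + K' * A) + (4 + 8 * rc) / de.
exists C; split; first by rewrite /C addr_ge0 ?mulr_ge0 ?addr_ge0 ?invr_ge0 ?mulr_ge0 ?(ltW A0) ?(ltW de0) ?(ltW rc0).
move=> lam phi l0 gp p0; have bp := supp_BC gp p0; have [mp _ _] := gp.
have hp := L1b_sq bp; set I := I1 _ in hp *.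
have ha := L1b_abs_sq rc0 l0 bp p0; rewrite -/I in ha.
have mJq : measurable_fun setT (Jq de) by rewrite /Jq; mes.
have B1 := L1bZ (lam / 2) (L1b_ker mJq hJ hp).
have B2 := L1bZ (K' / (2 * lam)) hF2.
have B3 := L1bZ 4 (L1b_ker (mes_Jfar de) (fun x => L1b_Jfar x de0) (L1b_norm ha)).
have I0 : 0 <= I by apply: I1_ge0 => x; exact: sqr_ge0.
have e1 : 0 <= lam / 2 by rewrite divr_ge0 // ltW.
have e2 : 0 <= K' / (2 * lam) by rewrite divr_ge0 // mulr_ge0// ltW.
have mu_ := mes_en (sol_mu HS j).
apply: (@L1b_weak _ _ _ _ _ _ _ _ (L1b_le2 _ _ (L1bD (L1bD B1 B2) B3))).
- rewrite (ger0_norm e1) (ger0_norm e2) (ger0_norm (ler0n R 4)) /C.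
  have li : 0 < lam^-1 by rewrite invr_gt0.
  have di : 0 < de^-1 by rewrite invr_gt0.
  rewrite -subr_ge0 (_ : _ - _ = cJ / 2 / lam + cJ / 2 * K' * A * (lam * I) + 8 * rc / de * (lam * I) + 4 / de / lam).
    by nnx.
  by field; rewrite !gt_eqF.
- by mes.
move=> x y /=; rewrite ger0_norm; last by nn.
have far0 : 0 <= 4 * (`|phi x| * Jfar de (x, y)) by nnx.
have n1 : 0 <= lam / 2 * (phi x ^+ 2 * Jq de (x, y)) by rewrite /Jq; nnx.
have n2 : 0 <= K' / (2 * lam) * F2 (x, y).
  by rewrite /F2; nnx.
have [px|px] := leP `|x - x0| rc; last first.
  by rewrite {1}p0// normr0 mul0r; apply: addr_ge0 => //; exact: addr_ge0.
have [l|l] := leP `|x - y| de; last first.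
  apply: le_trans (_ : 4 * (`|phi x| * Jfar de (x, y)) <= _); last by rewrite lerDr addr_ge0.
  rewrite [leRHS]mulrCA; apply: ler_wpM2l => //; rewrite /en /Jfar/= (ltW l) /ind mul1r.
  apply: ler_wpM2r; first exact: isq_ge0.
  rewrite -real_normK ?num_real//; have := sol_1 HS j x; have := sol_1 HS j y.
  have := ler_normB (u j x) (u j y); have := normr_ge0 (u j x - u j y); move: `|u j x - u j y| => q *.
  by have := ler_pM (_ : 0 <= q) (_ : 0 <= q) (_ : q <= 2) (_ : q <= 2); rewrite -expr2; cnra.
apply: le_trans (_ : lam / 2 * (phi x ^+ 2 * Jq de (x, y)) + K' / (2 * lam) * F2 (x, y) <= _); last by rewrite lerDl.
have py : `|y - x0| <= (2 * rc + r1) / 3 by have := ler_distD x y x0; rewrite (distrC y x); clra.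
have eu : u j x - u j y = W x - W y by rewrite !eW//; clra.
rewrite /en /Jq /F2/= l /ind !mul1r eu.
have [exy|ne] := eqVneq x y.
  by rewrite exy subrr expr0n/= !mul0r !mulr0 addr0; nnx.
have tp : 0 < `|x - y| by rewrite normr_gt0 subr_eq0.
have kp : 0 < kap `|x - y| by rewrite /kap powR_gt0.
rewrite -[(x - y) ^+ 2]real_normK ?num_real// -[phi x ^+ 2]real_normK ?num_real//.
have hD := hK x y; have D0 := sqr_ge0 (W x - W y).
move: ((W x - W y) ^+ 2) `|x - y| (kap _) `|phi x| hD D0 tp kp => D t k P hD D0 tp kp.
have t1 : 0 < lam * k / 2 by rewrite divr_gt0// mulr_gt0.
(* Of the two factors [D] that appear, one is replaced by [K' * t] at the end. *)
apply: le_trans (amgm P (D / t ^+ 2) t1) _; apply: lerD; first by apply: eqle; ring.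
have -> : (D / t ^+ 2) ^+ 2 / (4 * (lam * k / 2)) = D * (D / (2 * lam * t ^+ 4 * k)).
  by field; rewrite !gt_eqF.
have -> : K' / (2 * lam) * (D / (t ^+ 3 * k)) = K' * t * (D / (2 * lam * t ^+ 4 * k)).
  by field; rewrite !gt_eqF.
by apply: ler_wpM2r => //; rewrite divr_ge0// !mulr_ge0 ?exprn_ge0// ltW.
Qed.

(** A bound by [lam * I + lam^-1] for all [lam] is a bound by the norm of [phi]; keeping the
    parameter avoids square roots. *)
Lemma dual2 i chi L ra rb rc : cutoff chi x0 ra rb L -> 0 < L -> 0 < ra -> ra < rb -> rb < r1 -> 0 < rc -> rc < r1 ->
  exists C, 0 < C /\ forall lam phi, 0 < lam -> Good phi -> (forall x, rc < `|x - x0| -> phi x = 0) ->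
  `|form a (Wi u chi i) phi| <= C * (lam * I1 (fun x => phi x ^+ 2) + lam^-1).
Proof.
move=> hchi L0 ra0 rab rbr rc0 rcr.
have [_ L1 _ _] := sol_k HS; have Lp : 0 < Lam by clra.
have [Cj hCj] := choice (fun j => ent_term j rc0 rcr).
have C0 : 0 <= \sum_j Cj j by apply: sumr_ge0 => j _; case: (hCj j).
have M20 := L1b_ge0 (hm2 i).
pose LL := Lam * (2 * L ^+ 2 + 2 * L + 16).
have LL0 : 0 <= LL by rewrite /LL; have := ltW L0 => ?; nn; exact: ltW.
pose C := 2 * Lam * (\sum_j Cj j) + (1 + M2 i) + LL * (1 + rc).
have Cp : 0 < C.
  have q1 : 0 <= 2 * Lam * (\sum_j Cj j) by rewrite !mulr_ge0// ltW.
  have q2 : 0 <= LL * (1 + rc) by rewrite mulr_ge0//; clra.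
  by rewrite /C; clra.
exists C; split => // lam phi l0 gp p0; have bp := supp_BC gp p0; have [mp _ _] := gp.
have hp := L1b_sq bp; set I := I1 _ in hp *.
have I0 : 0 <= I by apply: I1_ge0 => x; exact: sqr_ge0.
have li : 0 < lam^-1 by rewrite invr_gt0.
have lI : 0 <= lam * I by rewrite mulr_ge0// ltW.
have h3 := L1b_abs_sq rc0 l0 bp p0; rewrite -/I in h3.
have h1 : L1b mu2 (fun z => `|phi z.1| * ent u z) (\sum_j Cj j * (lam * I + lam^-1)).
  apply: L1b_eq (L1b_sum (index_enum 'I_N) (P := xpredT) (fun j _ => (hCj j).2 lam phi l0 gp p0)) => z.
  by rewrite -mulr_sumr.
have h2 : L1b mu (fun x => m i x * phi x) (lam / 2 * I + (2 * lam)^-1 * M2 i).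
  have e1 : 0 <= lam / 2 by rewrite divr_ge0// ltW.
  have e2 : 0 <= (2 * lam)^-1 by rewrite invr_ge0 mulr_ge0// ltW.
  have := L1bD (L1bZ (lam / 2) hp) (L1bZ (2 * lam)^-1 (hm2 i)); rewrite (ger0_norm e1) (ger0_norm e2).
  have [cm hcm] := sol_mm HS i; have [mm _] := hcm.
  apply: L1b_le1; first by mes.
  move=> x; have := amgm `|phi x| `|m i x| (divr_gt0 l0 (ltr0Sn R 1)).
  rewrite normrM mulrC !real_normK ?num_real// => /le_trans; apply; apply: eqle; field; exact: lt0r_neq0.
have rb0 : 0 < rb by clra.
apply: le_trans (localized HS hchi rb0 L0 gp _ h1 h2 h3) _.
  by move=> x hx; apply: p0; have := r1r; clra.
rewrite -/LL -mulr_suml /C -subr_ge0.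
rewrite (_ : _ - _ = 2^-1 * (lam * I) + lam * I * M2 i + lam^-1 + M2 i / 2 * lam^-1
   + LL * (lam * I / 2 + rc * (lam * I) + lam^-1)).
  by nnx.
by field; exact: lt0r_neq0.
Qed.

End SquareDual.

(** * Dyadic difference quotients *)

Section DifferenceQuotients.
Variable R : realType.
Local Notation mu := (@lebesgue_measure R).
Local Notation mu2 := (mu \x mu)%E.
Variables (a W : R -> R) (Lam x0 rb rc h0 C : R).
Hypotheses (ok : ker_ok a Lam) (gW : Good W) (bW : BC W) (Ws : forall x, rb < `|x - x0| -> W x = 0)
  (h00 : 0 < h0) (rbc : rb + h0 <= rc) (C0 : 0 < C)
  (dual : forall lam phi, 0 < lam -> Good phi -> (forall x, rc < `|x - x0| -> phi x = 0) ->
    `|form a W phi| <= C * (lam * I1 (fun x => phi x ^+ 2) + lam^-1)).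

Lemma form_scale_diff k f g : Good f -> Good g ->
  form a W (fun x => k * (f x - g x)) = k * (form a W f - form a W g).
Proof.
move=> gf gg; have [c1 h1] := form_good_L1b ok gW gf; have [c2 h2] := form_good_L1b ok gW gg.
rewrite /form -(RintB h1 h2) -(RintZ _ (L1bB h1 h2)); apply: Rint_ext => z /=; ring.
Qed.

Lemma form_sum (s : seq nat) (f : nat -> R -> R) : (forall j, Good (f j)) ->
  form a W (fun x => \sum_(j <- s) f j x) = \sum_(j <- s) form a W (f j).
Proof.
move=> gf; have [c hc] := choice (fun j => form_good_L1b ok gW (gf j)).
rewrite /form -(Rint_sum _ hc); apply: Rint_ext => z /=.
by rewrite -mulr_suml -mulr_sumr -sumrB.
Qed.

Let hh j := dl h0 j.
Let v j := inc W (hh j).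
Let E j := form a (v j) (v j).

Let hh0 j : 0 < hh j. Proof. exact: dl_gt0. Qed.
Let Lp : 0 < Lam. Proof. by case: ok => _ L1 _ _; clra. Qed.
Let bv j : BC (v j). Proof. by apply: BC_B => //; exact: BC_shift. Qed.
Let gv j : Good (v j). Proof. exact: inc_Good. Qed.
Let pow_h j : 2 ^+ j = h0 * (hh j)^-1 :> R.
Proof. by rewrite /hh /dl; field; rewrite !gt_eqF ?exprn_gt0. Qed.
Let E0 j : 0 <= E j.
Proof. by have := L1b_ge0 (form_E ok (gv j)); rewrite pmulr_rge0. Qed.

Let v_supp j x : rc < `|x - x0| -> v j x = 0.
Proof.
move=> hx; have := dl_le j h00; rewrite -/(hh j) => hl; have := hh0 j; have := rbc => r1 r2.
rewrite /v /inc !Ws ?subrr//; first by clra.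
have := ler_normB (x + hh j - x0) (hh j); rewrite (ger0_norm (ltW (hh0 j))) addrAC addrK; clra.
Qed.

Let v_supp' j x : rc < `|x - x0| -> v j (x - hh j) = 0.
Proof.
move=> hx; have := dl_le j h00; rewrite -/(hh j) => hl; have := hh0 j; have := rbc => r1 r2.
rewrite /v /inc subrK !Ws ?subrr//; last by clra.
have := ler_normD (x - hh j - x0) (hh j); rewrite (ger0_norm (ltW (hh0 j))) addrAC subrK; clra.
Qed.

(* Test with [phi = sum_j 2^j D_(-h_j) D_(h_j) W]: its L2 norm is controlled by the sum to be bounded. *)
Lemma weighted_energy n : \sum_(0 <= j < n) 2 ^+ j * E j <= 96 * C ^+ 2 * h0 * Lam.
Proof.
pose phi x := \sum_(0 <= j < n) 2 ^+ j * (v j (x - hh j) - v j x).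
have gs j : Good (fun x => v j (x - hh j)) := Good_shift (- hh j) (gv j).
have gt j : Good (fun x => 2 ^+ j * (v j (x - hh j) - v j x)) by apply: GoodC; exact: GoodB.
have gp : Good phi by exact: Good_sum.
have p0 x : rc < `|x - x0| -> phi x = 0.
  by move=> hx; rewrite /phi big1// => j _; rewrite (v_supp j hx) (v_supp' j hx) subrr mulr0.
set Q := \sum_(0 <= j < n) _.
have eQ : form a W phi = Q.
  rewrite form_sum//; apply: eq_bigr => j _; rewrite form_scale_diff//.
  by rewrite /E {2}/v /inc (form_diff (hh j) ok gW (gv j)).
have bt j : BC (fun x => v j (x - hh j) - v j x) by apply: BC_B => //; exact: BC_shift.
have bD i j : BC (fun x => (v j (x + hh i) - v j x) ^+ 2) by apply: BC_X2; apply: BC_B => //; exact: BC_shift.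
have sqE : I1 (fun x => phi x ^+ 2) = \sum_(0 <= j < n) 2 ^+ j *
    (\sum_(0 <= i < n) 2 ^+ i * I1 (fun x => (v j (x + hh i) - v j x) ^+ 2)).
  have -> : I1 (fun x => phi x ^+ 2) = I1 (fun x => \sum_(0 <= j < n) \sum_(0 <= i < n)
     2 ^+ j * 2 ^+ i * ((v i (x - hh i) - v i x) * (v j (x - hh j) - v j x))).
    apply: I1_ext => x; rewrite expr2 {2}/phi mulr_sumr; apply: eq_bigr => j _.
    by rewrite /phi mulr_suml; apply: eq_bigr => i _; ring.
  rewrite I1_sum => [|j]; last by apply: BC_sum => i; apply: BC_Z; exact: BC_M.
  apply: eq_bigr => j _; rewrite I1_sum => [|i]; last by apply: BC_Z; exact: BC_M.
  rewrite mulr_sumr; apply: eq_bigr => i _; rewrite I1Z; last exact: BC_M.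
  (* After the steps have changed sides both factors are the same mixed second difference of [W], so
     every cross term is a square and is counted by [diff_sum_energy]. *)
  rewrite -mulrA second_diff//; congr (_ * (_ * _)); apply: I1_ext => x.
  by rewrite expr2; congr (_ * _); rewrite /v /inc (addrAC x (hh j)); ring.
have sq : I1 (fun x => phi x ^+ 2) <= 24 * h0 * Lam * Q.
  rewrite sqE /Q mulr_sumr; apply: ler_sum => j _.
  rewrite mulrCA; apply: ler_wpM2l; first exact: exprn_ge0.
  have := diff_sum_energy n (bv j) h00 (form_E ok (gv j)); rewrite -/(E j) => H.
  apply: le_trans (_ : h0 * (24 * (Lam * E j)) <= _); last by apply: eqle; ring.
  apply: le_trans (ler_wpM2l (ltW h00) H); apply: eqle; rewrite mulr_sumr; apply: eq_bigr => i _.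
  by rewrite pow_h mulrA.
(* With this [lam] the term containing the square of [phi] is at most [Q / 2] and is absorbed. *)
have l0 : 0 < (48 * C * h0 * Lam)^-1 by rewrite invr_gt0 !mulr_gt0.
have Q0 : 0 <= Q by apply: sumr_ge0 => j _; rewrite mulr_ge0 ?exprn_ge0.
have := dual l0 gp p0; rewrite eQ ger0_norm// invrK => D.
have hl : C * ((48 * C * h0 * Lam)^-1 * I1 (fun x => phi x ^+ 2)) <= Q / 2.
  apply: le_trans (_ : C * ((48 * C * h0 * Lam)^-1 * (24 * h0 * Lam * Q)) <= _).
    by apply: ler_wpM2l; [exact: ltW|apply: ler_wpM2l => //; exact: ltW].
  by apply: eqle; field; rewrite !gt_eqF.
have : Q <= Q / 2 + C * (48 * C * h0 * Lam) by apply: le_trans D _; rewrite mulrDr lerD2r.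
rewrite (_ : C * (48 * C * h0 * Lam) = 96 * C ^+ 2 * h0 * Lam / 2); last by field.
by move: (96 * _ * _ * _) => X; clra.
Qed.

Definition quot j x := (dl h0 j)^-1 * inc W (dl h0 j) x.
Let Nq j := I1 (fun x => quot j x ^+ 2).

Lemma quot_BC j : BC (quot j). Proof. by apply: BC_Z; exact: bv. Qed.

Lemma quot_step k : Nq k.+1 = Nq k + (hh k ^+ 2)^-1 * I1 (fun x => (v k.+1 (x + hh k.+1) - v k.+1 x) ^+ 2).
Proof.
have sc j : Nq j = (hh j ^+ 2)^-1 * I1 (fun x => v j x ^+ 2).
  rewrite -I1Z; last exact: BC_X2; apply: I1_ext => x.
  by rewrite /quot exprMn exprVn.
have h2 : hh k = 2 * hh k.+1 by rewrite /hh dlS; field.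
have pl := parallelogram (hh k.+1) (bv k.+1).
have e : I1 (fun x => (v k.+1 (x + hh k.+1) + v k.+1 x) ^+ 2) = I1 (fun x => v k x ^+ 2).
  apply: I1_ext => x; congr (_ ^+ 2); rewrite /v /inc h2.
  by rewrite (_ : x + hh k.+1 + hh k.+1 = x + 2 * hh k.+1); ring.
rewrite e in pl; rewrite !sc.
have -> : I1 (fun x => v k.+1 x ^+ 2) = 4^-1 * (4 * I1 (fun x => v k.+1 x ^+ 2)) by rewrite mulrA mulVf ?mul1r.
by rewrite -pl h2; field; rewrite gt_eqF.
Qed.

Lemma quot_mono j k : (j <= k)%N -> Nq j <= Nq k.
Proof.
move=> /subnK <-; elim: (k - j)%N => // n ih; apply: le_trans ih _; rewrite addSn quot_step lerDl.
by rewrite mulr_ge0 ?isq_ge0//; apply: I1_ge0 => x; exact: sqr_ge0.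
Qed.

Lemma quot_bounded : exists S, forall k, Nq k <= S.
Proof.
exists (Nq 0 + 6 * Lam / h0 * (96 * C ^+ 2 * h0 * Lam)) => k.
apply: le_trans (_ : Nq 0 + 6 * Lam / h0 * (\sum_(0 <= j < k.+1) 2 ^+ j * E j) <= _); last first.
  rewrite lerD2l; apply: ler_wpM2l; last exact: weighted_energy.
  by rewrite divr_ge0 ?mulr_ge0 ?(ltW Lp) ?(ltW h00).
elim: k => [|k ih].
  rewrite lerDl mulr_ge0 ?divr_ge0 ?mulr_ge0 ?(ltW Lp) ?(ltW h00)//.
  by apply: sumr_ge0 => j _; rewrite mulr_ge0 ?exprn_ge0.
rewrite quot_step big_nat_recr//= mulrDr addrA; apply: lerD => //.
have := diff_sum_energy 1 (bv k.+1) (hh0 k.+1) (form_E ok (gv k.+1)); rewrite big_nat1 dl0 -/(E k.+1).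
have i0 : 0 <= 4^-1 / hh k.+1 by rewrite divr_ge0 ?invr_ge0 ?(ltW (hh0 _)).
move=> /(ler_wpM2l i0) H.
have e : (hh k ^+ 2)^-1 = 4^-1 / hh k.+1 * (hh k.+1)^-1.
  by rewrite (_ : hh k = 2 * hh k.+1); [field; rewrite gt_eqF|rewrite /hh dlS; field].
rewrite e -mulrA; apply: le_trans H _; apply: eqle; rewrite pow_h; field; rewrite !gt_eqF//.
Qed.

Lemma quot_cauchy j k : (j <= k)%N -> I1 (fun x => (quot k x - quot j x) ^+ 2) <= 20 * (Nq k - Nq j).
Proof.
rewrite leq_eqVlt => /orP[/eqP ->|jk].
  rewrite subrr mulr0 (_ : I1 _ = I1 (fun=> 0)); first exact: L1b_Rint_le (L1b0 _).
  by apply: I1_ext => x; rewrite subrr expr0n.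
pose P := (2 ^ (k - j).-1)%N.
have P2 : (2 * P = 2 ^ (k - j))%N by rewrite /P -expnS prednK// subn_gt0.
have P0 : (0 < P)%N by rewrite /P expn_gt0.
have ek : hh j = (2 * P)%:R * hh k.
  rewrite P2 natrX /hh /dl -{2}(subnK (ltnW jk)) exprD; field; rewrite !gt_eqF ?exprn_gt0//.
have tel n x : \sum_(0 <= i < n) quot k (x + hh k * i%:R) = (hh k)^-1 * (W (x + hh k * n%:R) - W x).
  elim: n => [|n ih]; first by rewrite big_geq// mulr0 addr0 subrr mulr0.
  rewrite big_nat_recr//= ih /quot /inc -mulrDr; congr (_ * _).
  rewrite (_ : x + hh k * n%:R + dl h0 k = x + hh k * n.+1%:R); first by ring.
  by rewrite -natr1 mulrDr mulr1 addrA.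
apply: (average_dist (h := hh k) (quot_BC k) P0); apply/funext => x.
rewrite tel /quot /inc -/(hh j) ek invfM [hh k * _]mulrC -mulrA; congr (_ * (_ * (W _ - _))); ring.
Qed.

End DifferenceQuotients.

(** * Mean square limits *)

Section L2Limit.
Variable R : realType.
Local Notation mu := (@lebesgue_measure R).

(** The sum of [4^j] times the squared increments has an integrable bound [F], so almost everywhere
    the increments are at most [2^-j] times the square root of [F]; this gives a pointwise limit
    with a rate. *)
Lemma L2_limit (f : nat -> R -> R) : (forall j, BC (f j)) ->
  (forall j, I1 (fun x => (f j.+1 x - f j x) ^+ 2) <= 16^-1 ^+ j) ->
  exists (g : R -> R) c, [/\ measurable_fun setT g, 0 <= c & forall n, L1b mu (fun x => (g x - f n x) ^+ 2) (c * 4^-1 ^+ n)].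
Proof.
move=> bf hf; have mf j : measurable_fun setT (f j) by case: (bf j).
have bd j : BC (fun x => f j.+1 x - f j x) by apply: BC_B.
pose S n x := \sum_(0 <= j < n) 4 ^+ j * (f j.+1 x - f j x) ^+ 2.
have q0 : (0 : R) <= 4^-1 by rewrite invr_ge0.
have q1 : (4^-1 : R) < 1 by rewrite invf_lt1; clra.
have hS n : L1b mu (S n) ((1 - 4^-1)^-1).
  have h j : L1b mu (fun x => 4 ^+ j * (f j.+1 x - f j x) ^+ 2) (4^-1 ^+ j).
    have := L1bZ (4 ^+ j) (L1b_sq (bd j)); rewrite ger0_norm ?exprn_ge0//; apply: L1b_weak.
    apply: le_trans (ler_wpM2l (exprn_ge0 _ (ler0n R 4)) (hf j)) _; apply: eqle.
    by rewrite -exprMn; congr (_ ^+ _); field.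
  exact: (L1b_weak (geom_le n q0 q1) (L1b_sum _ (fun j _ => h j))).
have S0 n x : 0 <= S n x by apply: sumr_ge0 => j _; nn.
have [|F [hF F0 FS]] := L1b_levi hS S0.
  by move=> n x; rewrite /S big_nat_recr//= lerDl; nn.
have mF : measurable_fun setT F by case: hF.
pose rt x := F x `^ 2^-1.
have rtE x : rt x ^+ 2 = F x by rewrite /rt powR12_sqrt// sqr_sqrtr.
have rt0 x : 0 <= rt x by exact: powR_ge0.
have mrt : measurable_fun setT rt by rewrite /rt; mes.
(* Clamping the increments to their almost sure bound makes the series converge at every point, so
   the limit is measurable; off a null set nothing is changed. *)
pose D j x := Num.max (- (2^-1 ^+ j * rt x)) (Num.min (2^-1 ^+ j * rt x) (f j.+1 x - f j x)).
pose f' n x := f 0%N x + \sum_(0 <= j < n) D j x.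
have hb j x : 0 <= 2^-1 ^+ j * rt x by rewrite mulr_ge0 ?exprn_ge0 ?invr_ge0.
have Db j x : `|D j x| <= rt x * 2^-1 ^+ j.
  rewrite [leRHS]mulrC /D; have := hb j x; move: (_ * rt x) (_ - _) => b y b0.
  rewrite ler_norml; apply/andP; split; first by rewrite le_max lexx.
  by rewrite ge_max ge_min lexx orTb andbT; clra.
have mf' n : measurable_fun setT (f' n).
  by apply: mes_D => //; apply: mes_sum => j; have := mf j; have := mf j.+1 => ? ?; rewrite /D; mes.
have h2 : (0 : R) <= 2^-1 by rewrite invr_ge0.
have h21 : (2^-1 : R) < 1 by rewrite invf_lt1; clra.
have lim x : exists l, forall k, `|f' k x - l| <= rt x * 2^-1 ^+ k / (1 - 2^-1).
  apply: geo_lim => // k; rewrite /f' big_nat_recr//= addrA [_ + D k x]addrC addrK; exact: Db.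
have [g hg] := choice lim.
have mg : measurable_fun setT g.
  apply: (@measurable_fun_cvg _ _ _ _ (fun n => f' n)) => // x _.
  apply/cvgrPdist_lt => e e0.
  have rt1 : 0 < rt x + 1 by have := rt0 x; clra.
  have e2 : 0 < e / (2 * (rt x + 1)) by rewrite divr_gt0 ?mulr_gt0.
  have [n0 hn0] := dl_small (ltr01 : (0 : R) < 1) e2.
  exists n0 => // n /= nn; rewrite distrC; apply: le_lt_trans (hg x n) _.
  have := hn0 n nn; rewrite /dl div1r -exprVn ltr_pdivlMr ?mulr_gt0// => hh.
  apply: le_lt_trans hh; rewrite (_ : _ / (1 - 2^-1) = rt x * 2^-1 ^+ n * 2); last by field.
  have := exprn_ge0 n h2; have := rt0 x; move: (2^-1 ^+ n) (rt x) => p q; cnra.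
exists g, (4 * (1 - 4^-1)^-1); split => //; first by rewrite mulr_ge0// invr_ge0; clra.
have eqf : {ae mu, forall x, forall n, f' n x = f n x}.
  apply: aeS FS => x hx.
  have Dx j : D j x = f j.+1 x - f j x.
    have : `|f j.+1 x - f j x| <= 2^-1 ^+ j * rt x.
      rewrite -[leRHS](ger0_norm (hb j x)) -ler_sqr ?nnegrE// !real_normK ?num_real// exprMn rtE.
      have := hx j.+1; rewrite /S big_nat_recr//= => h.
      have Sj := S0 j x; rewrite /S in Sj.
      have p4 : 0 < 4 ^+ j :> R by rewrite exprn_gt0.
      rewrite -(ler_pM2l p4); apply: le_trans (_ : F x <= _); first by move: h Sj; clra.
      apply: eqle; rewrite mulrA -exprM mulnC exprM -exprMn.
      by rewrite (_ : 4 * 2^-1 ^+ 2 = 1) ?expr1n ?mul1r//; field.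
    rewrite ler_norml => /andP[l1 l2]; rewrite /D; move: l1 l2.
    by move: (_ - f j x) (_ * rt x) => y b l1 l2; rewrite min_r// max_r.
  move=> n; rewrite /f' (eq_bigr (fun j => f j.+1 x - f j x)) => [|j _]; last exact: Dx.
  by rewrite telescope_sumr// addrC subrK.
move=> n; have mn := mf n.
have := L1bZ (4 * 4^-1 ^+ n) hF; rewrite ger0_norm ?mulr_ge0 ?exprn_ge0// -mulrA [_ ^+ n * _]mulrC mulrA.
apply: L1b_ae_le; first by mes.
apply: aeS eqf => x hx; rewrite ger0_norm ?sqr_ge0// -hx.
rewrite -sqrrN opprB -real_normK ?num_real// -[in leRHS]rtE.
apply: le_trans (_ : (rt x * 2^-1 ^+ n / (1 - 2^-1)) ^+ 2 <= _).
  rewrite ler_sqr ?nnegrE// ?(le_trans _ (hg x n))//; exact: hg.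
apply: eqle; rewrite (_ : 4^-1 = 2^-1 ^+ 2); last by field.
by rewrite -exprM mulnC exprM; field.
Qed.

(** The factor 1/20 cancels the constant of [quot_cauchy], leaving the rate [16^-j] of
    [L2_limit]. *)
Lemma fast_subsequence (N : nat -> R) S : (forall j k, (j <= k)%N -> N j <= N k) -> (forall k, N k <= S) ->
  exists s : nat -> nat, forall j, [/\ (j <= s j)%N, (s j <= s j.+1)%N & N (s j.+1) - N (s j) <= 20^-1 * 16^-1 ^+ j].
Proof.
move=> mono bnd.
have hs : has_sup (range N) by split; [exists (N 0%N), 0%N|exists S => _ [k _ <-]].
have pick j : exists k0, forall k, N k - N k0 <= 20^-1 * 16^-1 ^+ j.
  have e0 : 0 < 20^-1 * 16^-1 ^+ j :> R by rewrite mulr_gt0 ?exprn_gt0 ?invr_gt0.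
  have [_ [k0 _ <-] h] := sup_adherent e0 hs; exists k0 => k.
  have : N k <= sup (range N) by apply: ub_le_sup; [case: hs|exists k].
  by move: (20^-1 * _) h => t; clra.
have [p hp] := choice pick.
pose s := fix s j := if j is i.+1 then maxn (s i).+1 (p i.+1) else p 0%N.
have ps j : (p j <= s j)%N by case: j => //= j; rewrite leq_maxr.
have inc_s j : (s j < s j.+1)%N by rewrite /= leq_maxl.
exists s => j; split; [|exact: ltnW|].
  by elim: j => // j ih; apply: leq_ltn_trans ih (inc_s j).
by apply: le_trans (hp j (s j.+1)); rewrite lerD2l lerN2; apply: mono.
Qed.

End L2Limit.

(** * Identification of the weak derivative *)

Section WeakDerivative.
Variable R : realType.
Local Notation mu := (@lebesgue_measure R).

Lemma derive1_off (K : set R) (f : R -> R) x : closed K -> (forall y, ~ K y -> f y = 0) -> ~ K x -> derive1 f x = 0.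
Proof.
move=> cK f0 Kx; rewrite derive1E (near_eq_derive (g := cst 0)) ?derive_cst//.
have : nbhs x (~` K) by apply: open_nbhs_nbhs; split => //; exact: closed_openC.
by apply: filterS => y /f0.
Qed.

Lemma mean_value (f : R -> R) x y : (forall z, derivable f z 1) -> x <= y ->
  exists2 z, x <= z <= y & f y - f x = derive1 f z * (y - x).
Proof.
move=> df xy; have [| |z] := @MVT_segment _ f (derive1 f) x y xy.
- by move=> z _; rewrite derive1E; exact: derivableP.
- apply: continuous_subspaceT => z; apply: differentiable_continuous; exact/derivable1_diffP.
by rewrite in_itv/= => hz e; exists z.
Qed.

Lemma test_taylor D (phi : R -> R) : test_fun D phi ->
  [/\ BC phi, BC (derive1 phi), (forall x, ~ D x -> phi x = 0 /\ derive1 phi x = 0) &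
   exists B, forall x h, 0 <= h -> `|phi (x - h) - phi x + h * derive1 phi x| <= B * h ^+ 2].
Proof.
move=> [df [K [cK [KD phi0]]]].
have clK : closed K by apply: compact_closed => //; exact: Rhausdorff.
have d0 x : derivable phi x 1 := df 0%N x.
have d1 x : derivable (derive1 phi) x 1 := df 1%N x.
have d2 x : derivable (derive1 (derive1 phi)) x 1 := df 2%N x.
have p1 x : ~ K x -> derive1 phi x = 0 by exact: derive1_off.
have p2 x : ~ K x -> derive1 (derive1 phi) x = 0 by exact: derive1_off.
have cont (f : R -> R) : (forall x, derivable f x 1) -> continuous f.
  by move=> h x; apply: differentiable_continuous; exact/derivable1_diffP.
have bnd (f : R -> R) : continuous f -> (forall x, ~ K x -> f x = 0) ->
    exists2 B, 0 <= B & forall x, `|f x| <= B.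
  move=> cf f0; have := compact_bounded (continuous_compact (continuous_subspaceT cf) cK).
  move=> [M [Mr hM]]; exists (`|M| + 1); first by apply: addr_ge0.
  move=> x; have [Kx|Kx] := pselect (K x); last by rewrite f0// normr0; apply: addr_ge0.
  by apply: (hM (`|M| + 1)) => /=; [have := ler_norm M; clra|exists x].
have [K1 hK1] : exists K1, forall x, K1 < `|x| -> ~ K x.
  have [M [Mr hM]] := compact_bounded cK; exists (`|M| + 1) => x hx Kx.
  have : `|x| <= `|M| + 1 by apply: (hM (`|M| + 1)) => //; have := ler_norm M; clra.
  by clra.
have bc (f : R -> R) : continuous f -> (forall x, ~ K x -> f x = 0) -> BC f.
  move=> cf f0; have [B B0 hB] := bnd f cf f0; split; first exact: continuous_measurable_fun.
  by exists B, K1; split => // x /hK1; exact: f0.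
split; [exact: bc (cont _ d0) phi0|exact: bc (cont _ d1) p1| |].
  by move=> x Dx; split; [apply: phi0 => /KD|apply: p1 => /KD].
have [B B0 hB] := bnd _ (cont _ d2) p2; exists B => x h h0.
have xh : x - h <= x by clra.
have [c /andP[c1 c2] e1] := mean_value d0 xh.
have [d _ e2] := mean_value d1 c2.
have -> : phi (x - h) - phi x + h * derive1 phi x = derive1 (derive1 phi) d * ((x - c) * h).
  rewrite mulrA -e2; have -> : phi (x - h) = phi x - derive1 phi c * (x - (x - h)) by rewrite -e1; ring.
  ring.
rewrite normrM; apply: ler_pM => //.
rewrite ger0_norm ?mulr_ge0//; last by clra.
by rewrite expr2; apply: ler_wpM2r => //; clra.
Qed.

(** Translation moves the difference quotient from [W] to [phi], with an error of order [h] by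
    Taylor's formula. Both this error and the distance to [g] are of order [2^-n], so the defect of
    the identity is zero. *)
Lemma quot_limit_weak W h0 (s : nat -> nat) (g : R -> R) c D phi : BC W -> 0 < h0 -> (forall n, (n <= s n)%N) ->
  measurable_fun setT g -> (forall n, L1b mu (fun x => (g x - quot W h0 (s n) x) ^+ 2) (c * 4^-1 ^+ n)) ->
  test_fun D phi -> I1 (fun x => W x * derive1 phi x) = - I1 (fun x => g x * phi x).
Proof.
move=> bW h00 hs mg hg tf; have [bp bp' _ [B hB]] := test_taylor tf.
have mp : measurable_fun setT phi by case: bp.
have bq n := quot_BC h0 bW (s n).
have mW : measurable_fun setT W by case: bW.
have [cW hW] := BC_L1b bW; have cW0 := L1b_ge0 hW.
set X := I1 (fun x => W x * derive1 phi x); set Y := I1 _.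
have hp := L1b_sq bp; set P := I1 _ in hp.
have P0 : 0 <= P by apply: I1_ge0 => x; exact: sqr_ge0.
have near n : L1b mu (fun x => (g x - quot W h0 (s n) x) * phi x) ((c + P) * 2^-1 ^+ n).
  have mq : measurable_fun setT (quot W h0 (s n)) by case: (bq n).
  have p2 : 0 < 2 ^+ n :> R by rewrite exprn_gt0.
  have q2 : 0 <= 2^-1 ^+ n :> R by rewrite exprn_ge0// invr_ge0.
  have := L1bD (L1bZ (2 ^+ n) (hg n)) (L1bZ (2^-1 ^+ n) hp); rewrite (ger0_norm (ltW p2)) (ger0_norm q2).
  move=> H; apply: (@L1b_weak _ _ _ _ _ _ _ _ (L1b_le1 _ _ H)).
  - apply: eqle; rewrite (_ : 4^-1 = 2^-1 * 2^-1); last by field.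
    by rewrite exprMn exprVn; field; rewrite gt_eqF.
  - by mes.
  move=> x; rewrite normrM; have := amgm `|g x - quot W h0 (s n) x| `|phi x| p2.
  rewrite !real_normK ?num_real// => /le_trans; apply; rewrite lerD2l exprVn mulrC.
  by apply: ler_wpM2r; [exact: sqr_ge0|rewrite lef_pV2 ?posrE ?mulr_gt0//; clra].
have main n : `|X + Y| <= (c + P + `|B| * h0 * cW) * 2^-1 ^+ n.
  have bqp : BC (fun x => quot W h0 (s n) x * phi x) by exact: BC_M.
  have [cq hq] := BC_L1b bqp.
  have eY : Y = I1 (fun x => (g x - quot W h0 (s n) x) * phi x) + I1 (fun x => quot W h0 (s n) x * phi x).
    by rewrite /I1 -(RintD (near n) hq); apply: Rint_ext => x /=; ring.
  set h := dl h0 (s n); have hp0 : 0 < h by exact: dl_gt0.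
  have b1 : BC (fun x => W (x + h) * phi x) by apply: BC_M => //; exact: BC_shift.
  have b2 : BC (fun x => W x * phi x) by exact: BC_M.
  have b3 : BC (fun x => W x * phi (x - h)) by apply: BC_M => //; exact: BC_shift.
  have b4 : BC (fun x => W x * derive1 phi x) by exact: BC_M.
  have eq : I1 (fun x => quot W h0 (s n) x * phi x) = h^-1 * (I1 (fun x => W x * phi (x - h)) - I1 (fun x => W x * phi x)).
    have -> : I1 (fun x => W x * phi (x - h)) = I1 (fun x => W (x + h) * phi x).
      by rewrite -(I1_shift h b3); apply: I1_ext => x; rewrite addrK.
    rewrite -I1B// -I1Z; last exact: BC_B.
    by apply: I1_ext => x; rewrite /quot /inc -/h; ring.
  have small : `|I1 (fun x => quot W h0 (s n) x * phi x) + X| <= `|B| * h * cW.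
    have -> : I1 (fun x => quot W h0 (s n) x * phi x) + X =
        I1 (fun x => h^-1 * (W x * (phi (x - h) - phi x + h * derive1 phi x))).
      have -> : X = h^-1 * (h * X) by rewrite mulrA mulVf ?mul1r// gt_eqF.
      rewrite eq -mulrDr -I1Z// -I1B// -I1D; [|exact: BC_B|exact: BC_Z].
      by rewrite -I1Z; [apply: I1_ext => x; ring|apply: BC_D; [exact: BC_B|exact: BC_Z]].
    have bB : 0 <= `|B| * h by rewrite mulr_ge0// ltW.
    have := L1bZ (`|B| * h) (L1b_norm hW); rewrite (ger0_norm bB) => H.
    apply: (L1b_Rint (L1b_le1 _ _ H)).
      have mp' : measurable_fun setT (derive1 phi) by case: bp'.
      by mes.
    move=> x; rewrite !normrM normfV (gtr0_norm hp0) mulrCA mulrC; apply: ler_wpM2r => //.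
    rewrite ler_pdivrMl//; apply: le_trans (hB x h (ltW hp0)) _.
    apply: le_trans (ler_wpM2r (sqr_ge0 h) (ler_norm B)) _; apply: eqle; ring.
  have hn : h <= h0 * 2^-1 ^+ n.
    rewrite /h /dl exprVn; apply: ler_wpM2l; first exact: ltW.
    by rewrite lef_pV2 ?posrE ?exprn_gt0// ler_eXn2l//; clra.
  have := L1b_Rint (near n); rewrite -/(I1 _) => nb.
  rewrite eY addrCA; apply: le_trans (ler_normD _ _) _.
  rewrite [X in _ <= X]mulrDl [X + _]addrC; apply: lerD => //.
  apply: le_trans small _; rewrite [leRHS](_ : _ = `|B| * (h0 * 2^-1 ^+ n) * cW); last by ring.
  by apply: ler_wpM2r => //; apply: ler_wpM2l.
apply/eqP; rewrite -addr_eq0; apply/negPn/negP => ne.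
have l0 : 0 < `|X + Y| by rewrite normr_gt0.
have c0 : 0 <= c by have := L1b_ge0 (hg 0%N); rewrite expr0 mulr1.
have k0 : 0 < c + P + `|B| * h0 * cW + 1.
  have q : 0 <= `|B| * h0 * cW by rewrite !mulr_ge0// ltW.
  by clra.
have [n hn] := dl_small k0 l0; have := hn n (leqnn n).
rewrite /dl -exprVn mulrDl mul1r; have := main n.
have : 0 <= 2^-1 ^+ n :> R by rewrite exprn_ge0// invr_ge0.
clra.
Qed.

Lemma EFin_I1 (F : R -> R) c : L1b mu F c -> (\int[mu]_x (F x)%:E = (I1 F)%:E)%E.
Proof. by move=> /L1b_int h; rewrite /I1 /Rintegral fineK//; exact: integrable_fin_num. Qed.

End WeakDerivative.

Section W12Main.
Variables (R : realType) (N : nat).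
Local Notation mu := (@lebesgue_measure R).
Variables (Lam : R) (a : R -> R) (Om : set R) (x0 r : R) (u m : R -> 'I_N -> R).
Hypotheses (N2 : (2 <= N)%N) (ok : ker_ok a Lam) (oOm : open Om) (r0 : 0 < r)
  (sOm : closure (ball x0 (2 * r)) `<=` Om) (hm : Lp_on 1 Om m) (hw : weak_solution a Om u m).

Lemma W12_main : Lp_on 2 (ball x0 (2 * r)) m -> W12_on (ball x0 r) u.
Proof.
move=> h2; have r0' := r0.
(* The radii in units of [r]: cut-off equal to 1 up to 5/4 and 0 from 3/2, test functions up to
   13/8, which leaves room for steps of length 1/8, and the Hoelder bound up to 7/4. *)
have q0 : 0 < r * (7 / 4) by clra.
have q1 : r * (7 / 4) < 2 * r by clra.
have g1 : (1 : R) < 2 by clra.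
have [v [HV uv _ [C [C0 hC]]]] := good_rep N2 ok oOm r0 sOm hm hw g1 h2 q0 q1.
have hu i x y : `|x - x0| <= r * (7 / 4) -> `|y - x0| <= r * (7 / 4) -> (v i x - v i y) ^+ 2 <= C ^+ 2 * `|x - y|.
  move=> hx hy; rewrite -real_normK ?num_real//.
  have -> : C ^+ 2 * `|x - y| = (C * `|x - y| `^ (1 - 2^-1)) ^+ 2.
    rewrite (_ : 1 - 2^-1 = 2^-1); last by field.
    by rewrite powR12_sqrt// exprMn sqr_sqrtr.
  by rewrite ler_sqr ?nnegrE ?mulr_ge0 ?powR_ge0//; exact: hC.
have g0 : (0 : R) < 2 by [].
have [M2 hM2] := choice (fun i => Lp_L1b oOm sOm hm i g0 h2).
have hm2 i : L1b mu (fun x => mi x0 r m i x ^+ 2) (M2 i).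
  by apply: L1b_eq (hM2 i) => x; rewrite powR_mulrn// real_normK ?num_real.
have a0 : 0 < r * (5 / 4) by clra.
have ab : r * (5 / 4) < r * (3 / 2) by clra.
have br : r * (3 / 2) < r * (7 / 4) by clra.
have c0 : 0 < r * (13 / 8) by clra.
have cr : r * (13 / 8) < r * (7 / 4) by clra.
have h00 : 0 < r / 8 by clra.
have bc : r * (3 / 2) + r / 8 <= r * (13 / 8) by clra.
have [chi [L [L0 hchi]]] := cutoff_ex x0 a0 ab.
have ex (i : 'I_N) : exists g : R -> R, [/\ measurable_fun setT g, exists c, L1b mu (fun x => g x ^+ 2) c &
    forall phi, test_fun (ball x0 r) phi -> I1 (fun x => Wi v chi i x * derive1 phi x) = - I1 (fun x => g x * phi x)].
  have gW := W_Good HV q1 hchi a0 ab br i; have bW := W_BC HV q1 hchi a0 ab br i.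
  have Ws x := W_supp v hchi i (x := x).
  have [K [K0 hK]] := dual2 HV q1 (sqr_ge0 C) hu hm2 i hchi L0 a0 ab br c0 cr.
  have [S hS] := quot_bounded ok gW bW Ws h00 bc K0 hK.
  have mono := quot_mono bW h00.
  have [s hs] := fast_subsequence mono hS.
  have bq j := quot_BC (r / 8) bW (s j).
  have [|g [c [mg _ hg]]] := L2_limit bq.
    move=> j; have [_ s1 s2] := hs j.
    by apply: le_trans (quot_cauchy _ bW s1) _; move: (16^-1 ^+ j) s2 => t; clra.
  exists g; split => //.
    have := L1bD (L1bZ 2 (hg 0%N)) (L1bZ 2 (L1b_sq (bq 0%N))) => H; eexists.
    apply: L1b_le1 H; first by mes.
    move=> x; rewrite ger0_norm ?sqr_ge0//; move: (g x) (quot _ _ _ _) => p q.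
    by apply: (@le_sub_sq _ (p - 2 * q)); ring.
  move=> phi; apply: (quot_limit_weak bW h00 _ mg hg) => j; by case: (hs j).
have [g hg] := choice ex.
have mD : measurable (ball x0 r : set R) by exact: measurable_ball.
have mu_ i : measurable_fun setT (fun x => u x i) by case: hw => [[h _] _]; exact: h.
split.
  move=> i; split; first exact: measurable_funTS.
  case: hw => [[_ [/(_ i)[_ h] _]] _]; apply: le_lt_trans h; apply: ge0_subset_integral => //.
  - exact: open_measurable.
  - apply/measurable_EFinP; apply: measurable_funTS; have := mu_ i => ?; mes.
  - by move=> x /ballP hx; apply: sOm; apply: subset_closure; apply/ballP; clra.
exists (fun x i => g i x); split.
  move=> i; have [mg [c hc] _] := hg i; split; first exact: measurable_funTS.
  apply: le_lt_trans (ltry c); have [_] := hc; apply: le_trans.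
  apply: (@le_trans _ _ (\int[mu]_x (`|g i x| `^ 2)%:E)%E).
    apply: ge0_subset_integral => //.
    - by apply/measurable_EFinP; mes.
  rewrite le_eqVlt; apply/orP; left; apply/eqP; apply: eq_integral => x _.
  by rewrite powR_mulrn// normrX.
move=> i phi tp; have [mg [c hc] hi] := hg i; have [bp bp' off _] := test_taylor tp.
have mp : measurable_fun setT phi by case: bp.
have mp' : measurable_fun setT (derive1 phi) by case: bp'.
have bW := W_BC HV q1 hchi a0 ab br i; have mW : measurable_fun setT (Wi v chi i) by case: bW.
have supp (F : R -> R) : (forall x, ~ ball x0 r x -> F x = 0) ->
    (\int[mu]_(x in ball x0 r) (F x)%:E = \int[mu]_x (F x)%:E)%E.
  by move=> h; apply: integral_supp => x /h ->.
apply: etrans (supp (fun x => u x i * derive1 phi x) _) _; first by move=> x /off[_ ->]; rewrite mulr0.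
have e2 := supp (fun x => g i x * phi x) (fun x h => etrans (congr1 _ (off x h).1) (mulr0 _)).
transitivity (- \int[mu]_x (g i x * phi x)%:E)%E; last by rewrite -e2.
have [c1 hc1] := BC_L1b (BC_M bW bp').
have hgp : L1b mu (fun x => g i x * phi x) (c + I1 (fun x => phi x ^+ 2)).
  apply: L1b_le1 (L1bD hc (L1b_sq bp)); first by mes.
  move=> x; rewrite normrM -[(g i x) ^+ 2]real_normK ?num_real// -[(phi x) ^+ 2]real_normK ?num_real//.
  have := normr_ge0 (g i x); have := normr_ge0 (phi x); move: `|g i x| `|phi x| => p q; cnra.
rewrite (EFin_I1 hgp) -EFinN -(hi phi tp) -(EFin_I1 hc1).
apply: ae_eq_integral => //.
- by apply/measurable_EFinP; have := mu_ i => ?; mes.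
- by apply/measurable_EFinP; mes.
have := uv i; apply: aeS => x ux _; rewrite ux; congr EFin.
have [Dx|Dx] := pselect (ball x0 r x); last by have [_ ->] := off _ Dx; rewrite !mulr0.
by rewrite /Wi (cut_1 hchi) ?mul1r//; move/ballP: Dx; clra.
Qed.

End W12Main.

Theorem mainTheorem3 (R : realType) (N : nat) (Lam : R) (a : R -> R)
    (Om : set R) (x0 r : R) (u mu : R -> 'I_N -> R) :
  (2 <= N)%N -> 1 <= Lam ->
  measurable_fun setT a ->
  (forall xi, a xi = a (- xi)) ->
  (forall xi, Lam^-1 <= a xi <= Lam) ->
  open Om -> 0 < r ->
  compact (closure (ball x0 (2 * r))) -> closure (ball x0 (2 * r)) `<=` Om ->
  Lp_on 1 Om mu ->
  weak_solution a Om u mu ->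
  (forall gam : R, 1 < gam -> Lp_on gam (ball x0 (2 * r)) mu ->
     holder_on (1 - gam^-1) (ball x0 r) u) /\
  ((forall xi, a xi = 1) -> Lp_on 2 (ball x0 (2 * r)) mu ->
     W12_on (ball x0 r) u).
Proof.
move=> N2 L1 ma sa ab oOm r0 _ sOm hm hw; have ok : ker_ok a Lam by split.
split; first by move=> gam; exact: holder_main N2 ok oOm r0 sOm hm hw gam.
by move=> _; exact: W12_main N2 ok oOm r0 sOm hm hw.
Qed.
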